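(* Fix $\alpha\in(1,2)$ and let $$\beta_\alpha=\begin{cases}\alpha-1,&\alpha\in(1,\frac43),\\ 1-\frac\alpha2,&\alpha\in[\frac43,\frac32],\\ \frac12-\frac\alpha6,&\alpha\in(\frac32,2).\end{cases}$$ Let $g\in BV(\mathbb T)$, $\mathbb T=\mathbb R/(2\pi\mathbb Z)$, and let $u$ be the solution of the cubic fractional Schrödinger equation $$iu_t+(-\Delta)^{\frac\alpha2}u=\pm|u|^2u,\quad x\in\mathbb T,\ t\in\mathbb R,\qquad u(0,\cdot)=g,$$ on its local existence interval. Then for any $0<\beta<\beta_\alpha$ and each $t\ne0$ in the local existence interval, $u(t,\cdot)\in C^\beta_x$; in particular the maximum $D_t$ of the fractal dimensions of the graphs of the real and imaginary parts of $u(t,\cdot)$ satisfies $D_t\le2-\beta$. If in addition $g\notin H^{\frac12+}(\mathbb T)$, then for each such $t\neq0$, $D_t\ge1+\beta$.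
   Context: $BV(\mathbb T)$ is the set of functions of bounded variation; $BV(\mathbb T)\subset H^{\frac12-}(\mathbb T)=\bigcap_{s<1/2}H^s$; $H^{\frac12+}=\bigcup_{s>1/2}H^s$. $(-\Delta)^{\alpha/2}$ is the Fourier multiplier $|n|^\alpha$. $u$ is the unique local-in-time solution provided by the $H^s(\mathbb T)$ (Bourgain space) well-posedness theory for $s<\frac12$ close to $\frac12$. $C^\beta_x$ is the Hölder space in $x$. The fractal (upper box-counting) dimension of a bounded set $E$ is $\limsup_{\epsilon\to0}\frac{\log\mathcal N(E,\epsilon)}{\log(1/\epsilon)}$, with $\mathcal N(E,\epsilon)$ the minimum number of $\epsilon$-balls needed to cover $E$. *)

(* Defs.v *)
From mathcomp Require Import all_boot all_order all_algebra complex.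
From mathcomp Require Import all_classical all_reals all_analysis.

Set Implicit Arguments.
Unset Strict Implicit.
Unset Printing Implicit Defensive.

Import Order.TTheory GRing.Theory Num.Theory.
Import numFieldNormedType.Exports.
Import ComplexField.Normc.

Local Open Scope classical_set_scope.
Local Open Scope ring_scope.
Local Open Scope complex_scope.

Section ComplexValued.
Variable R : realType.
Implicit Types (f : R -> R[i]) (D : set R).

Definition cis (x : R) : R[i] := cos x +i* sin x.

Definition cmeasurable f :=
  measurable_fun setT (fun x => complex.Re (f x)) /\
  measurable_fun setT (fun x => complex.Im (f x)).

Definition cintegral D f : R[i] :=
  (\int[@lebesgue_measure R]_(x in D) complex.Re (f x)) +i*
  (\int[@lebesgue_measure R]_(x in D) complex.Im (f x)).

(* Oriented integral, for t of either sign. *)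
Definition cintegral0 (t : R) f : R[i] :=
  if 0 <= t then cintegral `[0, t] f else - cintegral `[t, 0] f.

End ComplexValued.

(* Functions on the torus R / 2 pi Z are 2 pi-periodic functions on R, and
   `[0, 2 * pi] serves as a fundamental domain. *)
Section Torus.
Variable R : realType.
Implicit Types (f g h : R -> R[i]) (s : R).

Definition torus : set R := `[0, 2 * pi].

Definition is_periodic f := forall x, f (x + 2 * pi) = f x.

Definition in_BV f :=
  [/\ is_periodic f,
      bounded_variation 0 (2 * pi) (fun x => complex.Re (f x)) &
      bounded_variation 0 (2 * pi) (fun x => complex.Im (f x))].

Definition in_L2 f :=
  [/\ is_periodic f, cmeasurable f &
      (\int[@lebesgue_measure R]_(x in torus) ((normc (f x)) ^+ 2)%:E < +oo)%E].

Definition fourier f (n : int) : R[i] :=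
  ((2 * pi)^-1)%:C * cintegral torus (fun x => f x * cis (- (n%:~R * x))).

(* jap2 x = <x>^2, so that jap2 x `^ s = <x>^(2s). *)
Definition jap2 (x : R) : R := 1 + x ^+ 2.

Definition sobolev_norm2 s f : \bar R :=
  \esum_(n in [set: int]) (jap2 n%:~R `^ s * normc (fourier f n) ^+ 2)%:E.

(* H^s for s >= 0, as a subspace of L^2. *)
Definition in_H s f := in_L2 f /\ (sobolev_norm2 s f < +oo)%E.

Definition in_Hhalfplus f := exists2 s : R, 1 / 2 < s & in_H s f.

Definition holder (b : R) h :=
  exists C : R, forall x y, normc (h x - h y) <= C * `|x - y| `^ b.

End Torus.

Section FractalDimension.
Variable R : realType.
Local Open Scope ereal_scope.

Definition eball (c : R * R) (eps : R) : set (R * R) :=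
  [set p | ((p.1 - c.1) ^+ 2 + (p.2 - c.2) ^+ 2 < eps ^+ 2)%R].

Definition covered_by (E : set (R * R)) (eps : R) (k : nat) :=
  exists c : 'I_k -> R * R, E `<=` \bigcup_(i in [set: 'I_k]) eball (c i) eps.

Definition covering_number (E : set (R * R)) (eps : R) : \bar R :=
  ereal_inf [set k%:R%:E | k in covered_by E eps].

Definition fractal_dim (E : set (R * R)) : \bar R :=
  limf_esup (fun eps : R => lne (covering_number E eps) * ((ln eps^-1)^-1)%:E)
            (0^'+)%R.

Definition graph_on_torus (f : R -> R) : set (R * R) :=
  [set p | torus p.1 /\ p.2 = f p.1].

(* Maximum of the dimensions of the graphs of the real and imaginary parts. *)
Definition max_graph_dim (f : R -> R[i]) : \bar R :=
  maxe (fractal_dim (graph_on_torus (fun x => complex.Re (f x))))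
       (fractal_dim (graph_on_torus (fun x => complex.Im (f x)))).

End FractalDimension.

Section FractionalNLS.
Variable R : realType.
Implicit Types (alpha s b delta : R) (u : R -> R -> R[i]) (g : R -> R[i]).

(* The Fourier multiplier of (-Delta)^(alpha/2). *)
Definition frac_symbol alpha (n : int) : R := `|n%:~R| `^ alpha.

Definition cubic (f : R -> R[i]) : R -> R[i] :=
  fun x => (normc (f x) ^+ 2)%:C * f x.

(* The restriction to [-delta, delta] of the Bourgain space X^{s,b}: F n tau is
   the space-time Fourier transform of an extension of u to all times. Only
   for b > 1/2, where F n is integrable in tau by Cauchy-Schwarz, so that the
   inversion formula holds pointwise in t. *)
Definition in_X alpha s b delta u :=
  exists F : int -> R -> R[i],
    [/\ forall n, cmeasurable (F n),
        (\esum_(n in [set: int]) \int[@lebesgue_measure R]_(tau in [set: R])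
           (jap2 n%:~R `^ s * jap2 (tau - frac_symbol alpha n) `^ b *
            normc (F n tau) ^+ 2)%:E < +oo)%E &
        forall (n : int) (t : R), t \in `[- delta, delta] ->
          fourier (u t) n = cintegral setT (fun tau => F n tau * cis (t * tau))].

Definition continuous_in_H s delta u :=
  (forall t : R, t \in `[- delta, delta] -> in_H s (u t)) /\
  (forall t0 : R, t0 \in `[- delta, delta] ->
     (fun t => sobolev_norm2 s (fun x => u t x - u t0 x))
       @ within [set` `[- delta, delta]] (nbhs t0) --> 0%E).

(* Duhamel formula, on the Fourier side, for
     i u_t + (-Delta)^(alpha/2) u = (-1)^sg |u|^2 u,  u(0) = g. *)
Definition duhamel alpha (sg : bool) delta g u :=
  forall (n : int) (t : R), t \in `[- delta, delta] ->
    fourier (u t) n =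
      cis (t * frac_symbol alpha n) * fourier g n
      - (0 +i* 1) * (-1) ^+ sg *
        cintegral0 t (fun t' => cis ((t - t') * frac_symbol alpha n) *
                                fourier (cubic (u t')) n).

(* The solution given by the H^s local theory on [-delta, delta]: the local
   theory is a contraction argument in X^{s,b} for some b > 1/2. *)
Definition fNLS_solution alpha (sg : bool) s delta g u :=
  exists b : R,
    [/\ 1 / 2 < b, in_X alpha s b delta u, continuous_in_H s delta u &
        duhamel alpha sg delta g u].

Definition beta_exponent alpha : R :=
  if alpha < 4 / 3 then alpha - 1
  else if alpha <= 3 / 2 then 1 - alpha / 2
  else 1 / 2 - alpha / 6.

End FractionalNLS.

(* Main.v *)
(* In interaction variables the coefficients are a_n(t) = e^{-it|n|^alpha} u^_n(t), and the cubic
   term sums a_p conj(a_{p+q-n}) a_q with the phase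
     Phi = |p|^alpha - |p+q-n|^alpha + |q|^alpha - |n|^alpha,
   which is at least c |p-n| |q-n| max^(alpha-2).  The resonant terms p = n or q = n form
   2 (sum_m |a_m|^2) a_n, removed by a gauge factor independent of n, up to a term |a_n|^2 a_n;
   the others are integrated by parts in time and gain a factor 1 / |Phi|.  Hence, up to a
   unimodular constant, u(t) is the linear evolution of g plus a remainder whose coefficients lie
   in the scale of H^{1/2 + alpha - 1 -}.

   The dyadic blocks of the linear evolution are bounded uniformly in x: as g has bounded
   variation, they are integrals against dg of sum_n e^{i(t|n|^alpha + nx)} / n, which is small by
   the second and third derivative tests of van der Corput.  So u(t) has a Holder representative,
   which bounds the dimension of the graphs from above.

   If both graphs had dimension less than 1 + beta, a covering by few h-balls would bound the
   measure of the region between the graph and its translate by h, and with Holder continuity the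
   L^2 norm squared of v(. + h) - v by h^{1 + eta}.  This puts u(t), and with the remainder
   estimate also g, in H^{1/2+}. *)
Require Import Defs.
From mathcomp Require Import all_boot all_order all_algebra complex.
From mathcomp Require Import all_classical all_reals all_analysis.
From mathcomp Require Import measurable_realfun.
From mathcomp Require Import ring lra zify.
Import Order.TTheory GRing.Theory Num.Theory.
Import numFieldNormedType.Exports.
Local Open Scope classical_set_scope.
Local Open Scope ring_scope.
Local Open Scope complex_scope.
Local Set Implicit Arguments.
Local Unset Strict Implicit.
Local Unset Printing Implicit Defensive.
Local Notation normc := ComplexField.Normc.normc.
Local Notation Re := complex.Re.
Local Notation Im := complex.Im.

(** * Complex numbers and partial sums *)

(** The Bourgain norm is used once: it yields a sequence a_n in weighted l^2, independent of t, that
    majorizes |u^_n(t)| on the whole interval. From then on the nonlinear estimates concern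
    nonnegative sequences. The integration by parts in time is not expanded into boundary and
    quintic terms: the product of three coefficients is treated as a Lipschitz amplitude, with
    Lipschitz constants majorized by a_n and the cubic sum of a. Since the solution satisfies
    Duhamel's formula coefficient by coefficient, the coefficients of |u|^2 u must be recognized as
    limits of truncated convolution sums, which rests on an L^4 bound and on the L^2 convergence of
    Fourier series. One round of the gain, from majorants in H^{1/2 - eps}, loses 13 eps, whence the
    condition that s be close to 1/2. In the exponent beta_alpha, 1 - alpha/2 and 1/2 - alpha/6 come
    from one and from two van der Corput differencings, alpha - 1 from the remainder. *)

Lemma le_of_eq (d : Order.disp_t) (T : porderType d) (a b : T) : a = b -> (a <= b)%O.
Proof. by move=> ->. Qed.

Section ComplexBasics.
Variable R : realType.
Implicit Types (z w : R[i]) (x y : R).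

Lemma normcE_sqr z : normc z ^+ 2 = Re z ^+ 2 + Im z ^+ 2.
Proof. by case: z => a b /=; rewrite sqr_sqrtr// addr_ge0// sqr_ge0. Qed.

Lemma normc_ge0 z : 0 <= normc z.
Proof. by case: z => a b; exact: sqrtr_ge0. Qed.

Lemma normcD z w : normc (z + w) <= normc z + normc w.
Proof. exact: le_normcD. Qed.

Lemma normcB z w : normc (z - w) <= normc z + normc w.
Proof. by rewrite (le_trans (normcD _ _))// normcN. Qed.

Lemma normcBC z w : normc (z - w) = normc (w - z).
Proof. by rewrite -normcN opprB. Qed.

Lemma normc_triang z w u : normc (z - u) <= normc (z - w) + normc (w - u).
Proof. by have := normcD (z - w) (w - u); rewrite addrA subrK. Qed.

Lemma normc_real x : normc x%:C = `|x|.
Proof. by rewrite /= expr0n/= addr0 sqrtr_sqr. Qed.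

Lemma normc_conj z : normc (conjc z) = normc z.
Proof. by case: z => a b /=; rewrite sqrrN. Qed.

Lemma mul_conjc z : z * conjc z = (normc z ^+ 2)%:C.
Proof.
rewrite normcE_sqr; case: z => a b.
by apply/eqP; rewrite eq_complex /=; apply/andP; split; apply/eqP; ring.
Qed.

Lemma normc_Re z : `|Re z| <= normc z.
Proof.
by rewrite -[leRHS]ger0_norm ?normc_ge0// -ler_sqr ?nnegrE// !real_normK ?num_real//
  normcE_sqr lerDl sqr_ge0.
Qed.

Lemma normc_Im z : `|Im z| <= normc z.
Proof.
by rewrite -[leRHS]ger0_norm ?normc_ge0// -ler_sqr ?nnegrE// !real_normK ?num_real//
  normcE_sqr lerDr sqr_ge0.
Qed.

Lemma normc_ReIm z : normc z <= `|Re z| + `|Im z|.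
Proof.
rewrite -ler_sqr ?nnegrE ?normc_ge0 ?addr_ge0// normcE_sqr sqrrD.
by rewrite !real_normK ?num_real// lerD2r lerDl mulrn_wge0// mulr_ge0.
Qed.

Lemma cReD z w : Re (z + w) = Re z + Re w. Proof. by case: z; case: w. Qed.
Lemma cImD z w : Im (z + w) = Im z + Im w. Proof. by case: z; case: w. Qed.
Lemma cReN z : Re (- z) = - Re z. Proof. by case: z. Qed.
Lemma cImN z : Im (- z) = - Im z. Proof. by case: z. Qed.
Lemma cReM z w : Re (z * w) = Re z * Re w - Im z * Im w.
Proof. by case: z; case: w. Qed.
Lemma cImM z w : Im (z * w) = Re z * Im w + Im z * Re w.
Proof. by case: z => a b; case: w. Qed.
Lemma cRe_conj z : Re (conjc z) = Re z. Proof. by case: z. Qed.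
Lemma cIm_conj z : Im (conjc z) = - Im z. Proof. by case: z. Qed.

Lemma complexP z w : Re z = Re w -> Im z = Im w -> z = w.
Proof. by case: z; case: w => a b c d /= -> ->. Qed.

Lemma cRe_sum (I : Type) (s : seq I) (P : pred I) (F : I -> R[i]) :
  Re (\sum_(i <- s | P i) F i) = \sum_(i <- s | P i) Re (F i).
Proof. by apply: (big_morph (@complex.Re R)) => // x y; exact: cReD. Qed.

Lemma cIm_sum (I : Type) (s : seq I) (P : pred I) (F : I -> R[i]) :
  Im (\sum_(i <- s | P i) F i) = \sum_(i <- s | P i) Im (F i).
Proof. by apply: (big_morph (@complex.Im R)) => // x y; exact: cImD. Qed.

Lemma normc_sum (I : Type) (s : seq I) (P : pred I) (F : I -> R[i]) :
  normc (\sum_(i <- s | P i) F i) <= \sum_(i <- s | P i) normc (F i).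
Proof.
elim/big_rec2 : _ => [|i x y _ h]; first by rewrite ComplexField.Normc.normc0.
by rewrite (le_trans (normcD _ _))// lerD2l.
Qed.

Lemma realC_sum (I : Type) (s : seq I) (P : pred I) (F : I -> R) :
  (\sum_(i <- s | P i) F i)%:C = \sum_(i <- s | P i) (F i)%:C.
Proof. exact: raddf_sum. Qed.

Lemma cisD x y : cis (x + y) = cis x * cis y.
Proof. by apply: complexP; rewrite ?cReM ?cImM /= ?cosD ?sinD//; ring. Qed.

Lemma cis0 : cis (0 : R) = 1.
Proof. by rewrite /cis cos0 sin0. Qed.

Lemma cisN x : cis (- x) = conjc (cis x).
Proof. by rewrite /cis cosN sinN. Qed.

Lemma normc_cis x : normc (cis x) = 1.
Proof. by rewrite /= cos2Dsin2 sqrtr1. Qed.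

Lemma cisNM x : cis (- x) * cis x = 1.
Proof. by rewrite -cisD addNr cis0. Qed.

Lemma cis2pi x : cis (x + 2 * pi) = cis x.
Proof. by rewrite /cis mulr_natl cosD2pi sinD2pi. Qed.

Lemma cis2pin x (n : int) : cis (x + n%:~R * (2 * pi)) = cis x.
Proof.
have nat_case (m : nat) y : cis (y + m%:R * (2 * pi)) = cis y.
  elim: m y => [|m IH] y; first by rewrite mul0r addr0.
  by rewrite -natr1 mulrDl mul1r addrA cis2pi IH.
case: n => n; first exact: nat_case.
rewrite NegzE mulrNz mulNr.
by rewrite -[in RHS](subrK (n.+1%:~R * (2 * pi)) x) nat_case.
Qed.

Lemma abs_sin_le x : `|sin x| <= `|x|.
Proof.
wlog x0 : x / 0 < x => [H|].
  have [x0|x0|<-] := ltgtP 0 x; [exact: H| |by rewrite sin0 normr0].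
  by rewrite -(normrN x) -(normrN (sin x)) -sinN; apply: H; rewrite oppr_gt0.
have [c cx] : exists2 c, c \in `]0, x[%R & sin x - sin 0 = cos c * (x - 0).
  apply: MVT => //.
  by move=> y; apply: continuous_subspaceT; exact: continuous_sin.
rewrite sin0 !subr0 => ->; rewrite normrM -[leRHS]mul1r ler_wpM2r//.
exact: cos_max.
Qed.

Lemma cos_ge_quad x : 1 - x ^+ 2 / 2 <= cos x.
Proof.
rewrite -[x in cos x](@mulfVK _ 2)// mulr_natr cos_mulr2n cos2sin2.
have := abs_sin_le (x / 2); rewrite -ler_sqr ?nnegrE//.
by rewrite !real_normK ?num_real//; lra.
Qed.

Lemma normc_cisB1 x : normc (cis x - 1) = 2 * `|sin (x / 2)|.
Proof.
apply/eqP; rewrite -(@eqrXn2 _ 2)// ?normc_ge0//; apply/eqP.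
rewrite normcE_sqr cReD cImD cReN cImN /= exprMn real_normK ?num_real//.
rewrite -{1 2}[x](@mulfVK _ 2)// mulr_natr cos_mulr2n sin_mulr2n.
set s := sin _ ; set c := cos _.
by have := cos2Dsin2 (x / 2); rewrite -/s -/c; nra.
Qed.

End ComplexBasics.

(** * Sums over finite index lists, bounded uniformly *)

Section SumCalculus.
Variable R : realType.

(** For f >= 0 this is convergence of the series with sum at most C. Quantifying over finite lists
    keeps every estimate an inequality between real numbers. *)
Definition sumle (I : eqType) (f : I -> R) (C : R) :=
  forall s : seq I, uniq s -> \sum_(i <- s) f i <= C.

Section Generic.
Variable I : eqType.
Implicit Types (f g : I -> R) (C D : R) (s : seq I).

Lemma sumle_ge0 f C : sumle f C -> 0 <= C.
Proof. by move=> /(_ [::] isT); rewrite big_nil. Qed.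

Lemma sumle_point f C i : sumle f C -> f i <= C.
Proof. by move=> /(_ [:: i] isT); rewrite big_seq1. Qed.

Lemma le_sumle f g C : (forall i, f i <= g i) -> sumle g C -> sumle f C.
Proof. by move=> fg gC s us; apply: le_trans (gC s us); exact: ler_sum. Qed.

Lemma sumleD f g C D : sumle f C -> sumle g D -> sumle (fun i => f i + g i) (C + D).
Proof. by move=> fC gD s us; rewrite big_split/= lerD ?fC ?gD. Qed.

Lemma sumleZ f C c : 0 <= c -> sumle f C -> sumle (fun i => c * f i) (c * C).
Proof. by move=> c0 fC s us; rewrite -mulr_sumr ler_wpM2l// fC. Qed.

Lemma sumle_inj (J : eqType) (h : J -> I) f C : injective h ->
  sumle f C -> sumle (fun j => f (h j)) C.
Proof. by move=> hI fC s us; rewrite -(big_map h xpredT f) fC// map_inj_uniq. Qed.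

Lemma ler_sum_subset f s s' : (forall i, 0 <= f i) -> uniq s ->
  {subset s <= s'} -> \sum_(i <- s) f i <= \sum_(i <- s') f i.
Proof.
move=> f0; elim: s s' => [|x s IH] s' /=; first by rewrite big_nil sumr_ge0.
move=> /andP[xs us] sub; have xs' : x \in s' by apply: sub; rewrite mem_head.
rewrite big_cons (perm_big _ (perm_to_rem xs')) big_cons lerD2l; apply: IH => // y ys.
have : y \in s' by apply: sub; rewrite in_cons ys orbT.
rewrite (perm_mem (perm_to_rem xs')) in_cons => /predU1P[yx|//].
by move: xs; rewrite -yx ys.
Qed.

(** Cauchy--Schwarz with weights k, by induction on the list: the cross terms are absorbed by 2 x_a
    x_i <= x_a^2 + x_i^2. *)
Lemma jensen_sum (k x : I -> R) s : (forall i, 0 <= k i) ->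
  (\sum_(i <- s) k i * x i) ^+ 2 <=
  (\sum_(i <- s) k i) * \sum_(i <- s) k i * x i ^+ 2.
Proof.
move=> k0; elim: s => [|a s IH]; first by rewrite !big_nil; lra.
rewrite !big_cons.
have : 2 * x a * \sum_(i <- s) k i * x i <=
    \sum_(i <- s) k i * x i ^+ 2 + x a ^+ 2 * \sum_(i <- s) k i.
  rewrite !mulr_sumr -big_split /=; apply: ler_sum => i _.
  have := sqr_ge0 (x i - x a); have := k0 i; set u := k i; set v := x i; set w := x a.
  by nra.
move: IH (k0 a); set K := \sum_(i <- s) k i.
set A := \sum_(i <- s) k i * x i; set B := \sum_(i <- s) k i * x i ^+ 2.
by move=> IH ka h; have := ler_wpM2l ka h; nra.
Qed.

End Generic.

Definition zbox (N : nat) : seq int := [seq i%:Z - N%:Z | i <- iota 0 (N.*2.+1)].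

Lemma mem_zbox N (n : int) : (n \in zbox N) = (`|n| <= N)%N.
Proof.
apply/mapP/idP => [[k]|nN]; first by rewrite mem_iota => /andP[_ kN] ->; lia.
by exists (absz (n + N%:Z)); [rewrite mem_iota|]; lia.
Qed.

Lemma uniq_zbox N : uniq (zbox N).
Proof. by rewrite map_inj_uniq ?iota_uniq// => i j; lia. Qed.

Lemma zbox_sub N M : (N <= M)%N -> {subset zbox N <= zbox M}.
Proof. by move=> NM n; rewrite !mem_zbox => /leq_trans; apply. Qed.

Lemma seq_sub_zbox (s : seq int) : exists N, {subset s <= zbox N}.
Proof.
elim: s => [|n s [N sN]]; first by exists 0%N.
exists (maxn `|n| N) => m; rewrite in_cons mem_zbox => /predU1P[->|ms].
  by rewrite leq_maxl.
by rewrite leq_max -[(_ <= N)%N]mem_zbox (sN _ ms) orbT.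
Qed.

Lemma big_zboxS (V : nmodType) (F : int -> V) N :
  \sum_(n <- zbox N.+1) F n = F (- N.+1%:Z) + \sum_(n <- zbox N) F n + F N.+1%:Z.
Proof.
have h : perm_eq (zbox N.+1) (- N.+1%:Z :: N.+1%:Z :: zbox N).
  apply: uniq_perm; first by rewrite uniq_zbox.
    rewrite 2!cons_uniq uniq_zbox in_cons !mem_zbox; lia.
  by move=> n; rewrite mem_zbox 2!in_cons mem_zbox; lia.
by rewrite (perm_big _ h) 2!big_cons /= -addrA [X in _ + X]addrC.
Qed.

Lemma cvg_sum (I T : Type) (F : set_system T) (s : seq I) (f : I -> T -> R)
    (l : I -> R) : Filter F -> (forall i, f i x @[x --> F] --> l i) ->
  \sum_(i <- s) f i x @[x --> F] --> \sum_(i <- s) l i.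
Proof. by move=> FF h; apply: cvg_big => //; exact: add_continuous. Qed.

Section SupSeq.
Variable f : nat -> int -> R.
Hypothesis f_nd : forall n N M, (N <= M)%N -> f N n <= f M n.
Hypothesis f_ge0 : forall n N, 0 <= f N n.

(** The limit of a monotone sequence of truncated sums. It stands in for the infinite double sums
    over frequencies, of which only the truncations to boxes are formed. *)
Definition seqsup (n : int) : R := sup (range (fun N => f N n)).

Lemma le_seqsup n C : (forall N, f N n <= C) -> forall N, f N n <= seqsup n.
Proof.
move=> h N; apply: ub_le_sup; last by exists N.
by exists C => _ [M _ <-].
Qed.

Lemma seqsup_cvg n C : (forall N, f N n <= C) -> f ^~ n @ \oo --> seqsup n.
Proof.
move=> h; apply: nondecreasing_cvgn.
  by move=> N M; exact: f_nd.
by exists C => _ [M _ <-].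
Qed.

(** Monotone convergence: one term with w n > 0 already bounds [f N n] in N, and finite sums pass to
    the limit. *)
Lemma sumle_seqsup (w : int -> R) C : (forall n, 0 < w n) ->
  (forall N, sumle (fun n => w n * f N n ^+ 2) C) ->
  (forall n, exists D, forall N, f N n <= D) /\
  sumle (fun n => w n * seqsup n ^+ 2) C.
Proof.
move=> w0 h.
have bd n : exists D, forall N, f N n <= D.
  exists (C / w n + 1) => N; have := sumle_point n (h N).
  rewrite mulrC -ler_pdivlMr// => hN.
  by apply: (@le_trans _ _ (f N n ^+ 2 + 1)); [nra|rewrite lerD2r].
split => // s us.
have cv : (fun N => \sum_(n <- s) w n * f N n ^+ 2) @ \oo -->
    \sum_(n <- s) w n * seqsup n ^+ 2.
  apply: cvg_sum => n; apply: cvgMr.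
  have [D hD] := bd n; rewrite !expr2.
  by apply: cvgM; exact: seqsup_cvg hD.
rewrite -(cvg_lim _ cv)//; apply: limr_le; first by apply/cvg_ex; eexists; exact: cv.
by near=> N; exact: h.
Unshelve. all: by end_near. Qed.

End SupSeq.
End SumCalculus.

(** * Exponential sums *)

Section FiniteDifferences.
Variable R : realType.
Implicit Types (f : R -> R) (a h x : R) (hs : seq R).

Lemma is_derive_powR a x : 0 < x -> is_derive x 1 (@powR R ^~ a) (a * x `^ (a - 1)).
Proof.
move=> x0; have xI : x \in `]0, +oo[%R by rewrite in_itv/= x0.
by apply: DeriveDef; [exact: derivable_powR|rewrite -derive1E powR_derive1].
Qed.

Lemma is_derive_continuous_within (f df : R -> R) (p q : R) :
  (forall y, p <= y <= q -> is_derive y 1 f (df y)) -> {within `[p, q], continuous f}.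
Proof.
move=> df_f; apply: derivable_within_continuous => y.
by rewrite in_itv/= => yI; have [] := df_f _ yI.
Qed.

Definition fdiff h f x := f (x + h) - f x.
(** Iterated differences with steps [hs]: what repeated van der Corput differencing makes of a
    phase. *)
Definition fdiffs hs f := foldr fdiff f hs.

(** Falling factorial a (a - 1) ... (a - k + 1), the constant in the k-th derivative of y^a. *)
Fixpoint ffallr a k : R := if k is k'.+1 then a * ffallr (a - 1) k' else 1.

Lemma is_derive_fdiffs hs a x : all (> 0) hs -> 0 < x ->
  is_derive x 1 (fdiffs hs (@powR R ^~ a)) (a * fdiffs hs (@powR R ^~ (a - 1)) x).
Proof.
elim: hs a x => [|h hs IH] a x /=; first by move=> _; exact: is_derive_powR.
move=> /andP[h0 hs0] x0; rewrite /fdiff mulrBr.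
have xh : is_derive x 1 (fun y => y + h) 1.
  by rewrite -[X in is_derive _ _ _ X]addr0; apply: is_deriveD.
have d1 := IH a (x + h) hs0 (addr_gt0 x0 h0); have d2 := IH a x hs0 x0.
apply: is_deriveB.
by have := @is_derive1_comp R _ (fun y => y + h) x _ _ d1 xh; rewrite mulr1.
Qed.

(** Derivatives commute with differences, so each use of the mean value theorem trades one
    difference for a factor h and one derivative. *)
Lemma fdiffs_MVT hs a x : all (> 0) hs -> 0 < x ->
  exists2 y, x <= y <= x + \sum_(h <- hs) h &
    fdiffs hs (@powR R ^~ a) x =
    ffallr a (size hs) * (\prod_(h <- hs) h) * y `^ (a - (size hs)%:R).
Proof.
elim: hs a x => [|h hs IH] a x /=.
  by move=> _ x0; exists x; rewrite !big_nil ?addr0 ?lexx// subr0 !mul1r.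
move=> /andP[h0 hs0] x0; set F := fdiffs hs _.
have dF (y : R) : 0 < y -> is_derive y 1 F (a * fdiffs hs (@powR R ^~ (a - 1)) y).
  exact: is_derive_fdiffs.
have [|y yI||y] := @MVT R F (fun y => a * fdiffs hs (@powR R ^~ (a - 1)) y) x (x + h).
- by rewrite ltrDl.
- by apply: dF; move: yI; rewrite in_itv/= => /andP[+ _]; exact: lt_trans.
- apply: is_derive_continuous_within => y /andP[xy _]; apply: dF.
  exact: lt_le_trans x0 xy.
rewrite in_itv/= => /andP[xy yxh] Fy.
have [z /andP[yz zy] ez] := IH (a - 1) y hs0 (lt_trans x0 xy).
exists z; rewrite !big_cons.
  by apply/andP; split; [lra|]; move: zy; set s := (\sum_(_ <- _) _); lra.
have -> : a - (size hs).+1%:R = a - 1 - (size hs)%:R by rewrite -natr1; ring.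
by rewrite /fdiff Fy ez; ring.
Qed.

(** Strictly between 1 and 2 there is no integer, so no factor vanishes. *)
Lemma ffallr_neq0 a k : 1 < a < 2 -> ffallr a k != 0.
Proof.
move=> a12; have {a12} : forall n : nat, a != n%:R.
  move=> n; apply/eqP => an; move: a12; rewrite an ltr1n (ltr_nat R n 2); lia.
elim: k a => [|k IH] a an /=; first exact: oner_neq0.
rewrite mulf_neq0//; first exact: (an 0%N).
by apply: IH => n; rewrite subr_eq natr1; exact: an.
Qed.

Lemma fdiffs_linD hs f g c d :
  fdiffs hs (fun y => c * f y + d * g y) =
  (fun y => c * fdiffs hs f y + d * fdiffs hs g y).
Proof.
by elim: hs => //= h hs ->; apply/funext => y; rewrite /fdiff; ring.
Qed.

Lemma fdiffs_id hs x : (1 < size hs)%N -> fdiffs hs id x = 0.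
Proof.
elim: hs x => // h [|h' hs] IH x //= _.
case: hs IH => [|h'' hs] IH; first by rewrite /fdiffs/= /fdiff; ring.
have e z : fdiff h' (fdiffs (h'' :: hs) id) z = 0 := IH z isT.
by rewrite {1}/fdiff !e subrr.
Qed.

End FiniteDifferences.

Section ExponentialSums.
Variable R : realType.
Implicit Types (theta : nat -> R) (N M L H : nat).

Lemma sin_ge_half (z : R) : 0 <= z <= 1 -> z / 2 <= sin z.
Proof.
move=> /andP[z0 z1]; move: z0; rewrite le_eqVlt => /predU1P[<-|z0].
  by rewrite sin0 mul0r.
have [c cz] : exists2 c, c \in `]0, z[%R & sin z - sin 0 = cos c * (z - 0).
  by apply: MVT => // y; apply: continuous_subspaceT; exact: continuous_sin.
rewrite sin0 !subr0 => ->; move: cz; rewrite in_itv/= => /andP[c0 cz].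
by have := cos_ge_quad c; nra.
Qed.

Lemma normc_cisB1_le (x : R) : normc (cis x - 1) <= `|x|.
Proof.
rewrite normc_cisB1; have := abs_sin_le (x / 2).
by rewrite normrM (ger0_norm (_ : 0 <= 2^-1))//; lra.
Qed.

Lemma normc_cisB (x y : R) : normc (cis x - cis y) <= `|x - y|.
Proof.
have -> : cis x - cis y = cis y * (cis (x - y) - 1).
  by rewrite mulrBr -cisD mulr1 [y + _]addrC subrK.
by rewrite ComplexField.Normc.normcM normc_cis mul1r normc_cisB1_le.
Qed.

Lemma normc_cisB1_ge (x : R) : `|x| <= 2 -> `|x| / 2 <= normc (cis x - 1).
Proof.
move=> x2; rewrite normc_cisB1.
wlog x0 : x x2 / 0 <= x => [H|].
  have [|x0] := leP 0 x; first exact: H.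
  by have := H (- x); rewrite normrN mulNr sinN normrN oppr_ge0 => ->//; rewrite ltW.
move: x2; rewrite ger0_norm// => x2.
have h : x / 2 / 2 <= sin (x / 2) by apply: sin_ge_half; apply/andP; split; lra.
by rewrite ger0_norm; lra.
Qed.

(* Abel summation against c n = 1 / (cis (phi n) - 1), phi the increment of theta:
   cis (theta n) = (cis (theta n.+1) - cis (theta n)) * c n. *)
Lemma kusmin_landau theta N M (d e : R) : 0 < d -> 0 <= e ->
  (forall n, (N <= n < M)%N -> d <= `|theta n.+1 - theta n| <= 1) ->
  (forall n, (N <= n < M)%N ->
     `|(theta n.+2 - theta n.+1) - (theta n.+1 - theta n)| <= e) ->
  normc (\sum_(N <= n < M) cis (theta n)) <= 4 / d + (M - N)%:R * (4 * e / d ^+ 2).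
Proof.
move=> d0 e0 phid phie.
have [MN|NM] := leqP M N.
  rewrite big_geq// ComplexField.Normc.normc0 addr_ge0//; first by rewrite divr_ge0// ltW.
  by rewrite !mulr_ge0// invr_ge0 exprn_ge0 ?ltW.
pose phi n := theta n.+1 - theta n; pose c n := (cis (phi n) - 1)^-1.
have ge n : (N <= n < M)%N -> d / 2 <= normc (cis (phi n) - 1).
  move=> /phid /andP[h1 h2].
  by apply: le_trans (normc_cisB1_ge _); rewrite -/(phi n) in h1 h2 *; lra.
have nz n : (N <= n < M)%N -> cis (phi n) - 1 != 0.
  move=> /ge; apply: contraTneq => ->; rewrite ComplexField.Normc.normc0; lra.
have cle n : (N <= n < M)%N -> normc (c n) <= 2 / d.
  move=> nI; rewrite ComplexField.Normc.normcV -invf_div lef_pV2 ?posrE ?divr_gt0 ?ge//.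
  by apply: lt_le_trans (ge _ nI); rewrite divr_gt0.
have cB n : (N <= n)%N -> (n.+1 < M)%N -> normc (c n - c n.+1) <= 4 * e / d ^+ 2.
  move=> Nn nM; have n1 : (N <= n < M)%N by rewrite Nn ltnW.
  have n2 : (N <= n.+1 < M)%N by rewrite (leqW Nn).
  have -> : c n - c n.+1 = c n * c n.+1 * (cis (phi n.+1) - cis (phi n)).
    by rewrite /c; field; rewrite !nz.
  rewrite !ComplexField.Normc.normcM.
  have h3 := le_trans (normc_cisB _ _) (phie _ n1).
  have -> : 4 * e / d ^+ 2 = (2 / d) * (2 / d) * e by field; rewrite gt_eqF.
  by rewrite !ler_pM ?mulr_ge0 ?normc_ge0 ?cle.
(* The boundary term of the Abel summation is kept on the left, so that each step of the induction
   only costs [c n - c n.+1]. *)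
suff main k : (N + k < M)%N ->
    normc (\sum_(N <= n < (N + k).+1) cis (theta n) - cis (theta (N + k).+1) * c (N + k)%N)
    <= 2 / d + k%:R * (4 * e / d ^+ 2).
  have kM : (N + (M - N).-1 < M)%N by lia.
  have := main _ kM; have -> : (N + (M - N).-1).+1 = M by lia.
  set S := (\sum_(_ <= _ < _) _); set w := cis _ * _ => h.
  have -> : S = (S - w) + w by rewrite subrK.
  apply: le_trans (normcD _ _) _.
  have hw : normc w <= 2 / d.
    by rewrite ComplexField.Normc.normcM normc_cis mul1r cle; lia.
  have hk : (M - N).-1%:R * (4 * e / d ^+ 2) <= (M - N)%:R * (4 * e / d ^+ 2).
    apply: ler_wpM2r; last by rewrite ler_nat leq_pred.
    by rewrite !mulr_ge0// invr_ge0 exprn_ge0 ?ltW.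
  have -> : 4 / d = 2 / d + 2 / d by ring.
  move: h hk hw; set X := _.-1%:R * _; set Y := (M - N)%:R * _.
  by move: (2 / d) (normc _) (normc w) => p q r; lra.
have step n : (N <= n < M)%N -> cis (theta n) - cis (theta n.+1) * c n = - (cis (theta n) * c n).
  move=> nI; have -> : theta n.+1 = theta n + phi n by rewrite /phi addrC subrK.
  by rewrite cisD /c; field; rewrite nz.
elim: k => [|k IH] kM.
  rewrite addn0 big_nat1 step ?leqnn// mul0r addr0 normcN.
  by rewrite ComplexField.Normc.normcM normc_cis mul1r cle ?leqnn.
rewrite addnS big_nat_recr ?leqW ?leq_addr//= -addrA step; last lia.
have -> (S : R[i]) n : S - cis (theta n.+1) * c n.+1 =
  (S - cis (theta n.+1) * c n) + cis (theta n.+1) * (c n - c n.+1) by ring.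
apply: le_trans (normcD _ _) _.
have -> : k.+1%:R * (4 * e / d ^+ 2) = k%:R * (4 * e / d ^+ 2) + 4 * e / d ^+ 2.
  by rewrite -natr1; ring.
rewrite [leRHS]addrA lerD//; first by apply: IH; lia.
by rewrite ComplexField.Normc.normcM normc_cis mul1r cB; lia.
Qed.

(** In a window of length L + H the sequence, extended by zero and shifted by j <= H, keeps its sum.
    Averaging over the shifts starts van der Corput's inequality. *)
Lemma sum_shift_window (f : nat -> R) L H j : (j <= H)%N ->
  \sum_(0 <= m < L + H) (if (j <= m)%N && (m - j < L)%N then f (m - j)%N else 0) =
  \sum_(0 <= n < L) f n.
Proof.
move=> jH; rewrite (@big_cat_nat _ _ _ j)//=; last lia.
rewrite [X in X + _]big_nat_cond [X in X + _]big1 ?add0r; last first.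
  by move=> m /andP[/andP[_ mj] _]; rewrite leqNgt mj.
rewrite -{1}(add0n j) big_addn (@big_cat_nat _ _ _ L)//=; last lia.
rewrite [X in _ + X]big_nat_cond [X in _ + X]big1 ?addr0; last first.
  by move=> m /andP[/andP[Lm _] _]; rewrite addnK ltnNge Lm andbF.
by apply: eq_big_nat => m /andP[_ mL]; rewrite addnK leq_addl mL.
Qed.

(** Each distance from j occurs at most twice. *)
Lemma sum_dist (D : nat -> R) H j : (j < H)%N -> (forall h, 0 <= D h) ->
  \sum_(0 <= i < H) D (if (i <= j)%N then j - i else i - j)%N <=
  2 * \sum_(0 <= h < H) D h.
Proof.
move=> jH D0; rewrite (@big_cat_nat _ _ _ j)//=; last exact: ltnW.
have nneg a b : 0 <= \sum_(a <= h < b) D h by apply: sumr_ge0.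
have le_sub a b : (b <= H)%N -> \sum_(a <= h < b) D h <= \sum_(0 <= h < H) D h.
  move=> bH; have [ab|/ltnW ba] := leqP a b; last by rewrite [leLHS]big_geq.
  by rewrite (@big_cat_nat _ _ _ a 0 H)//= ?(@big_cat_nat _ _ _ b a H)//= ?(leq_trans ab)//;
     have := nneg 0%N a; have := nneg b H; lra.
have h1 : \sum_(0 <= i < j) D (if (i <= j)%N then j - i else i - j)%N <= \sum_(0 <= h < H) D h.
  rewrite big_nat_rev /= add0n.
  rewrite (_ : \sum_(_ <= _ < _) _ = \sum_(1 <= h < j.+1) D h); first by rewrite le_sub.
  rewrite big_add1 /=; apply: eq_big_nat => i /andP[_ ij].
  by rewrite leq_subr; congr (D _); lia.
have h2 : \sum_(j <= i < H) D (if (i <= j)%N then j - i else i - j)%N <= \sum_(0 <= h < H) D h.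
  rewrite -{1}(add0n j) big_addn.
  rewrite (_ : \sum_(_ <= _ < _) _ = \sum_(0 <= h < H - j) D h); first by rewrite le_sub// leq_subr.
  by apply: eq_big_nat => i _; case: ifP => // ij; congr (D _); lia.
by lra.
Qed.

(** H copies of the sum are spread over a window of length L + H. Cauchy--Schwarz in the position m
    leaves the correlations of pairs of shifts, which depend only on the distance of the shifts. *)
Lemma van_der_corput0 theta L H (D : nat -> R) : (0 < H)%N -> (forall h, 0 <= D h) ->
  (forall h, (h < H)%N -> \sum_(0 <= n < L - h) cos (theta (n + h)%N - theta n) <= D h) ->
  H%:R * normc (\sum_(0 <= n < L) cis (theta n)) ^+ 2 <=
  (L + H)%:R * (2 * \sum_(0 <= h < H) D h).
Proof.
move=> H0 D0 hD.
pose Z (f : R -> R) m j := if (j <= m)%N && (m - j < L)%N then f (theta (m - j)%N) else 0.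
have Zsum f : H%:R * \sum_(0 <= n < L) f (theta n) =
    \sum_(0 <= m < L + H) \sum_(0 <= j < H) Z f m j.
  rewrite exchange_big /=.
  rewrite [RHS](eq_big_nat _ _ (F2 := fun=> \sum_(0 <= n < L) f (theta n))).
    by rewrite sumr_const_nat subn0 mulr_natl.
  by move=> j /andP[_ jH]; rewrite (sum_shift_window (fun n => f (theta n)))// ltnW.
have CS (F : nat -> R) K : (\sum_(0 <= m < K) F m) ^+ 2 <= K%:R * \sum_(0 <= m < K) F m ^+ 2.
  have := @jensen_sum R _ (fun=> 1) F (index_iota 0 K) (fun=> ler01).
  rewrite sumr_const_nat subn0 => h.
  by under [in leLHS]eq_bigr do rewrite -[F _]mul1r;
     under [in leRHS]eq_bigr do rewrite -[_ ^+ 2]mul1r.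
have sqE (F : nat -> R) : (\sum_(0 <= j < H) F j) ^+ 2 =
    \sum_(0 <= j < H) \sum_(0 <= i < H) F j * F i.
  by rewrite expr2 mulr_suml; apply: eq_bigr => j _; rewrite mulr_sumr.
(* The products of cosines and of sines add up to the cosine of a phase difference, the real part of
   the correlation. *)
have K_le j i : (j < H)%N -> (i < H)%N ->
    \sum_(0 <= m < L + H) (Z cos m j * Z cos m i + Z sin m j * Z sin m i) <=
    D (if (i <= j)%N then j - i else i - j)%N.
  wlog ij : i j / (i <= j)%N => [hw|] jH iH.
    have [|/ltnW ji] := leqP i j; first by move=> ij; have := hw _ _ ij jH iH; rewrite ij.
    have := hw _ _ ji iH jH; rewrite ji => h; have [ij|_] := boolP (i <= j)%N.
      by move: h; have -> : i = j by lia.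
    by apply: le_trans h; apply/le_of_eq/eq_bigr => m _; congr (_ + _); rewrite mulrC.
  rewrite ij; apply: le_trans (hD (j - i)%N _); last lia.
  apply/le_of_eq.
  rewrite (_ : \sum_(0 <= n < L - _) _ = \sum_(0 <= n < L)
     (if (n + (j - i) < L)%N then cos (theta (n + (j - i))%N - theta n) else 0)); last first.
    rewrite [RHS](@big_cat_nat _ _ _ (L - (j - i)))//=; last lia.
    rewrite [X in _ = _ + X]big_nat_cond [X in _ = _ + X]big1 ?addr0; last first.
      by move=> m /andP[/andP[h1 h2] _]; rewrite ifF//; lia.
    by apply: eq_big_nat => m h; rewrite ifT//; lia.
  rewrite -(sum_shift_window _ L (ltnW jH)); apply: eq_big_nat => m _; rewrite /Z.
  case: ifPn => jm; last by rewrite !mul0r addr0.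
  have -> : (m - j + (j - i))%N = (m - i)%N by lia.
  have -> /= : (i <= m)%N by lia.
  case: ifPn => h; last by rewrite !mulr0 addr0.
  by rewrite cosB mulrC [X in _ + X]mulrC.
have HR : 0 < H%:R :> R by rewrite ltr0n.
rewrite -(ler_pM2l HR).
have -> : H%:R * (H%:R * normc (\sum_(0 <= n < L) cis (theta n)) ^+ 2) =
    (H%:R * \sum_(0 <= n < L) cos (theta n)) ^+ 2 +
    (H%:R * \sum_(0 <= n < L) sin (theta n)) ^+ 2.
  by rewrite normcE_sqr cRe_sum cIm_sum /=; ring.
rewrite (Zsum cos) (Zsum sin).
apply: le_trans (lerD (CS _ _) (CS _ _)) _.
rewrite -mulrDr mulrCA ler_wpM2l// -big_split/=.
under eq_bigr do rewrite !sqE -big_split/=.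
rewrite exchange_big /= mulrCA.
apply: (@le_trans _ _ (\sum_(0 <= j < H) 2 * \sum_(0 <= h < H) D h)); last first.
  by apply/le_of_eq; rewrite sumr_const_nat subn0 -[_ *+ H]mulr_natl mulrCA.
rewrite [leLHS]big_nat_cond [leRHS]big_nat_cond; apply: ler_sum => j /andP[/andP[_ jH] _].
under eq_bigr do rewrite -big_split/=.
rewrite exchange_big /=; apply: le_trans (sum_dist jH D0).
rewrite [leLHS]big_nat_cond [leRHS]big_nat_cond; apply: ler_sum => i /andP[/andP[_ iH] _].
exact: K_le.
Qed.

Lemma van_der_corput theta N M H (D : nat -> R) : (0 < H)%N -> (forall h, 0 <= D h) ->
  (M - N)%:R <= D 0%N ->
  (forall h, (0 < h < H)%N ->
     normc (\sum_(N <= n < M - h) cis (theta (n + h)%N - theta n)) <= D h) ->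
  H%:R * normc (\sum_(N <= n < M) cis (theta n)) ^+ 2 <=
  ((M - N) + H)%:R * (2 * \sum_(0 <= h < H) D h).
Proof.
move=> H0 D0 D00 hD.
have := @van_der_corput0 (fun n => theta (n + N)%N) (M - N) H D H0 D0.
rewrite -[in X in _ -> X](add0n N) big_addn add0n; apply => h hH.
have [->|h0] := posnP h.
  rewrite subn0; apply: le_trans D00.
  under eq_bigr do rewrite addn0 subrr cos0.
  by rewrite sumr_const_nat subn0.
have hhH : (0 < h < H)%N by rewrite h0.
apply: le_trans (hD h hhH); apply: le_trans (normc_Re _); apply: le_trans (ler_norm _).
rewrite cRe_sum; have := @big_addn _ 0 +%R 0%N (M - h) N predT
  (fun n => Re (cis (theta (n + h)%N - theta n))).
rewrite add0n => ->; rewrite (_ : (M - h - N)%N = (M - N - h)%N); last lia.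
by apply/le_of_eq/eq_bigr => n _; rewrite addnAC.
Qed.

End ExponentialSums.

Section PowRFacts.
Variable R : realType.
Implicit Types a b r s : R.

Lemma powRDp a r s : 0 < a -> a `^ (r + s) = a `^ r * a `^ s.
Proof. by move=> a0; rewrite powRD// (gt_eqF a0) implybT. Qed.

Lemma powR_opp_mono e a b : e <= 0 -> 0 < a -> a <= b -> b `^ e <= a `^ e.
Proof.
move=> e0 a0 ab; have b0 := lt_le_trans a0 ab.
rewrite -(opprK e) !(powRN _ (- e)) lef_pV2 ?posrE ?powR_gt0//.
by rewrite ge0_ler_powR ?nnegrE ?oppr_ge0// ltW.
Qed.

Lemma powR_ge1 a r : 1 <= a -> 0 <= r -> 1 <= a `^ r.
Proof. by move=> a1 r0; rewrite -[leLHS](powRr0 a) ler_powR. Qed.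

Definition loglen (N : nat) : R := 1 + ln N%:R.

Lemma loglen_ge1 N : (0 < N)%N -> 1 <= loglen N.
Proof. by move=> N0; rewrite /loglen lerDl ln_ge0// ler1n. Qed.

(** Induction with 1 / h <= ln h - ln (h - 1), a form of ln (1 + x) <= x at x = - 1 / h. *)
Lemma harmonic_le H N : (H <= N.+1)%N -> (0 < N)%N ->
  \sum_(1 <= h < H) (h%:R)^-1 <= loglen N.
Proof.
move=> HN N0; have [H1|H1] := leqP H 1; first by rewrite big_geq// (le_trans ler01)// loglen_ge1.
case: H HN H1 => [//|[//|H]] HN _; apply: (@le_trans _ _ (loglen H.+1)); last first.
  by rewrite lerD2l ler_ln ?posrE ?ltr0n// ler_nat; lia.
elim: H {HN} => [|H IH]; first by rewrite big_nat1 invr1 /loglen ln1 addr0.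
rewrite big_nat_recr//=; apply: le_trans (lerD IH (lexx _)) _.
rewrite /loglen -addrA lerD2l.
have -> : H.+1%:R = H.+2%:R * (1 + - (H.+2%:R)^-1) :> R.
  by rewrite mulrBr mulr1 divff ?pnatr_eq0// -[X in X - 1]natr1 addrK.
have h : 0 < (H.+2%:R : R)^-1 < 1.
  by rewrite invr_gt0 ltr0n/= invf_lt1 ?ltr0n// ltr1n.
rewrite lnM; [|by rewrite posrE ltr0n|by rewrite posrE subr_gt0; case/andP: h].
rewrite -addrA gerDl; have : ln (1 - (H.+2%:R)^-1) <= - (H.+2%:R : R)^-1.
  by apply: le_ln1Dx; rewrite ltrN2; case/andP: h.
by rewrite -lerBrDr sub0r.
Qed.

(** ln y <= y - 1 at y = N^e. *)
Lemma loglen_le e N : 0 < e -> (0 < N)%N -> loglen N <= (1 + e^-1) * N%:R `^ e.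
Proof.
move=> e0 N0; have n1 : 1 <= N%:R :> R by rewrite ler1n.
have n0 : 0 < N%:R :> R by rewrite ltr0n.
rewrite /loglen mulrDl mul1r; apply: lerD; first by rewrite powR_ge1// ltW.
rewrite ler_pdivlMl// -ln_powR.
have := @le_ln1Dx R (N%:R `^ e - 1); rewrite [1 + _]addrC subrK => h.
apply: le_trans (h _) _; last by rewrite gerBl.
by rewrite ltrBrDl addrN powR_gt0.
Qed.

End PowRFacts.

Section PowerPhase.
Variables (R : realType) (al t : R).
Hypotheses (al12 : 1 < al < 2) (t0 : t != 0).
Implicit Types (hs : seq R) (N A B : nat).

Definition power_phase (x y : R) : R := t * y `^ al + x * y.

(** Two differences remove the linear part of the phase; this makes the bounds below uniform in
    x. *)
Lemma fdiffs_power_phase hs x y : (1 < size hs)%N ->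
  fdiffs hs (power_phase x) y = t * fdiffs hs (@powR R ^~ al) y.
Proof.
by move=> h; rewrite (fdiffs_linD hs (@powR R ^~ al) id) fdiffs_id// mulr0 addr0.
Qed.

(** The intermediate point of [fdiffs_MVT] lies in [n, 8n], where y^(al - k) is determined up to the
    factor 8^(al - k). *)
Lemma fdiffs_powR_bounds k : (1 < k)%N -> exists c C : R, [/\ 0 < c, 0 < C &
  forall hs (n y : R), size hs = k -> all (> 0) hs -> 0 < n -> n <= y ->
    y + \sum_(h <- hs) h <= 8 * n ->
    c * (\prod_(h <- hs) h * n `^ (al - k%:R)) <= `|fdiffs hs (@powR R ^~ al) y| <=
    C * (\prod_(h <- hs) h * n `^ (al - k%:R))].
Proof.
move=> k1; have f0 : 0 < `|ffallr al k| by rewrite normr_gt0 ffallr_neq0.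
exists (`|ffallr al k| * 8 `^ (al - k%:R)), `|ffallr al k|; split=> //.
  by rewrite mulr_gt0// powR_gt0.
move=> hs n y sk hs0 n0 ny yn; have y0 := lt_le_trans n0 ny.
have [z /andP[yz zy] ->] := fdiffs_MVT al hs0 y0.
have e0 : al - k%:R <= 0.
  by move/andP: al12 => [_ a2]; rewrite subr_le0 (le_trans (ltW a2))// ler_nat.
have p0 : 0 <= \prod_(h <- hs) h.
  by rewrite big_seq prodr_ge0// => h /(allP hs0) /ltW.
rewrite sk !normrM (ger0_norm p0) (ger0_norm (powR_ge0 _ _)).
have z0 : 0 < z by exact: lt_le_trans y0 yz.
apply/andP; split; last first.
  by rewrite -mulrA ler_wpM2l// ler_wpM2l// powR_opp_mono// (le_trans ny).
rewrite -!mulrA ler_wpM2l// mulrCA ler_wpM2l//.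
rewrite -powRM ?(ltW n0)//; apply: powR_opp_mono => //; exact: le_trans zy yn.
Qed.

(** Kusmin--Landau on a dyadic range: the increments of the differenced phase have size |t| Q, where
    Q is the product of the steps with N^(al - k - 1), and the increments of these have size |t| Q /
    N. The condition C Q <= 1 keeps the former below 1, and summing e / d^2 over N terms then costs
    no more than 1 / d. *)
Lemma expsum_diff_small k : (0 < k)%N -> exists C K : R, [/\ 0 < C, 0 < K &
  forall hs N A B x, size hs = k -> all (> 0) hs -> (0 < N)%N -> (N <= A)%N ->
    (B <= N.*2)%N -> \sum_(h <- hs) h <= 4 * N%:R ->
    C * (\prod_(h <- hs) h * N%:R `^ (al - k.+1%:R)) <= 1 ->
    normc (\sum_(A <= n < B) cis (fdiffs hs (power_phase x) n%:R)) <=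
    K / (\prod_(h <- hs) h * N%:R `^ (al - k.+1%:R))].
Proof.
move=> k0; have [c1 [C1 [c10 C10 H1]]] := @fdiffs_powR_bounds k.+1 k0.
have [c2 [C2 [c20 C20 H2]]] := @fdiffs_powR_bounds k.+2 isT.
have tp : 0 < `|t| by rewrite normr_gt0.
exists (`|t| * C1), (4 / (`|t| * c1) + 4 * C2 / (`|t| * c1 ^+ 2)); split.
- exact: mulr_gt0.
- by rewrite addr_gt0// divr_gt0 ?mulr_gt0 ?exprn_gt0.
move=> hs N A B x sk hs0 N0 NA BN sN; set p := \prod_(h <- hs) h.
have n0 : 0 < N%:R :> R by rewrite ltr0n.
have n1 : 1 <= N%:R :> R by rewrite ler1n.
have p0 : 0 < p by rewrite /p big_seq prodr_gt0// => h /(allP hs0).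
set Q := p * _ => QC; have Q0 : 0 < Q by rewrite mulr_gt0// powR_gt0.
have nI n : (A <= n < B)%N -> N%:R <= n%:R :> R /\ n%:R + (2 + \sum_(h <- hs) h) <= 8 * N%:R :> R.
  move=> /andP[An nB]; rewrite ler_nat (leq_trans NA)//; split=> //.
  have : n%:R <= 2 * N%:R - 1 :> R.
    by rewrite lerBrDr natr1 -natrM ler_nat; move: nB BN; clear; lia.
  by move: sN; set s := \sum_(_ <- _) _; lra.
have D1 (n : nat) : fdiffs hs (power_phase x) n.+1%:R - fdiffs hs (power_phase x) n%:R =
    t * fdiffs (1 :: hs) (@powR R ^~ al) n%:R.
  by rewrite -(fdiffs_power_phase x)/= ?sk// /fdiff natr1.
have key := @kusmin_landau R (fun n => fdiffs hs (power_phase x) n%:R) A B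
  (`|t| * c1 * Q) (`|t| * C2 * (Q / N%:R)).
apply: le_trans (key _ _ _ _) _.
- by apply: mulr_gt0 => //; exact: mulr_gt0.
- by rewrite mulr_ge0 ?mulr_ge0 ?divr_ge0// ltW.
- move=> n nAB; rewrite D1 normrM; have [h1 h2] := nI n nAB.
  have := H1 (1 :: hs) N%:R n%:R; rewrite !big_cons mul1r /= sk ltr01 -/Q.
  move=> /(_ erefl hs0 n0 h1) /(_ _)/andP[|l1 l2].
    by move: h2; set s := \sum_(_ <- _) _; lra.
  rewrite -mulrA ler_pM2l// l1/=.
  by apply: le_trans QC; rewrite -mulrA ler_pM2l.
- move=> n nAB; rewrite !D1 -mulrBr normrM; have [h1 h2] := nI n nAB.
  have -> : fdiffs (1 :: hs) (@powR R ^~ al) n.+1%:R - fdiffs (1 :: hs) (@powR R ^~ al) n%:R =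
    fdiffs (1 :: 1 :: hs) (@powR R ^~ al) n%:R by rewrite [RHS]/= [RHS]/fdiff natr1.
  have := H2 (1 :: 1 :: hs) N%:R n%:R; rewrite !big_cons !mul1r /= sk ltr01 /=.
  move=> /(_ erefl hs0 n0 h1) /(_ _)/andP[|_ l].
    by move: h2; set s := \sum_(_ <- _) _; lra.
  rewrite -mulrA ler_pM2l//; apply: le_trans l _.
  rewrite ler_pM2l// /Q -mulrA ler_pM2l//.
  by rewrite -[in leRHS](powR_inv1 (ltW n0)) -powRDp// -addrA -opprD natr1.
have BA : (B - A)%:R <= N%:R :> R by rewrite ler_nat; move: NA BN; clear; lia.
have -> : (4 / (`|t| * c1) + 4 * C2 / (`|t| * c1 ^+ 2)) / Q =
   4 / (`|t| * c1 * Q) + N%:R * (4 * (`|t| * C2 * (Q / N%:R)) / (`|t| * c1 * Q) ^+ 2).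
  by field; rewrite !gt_eqF.
rewrite lerD2l ler_wpM2r// !mulr_ge0// ?invr_ge0 ?exprn_ge0 ?mulr_ge0 ?invr_ge0// ltW//.
Qed.

(** l is the size of the second derivative of the phase once differenced along [hs]. One further van
    der Corput differencing with shift h reduces to [expsum_diff_small] with h l in place of l; the
    sum over h of 1 / (h l) gives the logarithm. *)
Lemma second_derivative_test k : exists2 K : R, 0 < K &
  forall hs N A B x, size hs = k -> all (> 0) hs -> (0 < N)%N -> (N <= A)%N ->
    (B <= N.*2)%N -> \sum_(h <- hs) h <= 3 * N%:R ->
    forall l, l = \prod_(h <- hs) h * N%:R `^ (al - k.+2%:R) ->
    normc (\sum_(A <= n < B) cis (fdiffs hs (power_phase x) n%:R)) ^+ 2 <=
    K * ((1 + N%:R * l) * (N%:R + loglen R N / l)).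
Proof.
have [C [K [C0 K0 HCK]]] := @expsum_diff_small k.+1 isT.
exists (4 * (1 + C) * (1 + K)); first by nra.
move=> hs N A B x sk hs0 N0 NA BN sN l lE.
have n0 : 0 < N%:R :> R by rewrite ltr0n.
have p0 : 0 < \prod_(h <- hs) h by rewrite big_seq prodr_gt0// => h /(allP hs0).
have l0 : 0 < l by rewrite lE mulr_gt0// powR_gt0.
(* A shift h < H0 satisfies C h l <= 1, as [expsum_diff_small] requires; the cap by N keeps the
   shifts inside the dyadic range. *)
pose H0 := (Num.truncn (C * l)^-1).+1; pose H := minn N H0.
have Hp : (0 < H)%N by rewrite leq_min N0.
have HR : 0 < H%:R :> R by rewrite ltr0n.
have Cl0 : 0 < (C * l)^-1 by rewrite invr_gt0 mulr_gt0.
have /andP[tr1 tr2] := truncn_itv (ltW Cl0).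
have Hinv : (H%:R)^-1 <= N%:R^-1 + C * l.
  rewrite /H; have [_|_] := leqP N H0; first by rewrite lerDl mulr_ge0 ?ltW.
  apply: (@le_trans _ _ (C * l)); last by rewrite lerDr invr_ge0 ltW.
  by rewrite -[leRHS]invrK lef_pV2 ?posrE ?ltr0n// ltW.
pose D h := if h is 0%N then N%:R else K / l * (h%:R)^-1.
have D0 h : 0 <= D h.
  by case: h => [|h]; rewrite /D ?ler0n// !mulr_ge0 ?invr_ge0 ?ltW.
have := @van_der_corput R (fun n => fdiffs hs (power_phase x) n%:R) A B H D Hp D0.
rewrite {1}/D ler_nat => /(_ _ _) vdc.
have {}vdc := vdc _ _; have LN : (B - A <= N)%N by move: NA BN; clear; lia.
have {vdc} := vdc LN _; set S := normc _ => vdc.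
have {}vdc : H%:R * S ^+ 2 <= (B - A + H)%:R * (2 * \sum_(0 <= h < H) D h).
  apply: vdc => h /andP[h0 hH]; have hr : 0 < h%:R :> R by rewrite ltr0n.
  have hN : (h < N)%N by apply: leq_trans hH _; rewrite geq_minl.
  have hH0 : (h < H0)%N by apply: leq_trans hH _; rewrite geq_minr.
  have := HCK (h%:R :: hs) N A (B - h)%N x; rewrite !big_cons /= sk hr hs0.
  rewrite -mulrA -lE => HC.
  have -> : D h = K / (h%:R * l).
    by rewrite /D; case: h h0 hr {hH hN hH0 HC} => // h _ hr; rewrite invfM mulrAC -mulrA.
  rewrite [X in normc X](_ : _ = \sum_(A <= n < B - h) cis (fdiff h%:R (fdiffs hs (power_phase x)) n%:R)).
    apply: HC => //; first by move: BN; clear; lia.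
    - have : h%:R <= N%:R :> R by rewrite ler_nat ltnW.
      by move: sN; set s := \sum_(_ <- _) _; lra.
    - rewrite mulrCA -ler_pdivlMr ?mulr_gt0// div1r; apply: le_trans tr1.
      by rewrite ler_nat.
  by apply: eq_bigr => n _; rewrite /fdiff natrD.
have SD : \sum_(0 <= h < H) D h <= N%:R + K / l * loglen R N.
  rewrite big_ltn// lerD2l.
  rewrite (_ : \sum_(1 <= h < H) D h = K / l * \sum_(1 <= h < H) (h%:R)^-1); last first.
    rewrite mulr_sumr; apply: eq_big_nat => -[|h]//.
  apply: ler_wpM2l; first by rewrite divr_ge0// ltW.
  by apply: harmonic_le => //; apply: leq_trans (geq_minl _ _) _.
have Lam := loglen_ge1 R N0.
have BH : (B - A + H)%:R <= 2 * N%:R :> R.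
  by rewrite -natrM ler_nat mul2n -addnn leq_add// geq_minl.
have E : S ^+ 2 <= (N%:R^-1 + C * l) * (4 * N%:R * (N%:R + K / l * loglen R N)).
  apply: (@le_trans _ _ ((H%:R)^-1 * (4 * N%:R * (N%:R + K / l * loglen R N)))); last first.
    apply: ler_wpM2r Hinv.
    by rewrite mulr_ge0 ?mulr_ge0 ?addr_ge0 ?mulr_ge0 ?invr_ge0 ?(le_trans ler01 Lam)// ltW.
  rewrite ler_pdivlMl//; apply: le_trans vdc _.
  have -> : 4 * N%:R * (N%:R + K / l * loglen R N) = (2 * N%:R) * (2 * (N%:R + K / l * loglen R N)) by ring.
  by apply: ler_pM => //; [apply: mulr_ge0 => //; exact: sumr_ge0|rewrite ler_pM2l].
apply: le_trans E _.
set L := loglen R N in Lam *.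
have -> : (N%:R^-1 + C * l) * (4 * N%:R * (N%:R + K / l * L)) =
  4 * ((1 + C * (N%:R * l)) * (N%:R + K * (L / l))) by field; rewrite !gt_eqF.
have -> : 4 * (1 + C) * (1 + K) * ((1 + N%:R * l) * (N%:R + L / l)) =
  4 * (((1 + C) * (1 + N%:R * l)) * ((1 + K) * (N%:R + L / l))) by ring.
have X0 : 0 < N%:R * l by rewrite mulr_gt0.
have Y0 : 0 < L / l by rewrite divr_gt0// (lt_le_trans ltr01 Lam).
rewrite ler_pM2l//; move: C0 K0 X0 Y0 (n0); set y := N%:R * l; set w := L / l; clear.
by move=> C0 K0 X0 Y0 n0; apply: ler_pM; nra.
Qed.

(** The previous test for the phase itself: l = N^(al - 2), so 1 + N l is of order N^(al - 1) and N
    + log N / l at most of order N log N. *)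
Lemma expsum_second : exists2 K : R, 0 < K & forall N A B x, (0 < N)%N -> (N <= A)%N ->
  (B <= N.*2)%N -> normc (\sum_(A <= n < B) cis (power_phase x n%:R)) ^+ 2 <=
  K * (loglen R N ^+ 2 * N%:R `^ al).
Proof.
have [K K0 HK] := second_derivative_test 0; exists (4 * K); first by rewrite mulr_gt0.
move=> N A B x N0 NA BN; have := HK [::] N A B x erefl isT N0 NA BN.
rewrite !big_nil mul1r => /(_ _ _ erefl) H; apply: le_trans (H _) _; first by rewrite mulr_ge0.
move/andP: al12 => [a1 a2].
have n0 : 0 < N%:R :> R by rewrite ltr0n.
have n1 : 1 <= N%:R :> R by rewrite ler1n.
have Lam := loglen_ge1 R N0; set L := loglen R N in Lam *.
have e1 : N%:R * N%:R `^ (al - 2) = N%:R `^ (al - 1).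
  by rewrite -{1}(powRr1 (ltW n0)) -powRDp//; congr (_ `^ _); ring.
have e2 : (N%:R `^ (al - 2))^-1 = N%:R `^ (2 - al) by rewrite -powRN opprB.
have e3 : N%:R `^ al = N%:R * N%:R `^ (al - 1).
  by rewrite -{2}(powRr1 (ltW n0)) -powRDp//; congr (_ `^ _); ring.
rewrite e1 e2 e3.
have h1 : 1 <= N%:R `^ (al - 1) by rewrite powR_ge1// subr_ge0 ltW.
have h2 : N%:R `^ (2 - al) <= N%:R by rewrite ler1_powR//; lra.
have h3 := powR_ge0 N%:R (2 - al).
have -> : 4 * K * (L ^+ 2 * (N%:R * N%:R `^ (al - 1))) =
  K * ((2 * N%:R `^ (al - 1)) * (2 * L ^+ 2 * N%:R)) by ring.
rewrite ler_pM2l//.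
apply: ler_pM; [lra|nra|lra|].
apply: (@le_trans _ _ (N%:R + L * N%:R)); first by rewrite lerD2l ler_wpM2l//; lra.
have : N%:R + L * N%:R = (1 + L) * N%:R by ring.
by move=> ->; rewrite ler_pM2r//; nra.
Qed.

(** One differencing by h, then the second derivative test for the differenced phase, whose second
    derivative has size h N^(al - 3). The hypothesis al >= 3/2 enters through N <= X^2 and N^(3 -
    al) <= X^2 Y, which make the secondary terms harmless. *)
Lemma expsum_third : 3 / 2 <= al -> exists2 K : R, 0 < K & forall N A B x, (0 < N)%N ->
  (N <= A)%N -> (B <= N.*2)%N ->
  normc (\sum_(A <= n < B) cis (power_phase x n%:R)) ^+ 2 <=
  K * (loglen R N ^+ 2 * N%:R `^ (1 + al / 3)).
Proof.
move=> al32; have [K K0 HK] := second_derivative_test 1.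
exists (6 * (2 + 4 * K + K)); first by nra.
have h4 : 0 <= 1 + 4 * K by lra.
have K0' := ltW K0.
move=> N A B x N0 NA BN; move/andP: al12 => [a1 a2].
have n0 : 0 < N%:R :> R by rewrite ltr0n.
have n1 : 1 <= N%:R :> R by rewrite ler1n.
have Lam := loglen_ge1 R N0; set L := loglen R N in Lam *.
have L0 : 0 <= L by exact: le_trans Lam.
have L2 : L <= L ^+ 2 by rewrite expr2 ler_peMl.
set n : R := N%:R in n0 n1 *.
pose X := n `^ (al / 3); pose Y := n `^ (1 - al / 3).
have X0 : 0 < X by exact: powR_gt0.
have X0' := ltW X0.
have Y0 : 0 < Y by exact: powR_gt0.
have XY : X * Y = n by rewrite -powRDp// addrC subrK powRr1// ltW.
have X1 : 1 <= X by apply: powR_ge1 => //; lra.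
have Y1 : 1 <= Y by apply: powR_ge1 => //; lra.
have Yn : Y <= n by rewrite ler1_powR//; lra.
have nX2 : n <= X ^+ 2.
  by rewrite -[leLHS](powRr1 (ltW n0)) expr2 -powRDp// ler_powR//; lra.
have XX : X ^+ 2 = Y * n `^ (al - 1).
  by rewrite expr2 -!powRDp//; congr (_ `^ _); lra.
have nX3 : n `^ (3 - al) <= X * Y * X.
  by rewrite -!powRDp// ler_powR//; lra.
(* The number of shifts, about Y = N^(1 - al/3), balances the diagonal term N^2 / H against N X, the
   contribution of the differenced sums. *)
pose H := (Num.truncn Y).+1; have /andP[tr1 tr2] := truncn_itv (ltW Y0).
have HR : 0 < H%:R :> R by rewrite ltr0n.
have Hinv : (H%:R)^-1 <= Y^-1 by rewrite lef_pV2 ?posrE// ltW.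
have H2 : H%:R <= 2 * Y.
  have -> : H%:R = (Num.truncn Y)%:R + 1 :> R by rewrite natr1.
  by lra.
have HN : (H <= N.+1)%N by rewrite ltnS -(ler_nat R); exact: le_trans tr1 Yn.
pose D h := if h is 0%N then n else L * X * (1 + 4 * K) + K * L * n `^ (3 - al) / X * (h%:R)^-1.
have D0 h : 0 <= D h.
  case: h => [|h]; rewrite /D ?(ltW n0)//.
  have h1 : 0 <= (h.+1%:R : R)^-1 by rewrite invr_ge0 ler0n.
  have h2 : 0 <= X^-1 by rewrite invr_ge0.
  have h3 := powR_ge0 n (3 - al).
  by apply: addr_ge0; rewrite !mulr_ge0.
have vdc : H%:R * normc (\sum_(A <= m < B) cis (power_phase x m%:R)) ^+ 2 <=
    (B - A + H)%:R * (2 * \sum_(0 <= h < H) D h).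
  apply: van_der_corput => //; first by rewrite /D ler_nat; move: NA BN; clear; lia.
  move=> h /andP[h0 hH]; have hr : 0 < h%:R :> R by rewrite ltr0n.
  have h1 : 1 <= h%:R :> R by rewrite ler1n.
  have hN : (h <= N)%N by rewrite -ltnS (leq_trans hH).
  have hY : h%:R <= Y by apply: le_trans tr1; rewrite ler_nat.
  have := HK [:: h%:R] N A (B - h)%N x erefl; rewrite /= hr !big_seq1 -/n -/L => /(_ isT N0 NA).
  rewrite (eq_bigr (fun m => cis (power_phase x (m + h)%:R - power_phase x m%:R))); last first.
    by move=> m _; rewrite /fdiff natrD.
  set s := normc _ => /(_ _ _ _ erefl) HS.
  have {HS} : s ^+ 2 <= K * ((1 + n * (h%:R * n `^ (al - 3))) * (n + L / (h%:R * n `^ (al - 3)))).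
    apply: HS; first by move: BN; clear; lia.
    by have : h%:R <= n by [rewrite ler_nat]; lra.
  have e1 : n * (h%:R * n `^ (al - 3)) = h%:R * n `^ (al - 2).
    by rewrite mulrCA -{1}(powRr1 (ltW n0)) -powRDp//; congr (_ * _ `^ _); ring.
  have e2 : L / (h%:R * n `^ (al - 3)) = L * n `^ (3 - al) / h%:R.
    by rewrite invfM -powRN opprB mulrA mulrAC.
  have e3 : n `^ (al - 2) * n = n `^ (al - 1).
    by rewrite -{2}(powRr1 (ltW n0)) -powRDp//; congr (_ `^ _); ring.
  have e4 : n `^ (al - 2) * n `^ (3 - al) = n.
    by rewrite -powRDp// (_ : _ + _ = 1) ?powRr1 ?ltW//; ring.
  rewrite e1 e2 => HS.
  have HS2 : s ^+ 2 <= K * (4 * L * X ^+ 2 + L * n `^ (3 - al) / h%:R).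
    apply: le_trans HS _; rewrite ler_pM2l//.
    have -> : (1 + h%:R * n `^ (al - 2)) * (n + L * n `^ (3 - al) / h%:R) =
       n + L * n `^ (3 - al) / h%:R + h%:R * (n `^ (al - 2) * n) +
       L * (n `^ (al - 2) * n `^ (3 - al)) by field; rewrite gt_eqF.
    rewrite e3 e4 addrAC -[leLHS]addrA [X in X <= _]addrC [leRHS]addrC.
    have : h%:R * n `^ (al - 1) <= X ^+ 2 by rewrite XX ler_wpM2r// powR_ge0.
    set u := L * n `^ _ / _; set v := _ * n `^ _.
    have LX : L * n <= L * X ^+ 2 by rewrite ler_wpM2l.
    have nL : n <= L * n by rewrite ler_peMl// ltW.
    have XL : X ^+ 2 <= L * X ^+ 2 by rewrite ler_peMl// sqr_ge0.
    by move: LX nL XL; lra.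
  have s0 : 0 <= s by exact: normc_ge0.
  (* Turns the bound for s^2 into one that can be summed over h; X is the size expected of s. *)
  have sX : s <= X + s ^+ 2 / X.
    rewrite -(ler_pM2r X0) mulrDl divfK ?gt_eqF//.
    by move: X0 s0; clear; nra.
  apply: le_trans sX _.
  have {}HS2 : s ^+ 2 / X <= K * (4 * L * X ^+ 2 + L * n `^ (3 - al) / h%:R) / X.
    by rewrite ler_pM2r ?invr_gt0.
  apply: le_trans (lerD (lexx _) HS2) _.
  have -> : D h = L * X * (1 + 4 * K) + K * L * n `^ (3 - al) / X * (h%:R)^-1.
    by rewrite /D; case: (h) h0.
  have -> : K * (4 * L * X ^+ 2 + L * n `^ (3 - al) / h%:R) / X =
    4 * K * L * X + K * L * n `^ (3 - al) / X * (h%:R)^-1 by field; rewrite !gt_eqF.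
  have XL : X <= L * X by rewrite ler_peMl.
  rewrite addrA lerD2r (_ : L * X * (1 + 4 * K) = L * X + 4 * K * L * X); last by ring.
  by rewrite lerD2r.
have SD : \sum_(0 <= h < H) D h <= n + H%:R * (L * X * (1 + 4 * K)) + K * L ^+ 2 * n `^ (3 - al) / X.
  rewrite big_ltn// -addrA lerD2l.
  rewrite (_ : \sum_(1 <= h < H) D h = \sum_(1 <= h < H) (L * X * (1 + 4 * K)) +
      K * L * n `^ (3 - al) / X * \sum_(1 <= h < H) (h%:R)^-1); last first.
    by rewrite mulr_sumr -big_split/=; apply: eq_big_nat => -[|h].
  apply: lerD.
    rewrite sumr_const_nat -[_ *+ _]mulr_natl ler_wpM2r ?ler_nat ?leq_subr//.
      by rewrite !mulr_ge0.
  have -> : K * L ^+ 2 * n `^ (3 - al) / X = K * L * n `^ (3 - al) / X * L by ring.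
  apply: ler_wpM2l; last exact: harmonic_le.
  by rewrite !mulr_ge0 ?invr_ge0 ?powR_ge0.
set S := normc _ in vdc *.
have BH : (B - A + H)%:R <= 3 * n.
  by rewrite natrD; have : (B - A)%:R <= n by [rewrite ler_nat; move: NA BN; clear; lia]; lra.
have {}vdc : S ^+ 2 <= (H%:R)^-1 *
    (6 * n * (n + H%:R * (L * X * (1 + 4 * K)) + K * L ^+ 2 * n `^ (3 - al) / X)).
  rewrite ler_pdivlMl//; apply: le_trans vdc _.
  set T := n + _ + _ in SD *; have -> : 6 * n * T = (3 * n) * (2 * T) by ring.
  by apply: ler_pM => //; [apply: mulr_ge0 => //; exact: sumr_ge0|rewrite ler_pM2l].
apply: le_trans vdc _.
have -> : (H%:R)^-1 * (6 * n * (n + H%:R * (L * X * (1 + 4 * K)) + K * L ^+ 2 * n `^ (3 - al) / X)) =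
  6 * n * (n * (H%:R)^-1 + L * X * (1 + 4 * K) + K * L ^+ 2 * (n `^ (3 - al) / X) * (H%:R)^-1).
  by field; rewrite !gt_eqF.
have -> : n `^ (1 + al / 3) = n * X by rewrite powRDp// powRr1// ltW.
have -> : 6 * (2 + 4 * K + K) * (L ^+ 2 * (n * X)) =
  6 * n * (L ^+ 2 * X + L ^+ 2 * X * (1 + 4 * K) + K * L ^+ 2 * X) by ring.
rewrite ler_pM2l ?mulr_gt0//; apply: lerD; first apply: lerD.
- apply: (@le_trans _ _ X); last by rewrite ler_peMl ?(ltW X0)// (le_trans Lam).
  by rewrite -[leRHS](mulfK (lt0r_neq0 Y0)) XY ler_pM2l.
- by rewrite ler_pM2r ?ler_pM2r// addr_gt0// mulr_gt0.
- rewrite -mulrA ler_wpM2l; [by []|by rewrite mulr_ge0 ?sqr_ge0// ltW|].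
  apply: (@le_trans _ _ (X * Y * Y^-1)); last by rewrite mulfK// gt_eqF.
  apply: ler_pM => //; last by rewrite ler_pdivrMr.
    by rewrite divr_ge0 ?powR_ge0// ltW.
Qed.

(** Both tests give N^(1 - gam) up to a logarithm, which the gap gam - b absorbs. *)
Lemma expsum_bound b gam : 0 < b < gam ->
  (gam = 1 - al / 2) \/ (3 / 2 <= al /\ gam = 1 / 2 - al / 6) ->
  exists2 K : R, 0 < K & forall N A B x, (0 < N)%N -> (N <= A)%N -> (B <= N.*2)%N ->
    normc (\sum_(A <= n < B) cis (power_phase x n%:R)) <= K * N%:R `^ (1 - b).
Proof.
move=> /andP[b0 bg] hg.
have [K K0 HK] : exists2 K : R, 0 < K & forall N A B x, (0 < N)%N -> (N <= A)%N ->
    (B <= N.*2)%N -> normc (\sum_(A <= n < B) cis (power_phase x n%:R)) ^+ 2 <=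
    K * (loglen R N ^+ 2 * N%:R `^ (2 - 2 * gam)).
  case: hg => [->|[al32 ->]].
    have -> : 2 - 2 * (1 - al / 2) = al by lra.
    exact: expsum_second.
  have -> : 2 - 2 * (1 / 2 - al / 6) = 1 + al / 3 by lra.
  exact: expsum_third.
have e0 : 0 < gam - b by rewrite subr_gt0.
pose C := 1 + (gam - b)^-1; have C0 : 0 < C by rewrite addr_gt0 ?invr_gt0.
exists ((1 + K) * C); first by nra.
move=> N A B x N0 NA BN; have n0 : 0 < N%:R :> R by rewrite ltr0n.
have Lle := loglen_le e0 N0; have Lge := loglen_ge1 R N0.
rewrite -(@ler_pXn2r _ 2)// ?nnegrE ?normc_ge0//; last first.
  by rewrite !mulr_ge0 ?powR_ge0 ?addr_ge0 ?invr_ge0// ltW.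
apply: le_trans (HK _ _ _ _ N0 NA BN) _.
have -> : N%:R `^ (1 - b) = N%:R `^ (gam - b) * N%:R `^ (1 - gam).
  by rewrite -powRDp//; congr (_ `^ _); ring.
have -> : N%:R `^ (2 - 2 * gam) = N%:R `^ (1 - gam) ^+ 2.
  by rewrite expr2 -powRDp//; congr (_ `^ _); ring.
rewrite mulrA [leRHS](_ : _ = ((1 + K) ^+ 2 * (C * N%:R `^ (gam - b)) ^+ 2) * N%:R `^ (1 - gam) ^+ 2); last by ring.
rewrite ler_wpM2r ?sqr_ge0//; apply: ler_pM; rewrite ?sqr_ge0 ?(ltW K0)//; first nra.
by rewrite ler_pXn2r ?nnegrE ?(le_trans ler01 Lge)// (le_trans _ Lle)// (le_trans ler01 Lge).
Qed.

End PowerPhase.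

(** * Integration *)

Section RealIntegrals.
Variable R : realType.
Local Notation mu := (@lebesgue_measure R).
Implicit Types (f g F : R -> R) (a b c d S M K x y : R) (D : set R).

Lemma abs_between x y c : x <= y -> y <= c -> `|y| <= `|x| + `|c|.
Proof.
move=> xy yc; have := ler_norm c; have := ler_norm (- x); rewrite normrN ler_norml.
by have := normr_ge0 x; have := normr_ge0 c; move=> *; apply/andP; split; lra.
Qed.

Lemma integrable_bdd D f M : measurable D -> (mu D < +oo)%E ->
  measurable_fun D f -> (forall x, D x -> `|f x| <= M) -> mu.-integrable D (EFin \o f).
Proof.
move=> mD fD mf fM; apply: measurable_bounded_integrable => //.
exists M; split; first exact: num_real.
by move=> r Mr x /= Dx; apply: le_trans (fM _ Dx) (ltW Mr).
Qed.

Lemma itv_fin a b : (mu `[a, b] < +oo)%E.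
Proof. by rewrite lebesgue_measure_itv/=; case: ifP => // _; rewrite -EFinB ltry. Qed.

Lemma measurable_funTS_itv f D : measurable_fun setT f -> measurable_fun D f.
Proof. by move=> mf; apply: measurable_funS mf. Qed.

Lemma integrable_cont a b f : continuous f -> mu.-integrable `[a, b] (EFin \o f).
Proof.
move=> cf; apply: continuous_compact_integrable; first exact: segment_compact.
exact: continuous_subspaceT.
Qed.

Lemma Rintegral_split a b c f : a <= c <= b -> mu.-integrable `[a, b] (EFin \o f) ->
  \int[mu]_(x in `[a, b]) f x =
  \int[mu]_(x in `[a, c]) f x + \int[mu]_(x in `[c, b]) f x.
Proof.
move=> /andP[ac cb] fi; have := @Rintegral_itvB R f (BLeft a) (BRight b) c fi.
rewrite !bnd_simp => /(_ ac cb) h; rewrite -(Rintegral_itv_obnd_cbnd (r := c)).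
  by rewrite -h addrC subrK.
apply: integrableS fi => //; apply: subset_itv; rewrite bnd_simp//.
Qed.

Lemma normr_Rintegral_le D f M : measurable D -> (mu D < +oo)%E ->
  mu.-integrable D (EFin \o f) -> (forall x, D x -> `|f x| <= M) ->
  `|\int[mu]_(x in D) f x| <= M * fine (mu D).
Proof.
move=> mD fD fi fM; have h := @le_normr_Rintegral _ _ R mu D f mD fi.
apply: (le_trans h).
rewrite -Rintegral_cst//; apply: le_Rintegral => //.
  have := integrable_abse fi; apply: eq_integrable => // x _ /=.
by apply: (@integrable_bdd _ _ `|M|).
Qed.

Lemma fine_itv a b : a <= b -> fine (mu `[a, b]) = b - a.
Proof.
move=> ab; rewrite lebesgue_measure_itv/= lte_fin; case: ltP => //= ba.
by apply/esym/eqP; rewrite subr_eq0 eq_le ba.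
Qed.

Lemma FTC2R F f a b : a <= b -> (forall x, is_derive x 1 F (f x)) -> continuous f ->
  \int[mu]_(x in `[a, b]) f x = F b - F a.
Proof.
move=> ab dF cf; have cF : continuous F.
  by move=> x; apply/differentiable_continuous/derivable1_diffP; have [] := dF x.
move: ab; rewrite le_eqVlt => /predU1P[<-|ab].
  by rewrite set_itv1 Rintegral_set1 subrr.
rewrite /Rintegral (@continuous_FTC2 R f F)//.
- exact: continuous_subspaceT.
- split.
  + by move=> x _; have [] := dF x.
  + exact: cvg_at_right_filter (cF a).
  + exact: cvg_at_left_filter (cF b).
- by move=> x _; rewrite derive1E; have [] := dF x.
Qed.

(** One cell of the Riemann--Stieltjes sum: with g frozen at its left end the integral is explicit,
    and the rest is controlled by the increase of g. *)
Lemma nd_parts_incr F f g S K c d : (forall x, is_derive x 1 F (f x)) -> continuous f ->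
  {homo g : x y / x <= y} -> (forall x, c <= x <= d -> `|F x| <= S) ->
  (forall x, c <= x <= d -> `|f x| <= K) -> c <= d ->
  `|\int[mu]_(x in `[c, d]) (f x * g x) - (F d * g d - F c * g c)| <=
  (S + K * (d - c)) * (g d - g c).
Proof.
move=> dF cf ndg FS fK cd.
have gmono x : c <= x <= d -> 0 <= g x - g c <= g d - g c.
  by move=> /andP[cx xd]; rewrite subr_ge0 lerD2r !ndg.
have mg : measurable_fun `[c, d] g by exact: nondecreasing_measurable.
have mf : measurable_fun `[c, d] f by exact: measurable_funTS_itv (continuous_measurable_fun cf).
have K0 : 0 <= K by apply: le_trans (fK c _) => //; rewrite lexx.
have fi : mu.-integrable `[c, d] (EFin \o f) by exact: integrable_cont.
have fgi : mu.-integrable `[c, d] (EFin \o (fun x => f x * (g x - g c))).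
  apply: (@integrable_bdd _ _ (K * (g d - g c))) => //; first exact: itv_fin.
    by apply: measurable_funM => //; apply: measurable_funB.
  move=> x /=; rewrite in_itv/= => xI; have /andP[g0 g1] := gmono _ xI.
  by rewrite normrM (ger0_norm g0) ler_pM// fK.
have fci : mu.-integrable `[c, d] (EFin \o (fun x => f x * g c)).
  apply: (@integrable_bdd _ _ (K * `|g c|)) => //; first exact: itv_fin.
    by apply: measurable_funM.
  by move=> x /=; rewrite in_itv/= => xI; rewrite normrM ler_wpM2r// fK.
have -> : \int[mu]_(x in `[c, d]) (f x * g x) =
    \int[mu]_(x in `[c, d]) (f x * (g x - g c)) + (F d - F c) * g c.
  rewrite -(FTC2R cd dF cf) -RintegralZr// -RintegralD//.
  by apply: eq_Rintegral => x _; ring.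
have h : `|\int[mu]_(x in `[c, d]) (f x * (g x - g c))| <= K * (g d - g c) * (d - c).
  rewrite -(fine_itv cd); apply: normr_Rintegral_le => //; first exact: itv_fin.
  move=> x /=; rewrite in_itv/= => xI; have /andP[g0 g1] := gmono _ xI.
  by rewrite normrM (ger0_norm g0) ler_pM// fK.
set I := \int[mu]_(x in _) _ in h *.
have -> : I + (F d - F c) * g c - (F d * g d - F c * g c) = I - F d * (g d - g c) by ring.
apply: le_trans (ler_normB _ _) _; rewrite mulrDl addrC lerD//; last first.
  by rewrite mulrAC.
have g0 : 0 <= g d - g c by rewrite subr_ge0 ndg.
by rewrite normrM (ger0_norm g0) ler_wpM2r// FS// cd lexx.
Qed.

(* Integration by parts against a monotone g through Riemann-Stieltjes sums, so that no
   regularity of g is needed. *)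
Lemma nd_parts F f g S a b : (forall x, is_derive x 1 F (f x)) -> continuous f ->
  {homo g : x y / x <= y} -> (forall x, a <= x <= b -> `|F x| <= S) -> a <= b ->
  `|\int[mu]_(x in `[a, b]) (f x * g x)| <= 2 * S * (`|g a| + `|g b|).
Proof.
move=> dF cf ndg FS ab.
have [K fK] : exists K, forall x, a <= x <= b -> `|f x| <= K.
  have cfn : {within `[a, b], continuous (fun x => `|f x|)}.
    by apply: continuous_subspaceT => x; apply: cvg_norm; exact: cf.
  have [c _ hc] := EVT_max ab cfn.
  by exists `|f c| => x xI; apply: hc; rewrite in_itv.
have K0 : 0 <= K by apply: le_trans (fK a _) => //; rewrite lexx.
have S0 : 0 <= S by apply: le_trans (FS a _) => //; rewrite lexx.
have mf : measurable_fun `[a, b] f by exact: measurable_funTS_itv (continuous_measurable_fun cf).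
have fgi c : mu.-integrable `[a, c] (EFin \o (fun x => f x * g x)).
  have [ca|ac] := ltP c a.
    rewrite set_itv_ge ?bnd_simp -?ltNge//; exact: integrable_set0.
  have cfn : {within `[a, c], continuous (fun x => `|f x|)}.
    by apply: continuous_subspaceT => x; apply: cvg_norm; exact: cf.
  have [d _ hd] := EVT_max ac cfn.
  apply: (@integrable_bdd _ _ (`|f d| * (`|g a| + `|g c|))) => //; first exact: itv_fin.
    apply: measurable_funM; last exact: nondecreasing_measurable.
    exact: measurable_funTS_itv (continuous_measurable_fun cf).
  move=> x /=; rewrite in_itv/= => /andP[ax xc].
  rewrite normrM ler_pM//; first by apply: hd; rewrite in_itv/= ax.
  by apply: abs_between; exact: ndg.
pose V := g b - g a; have V0 : 0 <= V by rewrite subr_ge0 ndg.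
have main m : `|\int[mu]_(x in `[a, b]) (f x * g x) - (F b * g b - F a * g a)| <=
    (S + K * ((b - a) / m.+1%:R)) * V.
  pose h := (b - a) / m.+1%:R; pose x k := a + k%:R * h.
  have h0 : 0 <= h by rewrite divr_ge0// subr_ge0.
  have xm : x m.+1 = b.
    by rewrite /x /h mulrCA divff ?pnatr_eq0// mulr1 addrC subrK.
  have xS k : x k.+1 = x k + h by rewrite /x -natr1 mulrDl mul1r addrA.
  have xa k : a <= x k by rewrite lerDl mulr_ge0.
  have xb k : (k <= m.+1)%N -> x k <= b.
    by move=> km; rewrite -xm lerD2l ler_wpM2r// ler_nat.
  suff : forall k, (k <= m.+1)%N ->
      `|\int[mu]_(y in `[a, x k]) (f y * g y) - (F (x k) * g (x k) - F a * g a)| <=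
      (S + K * h) * (g (x k) - g a).
    by move=> /(_ m.+1 (leqnn _)); rewrite xm.
  elim=> [|k IH] km.
    by rewrite /x mul0r addr0 set_itv1 Rintegral_set1 !subrr normr0 mulr0.
  have xx : x k <= x k.+1 by rewrite xS lerDl.
  rewrite (@Rintegral_split a (x k.+1) (x k)) ?xa//.
  set I := \int[mu]_(y in `[a, x k]) _ in IH *; set J := \int[mu]_(_ in _) _.
  have -> : I + J - (F (x k.+1) * g (x k.+1) - F a * g a) =
    (I - (F (x k) * g (x k) - F a * g a)) +
    (J - (F (x k.+1) * g (x k.+1) - F (x k) * g (x k))) by ring.
  have -> : (S + K * h) * (g (x k.+1) - g a) =
    (S + K * h) * (g (x k) - g a) + (S + K * h) * (g (x k.+1) - g (x k)) by ring.
  apply: le_trans (ler_normD _ _) _; apply: lerD; first by apply: IH; exact: ltnW.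
  have sub y : x k <= y <= x k.+1 -> a <= y <= b.
    by move=> /andP[h1 h2]; rewrite (le_trans (xa k))// (le_trans h2)// xb.
  have := @nd_parts_incr F f g S K (x k) (x k.+1) dF cf ndg.
  rewrite [x k.+1 - x k](_ : _ = h); last by rewrite xS addrC addKr.
  by apply => // y /sub; [exact: FS|exact: fK].
have {}main : `|\int[mu]_(x in `[a, b]) (f x * g x) - (F b * g b - F a * g a)| <= S * V.
  rewrite leNgt; apply/negP => lt.
  set e := `|_| in lt main; have e0 : 0 < e - S * V by rewrite subr_gt0.
  pose m := Num.truncn (K * (b - a) * V / (e - S * V)).
  have := main m; rewrite leNgt => /negP; apply.
  have q0 : 0 <= K * (b - a) * V / (e - S * V).
    by rewrite divr_ge0 ?(ltW e0)// !mulr_ge0// subr_ge0.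
  have /andP[_] := truncn_itv q0.
  rewrite -/m ltr_pdivrMr// -ltr_pdivrMl ?ltr0n// => hm.
  have -> : (S + K * ((b - a) / m.+1%:R)) * V = S * V + m.+1%:R^-1 * (K * (b - a) * V) by ring.
  by rewrite -ltrBrDl.
set I := \int[mu]_(_ in _) _ in main *.
have -> : I = (I - (F b * g b - F a * g a)) + (F b * g b - F a * g a) by rewrite subrK.
apply: le_trans (ler_normD _ _) _.
have h1 : `|F b * g b| <= S * `|g b| by rewrite normrM ler_wpM2r// FS// ab lexx.
have h2 : `|F a * g a| <= S * `|g a| by rewrite normrM ler_wpM2r// FS// ab lexx.
have h3 : S * V <= S * (`|g a| + `|g b|).
  by rewrite ler_wpM2l// /V; have := ler_norm (g b); have := ler_norm (- g a); rewrite normrN; lra.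
by have := ler_normB (F b * g b) (F a * g a); nra.
Qed.

(* Quantitative "derivative of g is a measure of mass V": the only feature of BV or
   Lipschitz functions g that is used. *)
Definition parts_bound a b (V : R) g :=
  [/\ measurable_fun `[a, b] g, exists M, forall x, a <= x <= b -> `|g x| <= M &
   forall F f S, (forall x, is_derive x 1 F (f x)) -> continuous f ->
     (forall x, a <= x <= b -> `|F x| <= S) ->
     `|\int[mu]_(x in `[a, b]) (f x * g x)| <= S * V].

(** g is monotone on [a, b] only; composed with the projection onto [a, b] it becomes monotone on
    the line, as [nd_parts] demands. *)
Lemma parts_bound_nd a b g : a <= b -> {in `[a, b] &, {homo g : x y / x <= y}} ->
  parts_bound a b (2 * (`|g a| + `|g b|)) g.
Proof.
move=> ab ndg; pose cl x := Num.max a (Num.min x b); pose h x := g (cl x).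
have clI x : cl x \in `[a, b] by rewrite in_itv/= /cl le_max lexx ge_max ab ge_min lexx orbT.
have clid x : a <= x <= b -> cl x = x by move=> /andP[ax xb]; rewrite /cl (min_idPl xb) (max_idPr ax).
have ndh : {homo h : x y / x <= y}.
  move=> x y xy; apply: ndg => //; rewrite /cl.
  have m : Num.min x b <= Num.min y b by rewrite le_min !ge_min xy lexx orbT.
  by rewrite ge_max !le_max lexx /= m orbT.
have gh x : a <= x <= b -> g x = h x by move=> xI; rewrite /h clid.
have mh : measurable_fun `[a, b] h by exact: nondecreasing_measurable.
have aI : a <= a <= b by rewrite lexx.
have bI : a <= b <= b by rewrite lexx andbT.
split.
- by apply: eq_measurable_fun mh => x; rewrite inE/= in_itv/= => /gh.
- exists (`|g a| + `|g b|) => x xI; have /andP[ax xb] := xI.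
  have := ndg a x; have := ndg x b; rewrite !in_itv/= xI aI bI => /(_ isT isT xb) + /(_ isT isT ax).
  by move=> h1 h2; exact: abs_between.
- move=> F f S dF cf FS; rewrite (gh a)// (gh b)// mulrCA mulrA.
  rewrite (_ : \int[mu]_(x in _) _ = \int[mu]_(x in `[a, b]) (f x * h x)); last first.
    by apply: eq_Rintegral => x; rewrite inE/= in_itv/= => /gh ->.
  exact: nd_parts.
Qed.

Lemma parts_bound_integrable a b V f g : continuous f -> parts_bound a b V g ->
  mu.-integrable `[a, b] (EFin \o (fun x => f x * g x)).
Proof.
move=> cf [mg [M gM] _]; have := integrable_cont a b cf.
move=> fi; have := @integrableMl _ _ R mu `[a, b] _ (EFin \o f) g fi mg.
move=> /(_ (measurable_itv _)) h; apply: h.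
exists M; split; first exact: num_real.
by move=> r Mr x /=; rewrite in_itv/= => /gM /le_trans; apply; exact: ltW.
Qed.

Lemma parts_bound_subr a b V1 V2 g1 g2 g : a <= b -> parts_bound a b V1 g1 -> parts_bound a b V2 g2 ->
  (forall x, a <= x <= b -> g x = g1 x - g2 x) -> parts_bound a b (V1 + V2) g.
Proof.
move=> ab p1 p2 ge; have [m1 [M1 b1] B1] := p1; have [m2 [M2 b2] B2] := p2.
split.
- apply: (@eq_measurable_fun _ _ _ _ _ (g1 \- g2)); last exact: measurable_funB.
  by move=> x; rewrite inE/= in_itv/= => /ge ->.
- exists (M1 + M2) => x xI; rewrite ge//; apply: le_trans (ler_normB _ _) _.
  by rewrite lerD ?b1 ?b2.
- move=> F f S dF cf FS.
  rewrite (_ : \int[mu]_(x in _) _ = \int[mu]_(x in `[a, b]) (f x * g1 x - f x * g2 x)); last first.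
    by apply: eq_Rintegral => x; rewrite inE/= in_itv/= => /ge ->; rewrite mulrBr.
  rewrite RintegralB ?(parts_bound_integrable cf p1) ?(parts_bound_integrable cf p2)//.
  apply: le_trans (ler_normB _ _) _; rewrite mulrDr lerD//; [exact: B1 FS|exact: B2 FS].
Qed.

(** Jordan decomposition into a difference of two nondecreasing functions. *)
Lemma parts_bound_BV a b g : a <= b -> bounded_variation a b g ->
  exists V, parts_bound a b V g.
Proof.
move=> ab bv; have ndN := fine_neg_tv_nondecreasing bv.
have bvN : bounded_variation a b (\- g) by exact: bounded_variationN.
have ndP := fine_neg_tv_nondecreasing bvN.
eexists; apply: parts_bound_subr ab (parts_bound_nd ab ndP) (parts_bound_nd ab ndN) _.
by move=> x xI; rewrite (bounded_variation_pos_neg_tvE bv)// in_itv.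
Qed.

(** The same with the explicit decomposition g = (g + L (x - a)) - L (x - a). It keeps track of the
    constant, on which the time integrals below depend. *)
Lemma parts_bound_lipschitz a b g B L : a <= b -> 0 <= L ->
  (forall x, a <= x <= b -> `|g x| <= B) ->
  (forall x y, a <= x <= y -> y <= b -> `|g y - g x| <= L * (y - x)) ->
  parts_bound a b (4 * (B + L * (b - a))) g.
Proof.
move=> ab L0 gB gL.
have nd1 : {in `[a, b] &, {homo (fun x => g x + L * (x - a)) : x y / x <= y}}.
  move=> x y; rewrite !in_itv/= => /andP[ax xb] /andP[ay yb] xy.
  have := gL x y; rewrite ax xy yb => /(_ isT isT); rewrite ler_norml => /andP[h _].
  by nra.
have nd2 : {in `[a, b] &, {homo (fun x => L * (x - a)) : x y / x <= y}}.
  by move=> x y _ _ xy; rewrite ler_wpM2l// lerD2r.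
have := parts_bound_subr ab (parts_bound_nd ab nd1) (parts_bound_nd ab nd2) (g := g).
move=> /(_ _)[x _|m1 B1 H1]; first by rewrite addrK.
split=> // F f S dF cf FS; apply: le_trans (H1 F f S dF cf FS) _.
have S0 : 0 <= S by apply: le_trans (FS a _) => //; rewrite lexx.
rewrite ler_wpM2l// subrr mulr0 normr0 addr0 add0r.
have Lab : 0 <= L * (b - a) by rewrite mulr_ge0// subr_ge0.
rewrite (ger0_norm Lab); have := ler_normD (g b) (L * (b - a)); rewrite (ger0_norm Lab).
have := gB a; have := gB b; rewrite ab !lexx/= => /(_ isT) + /(_ isT).
by lra.
Qed.

End RealIntegrals.

(** * Complex-valued integrals, derivatives and continuity, by components *)

Section ComplexIntegrals.
Variable R : realType.
Local Notation mu := (@lebesgue_measure R).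
Implicit Types (f g F : R -> R[i]) (a b x y M : R) (D : set R).

Definition cintegrable D f :=
  mu.-integrable D (EFin \o (fun x => Re (f x))) /\
  mu.-integrable D (EFin \o (fun x => Im (f x))).

Definition cmeas D f :=
  measurable_fun D (fun x => Re (f x)) /\ measurable_fun D (fun x => Im (f x)).

Lemma eq_cintegral D f g : {in D, f =1 g} -> cintegral D f = cintegral D g.
Proof.
by move=> fg; apply: complexP; apply: eq_Rintegral => x xD; rewrite (fg _ xD).
Qed.

Lemma cintegralD D f g : measurable D -> cintegrable D f -> cintegrable D g ->
  cintegral D (fun x => f x + g x) = cintegral D f + cintegral D g.
Proof.
move=> mD [f1 f2] [g1 g2]; apply: complexP; rewrite ?cReD ?cImD /= -RintegralD//;
  by apply: eq_Rintegral => x _; rewrite ?cReD ?cImD.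
Qed.

Lemma integrable_lin D (r s : R) (p q : R -> R) : measurable D ->
  mu.-integrable D (EFin \o p) -> mu.-integrable D (EFin \o q) ->
  mu.-integrable D (EFin \o (fun x => r * p x + s * q x)).
Proof.
move=> mD pi qi.
have h1 := @integrableZl _ _ R mu D mD r _ pi; have h2 := @integrableZl _ _ R mu D mD s _ qi.
exact: (@integrableD _ _ R mu D mD _ _ h1 h2).
Qed.

Lemma cintegrableD D f g : measurable D -> cintegrable D f -> cintegrable D g ->
  cintegrable D (fun x => f x + g x).
Proof.
move=> mD [f1 f2] [g1 g2]; split.
  have := integrable_lin 1 1 mD f1 g1; apply: eq_integrable => // x _ /=.
  by rewrite cReD !mul1r.
have := integrable_lin 1 1 mD f2 g2; apply: eq_integrable => // x _ /=.
by rewrite cImD !mul1r.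
Qed.

Lemma cintegrableZ D c f : measurable D -> cintegrable D f ->
  cintegrable D (fun x => c * f x).
Proof.
move=> mD [f1 f2]; split.
  apply: eq_integrable (integrable_lin (Re c) (- Im c) mD f1 f2) => //.
  by move=> x _ /=; rewrite cReM mulNr.
apply: eq_integrable (integrable_lin (Im c) (Re c) mD f1 f2) => //.
by move=> x _ /=; rewrite cImM addrC.
Qed.

Lemma Rintegral_lin D (r s : R) (p q : R -> R) : measurable D ->
  mu.-integrable D (EFin \o p) -> mu.-integrable D (EFin \o q) ->
  \int[mu]_(x in D) (r * p x + s * q x) =
  r * \int[mu]_(x in D) p x + s * \int[mu]_(x in D) q x.
Proof.
move=> mD pi qi; rewrite RintegralD ?RintegralZl//.
  exact: (@integrableZl _ _ R mu D mD r _ pi).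
exact: (@integrableZl _ _ R mu D mD s _ qi).
Qed.

Lemma cintegralZ D c f : measurable D -> cintegrable D f ->
  cintegral D (fun x => c * f x) = c * cintegral D f.
Proof.
move=> mD [f1 f2]; apply: complexP; rewrite ?cReM ?cImM /=.
  rewrite -mulNr -Rintegral_lin//; apply: eq_Rintegral => x _.
  by rewrite cReM mulNr.
rewrite addrC -Rintegral_lin//; apply: eq_Rintegral => x _.
by rewrite cImM addrC.
Qed.

Lemma cintegrable0 D : cintegrable D (fun=> 0).
Proof. by split; exact: integrable0. Qed.

Lemma cintegral_zero D : cintegral D (fun=> 0) = 0.
Proof. by apply: complexP; rewrite /= /Rintegral integral0. Qed.

Lemma cintegral_sum (I : eqType) (s : seq I) D (F : I -> R -> R[i]) : measurable D ->
  (forall i, cintegrable D (F i)) ->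
  cintegrable D (fun x => \sum_(i <- s) F i x) /\
  cintegral D (fun x => \sum_(i <- s) F i x) = \sum_(i <- s) cintegral D (F i).
Proof.
move=> mD Fi; elim: s => [|i s [IH1 IH2]].
  have -> : (fun x => \sum_(i <- [::]) F i x) = fun=> 0 by apply/funext => x; rewrite big_nil.
  by rewrite big_nil cintegral_zero; split => //; exact: cintegrable0.
have -> : (fun x => \sum_(j <- i :: s) F j x) = fun x => F i x + \sum_(j <- s) F j x.
  by apply/funext => x; rewrite big_cons.
by rewrite big_cons -IH2 cintegralD//; split => //; exact: cintegrableD.
Qed.

(** The factor 2 is the price of estimating the two components separately. *)
Lemma normc_cintegral D f (h : R -> R) : measurable D -> cintegrable D f ->
  mu.-integrable D (EFin \o h) -> (forall x, D x -> normc (f x) <= h x) ->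
  normc (cintegral D f) <= 2 * \int[mu]_(x in D) h x.
Proof.
move=> mD [f1 f2] hi fh; apply: le_trans (normc_ReIm _) _ => /=.
have aux (p : R -> R) : mu.-integrable D (EFin \o p) -> (forall x, D x -> `|p x| <= h x) ->
    `|\int[mu]_(x in D) p x| <= \int[mu]_(x in D) h x.
  move=> pi ph; have l := @le_normr_Rintegral _ _ R mu D p mD pi.
  apply: (le_trans l); apply: le_Rintegral => //.
  by have := integrable_abse pi; apply: eq_integrable.
rewrite mulr_natl mulr2n; apply: lerD; apply: aux => // x Dx; apply: le_trans (fh _ Dx).
  exact: normc_Re.
exact: normc_Im.
Qed.

Lemma cmeasW D f : cmeasurable f -> cmeas D f.
Proof. by move=> [m1 m2]; split; exact: measurable_funTS_itv. Qed.

Lemma cmeasD D f g : cmeas D f -> cmeas D g -> cmeas D (fun x => f x + g x).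
Proof.
move=> [f1 f2] [g1 g2]; split.
  under eq_fun do rewrite cReD; exact: measurable_funD.
under eq_fun do rewrite cImD; exact: measurable_funD.
Qed.

Lemma cmeasN D f : cmeas D f -> cmeas D (fun x => - f x).
Proof.
move=> [f1 f2]; split.
  under eq_fun do rewrite cReN; exact: measurableT_comp.
under eq_fun do rewrite cImN; exact: measurableT_comp.
Qed.

Lemma cmeasM D f g : cmeas D f -> cmeas D g -> cmeas D (fun x => f x * g x).
Proof.
move=> [f1 f2] [g1 g2]; split.
  under eq_fun do rewrite cReM; apply: measurable_funB; exact: measurable_funM.
under eq_fun do rewrite cImM; apply: measurable_funD; exact: measurable_funM.
Qed.

Lemma cmeas_conj D f : cmeas D f -> cmeas D (fun x => conjc (f x)).
Proof.
move=> [f1 f2]; split.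
  by under eq_fun do rewrite cRe_conj.
under eq_fun do rewrite cIm_conj; exact: measurableT_comp.
Qed.

Lemma cmeas_real D (p : R -> R) : measurable_fun D p -> cmeas D (fun x => (p x)%:C).
Proof. by move=> mp; split => //=; exact: measurable_cst. Qed.

Lemma cmeas_normc2 D f : cmeas D f -> measurable_fun D (fun x => normc (f x) ^+ 2).
Proof.
move=> [f1 f2]; under eq_fun do rewrite normcE_sqr.
by apply: measurable_funD; exact: measurable_funX.
Qed.

Lemma cmeas_normc D f : cmeas D f -> measurable_fun D (fun x => normc (f x)).
Proof.
move=> mf; have := cmeas_normc2 mf => m2.
have -> : (fun x => normc (f x)) = (@Num.sqrt R) \o (fun x => normc (f x) ^+ 2).
  by apply/funext => x /=; rewrite sqrtr_sqr ger0_norm// normc_ge0.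
apply: measurableT_comp m2; apply: continuous_measurable_fun; exact: sqrt_continuous.
Qed.

Lemma cintegrable_le D f (h : R -> R) : measurable D -> cmeas D f ->
  mu.-integrable D (EFin \o h) -> (forall x, D x -> normc (f x) <= h x) -> cintegrable D f.
Proof.
move=> mD [m1 m2] hi fh; split.
  apply: le_integrable hi => //; first exact/measurable_EFinP.
  move=> x Dx /=; rewrite lee_fin; apply: le_trans (normc_Re _) _.
  by apply: le_trans (fh _ Dx) (ler_norm _).
apply: le_integrable hi => //; first exact/measurable_EFinP.
move=> x Dx /=; rewrite lee_fin; apply: le_trans (normc_Im _) _.
by apply: le_trans (fh _ Dx) (ler_norm _).
Qed.

Lemma is_derive_cvg (p : R -> R) (d x : R) : is_derive x 1 p d -> {for x, continuous p}.
Proof. by move=> [dp _]; apply: differentiable_continuous; apply/derivable1_diffP. Qed.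

Definition cderiv F f := forall x,
  is_derive x 1 (fun y => Re (F y)) (Re (f x)) /\
  is_derive x 1 (fun y => Im (F y)) (Im (f x)).

Definition ccontinuous f :=
  continuous (fun x => Re (f x)) /\ continuous (fun x => Im (f x)).

Lemma cderiv_continuous F f : cderiv F f -> ccontinuous F.
Proof.
move=> dF; split => x.
  exact: is_derive_cvg (proj1 (dF x)).
exact: is_derive_cvg (proj2 (dF x)).
Qed.

Lemma ccontinuous_meas D f : ccontinuous f -> cmeas D f.
Proof.
by move=> [c1 c2]; split; apply: measurable_funTS_itv; exact: continuous_measurable_fun.
Qed.

Lemma ccontinuousD f g : ccontinuous f -> ccontinuous g -> ccontinuous (fun x => f x + g x).
Proof.
move=> [f1 f2] [g1 g2]; split => x.
  by under eq_fun do rewrite cReD; apply: cvgD; [exact: f1|exact: g1].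
by under eq_fun do rewrite cImD; apply: cvgD; [exact: f2|exact: g2].
Qed.

Lemma ccontinuousM f g : ccontinuous f -> ccontinuous g -> ccontinuous (fun x => f x * g x).
Proof.
move=> [f1 f2] [g1 g2]; split => x.
  under eq_fun do rewrite cReM; apply: cvgB; apply: cvgM;
    [exact: f1|exact: g1|exact: f2|exact: g2].
under eq_fun do rewrite cImM; apply: cvgD; apply: cvgM;
    [exact: f1|exact: g2|exact: f2|exact: g1].
Qed.

Lemma ccontinuous_conj f : ccontinuous f -> ccontinuous (fun x => conjc (f x)).
Proof.
move=> [f1 f2]; split => x.
  by under eq_fun do rewrite cRe_conj; exact: f1.
by under eq_fun do rewrite cIm_conj; apply: cvgN; exact: f2.
Qed.

Lemma ccontinuous_cst c : ccontinuous (fun=> c).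
Proof. by split => x; exact: cvg_cst. Qed.

Lemma ccontinuous_sum (I : Type) (s : seq I) (P : pred I) (F : I -> R -> R[i]) :
  (forall i, ccontinuous (F i)) -> ccontinuous (fun x => \sum_(i <- s | P i) F i x).
Proof.
move=> cF; elim: s => [|i s IH].
  by under eq_fun do rewrite big_nil; exact: ccontinuous_cst.
have [Pi|Pi] := boolP (P i).
  by under eq_fun do rewrite big_cons Pi; exact: ccontinuousD.
by under eq_fun do rewrite big_cons (negbTE Pi).
Qed.

Lemma cintegrable_cont a b f : ccontinuous f -> cintegrable `[a, b] f.
Proof. by move=> [c1 c2]; split; exact: integrable_cont. Qed.

Lemma cderiv_cis (k m : R) :
  cderiv (fun x => cis (k * x + m)) (fun x => ('i * k%:C) * cis (k * x + m)).
Proof.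
move=> x; have lin : is_derive x 1 (fun y => k * y + m) k.
  have := is_deriveD (is_deriveZ k (is_derive_id x (1 : R))) (is_derive_cst m x (1 : R)).
  by rewrite addr0 /GRing.scale/= mulr1.
have -> : Re ('i * k%:C * cis (k * x + m)) = - sin (k * x + m) * k.
  by rewrite !cReM !cImM /=; ring.
have -> : Im ('i * k%:C * cis (k * x + m)) = cos (k * x + m) * k.
  by rewrite !cImM !cReM /=; ring.
split; first exact: (@is_derive1_comp R _ _ x _ _ (is_derive_cos (k * x + m)) lin).
exact: (@is_derive1_comp R _ _ x _ _ (is_derive_sin (k * x + m)) lin).
Qed.

Lemma cderivZ c F f : cderiv F f -> cderiv (fun x => c * F x) (fun x => c * f x).
Proof.
move=> dF x; have [d1 d2] := dF x; split.
  under eq_fun do rewrite cReM; rewrite cReM.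
  by apply: is_deriveB; exact: is_deriveZ.
under eq_fun do rewrite cImM; rewrite cImM.
by apply: is_deriveD; exact: is_deriveZ.
Qed.

Lemma cderiv_sum (I : Type) (s : seq I) (F f : I -> R -> R[i]) :
  (forall i, cderiv (F i) (f i)) ->
  cderiv (fun x => \sum_(i <- s) F i x) (fun x => \sum_(i <- s) f i x).
Proof.
move=> dF; elim: s => [|i s IH] x.
  under eq_fun do rewrite big_nil; under [X in _ /\ is_derive _ _ X _]eq_fun do rewrite big_nil.
  by rewrite big_nil; split; exact: is_derive_cst.
have [d1 d2] := dF i x; have [e1 e2] := IH x; rewrite big_cons cReD cImD; split.
  by under eq_fun do rewrite big_cons cReD; exact: is_deriveD.
by under eq_fun do rewrite big_cons cImD; exact: is_deriveD.
Qed.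

Lemma ccontinuous_cis k : ccontinuous (fun x => cis (k * x)).
Proof.
have := cderiv_continuous (cderiv_cis k 0).
by under eq_fun do rewrite addr0.
Qed.

(** The product has four real integrals in its components, each bounded by S V. *)
Lemma cparts a b (V S : R) F f g : a <= b -> cderiv F f -> ccontinuous f ->
  parts_bound a b V (fun x => Re (g x)) -> parts_bound a b V (fun x => Im (g x)) ->
  (forall x, a <= x <= b -> normc (F x) <= S) ->
  normc (cintegral `[a, b] (fun x => f x * g x)) <= 4 * (S * V).
Proof.
move=> ab dF [c1 c2] p1 p2 FS; apply: le_trans (normc_ReIm _) _ => /=.
have [_ _ P1] := p1; have [_ _ P2] := p2.
have i11 := parts_bound_integrable c1 p1; have i12 := parts_bound_integrable c1 p2.
have i21 := parts_bound_integrable c2 p1; have i22 := parts_bound_integrable c2 p2.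
have S1 x : a <= x <= b -> `|Re (F x)| <= S by move=> /FS; apply: le_trans; exact: normc_Re.
have S2 x : a <= x <= b -> `|Im (F x)| <= S by move=> /FS; apply: le_trans; exact: normc_Im.
have d1 x := proj1 (dF x); have d2 x := proj2 (dF x).
under eq_Rintegral do rewrite cReM; under [X in _ + `|X|]eq_Rintegral do rewrite cImM.
rewrite RintegralB// RintegralD//.
have := P1 _ _ S d1 c1 S1; have := P2 _ _ S d1 c1 S1.
have := P1 _ _ S d2 c2 S2; have := P2 _ _ S d2 c2 S2.
set x1 := \int[mu]_(_ in _) _; set x2 := \int[mu]_(_ in _) _.
set x3 := \int[mu]_(_ in _) _; set x4 := \int[mu]_(_ in _) _ => h1 h2 h3 h4.
have := ler_normB x4 x1; have := ler_normD x3 x2; lra.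
Qed.

End ComplexIntegrals.

(** * Fourier series on the torus *)

Arguments fourier : simpl never.
Arguments ComplexField.Normc.normc : simpl never.

Section TorusL2.
Variable R : realType.
Local Notation mu := (@lebesgue_measure R).
Local Notation torus := (@torus R).
Implicit Types (f g h : R -> R[i]) (x y : R) (m n : int) (N : nat).

Lemma twopi_gt0 : 0 < 2 * pi :> R.
Proof. by rewrite mulr_gt0// pi_gt0. Qed.

Lemma measurable_torus : measurable torus.
Proof. exact: measurable_itv. Qed.
Hint Resolve measurable_torus : core.

Lemma torus_fin : (mu torus < +oo)%E.
Proof. exact: itv_fin. Qed.

Lemma mu_torus : fine (mu torus) = 2 * pi.
Proof. by rewrite fine_itv ?subr0// ltW// twopi_gt0. Qed.

(** [in_L2] without periodicity, so that truncations and mollifications on the fundamental domain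
    qualify. *)
Definition L2 f := cmeas torus f /\
  mu.-integrable torus (EFin \o (fun x => normc (f x) ^+ 2)).

Definition nrm2 f : R := \int[mu]_(x in torus) normc (f x) ^+ 2.

Definition expi n x : R[i] := cis (n%:~R * x).

Lemma expiD m n x : expi (m + n) x = expi m x * expi n x.
Proof. by rewrite /expi intrD mulrDl cisD. Qed.

Lemma expiN n x : expi (- n) x = cis (- (n%:~R * x)).
Proof. by rewrite /expi intrN mulNr. Qed.

Lemma normc_expi n x : normc (expi n x) = 1.
Proof. exact: normc_cis. Qed.

Lemma fourierE f n :
  fourier f n = ((2 * pi)^-1)%:C * cintegral torus (fun x => f x * expi (- n) x).
Proof.
by congr (_ * _); apply: eq_cintegral => x _; rewrite expiN.
Qed.

Lemma ccontinuous_expi n : ccontinuous (expi n).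
Proof. exact: ccontinuous_cis. Qed.

Lemma in_L2_L2 f : in_L2 f -> L2 f.
Proof.
move=> [_ mf fi]; have mf' := cmeasW torus mf; split=> //.
apply/integrableP; split; first by apply/measurable_EFinP; exact: cmeas_normc2.
have e : forall x, torus x -> (`|(EFin \o (fun y => (normc (f y) ^+ 2)%R)) x| = (normc (f x) ^+ 2)%:E)%E.
  by move=> x _ /=; rewrite ger0_norm ?sqr_ge0.
apply: le_lt_trans fi; apply: le_of_eq; apply: eq_integral => x /set_mem xT.
exact: e.
Qed.

Lemma normc_sqrD (z w : R[i]) : normc (z + w) ^+ 2 <= 2 * normc z ^+ 2 + 2 * normc w ^+ 2.
Proof.
rewrite !normcE_sqr cReD cImD.
by have := sqr_ge0 (Re z - Re w); have := sqr_ge0 (Im z - Im w); nra.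
Qed.

Lemma normcM_le (z w : R[i]) : normc (z * w) <= normc z ^+ 2 + normc w ^+ 2.
Proof.
rewrite ComplexField.Normc.normcM.
by have := sqr_ge0 (normc z - normc w); have := normc_ge0 z; have := normc_ge0 w; nra.
Qed.

Lemma L2D f g : L2 f -> L2 g -> L2 (fun x => f x + g x).
Proof.
move=> [mf fi] [mg gi]; have mfg := cmeasD mf mg; split=> //.
apply: le_integrable (integrable_lin 2 2 measurable_torus fi gi) => //.
  by apply/measurable_EFinP; exact: cmeas_normc2.
move=> x _ /=; rewrite lee_fin ger0_norm ?sqr_ge0//.
by apply: le_trans (normc_sqrD _ _) (ler_norm _).
Qed.

Lemma L2_bounded f M : cmeas torus f -> (forall x, torus x -> normc (f x) <= M) -> L2 f.
Proof.
move=> mf fM; split=> //; apply: (@integrable_bdd _ _ _ (M ^+ 2)) => //.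
- exact: torus_fin.
- exact: cmeas_normc2.
- move=> x Tx; rewrite ger0_norm ?sqr_ge0// ler_sqr ?nnegrE ?normc_ge0//; first exact: fM.
  exact: le_trans (normc_ge0 _) (fM _ Tx).
Qed.

Lemma L2Z c f : L2 f -> L2 (fun x => c * f x).
Proof.
move=> [mf fi]; have mcf : cmeas torus (fun x => c * f x).
  by apply: cmeasM => //; split; exact: measurable_cst.
split=> //; have := integrable_lin (normc c ^+ 2) 0 measurable_torus fi fi.
apply: eq_integrable => // x _ /=.
by rewrite mul0r addr0 ComplexField.Normc.normcM exprMn.
Qed.

Lemma L2N f : L2 f -> L2 (fun x => - f x).
Proof.
by move=> Lf; have := L2Z (-1) Lf; under eq_fun do rewrite mulN1r.
Qed.

Lemma L2B f g : L2 f -> L2 g -> L2 (fun x => f x - g x).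
Proof. by move=> Lf Lg; apply: L2D => //; exact: L2N. Qed.

Lemma L2_cont f : ccontinuous f -> L2 f.
Proof.
move=> [c1 c2]; have cf : ccontinuous f by [].
have bd (p : R -> R) : continuous p -> exists M, forall x, torus x -> `|p x| <= M.
  move=> cp; have cn : {within `[0, 2 * pi], continuous (fun x : R => `|p x : R|)}.
    by apply: continuous_subspaceT => x; apply: cvg_norm; exact: cp.
  have [c _ hc] := EVT_max (ltW twopi_gt0) cn.
  by exists `|p c|.
have [M1 h1] := bd _ c1; have [M2 h2] := bd _ c2.
apply: (@L2_bounded _ (M1 + M2)); first exact: ccontinuous_meas.
move=> x Tx; apply: le_trans (normc_ReIm _) _.
by rewrite lerD ?h1 ?h2.
Qed.

Lemma L2_mul_cintegrable f g : L2 f -> L2 g -> cintegrable torus (fun x => f x * g x).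
Proof.
move=> [mf fi] [mg gi].
apply: cintegrable_le (integrable_lin 1 1 measurable_torus fi gi) _ => //.
  exact: cmeasM.
by move=> x _; rewrite !mul1r normcM_le.
Qed.

Lemma L2_conj f : L2 f -> L2 (fun x => conjc (f x)).
Proof.
move=> [mf fi]; split; first exact: cmeas_conj.
by under eq_fun do rewrite normc_conj.
Qed.

Lemma L2_expi n : L2 (expi n).
Proof. exact/L2_cont/ccontinuous_expi. Qed.

Lemma L2_fourier_integrable f n : L2 f -> cintegrable torus (fun x => f x * expi (- n) x).
Proof. by move=> Lf; apply: L2_mul_cintegrable => //; exact: L2_expi. Qed.

Lemma fourierD f g n : L2 f -> L2 g ->
  fourier (fun x => f x + g x) n = fourier f n + fourier g n.
Proof.
move=> Lf Lg; rewrite !fourierE -mulrDr -cintegralD//; try exact: L2_fourier_integrable.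
by congr (_ * _); apply: eq_cintegral => x _; rewrite mulrDl.
Qed.

Lemma fourierZ c f n : L2 f -> fourier (fun x => c * f x) n = c * fourier f n.
Proof.
move=> Lf; rewrite !fourierE [RHS]mulrCA.
rewrite -(cintegralZ c measurable_torus (L2_fourier_integrable n Lf)).
by congr (_ * _); apply: eq_cintegral => x _; rewrite mulrA.
Qed.

Lemma fourierN f n : L2 f -> fourier (fun x => - f x) n = - fourier f n.
Proof.
move=> Lf; rewrite -mulN1r -fourierZ//.
by congr (fourier _ n); apply/funext => x; rewrite mulN1r.
Qed.

Lemma fourierB f g n : L2 f -> L2 g ->
  fourier (fun x => f x - g x) n = fourier f n - fourier g n.
Proof. by move=> Lf Lg; rewrite fourierD ?fourierN//; exact: L2N. Qed.

Lemma fourier_expiM f m n : fourier (fun x => expi m x * f x) n = fourier f (n - m).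
Proof.
rewrite !fourierE; congr (_ * _); apply: eq_cintegral => x _.
by rewrite mulrAC mulrC -expiD opprB.
Qed.

Lemma cintegral_expi n : cintegral torus (expi n) = ((2 * pi) *+ (n == 0))%:C.
Proof.
have tp0 := ltW twopi_gt0; have [->|n0] := eqVneq n 0.
  have -> : expi 0 = fun=> 1 by apply/funext => x; rewrite /expi mul0r cis0.
  apply: complexP => /=; rewrite ?mulr1n.
    by rewrite Rintegral_cst// mul1r mu_torus.
  by rewrite Rintegral_cst// mul0r.
have nR : n%:~R != 0 :> R by rewrite intr_eq0.
have dE := @cderivZ R (- 'i * (n%:~R^-1)%:C) _ _ (@cderiv_cis R n%:~R 0).
have [c1 c2] := ccontinuous_expi n.
have e z : - 'i * (n%:~R^-1)%:C * ('i * n%:~R%:C * z) = z :> R[i].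
  have i2 : 'i * 'i = -1 :> R[i] by rewrite -expr2 sqr_i.
  have -> : - 'i * (n%:~R^-1)%:C * ('i * n%:~R%:C * z) =
     - ('i * 'i) * ((n%:~R^-1)%:C * n%:~R%:C) * z :> R[i] by ring.
  by rewrite i2 -rmorphM mulVf// opprK !mul1r.
have d1 x : is_derive x 1 (fun y => Re (- 'i * (n%:~R^-1)%:C * cis (n%:~R * y + 0))) (Re (expi n x)).
  by have := proj1 (dE x); rewrite e addr0.
have d2 x : is_derive x 1 (fun y => Im (- 'i * (n%:~R^-1)%:C * cis (n%:~R * y + 0))) (Im (expi n x)).
  by have := proj2 (dE x); rewrite e addr0.
have e0 : cis (n%:~R * (2 * pi) + 0) = cis (n%:~R * 0 + 0) :> R[i].
  by rewrite mulr0 !addr0 -[_ * (2 * pi)]add0r cis2pin.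
rewrite mulr0n; apply: complexP => /=.
  by rewrite (FTC2R tp0 d1 c1) e0 subrr.
by rewrite (FTC2R tp0 d2 c2) e0 subrr.
Qed.

Lemma fourier_expi m n : fourier (expi m) n = ((m == n)%:R)%:C.
Proof.
rewrite fourierE; under eq_cintegral do rewrite -expiD.
rewrite cintegral_expi subr_eq0 -rmorphM; congr (_%:C).
by case: eqP => _; rewrite ?mulr0// mulr1n mulVf// gt_eqF// twopi_gt0.
Qed.

Definition trig (s : seq int) (c : int -> R[i]) x : R[i] := \sum_(n <- s) c n * expi n x.

Lemma ccontinuous_trig s c : ccontinuous (trig s c).
Proof.
apply: ccontinuous_sum => n; apply: ccontinuousM; first exact: ccontinuous_cst.
exact: ccontinuous_expi.
Qed.

Lemma L2_trig s c : L2 (trig s c).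
Proof. exact/L2_cont/ccontinuous_trig. Qed.

Lemma fourier_trig s c n : uniq s -> fourier (trig s c) n = if n \in s then c n else 0.
Proof.
elim: s => [|m s IH] /=.
  move=> _; rewrite fourierE (@eq_cintegral _ _ _ (fun=> 0)) ?cintegral_zero ?mulr0//.
  by move=> x _; rewrite /trig big_nil mul0r.
move=> /andP[ms us].
have -> : trig (m :: s) c = fun x => c m * expi m x + trig s c x.
  by apply/funext => x; rewrite /trig big_cons.
rewrite fourierD ?fourierZ ?IH ?fourier_expi//; [|exact: L2_expi| |exact: L2_trig].
  rewrite in_cons eq_sym; case: eqP => [->|_] /=; last by rewrite mulr0 add0r.
  by rewrite (negbTE ms) addr0 mulr1.
by apply: L2Z; exact: L2_expi.
Qed.

Definition ip f g : R[i] := cintegral torus (fun x => f x * conjc (g x)).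

Lemma cintegral_fourier f n :
  cintegral torus (fun x => f x * expi (- n) x) = (2 * pi)%:C * fourier f n.
Proof.
rewrite fourierE mulrA -rmorphM mulfV ?mul1r//.
by rewrite gt_eqF// twopi_gt0.
Qed.

Lemma ip_trig f s c : L2 f ->
  ip f (trig s c) = (2 * pi)%:C * \sum_(n <- s) conjc (c n) * fourier f n.
Proof.
move=> Lf; have hi n := cintegrableZ (conjc (c n)) measurable_torus (L2_fourier_integrable n Lf).
have -> : ip f (trig s c) =
    cintegral torus (fun x => \sum_(n <- s) conjc (c n) * (f x * expi (- n) x)).
  apply: eq_cintegral => x _; rewrite /trig rmorph_sum/= mulr_sumr.
  by apply: eq_bigr => n _; rewrite rmorphM/= expiN cisN -/(expi n x) mulrCA.
rewrite (proj2 (cintegral_sum s measurable_torus hi)) mulr_sumr.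
apply: eq_bigr => n _; rewrite (cintegralZ _ measurable_torus (L2_fourier_integrable n Lf)).
by rewrite cintegral_fourier mulrCA.
Qed.

Lemma ip_self f : Re (ip f f) = nrm2 f.
Proof. by apply: eq_Rintegral => x _; rewrite mul_conjc. Qed.

Lemma nrm2_ge0 f : 0 <= nrm2 f.
Proof. by apply: Rintegral_ge0 => x _; exact: sqr_ge0. Qed.

Lemma nrm2B f g : L2 f -> L2 g ->
  nrm2 (fun x => f x - g x) = nrm2 f - 2 * Re (ip f g) + nrm2 g.
Proof.
move=> Lf Lg; have [mf fi] := Lf; have [mg gi] := Lg.
have [fgi _] := L2_mul_cintegrable Lf (L2_conj Lg).
have i1 := integrable_lin 1 (-2) measurable_torus fi fgi.
have -> : nrm2 f - 2 * Re (ip f g) =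
    \int[mu]_(x in torus) (1 * normc (f x) ^+ 2 + - 2 * Re (f x * conjc (g x))).
  by rewrite (Rintegral_lin _ _ measurable_torus fi fgi) mul1r mulNr.
have -> : nrm2 g = 1 * nrm2 g by rewrite mul1r.
rewrite -[X in X + _]mul1r -(Rintegral_lin _ _ measurable_torus i1 gi).
apply: eq_Rintegral => x _; rewrite !normcE_sqr cReD cImD cReN cImN cReM cRe_conj cIm_conj.
by ring.
Qed.

Lemma nrm2D_le f g : L2 f -> L2 g ->
  nrm2 (fun x => f x + g x) <= 2 * nrm2 f + 2 * nrm2 g.
Proof.
move=> Lf Lg; have [_ fi] := Lf; have [_ gi] := Lg; have [_ fgi] := L2D Lf Lg.
rewrite -(Rintegral_lin _ _ measurable_torus fi gi).
apply: le_Rintegral => //; first exact: (integrable_lin 2 2 measurable_torus fi gi).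
by move=> x _; exact: normc_sqrD.
Qed.

Lemma nrm2_trig s c : uniq s -> nrm2 (trig s c) = 2 * pi * \sum_(n <- s) normc (c n) ^+ 2.
Proof.
move=> us; rewrite -ip_self ip_trig; last exact: L2_trig.
rewrite cReM /= mul0r subr0 cRe_sum; congr (_ * _); apply: eq_big_seq => n ns.
by rewrite fourier_trig// ns mulrC mul_conjc.
Qed.

(** Completing the square in each coefficient. It contains Bessel's inequality and the optimality of
    the Fourier coefficients among all approximations with frequencies in s. *)
Lemma nrm2_approx f s d : uniq s -> L2 f ->
  nrm2 (fun x => f x - trig s d x) = nrm2 f
   - 2 * pi * (\sum_(n <- s) normc (fourier f n) ^+ 2)
   + 2 * pi * (\sum_(n <- s) normc (fourier f n - d n) ^+ 2).
Proof.
move=> us Lf; rewrite nrm2B ?nrm2_trig//; last exact: L2_trig.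
rewrite ip_trig// cReM /= mul0r subr0 cRe_sum -!addrA; congr (_ + _).
have -> (a b : R) : - (2 * (2 * pi * a)) + 2 * pi * b = 2 * pi * (- (2 * a) + b) by ring.
rewrite -[X in _ = X + _]mulrN -mulrDr; congr (_ * _).
rewrite -mulNr !mulr_sumr -sumrN -!big_split/=; apply: eq_bigr => n _.
by rewrite !normcE_sqr cReD cImD cReN cImN cReM cRe_conj cIm_conj; ring.
Qed.

Lemma bessel f : L2 f -> sumle (fun n => normc (fourier f n) ^+ 2) (nrm2 f / (2 * pi)).
Proof.
move=> Lf s us; rewrite ler_pdivlMr ?twopi_gt0// mulrC.
have := nrm2_approx (fourier f) us Lf; have := nrm2_ge0 (fun x => f x - trig s (fourier f) x).
move=> + e; rewrite e.
rewrite [X in _ + _ * X]big1 ?mulr0 ?addr0 ?subr_ge0// => n _.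
by rewrite subrr ComplexField.Normc.normc0 expr0n.
Qed.

Lemma nrm2_proj_le f s d : uniq s -> L2 f ->
  nrm2 (fun x => f x - trig s (fourier f) x) <= nrm2 (fun x => f x - trig s d x).
Proof.
move=> us Lf; rewrite !nrm2_approx// lerD2l ler_pM2l ?twopi_gt0//.
apply: ler_sum => n _; rewrite subrr ComplexField.Normc.normc0 expr0n/=; exact: sqr_ge0.
Qed.

Lemma sumle_cvg0 (I : eqType) (a : I -> R) C (k : nat -> I) : injective k ->
  (forall i, 0 <= a i) -> sumle a C -> a (k N) @[N --> \oo] --> 0.
Proof.
move=> kI a0 aC; apply: cvg_series_cvg_0.
apply: nondecreasing_is_cvgn.
  by move=> p q pq; apply: nondecreasing_series.
exists C => _ [N _ <-]; rewrite /series /= big_mkord.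
have := sumle_inj kI aC (s := index_iota 0 N); rewrite iota_uniq => /(_ isT).
by rewrite big_mkord.
Qed.

(** Riemann--Lebesgue as a consequence of Bessel's inequality. *)
Lemma fourier_cvg0 f (k : nat -> int) : injective k -> L2 f ->
  normc (fourier f (k N)) @[N --> \oo] --> 0.
Proof.
move=> kI Lf; have h := sumle_cvg0 kI (fun n => sqr_ge0 _) (bessel Lf).
have := cvg_comp _ _ h (@sqrt_continuous R 0); rewrite sqrtr0.
rewrite (_ : _ \o _ = fun N => normc (fourier f (k N)))//.
by apply/funext => N /=; rewrite sqrtr_sqr ger0_norm ?normc_ge0.
Qed.

End TorusL2.

(** * Mean-square convergence of Fourier series *)

Section FourierConvergence.
Variable R : realType.
Local Notation mu := (@lebesgue_measure R).
Local Notation torus := (@torus R).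
Implicit Types (f g h : R -> R[i]) (x y z : R) (n : int) (N M : nat).

Lemma squeeze0 (u v : nat -> R) : (forall N, 0 <= u N <= v N) -> v @ \oo --> 0 ->
  u @ \oo --> 0.
Proof.
move=> uv /cvgr0Pnorm_le v0; apply/cvgr0Pnorm_le => e /v0; apply: filterS => N.
have /andP[u0 uvN] := uv N; rewrite (ger0_norm u0) => h.
by apply: le_trans uvN _; exact: le_trans (ler_norm _) h.
Qed.

Lemma sin_ge_quarter z : 0 <= z <= 2 -> z / 4 <= sin z.
Proof.
move=> /andP[z0 z2]; have -> : z = (z / 2) *+ 2 by rewrite -mulr_natr divfK.
rewrite sin_mulr2n; have := @sin_ge_half R (z / 2) _; have := cos_ge_quad (z / 2).
have -> : 0 <= z / 2 <= 1 by apply/andP; split; lra.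
move=> h1 /(_ isT) h2; have h3 : 1 / 2 <= cos (z / 2) by nra.
have h4 : z / 4 <= sin (z / 2) by lra.
have : 1 / 2 * (z / 4) <= cos (z / 2) * sin (z / 2) by apply: ler_pM; lra.
by lra.
Qed.

(** e^{iz} - 1 has a simple zero at 0 and its next zeros at distance 2 pi. For z > pi the reflection
    sin (z/2) = sin (pi - z/2) brings the argument back to the range of [sin_ge_quarter]. *)
Lemma normc_cisB1_lower (e : R) : 0 < e -> exists2 c, 0 < c &
  forall z, `|z| <= 2 * pi - e -> c * `|z| <= normc (cis z - 1).
Proof.
move=> e0; have p0 := pi_gt0 R; pose c := Num.min 4^-1 (e / (8 * pi)).
have c4 : c <= 4^-1 by rewrite ge_min lexx.
have ce : c * (8 * pi) <= e by rewrite -ler_pdivlMr ?mulr_gt0// ge_min lexx orbT.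
exists c; first by rewrite lt_min invr_gt0 ltr0n divr_gt0 ?mulr_gt0.
move=> z ze; rewrite normc_cisB1.
wlog z0 : z ze / 0 <= z => [H|].
  have [|z0] := leP 0 z; first exact: H.
  by have := H (- z); rewrite normrN mulNr sinN normrN oppr_ge0 => ->//; rewrite ltW.
rewrite ger0_norm// in ze *; have pi2 := pihalf_lt2 R.
have [zp|pz] := leP z pi.
  have h : z / 2 / 4 <= sin (z / 2) by apply: sin_ge_quarter; apply/andP; split; lra.
  rewrite ger0_norm; last by apply: le_trans h; lra.
  by nra.
have -> : sin (z / 2) = sin (pi - z / 2).
  by rewrite -(opprK (pi - _)) sinN opprB -[RHS]sinDpi subrK.
have h : (pi - z / 2) / 4 <= sin (pi - z / 2) by apply: sin_ge_quarter; apply/andP; split; lra.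
rewrite ger0_norm; last by apply: le_trans h; lra.
have : c * z <= c * (2 * pi) by rewrite ler_pM2l; [lra|rewrite lt_min invr_gt0 ltr0n divr_gt0 ?mulr_gt0].
by nra.
Qed.

Lemma measurable_inv_nneg (D : set R) (p : R -> R) : measurable_fun D p ->
  (forall x, 0 <= p x) -> measurable_fun D (fun x => (p x)^-1).
Proof.
move=> mp p0; have -> : (fun x => (p x)^-1) = (@powR R ^~ (-1)) \o p.
  by apply/funext => x /=; rewrite powR_inv1.
exact: measurableT_comp (measurable_powR _) mp.
Qed.

Lemma cmeasV (D : set R) f : cmeas D f -> cmeas D (fun x => (f x)^-1).
Proof.
move=> mf; have -> : (fun x => (f x)^-1) =
    (fun x => conjc (f x) * ((normc (f x) ^+ 2)^-1)%:C).
  apply/funext => x; have [->|fx0] := eqVneq (f x) 0.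
    by rewrite invr0 ComplexField.Normc.normc0 expr0n invr0 mulr0.
  have e := mul_conjc (f x); have n0 : normc (f x) ^+ 2 != 0.
    rewrite sqrf_eq0; apply: contra fx0 => /eqP h; apply/eqP.
    exact: ComplexField.Normc.eq0_normc h.
  apply: (mulfI fx0); rewrite mulfV// mulrA e -rmorphM mulfV//.
apply: cmeasM; first exact: cmeas_conj.
apply: cmeas_real; apply: measurable_inv_nneg; first exact: cmeas_normc2.
by move=> x; exact: sqr_ge0.
Qed.

Definition fsum f N : R -> R[i] := trig (zbox N) (fourier f).

(* If f(y) - f(x0) = (e^{i(y-x0)} - 1) G(y) with G bounded, the Fourier series of f - f(x0)
   at x0 telescopes in the coefficients of G, which tend to 0. *)
Lemma fourier_cvg_pt f M (L x0 : R) : cmeas torus f -> (forall x, torus x -> normc (f x) <= M%:R) ->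
  0 < x0 < 2 * pi -> (forall y, torus y -> normc (f y - f x0) <= L * `|y - x0|) ->
  normc (fsum f N x0 - f x0) @[N --> \oo] --> 0.
Proof.
move=> mf fM /andP[x00 x0p] fL.
have L0 : 0 <= L.
  have Tz : torus 0 by rewrite /torus /= in_itv/= lexx ltW// twopi_gt0.
  have := le_trans (normc_ge0 _) (fL _ Tz).
  by rewrite pmulr_lge0// normr_gt0 sub0r oppr_eq0 gt_eqF.
pose e := Num.min x0 (2 * pi - x0); have e0 : 0 < e by rewrite lt_min x00 subr_gt0.
have [c c0 hc] := normc_cisB1_lower e0.
pose G y := (f y - f x0) * (cis (y - x0) - 1)^-1.
have Tx0 : torus x0 by rewrite /torus /= in_itv/= !ltW.
have Glow y : torus y -> c * `|y - x0| <= normc (cis (y - x0) - 1).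
  rewrite /torus /= in_itv/= => /andP[y0 yp]; apply: hc.
  have e1 : e <= x0 by rewrite ge_min lexx.
  have e2 : e <= 2 * pi - x0 by rewrite ge_min lexx orbT.
  by rewrite ler_norml; apply/andP; split; lra.
have wneq y : torus y -> y != x0 -> cis (y - x0) - 1 != 0.
  move=> /Glow h yx; apply: contraTneq h => ->.
  by rewrite ComplexField.Normc.normc0 -ltNge mulr_gt0// normr_gt0 subr_eq0.
have fG y : torus y -> f y = f x0 + (cis (y - x0) - 1) * G y.
  move=> Ty; have [->|yx] := eqVneq y x0; first by rewrite /G !subrr mul0r mulr0 addr0.
  by rewrite /G mulrCA mulfV ?wneq// mulr1 addrC subrK.
have GM y : torus y -> normc (G y) <= L / c.
  move=> Ty; have [->|yx] := eqVneq y x0.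
    by rewrite /G !subrr mul0r ComplexField.Normc.normc0 divr_ge0// ltW.
  have d0 : 0 < `|y - x0| by rewrite normr_gt0 subr_eq0.
  rewrite /G ComplexField.Normc.normcM ComplexField.Normc.normcV.
  have w0 : 0 < normc (cis (y - x0) - 1) by apply: lt_le_trans (Glow _ Ty); rewrite mulr_gt0.
  rewrite ler_pdivrMr//; apply: le_trans (fL _ Ty) _.
  apply: (@le_trans _ _ (L / c * (c * `|y - x0|))).
    by rewrite mulrA divfK// gt_eqF.
  by rewrite ler_wpM2l ?Glow// divr_ge0// ltW.
have cc : ccontinuous (fun y => cis (y - x0) - 1).
  apply: ccontinuousD; last exact: ccontinuous_cst.
  have := cderiv_continuous (@cderiv_cis R 1 (- x0)).
  by under eq_fun do rewrite mul1r.
have mG : cmeas torus G.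
  apply: cmeasM; first by apply: cmeasD => //; split; exact: measurable_cst.
  by apply: cmeasV; exact: ccontinuous_meas.
have LG : L2 G by exact: L2_bounded mG GM.
have Lf : L2 f by exact: L2_bounded mf fM.
have cf n : fourier f n = ((n == 0)%:R)%:C * f x0 + (cis (- x0) * fourier G (n - 1) - fourier G n).
  have L1 : L2 (fun x => f x0 * expi 0 x) by apply: L2Z; exact: L2_expi.
  have L3 : L2 (fun x => expi 1 x * G x).
    have [mG' _] := LG; apply: (@L2_bounded _ _ (L / c)).
      by apply: cmeasM => //; apply: ccontinuous_meas; exact: ccontinuous_expi.
    by move=> x Tx; rewrite ComplexField.Normc.normcM normc_expi mul1r GM.
  have L2' : L2 (fun x => cis (- x0) * (expi 1 x * G x)) by apply: L2Z.
  rewrite -(fourier_expiM G 1 n) -(fourierZ (cis (- x0)) n L3) -fourierB//.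
  rewrite [_%:C * _]mulrC -[(n == 0)%B]eq_sym -fourier_expi -fourierZ; last exact: L2_expi.
  rewrite -fourierD//; last exact: L2B.
  rewrite !fourierE; congr (_ * _); apply: eq_cintegral => x; rewrite inE => Tx.
  congr (_ * _); rewrite (fG _ Tx) /expi mul0r cis0 mulr1 mulrA -cisD mulr1z mul1r.
  by rewrite mulrBl mul1r [- x0 + x]addrC.
have tele N : fsum f N x0 - f x0 =
    expi (- N.+1%:Z) x0 * fourier G (- N.+1%:Z) - expi N%:Z x0 * fourier G N%:Z.
  have sh n : expi n x0 * cis (- x0) = expi (n - 1) x0.
    by rewrite expiD expiN mulr1z mul1r.
  elim: N => [|N IH].
    have e1 : expi (- 1%:Z) x0 = cis (- x0) by rewrite expiN mul1r.
    have e2 : expi 0 x0 = 1 by rewrite /expi mul0r cis0.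
    rewrite /fsum /trig (_ : zbox 0 = [:: 0])// big_seq1 cf eqxx sub0r e1 e2 mulr1 mul1r.
    by rewrite (_ : (true%:R)%:C = 1)// mul1r addrC addKr.
  have cfn n : n != 0 -> fourier f n * expi n x0 =
      expi (n - 1) x0 * fourier G (n - 1) - expi n x0 * fourier G n.
    move=> n0; rewrite cf (negbTE n0) (_ : (false%:R)%:C = 0)// mul0r add0r -(sh n).
    by move: (cis _) (expi _ _) (fourier _ _) (fourier _ _) => u v w z; ring.
  rewrite /fsum /trig big_zboxS -/(trig _ _ x0) -/(fsum f N x0) !cfn//.
  have -> : - N.+1%:Z - 1 = - N.+2%:Z by lia.
  have -> : N.+1%:Z - 1 = N%:Z by lia.
  have -> (a b b' d : R[i]) : a + b + b' - d = (b - d) + (a + b') by ring.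
  rewrite IH; move: (expi _ x0 * _) (expi _ x0 * _) (expi _ x0 * _) (expi _ x0 * _) => u v w z.
  by ring.
have k1 : injective (fun N => - N.+1%:Z) by move=> i j; lia.
have k2 : injective (fun N => N%:Z) by move=> i j; lia.
have s : normc (fourier G (- N.+1%:Z)) + normc (fourier G N%:Z) @[N --> \oo] --> 0.
  by rewrite -[0]addr0; apply: cvgD; [exact: (fourier_cvg0 k1 LG)|exact: (fourier_cvg0 k2 LG)].
apply: squeeze0 s => N; rewrite normc_ge0/= tele.
apply: le_trans (normcB _ _) _.
by rewrite !ComplexField.Normc.normcM !normc_expi !mul1r.
Qed.

Lemma nrm2_fsumB f N M : L2 f -> (N <= M)%N ->
  nrm2 (fun x => fsum f M x - fsum f N x) =
  2 * pi * (\sum_(n <- zbox M) normc (fourier f n) ^+ 2 - \sum_(n <- zbox N) normc (fourier f n) ^+ 2).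
Proof.
move=> Lf NM; have uN := uniq_zbox N; have uM := uniq_zbox M.
rewrite (nrm2_approx (fourier f) uN (L2_trig _ _)) nrm2_trig//.
have e n : n \in zbox N -> fourier (trig (zbox M) (fourier f)) n = fourier f n.
  by move=> nN; rewrite fourier_trig// (zbox_sub NM nN).
rewrite [X in _ + _ * X = _]big1_seq ?mulr0 ?addr0; last first.
  by move=> n /andP[_ nN]; rewrite (e _ nN) subrr ComplexField.Normc.normc0 expr0n.
by rewrite mulrBr; congr (_ - _ * _); apply: eq_big_seq => n nN; rewrite e.
Qed.

Definition open_torus : set R := `]0, 2 * pi[.

Definition L2cvg f := nrm2 (fun x => f x - fsum f N x) @[N --> \oo] --> 0.

Lemma L2_fsum f N : L2 (fsum f N).
Proof. exact: L2_trig. Qed.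

Lemma nrm2_open f : L2 f ->
  (nrm2 f)%:E = (\int[mu]_(x in open_torus) (normc (f x) ^+ 2)%:E)%E.
Proof.
move=> [mf fi]; rewrite /nrm2 /Defs.torus /open_torus.
have fi2 : mu.-integrable `[0, 2 * pi[ (EFin \o (fun x => normc (f x) ^+ 2)).
  apply: integrableS fi; [exact: measurable_itv|exact: measurable_itv|].
  by move=> x /=; rewrite /Defs.torus/= !in_itv/= => /andP[-> /ltW ->].
have fi3 : mu.-integrable `]0, 2 * pi[ (EFin \o (fun x => normc (f x) ^+ 2)).
  apply: integrableS fi2; [exact: measurable_itv|exact: measurable_itv|].
  by move=> x /=; rewrite !in_itv/= => /andP[/ltW -> ->].
rewrite -Rintegral_itv_bndo_bndc// -Rintegral_itv_obnd_cbnd// /Rintegral fineK//.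
exact: integrable_fin_num.
Qed.

(** Bessel's inequality makes the partial sums Cauchy in L^2, and Fatou's lemma, as M grows,
    identifies their limit with f. The integrals are taken over the open interval, where the
    pointwise convergence is given. *)
Lemma L2cvg_pt f : L2 f ->
  (forall x, 0 < x < 2 * pi -> normc (fsum f N x - f x) @[N --> \oo] --> 0) -> L2cvg f.
Proof.
move=> Lf ptw; pose A N := \sum_(n <- zbox N) normc (fourier f n) ^+ 2.
have tp := twopi_gt0 R.
have Am N M : (N <= M)%N -> A N <= A M.
  by move=> NM; apply: ler_sum_subset; [move=> n; exact: sqr_ge0|exact: uniq_zbox|exact: zbox_sub].
have Ab N : A N <= nrm2 f / (2 * pi) by apply: bessel => //; exact: uniq_zbox.
have cA : cvgn A.
  apply: nondecreasing_is_cvgn; first by move=> N M; exact: Am.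
  by exists (nrm2 f / (2 * pi)) => _ [N _ <-].
pose l := limn A; have Al : A @ \oo --> l by exact: cA.
have Al_le N : A N <= l.
  by apply: nondecreasing_cvgn_le => // ? ?; exact: Am.
have key N : nrm2 (fun x => f x - fsum f N x) <= 2 * pi * (l - A N).
  rewrite -lee_fin nrm2_open; last by apply: L2B => //; exact: L2_fsum.
  pose F M x := (normc (fsum f (M + N) x - fsum f N x) ^+ 2)%:E.
  have mF M : measurable_fun open_torus (F M).
    apply/measurable_EFinP; apply: cmeas_normc2; apply: cmeasD; last apply: cmeasN.
      exact/ccontinuous_meas/ccontinuous_trig.
    exact/ccontinuous_meas/ccontinuous_trig.
  have F0 M x : open_torus x -> (0 <= F M x)%E by rewrite lee_fin sqr_ge0.
  have := @fatou _ _ R mu open_torus (measurable_itv _) F mF F0.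
  rewrite (@eq_integral _ _ _ mu _ (fun x => (normc (f x - fsum f N x) ^+ 2)%:E)); last first.
    move=> x; rewrite inE /open_torus/= in_itv/= => xI; apply/esym.
    suff /cvg_limn_einf_sup[-> _] : F M x @[M --> \oo] --> (normc (f x - fsum f N x) ^+ 2)%:E by [].
    apply: cvg_EFin; first by near=> M.
    rewrite (_ : _ \o _ = fun M => normc (fsum f (M + N) x - fsum f N x) * normc (fsum f (M + N) x - fsum f N x)); last first.
      by apply/funext => M /=; rewrite expr2.
    rewrite expr2.
    have c1 : normc (fsum f (M + N) x - fsum f N x) @[M --> \oo] --> normc (f x - fsum f N x).
      have /cvgr0Pnorm_le pt : normc (fsum f (M + N) x - f x) @[M --> \oo] --> 0.
        by rewrite (cvg_shiftn N (fun M => normc (fsum f M x - f x))); exact: ptw.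
      apply/cvgrPdist_le => e e0; have := pt e e0; apply: filterS => M.
      rewrite ger0_norm ?normc_ge0// => h; rewrite ler_norml; apply/andP; split.
        rewrite lerNl opprB lerBlDr.
        apply: le_trans (normc_triang _ (f x) _) _.
        by rewrite lerD2r.
      rewrite lerBlDr; apply: le_trans (normc_triang _ (fsum f (M + N) x) _) _.
      by rewrite lerD2r normcBC.
    exact: cvgM.
  move=> h; apply: le_trans h _; rewrite limn_einf_lim; apply: lime_le; first exact: is_cvg_einfs.
  near=> M; apply: (@le_trans _ _ (\int[mu]_(x in open_torus) F M x)%E).
    by apply: ereal_inf_lbound; exists M => //=.
  rewrite -nrm2_open; last by apply: L2B; exact: L2_fsum.
  rewrite lee_fin nrm2_fsumB ?leq_addl// ler_pM2l// lerD2r; exact: Al_le.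
have c0 : 2 * pi * (l - A N) @[N --> \oo] --> 0.
  have -> : 0 = 2 * pi * (l - l) by rewrite subrr mulr0.
  by apply: cvgMr; apply: cvgB => //; exact: cvg_cst.
by apply: squeeze0 c0 => N; rewrite nrm2_ge0 key.
Unshelve. all: by end_near. Qed.

(** The partial sum of f approximates f at least as well as the partial sum of h does, so
    convergence passes to L^2 limits. *)
Lemma L2cvg_approx f : L2 f ->
  (forall e, 0 < e -> exists h, [/\ L2 h, L2cvg h & nrm2 (fun x => f x - h x) <= e]) -> L2cvg f.
Proof.
move=> Lf H; apply/cvgr0Pnorm_le => e e0.
have e4 : 0 < e / 4 by rewrite divr_gt0.
have [h [Lh /cvgr0Pnorm_le ch fh]] := H _ e4.
have := ch _ e4; apply: filterS => N hN; rewrite (ger0_norm (nrm2_ge0 _)) in hN.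
rewrite (ger0_norm (nrm2_ge0 _)).
apply: le_trans (nrm2_proj_le (fourier h) (uniq_zbox N) Lf) _.
rewrite -/(fsum h N) (_ : (fun x => f x - _) = fun x => (f x - h x) + (h x - fsum h N x)); last first.
  by apply/funext => x; rewrite addrA subrK.
apply: le_trans (nrm2D_le (L2B Lf Lh) (L2B Lh (L2_fsum h N))) _; lra.
Qed.

Lemma lipschitz_cmeas f (L : R) : (forall x y, normc (f x - f y) <= L * `|x - y|) -> ccontinuous f.
Proof.
move=> fL; have aux (p : R -> R) : (forall x y, `|p x - p y| <= L * `|x - y|) -> continuous p.
  move=> pL x; apply/cvgrPdist_le => e e0.
  have L1 : 0 < `|L| + 1 by rewrite ltr_pwDr.
  near=> y; apply: le_trans (pL _ _) _.
  apply: (@le_trans _ _ ((`|L| + 1) * `|x - y|)).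
    by rewrite ler_wpM2r// (le_trans (ler_norm _))// lerDl.
  rewrite -ler_pdivlMl//; near: y.
  by apply: cvgr_dist_le => //; rewrite mulr_gt0// invr_gt0.
split; apply: aux => x y; apply: le_trans (fL x y).
  by have := normc_Re (f x - f y); rewrite cReD cReN.
by have := normc_Im (f x - f y); rewrite cImD cImN.
Unshelve. all: by end_near. Qed.

Lemma L2cvg_lipschitz f (L : R) : (forall x y, normc (f x - f y) <= L * `|x - y|) -> L2cvg f.
Proof.
move=> fL; have cf := lipschitz_cmeas fL; have Lf := L2_cont cf.
apply: L2cvg_pt => // x xI; have Tx : torus x by rewrite /Defs.torus /= in_itv/=; lra.
pose B := normc (f x) + L * (2 * pi).
have L0 : 0 <= L by have := le_trans (normc_ge0 _) (fL 1 0); rewrite subr0 normr1 mulr1.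
apply: (@fourier_cvg_pt f (Num.truncn B).+1 L) => //; first exact: ccontinuous_meas.
move=> y; rewrite /Defs.torus /= in_itv/= => yI; apply: (@le_trans _ _ B).
  rewrite -[f y](subrK (f x)); apply: le_trans (normcD _ _) _; rewrite /B addrC lerD2l.
  apply: le_trans (fL _ _) _; rewrite ler_wpM2l// ler_norml; apply/andP; split; lra.
by apply/ltW/truncnS_gt.
Qed.

(** Difference quotients of the primitive with step 1 / (k + 1), that is, averages of p over short
    intervals: Lipschitz since the primitive is, bounded by B, and convergent almost everywhere by
    Lebesgue's differentiation theorem. *)
Lemma mollify (p : R -> R) (B : R) : measurable_fun setT p -> (forall x, `|p x| <= B) ->
  (forall x, ~ torus x -> p x = 0) ->
  exists q : nat -> R -> R, [/\ forall k, exists L, forall x y, `|q k x - q k y| <= L * `|x - y|,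
    forall k x, `|q k x| <= B & {ae mu, forall x, q k x @[k --> \oo] --> p x}].
Proof.
move=> mp pB p0.
have B0 : 0 <= B by apply: le_trans (pB 0).
have mp' : measurable_fun torus p by exact: measurable_funTS_itv mp.
have ti := @integrable_bdd R torus p B (@measurable_torus R) (@torus_fin R) mp' (fun x _ => pB x).
have pT : mu.-integrable setT (EFin \o p).
  have [h _] := @integrable_mkcond _ _ R mu torus (EFin \o p) (@measurable_torus R).
  have := h ti; apply: eq_integrable => // x _.
  rewrite patchE; case: ifPn => // /negP hx; rewrite /= p0// => Tx; apply: hx.
  by rewrite inE.
have pI (i : interval R) : mu.-integrable [set` i] (EFin \o p) by apply: integrableS pT.
pose F x := \int[mu]_(t in `]-oo, x]) p t.
have FB x y : x <= y -> `|F y - F x| <= B * (y - x).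
  move=> xy; rewrite /F (Rintegral_itvB (pI _))//.
  have -> : B * (y - x) = B * fine (mu `]x, y]).
    rewrite lebesgue_measure_itv/= lte_fin; case: ltP => //= yx.
    have -> : x = y by apply/le_anti; rewrite xy yx.
    by rewrite subrr.
  by apply: normr_Rintegral_le => //; rewrite lebesgue_measure_itv/=; case: ifP => // _; rewrite -EFinB ltry.
have FL x y : `|F x - F y| <= B * `|x - y|.
  have [xy|/ltW yx] := leP x y.
    by rewrite distrC (distrC x) (ger0_norm (_ : 0 <= y - x)) ?subr_ge0// FB.
  by rewrite (ger0_norm (_ : 0 <= x - y)) ?subr_ge0// FB.
pose q k x := k.+1%:R * (F (x + k.+1%:R^-1) - F x); exists q; split.
- move=> k; exists (k.+1%:R * (2 * B)) => x y; rewrite /q -mulrBr normrM ger0_norm//.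
  rewrite -!mulrA ler_wpM2l//.
  have -> (a b c d : R) : a - b - (c - d) = (a - c) - (b - d) by ring.
  apply: le_trans (ler_normB _ _) _; have := FL x y.
  have := FL (x + k.+1%:R^-1) (y + k.+1%:R^-1).
  have -> : x + k.+1%:R^-1 - (y + k.+1%:R^-1) = x - y by ring.
  by lra.
- move=> k x; rewrite /q normrM ger0_norm//; have := FL (x + k.+1%:R^-1) x.
  rewrite [x + _]addrC addrK (ger0_norm (_ : 0 <= k.+1%:R^-1)) ?invr_ge0// => h.
  by rewrite -ler_pdivlMl// mulrC.
- have lp : locally_integrable setT p by apply: open_integrable_locally => //; exact: openT.
  have := FTC1Ny (fun y => pI `]-oo, y]) lp.
  apply: filterS; first exact: (ae_filter_ringOfSetsType mu).
  move=> x [dF Fp].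
  have /cvg_ex [l cl] := dF; have lE : l = p x.
    by rewrite -Fp derive1E /derive; apply/esym/cvg_lim.
  move: cl; rewrite lE => cl.
  have hk : (fun k : nat => k.+1%:R^-1 : R) @ \oo --> (0 : R)^'.
    move=> A; rewrite /dnbhs /within /= => hA; have := @cvg_harmonic R _ hA.
    move=> [N _ HN]; exists N => // k Nk; apply: (HN k Nk).
    by rewrite /harmonic/= invr_eq0 pnatr_eq0.
  have := cvg_comp _ _ hk cl; apply: cvg_trans; apply: near_eq_cvg; near=> k => /=.
  by rewrite /q /GRing.scale/= mulr1 invrK [_ + x]addrC.
Unshelve. all: by end_near. Qed.

Lemma L2cvg_bounded f (M : R) : cmeas torus f -> (forall x, torus x -> normc (f x) <= M) ->
  L2cvg f.
Proof.
move=> mf fM; have Lf := L2_bounded mf fM; have [m1 m2] := mf.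
have M0 : 0 <= M.
  have T0 : torus 0 by rewrite /Defs.torus /= in_itv/= lexx ltW// twopi_gt0.
  exact: le_trans (normc_ge0 _) (fM _ T0).
pose res (p : R -> R) := p \_ torus.
have resB (p : R -> R) : (forall x, torus x -> `|p x| <= M) -> forall x, `|res p x| <= M.
  by move=> pM x; rewrite /res patchE; case: ifPn => [|_]; rewrite ?normr0// inE; exact: pM.
have res0 (p : R -> R) x : ~ torus x -> res p x = 0.
  by move=> h; rewrite /res patchE memNset.
have resT (p : R -> R) x : torus x -> res p x = p x.
  by move=> h; rewrite /res patchE mem_set.
have mres (p : R -> R) : measurable_fun torus p -> measurable_fun setT (res p).
  by move=> mp; apply/(measurable_restrictT _ (@measurable_torus R)).
have b1 x : torus x -> `|Re (f x)| <= M by move=> /fM; apply: le_trans; exact: normc_Re.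
have b2 x : torus x -> `|Im (f x)| <= M by move=> /fM; apply: le_trans; exact: normc_Im.
have [q1 [q1L q1B q1c]] := mollify (mres _ m1) (resB _ b1) (res0 _).
have [q2 [q2L q2B q2c]] := mollify (mres _ m2) (resB _ b2) (res0 _).
pose h k x := q1 k x +i* q2 k x.
have hL k : exists L, forall x y, normc (h k x - h k y) <= L * `|x - y|.
  have [K1 H1] := q1L k; have [K2 H2] := q2L k; exists (K1 + K2) => x y.
  apply: le_trans (normc_ReIm _) _; rewrite cReD cImD cReN cImN mulrDl.
  by apply: lerD; [exact: H1|exact: H2].
have Lh k : L2 (h k) by have [L HL] := hL k; exact/L2_cont/(lipschitz_cmeas HL).
have nc : nrm2 (fun x => f x - h k x) @[k --> \oo] --> 0.
  (* Each component of f - h k is at most 2 M, whence the dominating constant. *)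
  have i8 : mu.-integrable torus (EFin \o (fun=> 8 * M ^+ 2)).
    by apply: (@integrable_bdd R torus _ `|8 * M ^+ 2| (@measurable_torus R) (@torus_fin R)).
  have mF k : measurable_fun torus (fun x => (normc (f x - h k x) ^+ 2)%:E).
    by apply/measurable_EFinP; have [] := L2B Lf (Lh k) => /cmeas_normc2.
  have [] := @dominated_convergence _ _ R mu torus (@measurable_torus R)
      (fun k x => (normc (f x - h k x) ^+ 2)%:E) (cst 0%E) _ mF (measurable_cst _) _ i8.
  - apply: filterS2 q1c q2c; first exact: (ae_filter_ringOfSetsType mu).
    move=> x c1 c2 Tx.
    rewrite /cst -[0%E]/(0%:E); apply: cvg_EFin; first exact: nearW.
    rewrite (_ : _ \o _ = fun k => (Re (f x) - q1 k x) ^+ 2 + (Im (f x) - q2 k x) ^+ 2); last first.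
      by apply/funext => k /=; rewrite normcE_sqr cReD cImD cReN cImN.
    have z (u : nat -> R) (l : R) : u k @[k --> \oo] --> l -> (l - u k) ^+ 2 @[k --> \oo] --> 0.
      move=> ul; rewrite (_ : 0 = (l - l) * (l - l)); last by rewrite subrr mulr0.
      by under eq_fun do rewrite expr2; apply: cvgM; apply: cvgB => //; exact: cvg_cst.
    rewrite (_ : 0 = 0 + 0); last by rewrite addr0.
    by rewrite !resT// in c1 c2; apply: cvgD; apply: z.
  - apply: aeW => x k Tx /=; rewrite lee_fin ger0_norm ?sqr_ge0// normcE_sqr cReD cImD cReN cImN /=.
    have := b1 _ Tx; have := b2 _ Tx; have := q1B k x; have := q2B k x.
    rewrite !ler_norml => /andP[? ?] /andP[? ?] /andP[? ?] /andP[? ?]; nra.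
  move=> _ _; rewrite integral0 => c.
  rewrite (_ : (fun k => _) = fun k => fine (\int[mu]_(x in torus) (normc (f x - h k x) ^+ 2)%:E))%E//.
  by apply: fine_cvg.
apply: L2cvg_approx => // e e0; have /cvgr0Pnorm_le/(_ e e0) := nc.
move=> -[k0 _ /(_ k0 (leqnn _))] /=; rewrite (ger0_norm (nrm2_ge0 _)) => hk.
have [L HL] := hL k0.
by exists (h k0); split => //; exact: L2cvg_lipschitz HL.
Qed.

(** The damped functions f k / (k + |f|^2) are bounded, dominated by |f| and converge to f
    pointwise, which reduces the claim to bounded functions by dominated convergence. *)
Lemma L2cvg_L2 f : L2 f -> L2cvg f.
Proof.
move=> Lf; have [mf fi] := Lf.
pose w k x : R := k.+1%:R * (k.+1%:R + normc (f x) ^+ 2)^-1.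
pose h k x := f x * (w k x)%:C.
have den k x : 0 < k.+1%:R + normc (f x) ^+ 2 by rewrite ltr_pwDl// sqr_ge0.
have mh k : cmeas torus (h k).
  apply: cmeasM => //; apply: cmeas_real; apply: measurable_funM => //.
  apply: measurable_inv_nneg; last by move=> x; exact: ltW.
  by apply: measurable_funD => //; exact: cmeas_normc2.
have w0 k x : 0 <= w k x by rewrite mulr_ge0// invr_ge0 ltW.
have hb k x : normc (h k x) <= k.+1%:R.
  rewrite ComplexField.Normc.normcM normc_real ger0_norm// /w mulrCA -ler_pdivlMl// mulVf// ler_pdivrMr// mul1r.
  have : 1 <= k.+1%:R :> R by rewrite ler1n.
  by have := sqr_ge0 (normc (f x) - 1); have := sqr_ge0 (normc (f x)); nra.
have Lh k : L2 (h k) by exact: L2_bounded (mh k) (fun x _ => hb k x).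
have dE k x : normc (f x - h k x) ^+ 2 = (normc (f x) * (1 - w k x)) ^+ 2.
  have -> : f x - h k x = f x * (1 - w k x)%:C by rewrite /h rmorphB/= mulrBr mulr1.
  rewrite ComplexField.Normc.normcM normc_real ger0_norm//.
  by rewrite subr_ge0 /w ler_pdivrMr// mul1r lerDl sqr_ge0.
have w1 k x : w k x <= 1 by rewrite /w ler_pdivrMr// mul1r lerDl sqr_ge0.
have nc : nrm2 (fun x => f x - h k x) @[k --> \oo] --> 0.
  have mF k : measurable_fun torus (fun x => (normc (f x - h k x) ^+ 2)%:E).
    by apply/measurable_EFinP; have [] := L2B Lf (Lh k) => /cmeas_normc2.
  have := @dominated_cvg _ _ R mu torus (@measurable_torus R)
      (fun k x => (normc (f x - h k x) ^+ 2)%:E) (cst 0%E) (EFin \o (fun x => normc (f x) ^+ 2)) mF.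
  rewrite integral0 => c.
  rewrite (_ : (fun k => _) = fun k => fine (\int[mu]_(x in torus) (normc (f x - h k x) ^+ 2)%:E))%E//.
  apply: fine_cvg; apply: c => //.
    move=> x Tx; rewrite /cst -[0%E]/(0%:E); apply: cvg_EFin; first exact: nearW.
    rewrite (_ : _ \o _ = fun k => (normc (f x) * (1 - w k x)) ^+ 2); last first.
      by apply/funext => k /=; rewrite dE.
    have hk : normc (f x) ^+ 3 * (k.+1%:R)^-1 @[k --> \oo] --> (0 : R).
      by rewrite -[0](mulr0 (normc (f x) ^+ 3)); apply: cvgMr; exact: cvg_harmonic.
    have hk2 : normc (f x) * (1 - w k x) @[k --> \oo] --> 0.
      apply: squeeze0 hk => k; rewrite mulr_ge0 ?normc_ge0 ?subr_ge0//=.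
      have -> : 1 - w k x = normc (f x) ^+ 2 * (k.+1%:R + normc (f x) ^+ 2)^-1.
        rewrite /w -[X in X - _](mulfV (lt0r_neq0 (den k x))) -mulrBl.
        by congr (_ * _); rewrite addrC addKr.
      rewrite mulrA -exprS ler_wpM2l ?exprn_ge0 ?normc_ge0// lef_pV2 ?posrE//.
      by rewrite lerDl sqr_ge0.
    by rewrite -[0](mulr0 0); under eq_fun do rewrite expr2; exact: cvgM.
  move=> k x Tx; rewrite /= lee_fin ger0_norm ?sqr_ge0// dE exprMn ler_piMr ?sqr_ge0//.
  by have := w0 k x; have := w1 k x; nra.
apply: L2cvg_approx => // e e0; have /cvgr0Pnorm_le/(_ e e0) := nc.
move=> -[k0 _ /(_ k0 (leqnn _))] /=; rewrite (ger0_norm (nrm2_ge0 _)) => hk.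
exists (h k0); split => //; apply: (@L2cvg_bounded _ k0.+1%:R) => //.
Qed.

End FourierConvergence.

(** * Fourier coefficients of the cubic term *)

Section CubicCoefficients.
Variable R : realType.
Local Notation mu := (@lebesgue_measure R).
Local Notation torus := (@torus R).
Implicit Types (f g h : R -> R[i]) (x y z : R) (n : int) (N M : nat).

(* Partial sums of the convolution sum over n1 - n2 + n3 = n; here n1 = p, n3 = q and
   n2 = p + q - n. *)
Definition csum N (c : int -> R[i]) n : R[i] :=
  \sum_(p <- zbox N) \sum_(q <- zbox N | p + q - n \in zbox N)
    c p * conjc (c (p + q - n)) * c q.

Definition asum N (a : int -> R) n : R :=
  \sum_(p <- zbox N) \sum_(q <- zbox N | p + q - n \in zbox N) a p * a (p + q - n) * a q.

Lemma normc_csum N c (a : int -> R) n : (forall m, normc (c m) <= a m) ->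
  normc (csum N c n) <= asum N a n.
Proof.
move=> ca; apply: le_trans (normc_sum _ _ _) _; apply: ler_sum => p _.
apply: le_trans (normc_sum _ _ _) _; apply: ler_sum => q _.
rewrite !ComplexField.Normc.normcM normc_conj.
by rewrite !ler_pM ?mulr_ge0 ?normc_ge0.
Qed.

Lemma fourier_conj f n : L2 f -> fourier (fun x => conjc (f x)) n = conjc (fourier f (- n)).
Proof.
move=> Lf; rewrite !fourierE opprK rmorphM; congr (_ * _); first by apply: complexP; rewrite /= ?oppr0.
have [i1 i2] := L2_mul_cintegrable Lf (L2_expi R n).
have e x : conjc (f x) * expi (- n) x = conjc (f x * expi n x).
  by rewrite rmorphM/= expiN cisN.
apply: complexP; rewrite ?cRe_conj ?cIm_conj /=.
  by apply: eq_Rintegral => x _; rewrite e cRe_conj.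
rewrite -[RHS]mulN1r; have := @RintegralZl _ _ R mu _ _ (-1) (@measurable_torus R) i2 => /= <-.
by apply: eq_Rintegral => x _; rewrite e cIm_conj mulN1r.
Qed.

Lemma fourier_sum (I : eqType) (s : seq I) (P : pred I) (F : I -> R -> R[i]) n :
  (forall i, L2 (F i)) ->
  fourier (fun x => \sum_(i <- s | P i) F i x) n = \sum_(i <- s | P i) fourier (F i) n.
Proof.
move=> LF; elim: s => [|i s IH].
  rewrite big_nil fourierE (@eq_cintegral _ _ _ (fun=> 0)) ?cintegral_zero ?mulr0// => x _.
  by rewrite big_nil mul0r.
have LS : L2 (fun x => \sum_(i <- s | P i) F i x).
  elim: s {IH} => [|j s IH].
    by under eq_fun do rewrite big_nil; apply: L2_cont; exact: ccontinuous_cst.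
  have [Pj|Pj] := boolP (P j).
    by under eq_fun do rewrite big_cons Pj; exact: L2D.
  by under eq_fun do rewrite big_cons (negbTE Pj).
have [Pi|Pi] := boolP (P i).
  rewrite big_cons Pi -IH -fourierD//.
  by congr (fourier _ n); apply/funext => x; rewrite big_cons Pi.
rewrite big_cons (negbTE Pi) -IH.
by congr (fourier _ n); apply/funext => x; rewrite big_cons (negbTE Pi).
Qed.

Lemma cubicE f x : cubic f x = f x * conjc (f x) * f x.
Proof. by rewrite /cubic mul_conjc. Qed.

Lemma fourier_cubic_trig N c n : fourier (cubic (trig (zbox N) c)) n = csum N c n.
Proof.
set p := trig (zbox N) c; have Lp : L2 p by exact: L2_trig.
have cp : ccontinuous p by exact: ccontinuous_trig.
have -> : cubic p = fun x => \sum_(k <- zbox N) \sum_(l <- zbox N)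
    (c k * c l) * (expi (k + l) x * conjc (p x)).
  apply/funext => x; rewrite cubicE mulrAC /p {1 2}/trig !mulr_suml.
  apply: eq_bigr => k _; rewrite !mulr_sumr mulr_suml; apply: eq_bigr => l _.
  by rewrite expiD; ring.
have Lkl k l : L2 (fun x => expi (k + l) x * conjc (p x)).
  by apply: L2_cont; apply: ccontinuousM; [exact: ccontinuous_expi|exact: ccontinuous_conj].
have Lk k l : L2 (fun x => (c k * c l) * (expi (k + l) x * conjc (p x))) by exact: L2Z.
rewrite fourier_sum; last first.
  move=> k; apply: L2_cont; apply: ccontinuous_sum => l; apply: ccontinuousM.
    exact: ccontinuous_cst.
  by apply: ccontinuousM; [exact: ccontinuous_expi|exact: ccontinuous_conj].
apply: eq_bigr => k _; rewrite fourier_sum// [RHS]big_mkcond/=; apply: eq_bigr => l _.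
rewrite fourierZ// fourier_expiM fourier_conj// opprB fourier_trig ?uniq_zbox//.
by case: ifP => _; rewrite ?conjc0 ?mulr0//; ring.
Qed.

Definition nrm4 f : R := \int[mu]_(x in torus) normc (f x) ^+ 4.

Lemma normc_cubic f x : normc (cubic f x) = normc (f x) ^+ 3.
Proof.
by rewrite /cubic ComplexField.Normc.normcM normc_real ger0_norm ?sqr_ge0// -exprSr.
Qed.

(** The integral of |p|^4 is the inner product of |p|^2 p with p, hence a sum of products of
    coefficients, which those of a majorize. *)
Lemma nrm4_trig N c (a A3 : int -> R) K : (forall m, normc (c m) <= a m) ->
  (forall n, asum N a n <= A3 n) -> sumle (fun n => a n * A3 n) K ->
  nrm4 (trig (zbox N) c) <= 2 * pi * K.
Proof.
move=> ca aA hK; set p := trig (zbox N) c.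
have a0 m : 0 <= a m by apply: le_trans (normc_ge0 _) (ca m).
have cp : ccontinuous p by exact: ccontinuous_trig.
have Lc : L2 (cubic p).
  apply: L2_cont; have : ccontinuous (fun x => p x * conjc (p x) * p x).
    by apply: ccontinuousM => //; apply: ccontinuousM => //; exact: ccontinuous_conj.
  by congr ccontinuous; apply/funext => x; rewrite cubicE.
have -> : nrm4 p = Re (ip (cubic p) p).
  apply: eq_Rintegral => x _; rewrite /cubic -mulrA mul_conjc -rmorphM /=.
  by rewrite -exprD.
rewrite (ip_trig _ _ Lc) cReM /= mul0r subr0 ler_pM2l ?twopi_gt0// cRe_sum.
apply: le_trans (hK _ (uniq_zbox N)); apply: ler_sum => n _.
apply: le_trans (ler_norm _) _; apply: le_trans (normc_Re _) _.
rewrite ComplexField.Normc.normcM normc_conj fourier_cubic_trig.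
rewrite ler_pM ?normc_ge0//; exact: le_trans (normc_csum N n ca) (aA n).
Qed.

Lemma integrable_cont_normc f k : ccontinuous f ->
  mu.-integrable torus (EFin \o (fun x => normc (f x) ^+ k)).
Proof.
move=> cf; have [c1 c2] := cf.
have bd (p : R -> R) : continuous p -> exists B : R, forall x, torus x -> `|p x| <= B.
  move=> cp; have cn : {within `[0, 2 * pi], continuous (fun x : R => `|p x : R|)}.
    by apply: continuous_subspaceT => x; apply: cvg_norm; exact: cp.
  have [c _ hc] := EVT_max (ltW (twopi_gt0 R)) cn.
  by exists `|p c|.
have [M1 h1] := bd _ c1; have [M2 h2] := bd _ c2.
have mf : measurable_fun torus (fun x => normc (f x) ^+ k).
  by apply: measurable_funX; apply: cmeas_normc; exact: ccontinuous_meas.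
apply: (@integrable_bdd R torus _ ((M1 + M2) ^+ k) (@measurable_torus R) (@torus_fin R) mf).
move=> x Tx; rewrite normrX ger0_norm ?normc_ge0// lerXn2r ?nnegrE ?normc_ge0//.
  by rewrite addr_ge0// (le_trans (normr_ge0 _) (h1 _ Tx), le_trans (normr_ge0 _) (h2 _ Tx)).
by apply: le_trans (normc_ReIm _) _; rewrite lerD ?h1 ?h2.
Qed.

Section L4.
Variables (f : R -> R[i]) (K : R).
Hypotheses (Lf : L2 f) (K0 : 0 <= K) (fK : forall N, nrm4 (fsum f N) <= K).

Lemma cont N : ccontinuous (fsum f N).
Proof. exact: ccontinuous_trig. Qed.

Let trunc (B : R) (z : R[i]) : R := Num.min (normc z) B.

Lemma mf : measurable_fun torus (fun x => normc (f x)).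
Proof. by have [] := Lf => /cmeas_normc. Qed.

Lemma trunc_integrable (B : R) : 0 <= B ->
  mu.-integrable torus (EFin \o (fun x => trunc B (f x) ^+ 4)).
Proof.
move=> B0; have mt : measurable_fun torus (fun x => trunc B (f x) ^+ 4).
  apply: measurable_funX; apply: measurable_minr => //; exact: mf.
apply: (@integrable_bdd R torus _ (B ^+ 4) (@measurable_torus R) (@torus_fin R) mt).
have t0 x : 0 <= trunc B (f x) by rewrite le_min normc_ge0.
by move=> x _; rewrite normrX ger0_norm// lerXn2r ?nnegrE// ge_min lexx orbT.
Qed.

(* min(|f|, B)^4 is a Lipschitz function of f, so its integral passes to the L^2 limit. *)
Lemma trunc_le (B : R) : 0 <= B -> \int[mu]_(x in torus) trunc B (f x) ^+ 4 <= K.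
Proof.
move=> B0; apply/ler_addgt0Pr => e e0; have tp := twopi_gt0 R.
pose C := 4 * B ^+ 3; have C0 : 0 <= C by rewrite mulr_ge0// exprn_ge0.
pose l := e / (2 * (C + 1) * (2 * pi)).
have C1 : 0 < C + 1 by rewrite ltr_wpDl.
have C2 : 0 < 2 * (C + 1) by rewrite mulr_gt0.
have l0 : 0 < l by rewrite divr_gt0// mulr_gt0.
have d0 : 0 < e * l / (2 * (C + 1)) by apply: divr_gt0 => //; exact: mulr_gt0.
have /cvgr0Pnorm_le/(_ _ d0)[N _ /(_ N (leqnn N))] := L2cvg_L2 Lf.
rewrite /= (ger0_norm (nrm2_ge0 _)); set d := nrm2 _ => hd.
have pw x : trunc B (f x) ^+ 4 <=
    normc (fsum f N x) ^+ 4 + C * (l * 1 + l^-1 * normc (f x - fsum f N x) ^+ 2).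
  have tri : normc (f x) <= normc (fsum f N x) + normc (f x - fsum f N x).
    by rewrite -[f x in leLHS](subrK (fsum f N x)) addrC; exact: normcD.
  move: (normc_ge0 (f x)) (normc_ge0 (fsum f N x)) (normc_ge0 (f x - fsum f N x)) tri.
  rewrite /trunc; set u := normc (f x); set v := normc (fsum f N x); set w := normc _.
  move=> u0 v0 w0 uvw.
  have ww : w <= l * 1 + l^-1 * w ^+ 2.
    rewrite -(ler_pM2l l0) mulrDr [l * (l^-1 * _)]mulrA mulfV ?gt_eqF// mul1r mulr1.
    by have := sqr_ge0 (l - w); nra.
  set m := Num.min u B; have m0 : 0 <= m by rewrite le_min u0.
  have mB : m <= B by rewrite ge_min lexx orbT.
  have mvw : m <= v + w by rewrite ge_min uvw.
  apply: (@le_trans _ _ (v ^+ 4 + C * w)); last by rewrite lerD2l ler_wpM2l.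
  have [mv|vm] := leP m v.
    by apply: (@le_trans _ _ (v ^+ 4)); [rewrite lerXn2r ?nnegrE|rewrite lerDl mulr_ge0].
  have : m ^+ 4 - v ^+ 4 <= C * (m - v).
    have -> : m ^+ 4 - v ^+ 4 = (m ^+ 3 + m ^+ 2 * v + m * v ^+ 2 + v ^+ 3) * (m - v) by ring.
    rewrite ler_wpM2r ?subr_ge0 ?(ltW vm)//.
    have vB : v <= B by apply: le_trans mB; exact: ltW.
    have B3 (i j : nat) (a b : R) : 0 <= a <= B -> 0 <= b <= B -> (i + j = 3)%N -> a ^+ i * b ^+ j <= B ^+ 3.
      move=> /andP[a0 aB] /andP[b0 bB] <-; rewrite exprD.
      by apply: ler_pM; rewrite ?exprn_ge0// lerXn2r ?nnegrE.
    have mI : 0 <= m <= B by rewrite m0.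
    have vI : 0 <= v <= B by rewrite v0.
    have := B3 3 0 m v mI vI erefl; have := B3 2 1 m v mI vI erefl.
    have := B3 1 2 m v mI vI erefl; have := B3 0 3 m v mI vI erefl.
    by rewrite /C !expr0 !expr1 mul1r mulr1; lra.
  by have : C * (m - v) <= C * w by [rewrite ler_wpM2l//; lra]; lra.
have i4 : mu.-integrable torus (EFin \o (fun x => normc (fsum f N x) ^+ 4)).
  by apply: integrable_cont_normc; exact: cont.
have [_ i2] := L2B Lf (L2_fsum f N).
have i1 : mu.-integrable torus (EFin \o (fun=> 1 : R)).
  apply: (@integrable_bdd R torus _ 1 (@measurable_torus R) (@torus_fin R)) => //.
  by move=> x _; rewrite normr1.
have i12 := integrable_lin l (l^-1) (@measurable_torus R) i1 i2.
have i := integrable_lin 1 C (@measurable_torus R) i4 i12.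
apply: (@le_trans _ _ (\int[mu]_(x in torus) (1 * normc (fsum f N x) ^+ 4 +
    C * (l * 1 + l^-1 * normc (f x - fsum f N x) ^+ 2)))).
  apply: (@le_Rintegral _ _ R mu torus _ _ (@measurable_torus R) (trunc_integrable B0) i).
  by move=> x _; rewrite mul1r.
rewrite (Rintegral_lin 1 C (@measurable_torus R) i4 i12) (Rintegral_lin l (l^-1) (@measurable_torus R) i1 i2).
rewrite -/(nrm4 _) -/(nrm2 _) -/d mul1r Rintegral_cst ?mul1r ?mu_torus; last exact: measurable_torus.
rewrite lerD ?fK//.
have h1 : l * (2 * pi) = e / (2 * (C + 1)) by rewrite /l invfM [e * _]mulrA divfK// gt_eqF.
have h2 : l^-1 * d <= e / (2 * (C + 1)).
  by rewrite ler_pdivrMl// mulrA [l * e]mulrC.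
rewrite h1; apply: (@le_trans _ _ (C * (e / (2 * (C + 1)) + e / (2 * (C + 1))))).
  by rewrite ler_wpM2l// lerD2l.
have -> : C * (e / (2 * (C + 1)) + e / (2 * (C + 1))) = e * (C / (C + 1)).
  by field; rewrite gt_eqF.
by rewrite ler_piMr ?(ltW e0)// ler_pdivrMr ?ltr_wpDl// mul1r lerDl.
Qed.

(** The bounds for the truncations are uniform in the level, and Fatou's lemma removes it. This
    avoids extracting from the partial sums a subsequence that converges almost everywhere. *)
Lemma L4_fatou : mu.-integrable torus (EFin \o (fun x => normc (f x) ^+ 4)) /\ nrm4 f <= K.
Proof.
have mf4 : measurable_fun torus (fun x => normc (f x) ^+ 4) by apply: measurable_funX; exact: mf.
have mF k : measurable_fun torus (fun x => (trunc k%:R (f x) ^+ 4)%:E).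
  have k0 : 0 <= k%:R :> R by [].
  by have /integrableP[] := trunc_integrable k0.
have F0 (k : nat) x : torus x -> (0 <= (trunc k%:R (f x) ^+ 4)%:E)%E.
  by move=> _; rewrite lee_fin exprn_even_ge0.
have := @fatou _ _ R mu torus (@measurable_torus R) _ mF F0.
rewrite (@eq_integral _ _ _ mu _ (fun x => (normc (f x) ^+ 4)%:E)); last first.
  move=> x _; apply/esym.
  suff /cvg_limn_einf_sup[-> _] : (trunc k%:R (f x) ^+ 4)%:E @[k --> \oo] --> (normc (f x) ^+ 4)%:E by [].
  apply: cvg_near_cst; exists (Num.truncn (normc (f x))).+1 => // k /= kN.
  rewrite /trunc (min_idPl _)//; apply: le_trans (_ : (Num.truncn (normc (f x))).+1%:R <= _).
    exact/ltW/truncnS_gt.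
  by rewrite ler_nat.
move=> h; have {h} le : (\int[mu]_(x in torus) (normc (f x) ^+ 4)%:E <= K%:E)%E.
  apply: le_trans h _; rewrite limn_einf_lim; apply: lime_le; first exact: is_cvg_einfs.
  near=> M; apply: (@le_trans _ _ (\int[mu]_(x in torus) (trunc M%:R (f x) ^+ 4)%:E)%E).
    by apply: ereal_inf_lbound; exists M => //=.
  have M0 : 0 <= M%:R :> R by [].
  have fi := @integrable_fin_num _ _ R mu torus (@measurable_torus R) _ (trunc_integrable M0).
  by rewrite -(fineK fi) lee_fin; exact: trunc_le.
have i4 : mu.-integrable torus (EFin \o (fun x => normc (f x) ^+ 4)).
  apply/integrableP; split; first exact/measurable_EFinP.
  apply: le_lt_trans (ltry K); apply: le_trans le; apply: le_of_eq.
  by apply: eq_integral => x _ /=; rewrite ger0_norm// exprn_even_ge0.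
split => //; rewrite -lee_fin; apply: le_trans le; apply: le_of_eq.
rewrite /nrm4 /Rintegral fineK//; exact: (@integrable_fin_num _ _ R mu torus (@measurable_torus R) _ i4).
Unshelve. all: by end_near. Qed.

Lemma mul_young (x y l : R) : 0 < l -> x * y <= l^-1 * x ^+ 2 + l * y ^+ 2.
Proof.
move=> l0; rewrite -(ler_pM2l l0) mulrDr mulVKf ?gt_eqF//.
by have := sqr_ge0 (x - l * y); have := sqr_ge0 x; have := sqr_ge0 (l * y); nra.
Qed.

(** The left-hand side is at most 2 |z - w| (|z|^2 + |w|^2), split by Young's inequality. Integrated
    over the torus, the first part is small by L^2 convergence, the second by the choice of l and
    the L^4 bounds. *)
Lemma cubic_lip (z w : R[i]) (l : R) : 0 < l ->
  normc ((normc z ^+ 2)%:C * z - (normc w ^+ 2)%:C * w) <=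
  2 * l^-1 * normc (z - w) ^+ 2 + 4 * l * (1 * normc z ^+ 4 + 1 * normc w ^+ 4).
Proof.
move=> l0; set u := normc z; set v := normc w; set d := normc (z - w).
have u0 : 0 <= u by exact: normc_ge0.
have v0 : 0 <= v by exact: normc_ge0.
have d0 : 0 <= d by exact: normc_ge0.
have e : (u ^+ 2)%:C * z - (v ^+ 2)%:C * w = (u ^+ 2)%:C * (z - w) + ((u ^+ 2) - (v ^+ 2))%:C * w.
  by rewrite rmorphB/=; ring.
have uv : `|u - v| <= d.
  have h1 : u <= d + v by rewrite /u -{1}(subrK w z); exact: normcD.
  have h2 : v <= d + u by rewrite /v -{1}(subrK z w) /d normcBC; exact: normcD.
  by rewrite ler_norml; lra.
have b1 : normc ((u ^+ 2)%:C * z - (v ^+ 2)%:C * w) <= 2 * d * (u ^+ 2 + v ^+ 2).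
  rewrite e; apply: le_trans (normcD _ _) _.
  rewrite !ComplexField.Normc.normcM !normc_real -/d -/v ger0_norm ?sqr_ge0//.
  rewrite subr_sqr normrM (ger0_norm (addr_ge0 u0 v0)).
  have h : `|u - v| * (u + v) * v <= d * ((u + v) * v).
    by rewrite -mulrA ler_wpM2r// mulr_ge0// addr_ge0.
  apply: le_trans (lerD (lexx _) h) _.
  have h2 : (u + v) * v <= u ^+ 2 + 2 * v ^+ 2 by have := sqr_ge0 (u - v); nra.
  have := ler_wpM2l d0 h2; nra.
apply: le_trans b1 _; set s := u ^+ 2 + v ^+ 2.
have s2 : s ^+ 2 <= 2 * (u ^+ 4 + v ^+ 4).
  have := sqr_ge0 (u ^+ 2 - v ^+ 2); rewrite /s -![_ ^+ 4]/(_ ^+ (2 * 2)) !exprM; nra.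
have := mul_young d s l0.
have := ler_wpM2l (ltW l0) s2; rewrite !mul1r; set q := l^-1; nra.
Qed.

Lemma fourier_cubic_cvg n :
  normc (fourier (cubic f) n - csum N (fourier f) n) @[N --> \oo] --> 0.
Proof.
have [i4 f4] := L4_fatou; have tp := twopi_gt0 R; have mT := @measurable_torus R.
have [mcf _] := Lf.
have cubic_ci (h : R -> R[i]) : cmeas torus h ->
    mu.-integrable torus (EFin \o (fun x => normc (h x) ^+ 4)) ->
    cintegrable torus (fun x => cubic h x * expi (- n) x).
  move=> mh ih.
  have i1 : mu.-integrable torus (EFin \o (fun=> 1 : R)).
    apply: (@integrable_bdd R torus _ 1 mT (@torus_fin R)) => //.
    by move=> x _; rewrite normr1.
  apply: (cintegrable_le mT _ (integrable_lin 1 1 mT i1 ih)).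
    apply: cmeasM; last exact/ccontinuous_meas/ccontinuous_expi.
    by apply: cmeasM => //; apply: cmeas_real; exact: cmeas_normc2.
  move=> x _; rewrite ComplexField.Normc.normcM normc_expi mulr1 normc_cubic !mul1r.
  have := normc_ge0 (h x); set u := normc _ => u0.
  rewrite -[u ^+ 4]/(u ^+ (1 + 3)) exprD; have := exprn_ge0 3 u0; rewrite expr1.
  have [u1|u1] := leP 1 u; first by nra.
  have : u ^+ 3 <= 1 by rewrite exprn_ile1// ltW.
  by nra.
have key N (l : R) : 0 < l -> normc (fourier (cubic f) n - csum N (fourier f) n) <=
    (2 * pi)^-1 * (2 * (2 * l^-1 * nrm2 (fun x => f x - fsum f N x) + 8 * l * K)).
  move=> l0; set p := fsum f N.
  have ip4 : mu.-integrable torus (EFin \o (fun x => normc (p x) ^+ 4)).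
    by apply: integrable_cont_normc; exact: cont.
  have mp : cmeas torus p by apply: ccontinuous_meas; exact: cont.
  rewrite -fourier_cubic_trig -/(fsum f N) -/p !fourierE -mulrBr ComplexField.Normc.normcM.
  rewrite normc_real ger0_norm ?invr_ge0 ?(ltW tp)// ler_pM2l ?invr_gt0//.
  have c1 := cubic_ci f mcf i4; have c2 := cubic_ci p mp ip4.
  have c2' := cintegrableZ (-1) mT c2.
  have -> : cintegral torus (fun x => cubic f x * expi (- n) x) -
      cintegral torus (fun x => cubic p x * expi (- n) x) =
      cintegral torus (fun x => cubic f x * expi (- n) x + -1 * (cubic p x * expi (- n) x)).
    by rewrite cintegralD// cintegralZ// mulN1r.
  have c12 := cintegrableD mT c1 c2'.
  have [_ i2] := L2B Lf (L2_fsum f N).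
  have i44 := integrable_lin 1 1 mT i4 ip4.
  have ih := integrable_lin (2 * l^-1) (4 * l) mT i2 i44.
  apply: le_trans (normc_cintegral mT c12 ih _) _.
    move=> x _; rewrite mulN1r -mulNr -mulrDl ComplexField.Normc.normcM normc_expi mulr1.
    exact: cubic_lip.
  rewrite (Rintegral_lin _ _ mT i2 i44) (Rintegral_lin 1 1 mT i4 ip4) ler_pM2l// lerD2l.
  rewrite -/(nrm4 f) -/(nrm4 p) !mul1r.
  by have := fK N; have : 0 < 4 * l by [rewrite mulr_gt0]; have := f4; rewrite -/p; nra.
apply/cvgr0Pnorm_le => e e0.
pose l := e * (2 * pi) / (32 * (K + 1)).
have K1 : 0 < K + 1 by rewrite ltr_wpDl.
have ep : 0 < e * (2 * pi) by exact: mulr_gt0.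
have l0 : 0 < l by apply: divr_gt0 => //; apply: mulr_gt0.
have d0 : 0 < e * (2 * pi) * l / 8 by apply: divr_gt0 => //; exact: mulr_gt0.
have := L2cvg_L2 Lf; move=> /cvgr0Pnorm_le/(_ _ d0); apply: filterS => N.
rewrite (ger0_norm (nrm2_ge0 _)) => hN; rewrite (ger0_norm (normc_ge0 _)).
apply: le_trans (key N l l0) _; rewrite ler_pdivrMl//.
have h1 : l^-1 * nrm2 (fun x => f x - fsum f N x) <= 2 * pi * e / 8.
  by rewrite ler_pdivrMl//; apply: le_trans hN _; apply: le_of_eq; ring.
have h2 : l * K <= 2 * pi * e / 32.
  have -> : l * K = 2 * pi * e / 32 * (K / (K + 1)).
    by rewrite /l; field; rewrite gt_eqF.
  rewrite ler_piMr//; first by rewrite divr_ge0// mulr_ge0 ?ltW.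
  by rewrite ler_pdivrMr ?ltr_wpDl// mul1r lerDl.
rewrite -[2 * l^-1 * _]mulrA -[8 * l * _]mulrA; move: h1 h2.
by set q1 := l^-1 * _; set q2 := l * K; lra.
Qed.

End L4.

Lemma cubic_coef_cvg f (a A3 : int -> R) K n : L2 f ->
  (forall m, normc (fourier f m) <= a m) ->
  (forall N m, asum N a m <= A3 m) -> sumle (fun m => a m * A3 m) K ->
  normc (fourier (cubic f) n - csum N (fourier f) n) @[N --> \oo] --> 0.
Proof.
move=> Lf fa aA hK; apply: (@fourier_cubic_cvg f (2 * pi * K)) => //.
  by rewrite mulr_ge0 ?(sumle_ge0 hK)// ltW// twopi_gt0.
by move=> N; apply: nrm4_trig fa (aA N) hK.
Qed.

End CubicCoefficients.

(** * The resonance function and weighted sums *)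

Section PhaseBound.
Variable R : realType.
Implicit Types (x y th mu al h k n : R).

(** Weighted means: ln y <= y - 1 at y = r/u and y = 1/u, with weights th and 1 - th for which the
    right-hand sides cancel. *)
Lemma powR_bernoulli th r : 0 <= th <= 1 -> 0 <= r -> r `^ th <= 1 + th * (r - 1).
Proof.
move=> /andP[t0 t1]; rewrite le_eqVlt => /predU1P[<-|r0].
  have [->|tn0] := eqVneq th 0; first by rewrite powRr0 mul0r addr0.
  by rewrite powR0//; lra.
set u := 1 + th * (r - 1); have u0 : 0 < u by rewrite /u; nra.
have lnle (y : R) : 0 < y -> ln y <= y - 1.
  move=> y0; have := @le_ln1Dx R (y - 1); rewrite [1 + _]addrC subrK; apply; lra.
rewrite -ler_ln ?posrE ?powR_gt0// ln_powR.
have iu : 0 < u^-1 by rewrite invr_gt0.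
have h1 := lnle (r / u) (divr_gt0 r0 u0); have h2 := lnle _ iu.
rewrite ln_div ?posrE// in h1; rewrite lnV ?posrE// in h2.
have e : th * (r / u - 1) + (1 - th) * (u^-1 - 1) = 0.
  apply: (mulIf (lt0r_neq0 u0)); rewrite mul0r mulrDl -!mulrA !mulrBl mul1r divfK ?gt_eqF//.
  by rewrite mulVf ?gt_eqF// /u; ring.
have := ler_wpM2l t0 h1; have t10 : 0 <= 1 - th by lra.
by have := ler_wpM2l t10 h2; move: e; lra.
Qed.

(** The odd power; al times [sgpow (al - 1)] is the derivative of |x|^al. *)
Definition sgpow th x : R := Num.sg x * `|x| `^ th.

Lemma sgpowN th x : sgpow th (- x) = - sgpow th x.
Proof. by rewrite /sgpow sgrN normrN mulNr. Qed.

Lemma sgpow_pos th x : 0 < x -> sgpow th x = x `^ th.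
Proof. by move=> x0; rewrite /sgpow gtr0_sg// mul1r gtr0_norm. Qed.

(** On the positive axis concavity, in the form of Bernoulli's inequality, bounds the increment
    below by the slope at the right end. Oddness covers the negative axis, and across 0 the two
    halves are added. *)
Lemma sgpow_mono th mu x y : 0 < th < 1 -> `|x| <= mu -> `|y| <= mu -> x <= y ->
  th * mu `^ (th - 1) * (y - x) <= sgpow th y - sgpow th x.
Proof.
move=> /andP[t0 t1].
have key a b : 0 < b -> 0 <= a <= b -> b <= mu ->
    th * mu `^ (th - 1) * (b - a) <= b `^ th - a `^ th.
  move=> b0 /andP[a0 ab] bm.
  have t01 : 0 <= th <= 1 by rewrite !ltW.
  have := powR_bernoulli t01 (divr_ge0 a0 (ltW b0)).
  rewrite powRM ?invr_ge0 ?(ltW b0)// => hb.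
  have bth := powR_gt0 th b0.
  have ei : b^-1 `^ th * b `^ th = 1.
    by rewrite -powRM ?invr_ge0 ?(ltW b0)// mulVf ?gt_eqF// powR1.
  have := ler_wpM2r (ltW bth) hb; rewrite -[X in X <= _]mulrA ei mulr1 => hb2.
  have e2 : b `^ th = b * b `^ (th - 1).
    by rewrite -{2}(powRr1 (ltW b0)) -powRDp// addrC subrK.
  have m : mu `^ (th - 1) <= b `^ (th - 1) by apply: powR_opp_mono => //; lra.
  have m2 : th * mu `^ (th - 1) * (b - a) <= th * b `^ (th - 1) * (b - a).
    by rewrite ler_wpM2r ?subr_ge0// ler_wpM2l// ltW.
  apply: le_trans m2 _; rewrite lerBrDr -lerBrDl; apply: le_trans hb2 _.
  rewrite e2; apply: le_of_eq; field; exact: lt0r_neq0.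
have pos a b : 0 <= a <= b -> b <= mu ->
    th * mu `^ (th - 1) * (b - a) <= sgpow th b - sgpow th a.
  move=> /andP[a0 ab] bm; have [b0|b0] := ltP 0 b; last first.
    have -> : b = a by lra.
    by rewrite !subrr mulr0.
  rewrite (sgpow_pos _ b0); move: a0; rewrite le_eqVlt => /predU1P[a0|a0].
    rewrite -a0 /sgpow sgr0 mul0r; have := key 0 b b0.
    by rewrite powR0 ?gt_eqF//; apply=> //; rewrite lexx ltW.
  by rewrite (sgpow_pos _ a0) key// ab ltW.
move=> xm ym xy; have [x0|x0] := leP 0 x.
  by apply: pos; rewrite ?x0//; apply: le_trans ym; exact: ler_norm.
have [y0|y0] := leP y 0.
  have := pos (- y) (- x); rewrite !sgpowN !opprK [- x + y]addrC [- _ + sgpow th y]addrC.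
  apply; first by rewrite oppr_ge0 y0 lerN2.
  by apply: le_trans xm; rewrite ler0_norm// ltW.
have half a : 0 < a -> a <= mu -> th * mu `^ (th - 1) * a <= sgpow th a.
  move=> a0 am; have := pos 0 a; rewrite subr0 /sgpow sgr0 mul0r subr0.
  by apply=> //; rewrite lexx ltW.
have h1 := half y y0 (le_trans (ler_norm _) ym).
have nx0 : 0 < - x by rewrite oppr_gt0.
have h2 := half (- x) nx0 (le_trans (ler_norm (- x)) (eq_ind_r (fun z => z <= mu) xm (normrN x))).
by move: h1 h2; rewrite sgpowN; lra.
Qed.

Lemma is_derive_abspow al x : 1 < al ->
  is_derive x 1 (fun y : R => `|y| `^ al) (al * sgpow (al - 1) x).
Proof.
move=> al1; have [x0|x0|<-] := ltgtP 0 x.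
- rewrite sgpow_pos//; apply: near_eq_is_derive (is_derive_powR al x0).
  near=> y; rewrite ger0_norm//; apply: ltW; near: y; exact: lt_nbhsr.
- rewrite -[x in sgpow _ x]opprK sgpowN sgpow_pos ?oppr_gt0// mulrN.
  have nx0 : 0 < - x by rewrite oppr_gt0.
  have d1 := is_derive_powR al nx0.
  have d2 : is_derive x 1 (-%R : R -> R) (-1) by apply: is_deriveN.
  have := is_derive1_comp d1 d2; rewrite mulrN1.
  apply: near_eq_is_derive.
  near=> y; rewrite /= ltr0_norm//; near: y; exact: lt_nbhsl.
- rewrite /sgpow sgr0 mul0r mulr0.
  have cv : (fun h : R => h^-1 * `|h| `^ al) @ 0^' --> (0 : R).
    apply/cvgr0Pnorm_le => e e0; have a10 : 0 < al - 1 by lra.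
    near=> h; have hn0 : h != 0 by near: h; exact: nbhs_dnbhs_neq.
    have h0 : 0 < `|h| by rewrite normr_gt0.
    have e1 : `|h| `^ al = `|h| * `|h| `^ (al - 1).
      by rewrite -{2}(powRr1 (ltW h0)) -powRDp// addrC subrK.
    rewrite normrM normfV e1 (ger0_norm (mulr_ge0 (ltW h0) (powR_ge0 _ _))) mulKf ?gt_eqF//.
    have -> : e = (e `^ (al - 1)^-1) `^ (al - 1).
      by rewrite -powRrM mulVf ?gt_eqF// powRr1// ltW.
    rewrite ge0_ler_powR ?nnegrE ?powR_ge0// ltW//.
    near: h; apply: dnbhs0_lt; exact: powR_gt0.
  have E : (fun h : R => h^-1 *: (((fun y : R => `|y| `^ al) \o shift 0) (h *: (1 : R)) -
      `|0 : R| `^ al)) = (fun h => h^-1 * `|h| `^ al).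
    apply/funext => h; rewrite /= /shift /= addr0 [h *: 1]mulr1 normr0 powR0 ?subr0//.
    by rewrite gt_eqF//; lra.
  by apply: DeriveDef; rewrite /derivable /derive E; [apply/cvg_ex; exists 0|exact: cvg_lim].
Unshelve. all: by end_near. Qed.

(* The second difference is k times a difference of derivatives (mean value theorem), and
   the derivative of |x|^al is strongly increasing on [-mu, mu]. *)
Lemma phase_lower al mu n h k : 1 < al < 2 -> `|n| <= mu -> `|n + h| <= mu ->
  `|n + k| <= mu -> `|n + h + k| <= mu ->
  al * (al - 1) * mu `^ (al - 2) * (`|h| * `|k|) <=
  `| `|n + h| `^ al - `|n + h + k| `^ al + `|n + k| `^ al - `|n| `^ al |.
Proof.
move=> /andP[al1 al2].
(* Passing from (n, k) to (n + k, - k) permutes the four points and only changes the sign of the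
   expression; the same holds for h. *)
wlog k0 : n k / 0 < k => [H|].
  have [|k0|<-] := ltgtP 0 k; first exact: H.
    move=> mn mh mk mhk; have := H (n + k) (- k); rewrite oppr_gt0 k0 normrN.
    have -> : n + k + h + - k = n + h by ring.
    have -> : n + k + h = n + h + k by ring.
    have -> : n + k - k = n by ring.
    move=> /(_ isT mk mhk mn mh) /le_trans; apply; apply: le_of_eq.
    by rewrite -normrN; congr `|_|; ring.
  by rewrite normr0 !mulr0.
wlog h0 : n h / 0 < h => [H|].
  have [|h0|<-] := ltgtP 0 h; first exact: H.
    move=> mn mh mk mhk; have := H (n + h) (- h); rewrite oppr_gt0 h0 normrN.
    have -> : n + h + - h + k = n + k by ring.
    have -> : n + h - h = n by ring.
    move=> /(_ isT mh mn mhk mk) /le_trans; apply; apply: le_of_eq.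
    by rewrite -normrN; congr `|_|; ring.
  by rewrite normr0 mul0r !mulr0.
move=> mn mh mk mhk.
pose D x : R := `|x + h| `^ al - `|x| `^ al.
pose dD x : R := al * sgpow (al - 1) (x + h) - al * sgpow (al - 1) x.
have dDP x : is_derive x 1 D (dD x).
  have d1 := is_derive_abspow (x + h) al1; have d2 := is_derive_abspow x al1.
  have d3 : is_derive x 1 (fun y : R => y + h) 1.
    by rewrite -[X in is_derive _ _ _ X]addr0; apply: is_deriveD.
  have := @is_derive1_comp R (fun y => `|y| `^ al) (fun y => y + h) x _ _ d1 d3; rewrite mulr1 => d4.
  exact: is_deriveB d4 d2.
have nk : n < n + k by lra.
have cD : {within `[n, n + k], continuous D}.
  apply: continuous_subspaceT => x; apply: differentiable_continuous.
  by apply/derivable1_diffP; have := dDP x; case.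
have [c cI e] := MVT nk (fun x _ => dDP x) cD.
have -> : `|n + h| `^ al - `|n + h + k| `^ al + `|n + k| `^ al - `|n| `^ al =
    - (D (n + k) - D n) by rewrite /D -!addrA [k + h]addrC; ring.
move: cI; rewrite in_itv /= => /andP[c1 c2].
rewrite normrN e [n + k]addrC addrK.
have mc : `|c| <= mu by move: mn mk; rewrite !ler_norml; lra.
have mch : `|c + h| <= mu by move: mh mhk; rewrite !ler_norml; lra.
have th01 : 0 < al - 1 < 1 by lra.
have cch : c <= c + h by lra.
have := sgpow_mono th01 mc mch cch; rewrite [c + h]addrC addrK -addrA -opprD => hm.
have {}hm : al * ((al - 1) * mu `^ (al - 2) * h) <= dD c.
  by rewrite /dD -mulrBr ler_wpM2l//; [lra|rewrite [c + h]addrC].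
rewrite normrM (gtr0_norm k0) (gtr0_norm h0); apply: le_trans (ler_wpM2r (ltW k0) (ler_norm (dD c))).
by have := ler_wpM2r (ltW k0) hm; rewrite !mulrA.
Qed.

End PhaseBound.

(** * The weight inequality behind the smoothing *)

Section Weights.
Variable R : realType.
Implicit Types (x y n h k eps kap kp al : R) (m p q : int).

Lemma powRX (x s : R) j : (x `^ s) ^+ j = x `^ (s * j%:R).
Proof. by rewrite -powR_mulrn ?powR_ge0// -powRrM. Qed.

Definition wt (m : int) : R := 1 + `|m%:~R|.

Lemma wt_ge1 m : 1 <= wt m.
Proof. by rewrite /wt lerDl. Qed.

Lemma wt_gt0 m : 0 < wt m.
Proof. exact: lt_le_trans (wt_ge1 m). Qed.

Lemma wtN m : wt (- m) = wt m.
Proof. by rewrite /wt mulrNz normrN. Qed.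

Lemma wtD p q : wt (p + q) <= wt p + wt q.
Proof. by rewrite /wt mulrzDr; have := ler_normD (p%:~R : R) q%:~R; lra. Qed.

Lemma wt_jap2 m : jap2 (m%:~R : R) <= wt m ^+ 2 <= 2 * jap2 (m%:~R : R).
Proof.
rewrite /wt /jap2 -(real_normK (num_real m%:~R)); set x := `|_|.
have x0 : 0 <= x by exact: normr_ge0.
have := sqr_ge0 (1 - x); rewrite !expr2; nra.
Qed.

Definition W x : R := 1 + `|x|.

Lemma W_ge1 x : 1 <= W x. Proof. by rewrite /W lerDl. Qed.

Lemma mulr3_ge0 x y z : 0 <= x -> 0 <= y -> 0 <= z -> 0 <= x * y * z.
Proof. by move=> x0 y0 z0; rewrite !mulr_ge0. Qed.

Lemma le_add2_mul x y z : 1 <= x -> 1 <= y -> 1 <= z -> x + y <= 2 * (x * y * z).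
Proof.
move=> x1 y1 z1; have h1 : y <= x * y by nra.
have h2 : x <= x * y by nra.
by have h3 : x * y <= x * y * z by [nra]; lra.
Qed.

Lemma le_add3_mul x y z : 1 <= x -> 1 <= y -> 1 <= z -> x + y + z <= 3 * (x * y * z).
Proof.
move=> x1 y1 z1; have h := le_add2_mul x1 y1 z1.
have h2 : 1 <= x * y by nra.
by have h3 : z <= x * y * z by [nra]; lra.
Qed.

(** If <n> <= 4 |h|, then <n> and |k| are at most a constant times P, and the exponents 1/2 - kap
    and kp add up to at most 1/2 - eps. If <n> > 4 |h|, all three arguments are comparable with n,
    so P is at least <n>^3 / 8, and 1 + (1/2 - kap) + kp <= 3 (1/2 - eps) is exactly the condition 3
    eps + kp <= kap. *)
Lemma weight_core eps kap kp n h k : 0 <= eps -> 0 <= kp -> 3 * eps + kp <= kap ->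
  kap <= 1 / 2 -> 1 <= `|k| -> `|k| <= `|h| ->
  (W n + 2 * `|h|) * W n `^ (1 / 2 - kap) * `|k| `^ kp <=
  36 * (`|h| * (W (n + h) * W (n + h + k) * W (n + k)) `^ (1 / 2 - eps)).
Proof.
move=> e0 kp0 h3 k2 k1 kh; set P := W (n + h) * _ * _; have h1 := le_trans k1 kh.
have [w0 w1 w2 w3] := And4 (W_ge1 n) (W_ge1 (n + h)) (W_ge1 (n + h + k)) (W_ge1 (n + k)).
have P1 : 1 <= P by rewrite /P !mulr_ege1.
have P0 : 0 <= P by exact: le_trans P1.
have [hn|nh] := leP (W n) (4 * `|h|).
  have nP : W n <= 3 * P.
    have : W n <= W (n + h) + W (n + h + k) + W (n + k).
      rewrite /W; have := ler_normB (n + h) (n + h + k - (n + k)).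
      have := ler_normB (n + h + k) (n + k).
      have -> : n + h - (n + h + k - (n + k)) = n by ring.
      by lra.
    by move=> /le_trans; apply; exact: le_add3_mul.
  have kP : `|k| <= 2 * P.
    have : `|k| <= `|n + h| + `|n + h + k|.
      have := ler_normB (n + h) (n + h + k).
      have -> : n + h - (n + h + k) = - k by ring.
      by rewrite normrN.
    move=> /le_trans; apply; apply: le_trans (le_add2_mul w1 w2 w3).
    by rewrite /W; lra.
  clearbody P; have r0 : 0 <= 1 / 2 - kap by clear -h3 k2 e0 kp0; lra.
  have b1 : W n `^ (1 / 2 - kap) <= 3 * P `^ (1 / 2 - kap).
    apply: le_trans (_ : (3 * P) `^ (1 / 2 - kap) <= _).
      by rewrite ge0_ler_powR// nnegrE; [apply: le_trans w0|apply: mulr_ge0].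
    by rewrite powRM// ler_wpM2r ?powR_ge0// ler1_powR//; lra.
  have b2 : `|k| `^ kp <= 2 * P `^ kp.
    apply: le_trans (_ : (2 * P) `^ kp <= _).
      by rewrite ge0_ler_powR// nnegrE mulr_ge0.
    by rewrite powRM// ler_wpM2r ?powR_ge0// ler1_powR//; lra.
  have b3 : P `^ (1 / 2 - kap) * P `^ kp <= P `^ (1 / 2 - eps).
    by rewrite -powRDp; [rewrite ler_powR//; lra|apply: lt_le_trans P1].
  rewrite -mulrA; apply: (@le_trans _ _ ((6 * `|h|) * ((3 * P `^ (1 / 2 - kap)) * (2 * P `^ kp)))).
    apply: ler_pM => //; rewrite ?mulr_ge0 ?powR_ge0 ?addr_ge0//.
    - by lra.
    - by apply: ler_pM => //; exact: powR_ge0.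
  have -> : 6 * `|h| * (3 * P `^ (1 / 2 - kap) * (2 * P `^ kp)) =
    36 * (`|h| * (P `^ (1 / 2 - kap) * P `^ kp)) by ring.
  by rewrite ler_wpM2l// ler_wpM2l.
have nP : W n ^+ 3 <= 8 * P.
  have c1 : 3 / 4 * W n <= W (n + h).
    rewrite /W; have := ler_normB (n + h) h; rewrite addrK; move: nh; rewrite /W; lra.
  have c2 : 1 / 2 * W n <= W (n + h + k).
    rewrite /W; have := ler_normB (n + h) h; rewrite addrK.
    by have := ler_normB (n + h + k) k; rewrite addrK; move: nh; rewrite /W; lra.
  have c3 : 3 / 4 * W n <= W (n + k).
    rewrite /W; have := ler_normB (n + k) k; rewrite addrK; move: nh; rewrite /W; lra.
  have Wn0 : 0 <= W n by exact: le_trans w0.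
  have c12 : 3 / 4 * W n * (1 / 2 * W n) <= W (n + h) * W (n + h + k).
    by apply: ler_pM => //; apply: mulr_ge0 => //; lra.
  have c123 : 3 / 4 * W n * (1 / 2 * W n) * (3 / 4 * W n) <= P.
    by apply: ler_pM => //; rewrite ?mulr_ge0//; lra.
  have : 0 <= W n ^+ 3 by rewrite exprn_ge0.
  by move: c123; rewrite !exprS expr0; nra.
clearbody P; clear w1 w2 w3; have Wn0 : 0 < W n by exact: lt_le_trans w0.
have s0 : 0 <= 1 / 2 - eps by lra.
have b1 : `|k| `^ kp <= W n `^ kp.
  by rewrite ge0_ler_powR ?nnegrE// ?ltW//; lra.
have b2 : W n * W n `^ (1 / 2 - kap) * W n `^ kp <= 8 * P `^ (1 / 2 - eps).
  apply: le_trans (_ : (W n ^+ 3) `^ (1 / 2 - eps) <= _).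
    rewrite -powR_mulrn ?(ltW Wn0)// -powRrM -{1}(powRr1 (ltW Wn0)) -!powRDp//.
    by rewrite ler_powR//; lra.
  apply: le_trans (_ : (8 * P) `^ (1 / 2 - eps) <= _).
    by rewrite ge0_ler_powR// nnegrE; [rewrite exprn_ge0// ltW|apply: mulr_ge0].
  by rewrite powRM// ler_wpM2r ?powR_ge0// ler1_powR//; lra.
apply: (@le_trans _ _ (2 * W n * W n `^ (1 / 2 - kap) * W n `^ kp)).
  apply: ler_pM => //; rewrite ?mulr_ge0 ?powR_ge0 ?addr_ge0// ?(ltW Wn0)//.
  by rewrite ler_wpM2r ?powR_ge0//; lra.
rewrite -!mulrA in b2 *; apply: le_trans (ler_wpM2l (ler0n R 2) b2) _.
set q := P `^ _; have q0 : 0 <= q by exact: powR_ge0.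
by have := ler_wpM2r q0 h1; rewrite mul1r; lra.
Qed.

(* Puts the output in H^(1/2 + al - 1 - kap) when the three inputs are in H^(1/2 - eps). *)
Lemma abs_powR_W (k kp : R) : 0 <= kp -> kp <= 1 -> 1 <= `|k| ->
  `|k| `^ (- 1 - kp) <= 4 * W k `^ (- 1 - kp).
Proof.
move=> kp0 kp1 k1.
have Wk2 : W k <= 2 * `|k| by rewrite /W; lra.
have W0 : 0 < W k by exact: lt_le_trans (W_ge1 k).
have := @powR_opp_mono R (-1 - kp) (W k) (2 * `|k|); have -> : -1 - kp <= 0 by lra.
move=> /(_ isT W0 Wk2); rewrite powRM// => hh.
have e4 : 2 `^ (1 + kp) <= 4 :> R.
  apply: le_trans (_ : 2 `^ 2%:R <= _); first by rewrite ler_powR ?ler1n//; lra.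
  by rewrite powR_mulrn//; lra.
have e2 : 2 `^ (1 + kp) * 2 `^ (- 1 - kp) = 1 :> R.
  by rewrite -powRDp// (_ : 1 + kp + (-1 - kp) = 0) ?powRr0//; ring.
have := ler_wpM2l (powR_ge0 2 (1 + kp)) hh; rewrite mulrA e2 mul1r => /le_trans; apply.
by rewrite ler_wpM2r// powR_ge0.
Qed.

(** Let h, k be the larger and the smaller of the gaps p - n0 and q - n0. [phase_lower] with mu =
    <n0> + 2 |h| bounds the phase below, and [weight_core] supplies the rest. The decay <k>^(-1 -
    kp) left over in the smaller gap is majorized by the sum over both gaps, to be symmetric in p
    and q. *)
Lemma tri_weight al eps kap kp p q (n0 : int) : 1 < al < 2 -> 0 <= eps -> 0 <= kp -> kp <= 1 ->
  3 * eps + kp <= kap -> kap <= 1 / 2 -> p != n0 -> q != n0 ->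
  wt n0 `^ (1 / 2 + (al - 1 - kap)) <= 144 / (al * (al - 1)) *
  (`| frac_symbol al p - frac_symbol al (p + q - n0) + frac_symbol al q -
     frac_symbol al n0 | *
   (wt p * wt (p + q - n0) * wt q) `^ (1 / 2 - eps) *
   (wt (p - n0) `^ (- 1 - kp) + wt (q - n0) `^ (- 1 - kp))).
Proof.
move=> al12 e0 kp0 kp1 h3 k2 pn qn; have [al1 al2] := andP al12.
have c0 : 0 < al * (al - 1) by apply: mulr_gt0; lra.
have Wwt m : wt m = W m%:~R by [].
have key (n h k : R) : 1 <= `|k| -> `|k| <= `|h| ->
    W n `^ (1 / 2 + (al - 1 - kap)) <= 144 / (al * (al - 1)) *
    (`| `|n + h| `^ al - `|n + h + k| `^ al + `|n + k| `^ al - `|n| `^ al | *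
     (W (n + h) * W (n + h + k) * W (n + k)) `^ (1 / 2 - eps) * W k `^ (- 1 - kp)).
  move=> k1 kh; have h1 := le_trans k1 kh.
  have core := weight_core n e0 kp0 h3 k2 k1 kh.
  set mu := W n + 2 * `|h| in core; set P := _ * W (n + k) in core *.
  have w1 := W_ge1 n; have mu1 : 1 <= mu by rewrite /mu; lra.
  have mu0 : 0 < mu by exact: lt_le_trans mu1.
  have k0 : 0 < `|k| by exact: lt_le_trans k1.
  have b0 : `|n| <= mu by rewrite /mu /W; lra.
  have b1 : `|n + h| <= mu by apply: le_trans (ler_normD _ _) _; rewrite /mu /W; lra.
  have b2 : `|n + k| <= mu by apply: le_trans (ler_normD _ _) _; rewrite /mu /W; lra.
  have b3 : `|n + h + k| <= mu.
    apply: le_trans (ler_normD _ _) _; have := ler_normD n h; rewrite /mu /W; lra.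
  have := phase_lower al12 b0 b1 b2 b3; set F := `| _ - _ |.
  set c := al * (al - 1) in c0 * => ph.
  have Wk : `|k| `^ (- 1 - kp) <= 4 * W k `^ (- 1 - kp).
    exact: abs_powR_W.
  have s1 : W n `^ (1 / 2 + (al - 1 - kap)) <= mu `^ (al - 1) * W n `^ (1 / 2 - kap).
    have -> : 1 / 2 + (al - 1 - kap) = (al - 1) + (1 / 2 - kap) by ring.
    rewrite powRDp ?(lt_le_trans _ w1)// ler_wpM2r ?powR_ge0// ge0_ler_powR ?nnegrE//.
    - by rewrite subr_ge0 ltW.
    - exact: le_trans w1.
    - exact: ltW.
    - by rewrite /mu; lra.
  have s2 : mu `^ (al - 1) = mu `^ (al - 2) * mu.
    rewrite -[X in _ * X](powRr1 (ltW mu0)) -powRDp//; congr (_ `^ _); ring.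
  have s3 : `|k| `^ kp * (`|k| * `|k| `^ (- 1 - kp)) = 1.
    rewrite -[X in _ * (X * _)](powRr1 (ltW k0)) -!powRDp// (_ : kp + _ = 0) ?powRr0//; ring.
  set A := W n `^ (1 / 2 - kap) in core s1; set M := mu `^ (al - 2) in ph s2.
  set Ps := P `^ _ in core *; set Y := `|k| `^ kp in core s3.
  set Z := `|k| `^ _ in s3 Wk; set V := W k `^ _ in Wk *.
  have M0 : 0 <= M by exact: powR_ge0.
  have Z0 : 0 <= Z by exact: powR_ge0.
  have Ps0 : 0 <= Ps by exact: powR_ge0.
  have A0 : 0 <= A by exact: powR_ge0.
  apply: le_trans s1 _; rewrite s2.
  have -> : M * mu * A = M * (mu * A * Y) * (`|k| * Z) by rewrite -[LHS]mulr1 -s3; ring.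
  have t1 : M * (mu * A * Y) * (`|k| * Z) <= M * (36 * (`|h| * Ps)) * (`|k| * Z).
    by rewrite ler_wpM2r ?mulr_ge0// ler_wpM2l.
  apply: le_trans t1 _.
  have -> : M * (36 * (`|h| * Ps)) * (`|k| * Z) = 36 / c * (c * M * (`|h| * `|k|) * Ps * Z).
    by field; exact: lt0r_neq0.
  have -> : 144 / c * (F * Ps * V) = 36 / c * (F * Ps * (4 * V)) by field; exact: lt0r_neq0.
  rewrite ler_wpM2l ?divr_ge0 ?(ltW c0)//.
  have cM : 0 <= c * M * (`|h| * `|k|).
    by apply: mulr_ge0; [apply: mulr_ge0 => //; exact: ltW|exact: mulr_ge0].
  apply: ler_pM => //; first exact: mulr_ge0 cM Ps0.
  by rewrite ler_wpM2r.
have intle (m : int) : m != 0 -> 1 <= `|m%:~R : R|.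
  by move=> m0; rewrite -intr_norm ler1z; lia.
have {}c0 : 0 <= 144 / (al * (al - 1)) by rewrite divr_ge0// ltW.
have hp : 1 <= `|(p - n0)%:~R : R| by rewrite intle// subr_eq0.
have hq : 1 <= `|(q - n0)%:~R : R| by rewrite intle// subr_eq0.
have ep : n0%:~R + (p - n0)%:~R = p%:~R :> R by rewrite -mulrzDr addrC subrK.
have eq : n0%:~R + (q - n0)%:~R = q%:~R :> R by rewrite -mulrzDr addrC subrK.
have em : n0%:~R + (p - n0)%:~R + (q - n0)%:~R = (p + q - n0)%:~R :> R.
  by rewrite -!mulrzDr [n0 + _]addrC subrK addrA.
have [le|/ltW le] := leP (`|(q - n0)%:~R : R|) (`|(p - n0)%:~R : R|).
  apply: le_trans (key n0%:~R _ _ hq le) _; rewrite em ep eq.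
  rewrite ler_wpM2l// ler_wpM2l ?mulr_ge0 ?powR_ge0// lerDr powR_ge0//.
apply: le_trans (key n0%:~R _ _ hp le) _.
rewrite [_ + (q - n0)%:~R + _]addrAC em ep eq.
have -> : W q%:~R * W (p + q - n0)%:~R * W p%:~R = wt p * wt (p + q - n0) * wt q.
  by rewrite !Wwt; ring.
have -> : frac_symbol al p - frac_symbol al (p + q - n0) + frac_symbol al q -
    frac_symbol al n0 = `|q%:~R| `^ al - `|(p + q - n0)%:~R| `^ al + `|p%:~R| `^ al - `|n0%:~R| `^ al.
  by rewrite /frac_symbol; ring.
by rewrite ler_wpM2l// ler_wpM2l ?mulr_ge0 ?powR_ge0// lerDl powR_ge0.
Qed.

(* Telescoping: N^(-th) - (N+1)^(-th) >= th (N+1)^(-1-th). *)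
Lemma sumle_wt_opp r : 1 < r -> exists K, sumle (fun m => wt m `^ (- r)) K.
Proof.
move=> r1; pose th := r - 1; have th0 : 0 < th by rewrite /th; lra.
have step (x : R) : 1 <= x -> th * (x + 1) `^ (- r) <= x `^ (- th) - (x + 1) `^ (- th).
  move=> x1; have x0 : 0 < x by lra. have x10 : 0 < x + 1 by lra.
  have -> : - r = - th + - 1 by rewrite /th; ring.
  rewrite powRDp// [_ `^ -1]powR_inv1 ?(ltW x10)//.
  have a := powR_gt0 (- th) x10.
  have -> : x `^ (- th) = (x + 1) `^ (- th) * expR (th * ln ((x + 1) / x)).
    rewrite /powR !gt_eqF// -expRD; congr expR; rewrite ln_div ?posrE//; ring.
  have h1 := expR_ge1Dx (th * ln ((x + 1) / x)).
  have h2 : (x + 1)^-1 <= ln ((x + 1) / x).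
    have -> : (x + 1) / x = (x / (x + 1))^-1 by rewrite invf_div.
    rewrite lnV ?posrE ?divr_gt0// lerNr.
    have -> : x / (x + 1) = 1 + (- (x + 1)^-1) by field; exact: lt0r_neq0.
    apply: le_ln1Dx; rewrite ltrN2 invf_lt1//; lra.
  have h3 := ler_wpM2l (ltW th0) h2.
  have := ler_wpM2l (ltW a) (le_trans (lerD (lexx 1) h3) h1).
  set b := _ `^ _; set c := expR _; set d := (x + 1)^-1; have -> : th * (b * d) = b * (th * d) by ring.
  by rewrite mulrDr mulr1; lra.
have box N : \sum_(m <- zbox N) wt m `^ (- r) <= 1 + 2 / th * (1 - (N%:R + 1) `^ (- th)).
  elim: N => [|N IH].
    rewrite /zbox /= big_seq1 subrr /wt mulr0z normr0 addr0 !powR1 add0r powR1 subrr mulr0 addr0//.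
  have wS : wt N.+1%:Z = N%:R + 1 + 1 by rewrite /wt -[_%:~R]/(N.+1%:R) ger0_norm// -natr1; ring.
  rewrite big_zboxS wtN wS -[N.+1%:R]natr1.
  have N1 : 1 <= N%:R + 1 :> R by rewrite lerDr.
  have := step _ N1; rewrite -ler_pdivlMl// => hs.
  have e : 2 / th * (1 - (N%:R + 1 + 1) `^ (- th)) = 2 / th * (1 - (N%:R + 1) `^ (- th)) +
     2 * (th^-1 * ((N%:R + 1) `^ (- th) - (N%:R + 1 + 1) `^ (- th))) by ring.
  by rewrite e; lra.
exists (1 + 2 / th) => s us; have [N sN] := seq_sub_zbox s.
apply: le_trans (ler_sum_subset _ us sN) _; first by move=> m; exact: powR_ge0.
apply: le_trans (box N) _; by rewrite lerD2l ler_piMr ?divr_ge0 ?(ltW th0)// lerBlDr lerDl powR_ge0.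
Qed.

End Weights.

(** * Trilinear sums in weighted l^2 *)

Section TrilinearSums.
Variable R : realType.
Implicit Types (a A B e : int -> R) (n m p q : int) (N M : nat) (K E eps : R).

Lemma inj_addsub p n : injective (fun q : int => p + q - n).
Proof. by move=> x y; lia. Qed.

Lemma inj_add_sub p n : injective (fun q : int => q + p - n).
Proof. by move=> x y; lia. Qed.

Lemma inj_sub p : injective (fun n : int => p - n).
Proof. by move=> x y; lia. Qed.

(** Schur's test: Cauchy--Schwarz in p against the kernel, then summation in n. *)
Lemma schur_test (kap : int -> int -> R) A E K N : (forall p n, 0 <= kap p n) ->
  (forall n, \sum_(p <- zbox N) kap p n <= E) -> (forall p, sumle (kap p) E) ->
  sumle (fun p => A p ^+ 2) K ->
  sumle (fun n => (\sum_(p <- zbox N) kap p n * A p) ^+ 2) (E * (E * K)).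
Proof.
move=> k0 kE Ek AK s us; have E0 := sumle_ge0 (Ek 0).
apply: le_trans (_ : \sum_(n <- s) E * \sum_(p <- zbox N) kap p n * A p ^+ 2 <= _).
  apply: ler_sum => n _; apply: le_trans (jensen_sum _ _ (k0 ^~ n)) _.
  by rewrite ler_wpM2r// sumr_ge0// => p _; rewrite mulr_ge0// sqr_ge0.
rewrite -mulr_sumr ler_wpM2l// exchange_big /=.
apply: le_trans (_ : \sum_(p <- zbox N) E * A p ^+ 2 <= _).
  by apply: ler_sum => p _; rewrite -mulr_suml ler_wpM2r ?sqr_ge0// Ek.
by rewrite -mulr_sumr ler_wpM2l// AK// uniq_zbox.
Qed.

Definition boxsum N (F : int -> int -> R) n : R :=
  \sum_(p <- zbox N) \sum_(q <- zbox N | p + q - n \in zbox N) F p q.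

Lemma boxsum_ge0 N F n : (forall p q, 0 <= F p q) -> 0 <= boxsum N F n.
Proof. by move=> F0; apply: sumr_ge0 => p _; apply: sumr_ge0. Qed.

Lemma ler_boxsum N F G n : (forall p q, F p q <= G p q) -> boxsum N F n <= boxsum N G n.
Proof. by move=> FG; apply: ler_sum => p _; apply: ler_sum => q _. Qed.

Lemma boxsum_le_full N F n : (forall p q, 0 <= F p q) ->
  boxsum N F n <= \sum_(p <- zbox N) \sum_(q <- zbox N) F p q.
Proof.
by move=> F0; apply: ler_sum => p _; rewrite big_mkcond; apply: ler_sum => q _; case: ifP.
Qed.

Lemma boxsum_mono N M F n : (forall p q, 0 <= F p q) -> (N <= M)%N ->
  boxsum N F n <= boxsum M F n.
Proof.
move=> F0 NM; apply: le_trans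
  (_ : \sum_(p <- zbox N) \sum_(q <- zbox M | p + q - n \in zbox M) F p q <= _).
  apply: ler_sum => p _; rewrite -big_filter -[leRHS]big_filter.
  apply: ler_sum_subset => //; first by rewrite filter_uniq// uniq_zbox.
  move=> q; rewrite !mem_filter => /andP[h1 h2].
  by rewrite !(zbox_sub NM).
apply: ler_sum_subset; [|exact: uniq_zbox|exact: zbox_sub].
by move=> p; exact: sumr_ge0.
Qed.

Lemma boxsumD N F G n :
  boxsum N (fun p q => F p q + G p q) n = boxsum N F n + boxsum N G n.
Proof. by rewrite /boxsum -big_split; apply: eq_bigr => p _; rewrite big_split. Qed.

Lemma boxsumZ N F n c : boxsum N (fun p q => c * F p q) n = c * boxsum N F n.
Proof. by rewrite /boxsum mulr_sumr; apply: eq_bigr => p _; rewrite mulr_sumr. Qed.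

Lemma boxsumC N F n : boxsum N (fun p q => F q p) n = boxsum N F n.
Proof.
rewrite /boxsum; under eq_bigr do rewrite big_mkcond; rewrite exchange_big /=.
by apply: eq_bigr => p _; rewrite [RHS]big_mkcond; apply: eq_bigr => q _; rewrite [q + p]addrC.
Qed.

Lemma sumle_shift (f : int -> R) n K : sumle f K -> sumle (fun p => f (p - n)) K.
Proof. by move=> fK; apply: (sumle_inj (h := fun p => p - n)) fK => p q; lia. Qed.

Lemma powR_half_sqr (x s : R) : (x `^ s) ^+ 2 = x `^ (2 * s).
Proof. by rewrite powRX mulrC. Qed.

(* The phase vanishes at the resonant terms p = n and q = n. *)
Definition tri al B n p q : R :=
  if (p == n) || (q == n) then 0 else
  B p * B (p + q - n) * B q / `| frac_symbol al p - frac_symbol al (p + q - n) +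
    frac_symbol al q - frac_symbol al n |.

Lemma tri_ge0 al B n p q : (forall m, 0 <= B m) -> 0 <= tri al B n p q.
Proof. by move=> B0; rewrite /tri; case: ifP => // _; rewrite divr_ge0// !mulr_ge0. Qed.

(** With the weight <m>^(1/2 - eps) the inputs lie in l^2, and [tri_weight] leaves the kernel k(p -
    n) + k(q - n), whose two parts are exchanged by symmetry. The sum over q is at most K by
    Cauchy--Schwarz; the sum over p is a convolution with the summable <m>^(-1 - kp), bounded on l^2
    by Schur's test. *)
Lemma tri_gain (al : R) eps (kap kp : R) B K : 1 < al < 2 -> 0 <= eps -> 0 < kp -> kp <= 1 ->
  3 * eps + kp <= kap -> kap <= 1 / 2 -> (forall m, 0 <= B m) ->
  sumle (fun m => wt R m `^ (1 - 2 * eps) * B m ^+ 2) K ->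
  exists K', forall N,
    sumle (fun n => wt R n `^ (1 + 2 * (al - 1 - kap)) * boxsum N (tri al B n) n ^+ 2) K'.
Proof.
move=> al12 e0 kp0 kp1 h3 k2 B0 BK.
pose A m := wt R m `^ (1 / 2 - eps) * B m.
have A0 m : 0 <= A m by rewrite mulr_ge0 ?powR_ge0.
have AK : sumle (fun m => A m ^+ 2) K.
  apply: le_sumle BK => m; rewrite /A exprMn powR_half_sqr ler_wpM2r ?sqr_ge0//.
  by apply: le_of_eq; congr powR; lra.
have K0 := sumle_ge0 BK.
have kp1' : 1 < 1 + kp by lra.
have [E wE] := sumle_wt_opp kp1'; have E0 := sumle_ge0 wE.
pose k m := wt R m `^ (- (1 + kp)); have k0 m : 0 <= k m by exact: powR_ge0.
have [C0 C00 tw] : exists2 C0, 0 <= C0 & forall p q n, p != n -> q != n ->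
    wt R n `^ (1 / 2 + (al - 1 - kap)) <= C0 *
    (`| frac_symbol al p - frac_symbol al (p + q - n) + frac_symbol al q - frac_symbol al n | *
     (wt R p * wt R (p + q - n) * wt R q) `^ (1 / 2 - eps) *
     (wt R (p - n) `^ (- 1 - kp) + wt R (q - n) `^ (- 1 - kp))).
  exists (144 / (al * (al - 1))); last by move=> p q n pn qn; apply: tri_weight => //; exact: ltW.
  by move: al12 => /andP[? ?]; rewrite divr_ge0// mulr_ge0//; lra.
have term n p q : wt R n `^ (1 / 2 + (al - 1 - kap)) * tri al B n p q <=
    C0 * ((k (p - n) + k (q - n)) * (A p * A (p + q - n) * A q)).
  have rhs0 : 0 <= C0 * ((k (p - n) + k (q - n)) * (A p * A (p + q - n) * A q)).
    by apply: mulr_ge0 => //; apply: mulr_ge0; [exact: addr_ge0|exact: mulr3_ge0].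
  rewrite /tri; case: ifP => [_|/negbT]; first by rewrite mulr0.
  rewrite negb_or => /andP[pn qn].
  have {tw} := tw p q n pn qn; set F := `| _ |.
  have F0 : 0 <= F by exact: normr_ge0.
  (* Division by a vanishing phase gives 0, so this case is trivial. *)
  move=> tw; have [->|Fn0] := eqVneq F 0; first by rewrite invr0 !mulr0.
  have Fp : 0 < F by rewrite lt_neqAle eq_sym Fn0.
  set b := B p * _ * B q; have b0 : 0 <= b by rewrite !mulr_ge0.
  rewrite mulrA ler_pdivrMr//; apply: le_trans (ler_wpM2r b0 tw) _.
  rewrite !powRM ?mulr_ge0 ?(ltW (wt_gt0 _ _))// /A /b /k.
  by rewrite (_ : - 1 - kp = - (1 + kp)); [apply: le_of_eq; ring|ring].
have inner n p N : \sum_(q <- zbox N) A (p + q - n) * A q <= K.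
  apply: le_trans (_ : \sum_(q <- zbox N) 2^-1 * (A (p + q - n) ^+ 2 + A q ^+ 2) <= _).
    by apply: ler_sum => q _; have := sqr_ge0 (A (p + q - n) - A q); nra.
  rewrite -mulr_sumr big_split /=.
  have h1 := AK _ (uniq_zbox N).
  have h2 : \sum_(q <- zbox N) A (p + q - n) ^+ 2 <= K.
    have h := sumle_inj (@inj_addsub p n) AK; by apply: h; exact: uniq_zbox.
  by lra.
have sum1 n N : \sum_(p <- zbox N) \sum_(q <- zbox N)
    k (p - n) * (A p * A (p + q - n) * A q) <= K * \sum_(p <- zbox N) k (p - n) * A p.
  rewrite mulr_sumr; apply: ler_sum => p _.
  have -> : \sum_(q <- zbox N) k (p - n) * (A p * A (p + q - n) * A q) =
      (k (p - n) * A p) * \sum_(q <- zbox N) A (p + q - n) * A q.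
    by rewrite mulr_sumr; apply: eq_bigr => q _; ring.
  by rewrite [leRHS]mulrC ler_wpM2l// mulr_ge0.
have bound n N : wt R n `^ (1 / 2 + (al - 1 - kap)) * boxsum N (tri al B n) n <=
    2 * C0 * K * \sum_(p <- zbox N) k (p - n) * A p.
  rewrite -boxsumZ; apply: le_trans (ler_boxsum N n (term n)) _.
  rewrite boxsumZ -!mulrA [2 * _]mulrCA ler_wpM2l//.
  pose F p q := k (p - n) * (A p * A (p + q - n) * A q).
  have -> : (fun p q => (k (p - n) + k (q - n)) * (A p * A (p + q - n) * A q)) =
      (fun p q => F p q + F q p).
    by apply/funext => p; apply/funext => q; rewrite /F [q + p]addrC; ring.
  have -> : boxsum N (fun p q => F p q + F q p) n = 2 * boxsum N F n.
    by rewrite boxsumD (boxsumC N F n); ring.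
  rewrite ler_wpM2l//.
  apply: le_trans (sum1 n N); apply: boxsum_le_full => p q.
  by rewrite /F; apply: mulr_ge0 => //; exact: mulr3_ge0.
exists ((2 * C0 * K) ^+ 2 * (E * (E * K))) => N.
have sch := @schur_test (fun p n => k (p - n)) A E K N (fun p n => k0 _) _ _ AK.
apply: le_sumle (sumleZ (sqr_ge0 (2 * C0 * K)) (sch _ _)).
- move=> n; rewrite -exprMn.
  have -> : 1 + 2 * (al - 1 - kap) = 2 * (1 / 2 + (al - 1 - kap)) by field.
  rewrite -powR_half_sqr -exprMn lerXn2r ?nnegrE//.
    by rewrite mulr_ge0 ?powR_ge0// boxsum_ge0// => p q; exact: tri_ge0.
  by rewrite !mulr_ge0// sumr_ge0// => p _; rewrite mulr_ge0.
- by move=> n; exact: (sumle_shift n wE) (uniq_zbox N).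
- by move=> p; have h := sumle_inj (@inj_sub p) wE.
Qed.

(** With x the largest weight, u^(1/2 - 4 eps) x^(-(1/2 - eps)) is at most 3 x^(-3 eps). This
    surplus is shared between y and z, raising their exponents from 1/2 - eps to 1/2 + eps/2, beyond
    the threshold at which sequences in l^2 become summable. *)
Lemma conv_weight eps (x y z u : R) : 0 <= eps -> 8 * eps <= 1 -> 1 <= y <= x -> 1 <= z <= x ->
  0 <= u <= x + y + z ->
  u `^ (1 / 2 - 4 * eps) * (x * y * z) `^ (- (1 / 2 - eps)) <=
  3 * (y `^ (- (1 / 2 + eps / 2)) * z `^ (- (1 / 2 + eps / 2))).
Proof.
move=> e0 e8 /andP[y1 yx] /andP[z1 zx] /andP[u0 ul]; have x1 := le_trans y1 yx.
have [x0 y0 z0] : [/\ 0 < x, 0 < y & 0 < z] by split; lra.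
have r0 : 0 <= 1 / 2 - 4 * eps by lra.
have h1 : u `^ (1 / 2 - 4 * eps) <= 3 * x `^ (1 / 2 - 4 * eps).
  apply: le_trans (_ : (3 * x) `^ (1 / 2 - 4 * eps) <= _).
    by rewrite ge0_ler_powR ?nnegrE//; lra.
  by rewrite powRM ?(ltW x0)// ler_wpM2r ?powR_ge0// ler1_powR//; lra.
rewrite 2?powRM ?mulr_ge0 ?(ltW x0) ?(ltW y0) ?(ltW z0)//.
set X := x `^ _; set Y := y `^ _; set Z := z `^ _.
apply: le_trans (_ : 3 * x `^ (1 / 2 - 4 * eps) * (X * Y * Z) <= _).
  by rewrite ler_wpM2r// !mulr_ge0 ?powR_ge0.
have -> : 3 * x `^ (1 / 2 - 4 * eps) * (X * Y * Z) =
    3 * (x `^ (1 / 2 - 4 * eps) * X * (Y * Z)) by ring.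
rewrite ler_wpM2l// /X -powRDp//.
have -> : 1 / 2 - 4 * eps + - (1 / 2 - eps) = - (3 / 2 * eps) + - (3 / 2 * eps) by field.
rewrite powRDp//.
have sp (t : R) : 0 < t -> t `^ (- (1 / 2 + eps / 2)) = t `^ (- (3 / 2 * eps)) * t `^ (- (1 / 2 - eps)).
  by move=> t0; rewrite -powRDp//; congr powR; field.
rewrite (sp y)// (sp z)// -/Y -/Z.
have hy : x `^ (- (3 / 2 * eps)) <= y `^ (- (3 / 2 * eps)) by apply: powR_opp_mono => //; lra.
have hz : x `^ (- (3 / 2 * eps)) <= z `^ (- (3 / 2 * eps)) by apply: powR_opp_mono => //; lra.
apply: le_trans (_ : y `^ (- (3 / 2 * eps)) * z `^ (- (3 / 2 * eps)) * (Y * Z) <= _).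
  by rewrite ler_wpM2r ?mulr_ge0 ?powR_ge0// ler_pM ?powR_ge0.
by apply: le_of_eq; ring.
Qed.

(** The factor of highest frequency stays in l^2, while [conv_weight] turns the other two into the
    summable [e]. Young's inequality for l^1, l^1 and l^2, in the form of Schur's test, closes the
    estimate. The price is the passage from eps to 4 eps. *)
Lemma asum_gain eps a K : 0 < eps -> 8 * eps <= 1 -> (forall m, 0 <= a m) ->
  sumle (fun m => wt R m `^ (1 - 2 * eps) * a m ^+ 2) K ->
  exists K', forall N, sumle (fun n => wt R n `^ (1 - 8 * eps) * asum N a n ^+ 2) K'.
Proof.
move=> e0 e8 a0 aK.
pose A m := wt R m `^ (1 / 2 - eps) * a m.
have A0 m : 0 <= A m by rewrite mulr_ge0 ?powR_ge0.
have AK : sumle (fun m => A m ^+ 2) K.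
  apply: le_sumle aK => m; rewrite /A exprMn powR_half_sqr ler_wpM2r ?sqr_ge0//.
  by apply: le_of_eq; congr powR; lra.
have K0 := sumle_ge0 aK.
pose e m := wt R m `^ (- (1 / 2 + eps / 2)) * A m.
have e_0 m : 0 <= e m by rewrite mulr_ge0 ?powR_ge0.
have e1' : 1 < 1 + eps by lra.
have [E0 wE] := sumle_wt_opp e1'.
have [E eE] : exists E, sumle e E.
  exists (2^-1 * (E0 + K)); apply: le_sumle (sumleZ _ (sumleD wE AK)); last by rewrite invr_ge0.
  move=> m; rewrite /e; have -> : - (1 + eps) = 2 * - (1 / 2 + eps / 2) by field.
  rewrite -powR_half_sqr.
  by have := sqr_ge0 (wt R m `^ (- (1 / 2 + eps / 2)) - A m); nra.
have E_0 := sumle_ge0 eE.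
have aA m : a m = wt R m `^ (- (1 / 2 - eps)) * A m.
  by rewrite /A mulrA -powRDp ?wt_gt0// addNr powRr0 mul1r.
(* One summand for each position of the largest weight. *)
have term n p q : wt R n `^ (1 / 2 - 4 * eps) * (a p * a (p + q - n) * a q) <=
    3 * (A p * (e (p + q - n) * e q) + A q * (e (q + p - n) * e p) +
         e p * (e q * A (p + q - n))).
  set m := p + q - n; have -> : q + p - n = m by rewrite addrC [q + p]addrC /m addrC.
  have nD : wt R n <= wt R p + wt R m + wt R q.
    have -> : n = p + q + - m by rewrite /m; lia.
    by have := wtD R (p + q) (- m); have := wtD R p q; rewrite wtN; lra.
  have [p1 m1 q1] : [/\ 1 <= wt R p, 1 <= wt R m & 1 <= wt R q] by rewrite !wt_ge1.
  have n0 : 0 <= wt R n by exact: ltW (wt_gt0 R n).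
  have P0 : 0 <= A p * A m * A q by exact: mulr3_ge0.
  have -> : a p * a m * a q = (wt R p * wt R m * wt R q) `^ (- (1 / 2 - eps)) * (A p * A m * A q).
    by rewrite !aA !powRM ?mulr_ge0 ?(ltW (wt_gt0 _ _))//; ring.
  rewrite mulrA.
  have t1 : 0 <= A p * (e m * e q) by apply: mulr_ge0 => //; exact: mulr_ge0.
  have t2 : 0 <= A q * (e m * e p) by apply: mulr_ge0 => //; exact: mulr_ge0.
  have t3 : 0 <= e p * (e q * A m) by apply: mulr_ge0 => //; exact: mulr_ge0.
  have [mp|pm] := leP (wt R m) (wt R p).
    have [qp|pq] := leP (wt R q) (wt R p).
      have := @conv_weight eps (wt R p) (wt R m) (wt R q) (wt R n) (ltW e0) e8.
      rewrite m1 mp q1 qp n0 nD => /(_ isT isT isT) /(ler_wpM2r P0) /le_trans; apply.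
      by rewrite -[X in X <= _]mulrA ler_wpM2l//; apply: le_trans (_ : A p * (e m * e q) <= _);
        [apply: le_of_eq; rewrite /e; ring|lra].
    have := @conv_weight eps (wt R q) (wt R m) (wt R p) (wt R n) (ltW e0) e8.
    rewrite m1 (le_trans mp (ltW pq)) p1 (ltW pq) n0 (_ : wt R q + wt R m + wt R p = wt R p + wt R m + wt R q); last by ring.
    rewrite nD (_ : wt R q * wt R m * wt R p = wt R p * wt R m * wt R q); last by ring.
    move=> /(_ isT isT isT) /(ler_wpM2r P0) /le_trans; apply.
    by rewrite -[X in X <= _]mulrA ler_wpM2l//; apply: le_trans (_ : A q * (e m * e p) <= _);
      [apply: le_of_eq; rewrite /e; ring|lra].
  have [qm|mq] := leP (wt R q) (wt R m).
    have := @conv_weight eps (wt R m) (wt R p) (wt R q) (wt R n) (ltW e0) e8.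
    rewrite p1 (ltW pm) q1 qm n0 (_ : wt R m + wt R p + wt R q = wt R p + wt R m + wt R q); last by ring.
    rewrite nD (_ : wt R m * wt R p * wt R q = wt R p * wt R m * wt R q); last by ring.
    move=> /(_ isT isT isT) /(ler_wpM2r P0) /le_trans; apply.
    by rewrite -[X in X <= _]mulrA ler_wpM2l//; apply: le_trans (_ : e p * (e q * A m) <= _);
      [apply: le_of_eq; rewrite /e; ring|lra].
  have := @conv_weight eps (wt R q) (wt R m) (wt R p) (wt R n) (ltW e0) e8.
  rewrite m1 (ltW mq) p1 (le_trans (ltW pm) (ltW mq)) n0 (_ : wt R q + wt R m + wt R p = wt R p + wt R m + wt R q); last by ring.
  rewrite nD (_ : wt R q * wt R m * wt R p = wt R p * wt R m * wt R q); last by ring.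
  move=> /(_ isT isT isT) /(ler_wpM2r P0) /le_trans; apply.
  by rewrite -[X in X <= _]mulrA ler_wpM2l//; apply: le_trans (_ : A q * (e m * e p) <= _);
    [apply: le_of_eq; rewrite /e; ring|lra].
pose k1 N p n := \sum_(q <- zbox N) e (p + q - n) * e q.
pose k2 N m n := \sum_(q <- zbox N) e (m + n - q) * e q.
have k10 N p n : 0 <= k1 N p n by apply: sumr_ge0 => q _; rewrite mulr_ge0.
have k20 N p n : 0 <= k2 N p n by apply: sumr_ge0 => q _; rewrite mulr_ge0.
have ksum N (s : seq int) (h : int -> int -> int) : (forall q, injective (h q)) -> uniq s ->
    \sum_(x <- s) \sum_(q <- zbox N) e (h q x) * e q <= E * E.
  move=> hI us; rewrite exchange_big /=.
  apply: le_trans (_ : \sum_(q <- zbox N) E * e q <= _).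
    by apply: ler_sum => q _; rewrite -mulr_suml ler_wpM2r// (sumle_inj (hI q) eE).
  by rewrite -mulr_sumr ler_wpM2l// eE// uniq_zbox.
have bound n N : wt R n `^ (1 / 2 - 4 * eps) * asum N a n <=
    6 * (\sum_(p <- zbox N) k1 N p n * A p) + 3 * \sum_(p <- zbox N) k2 N p n * A p.
  rewrite -[asum N a n]/(boxsum N (fun p q => a p * a (p + q - n) * a q) n) -boxsumZ.
  apply: le_trans (ler_boxsum N n (term n)) _.
  pose F p q := A p * (e (p + q - n) * e q).
  rewrite boxsumZ boxsumD (boxsumD N F (fun p q => F q p)) (boxsumC N F n).
  have h1 : boxsum N F n <= \sum_(p <- zbox N) k1 N p n * A p.
    apply: le_trans (boxsum_le_full N n _) _; first by move=> p q; apply: mulr_ge0 => //; exact: mulr_ge0.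
    by apply: ler_sum => p _; rewrite -mulr_sumr mulrC.
  (* Here the factor in l^2 sits at the middle frequency m = p + q - n, which replaces p as
     summation variable. *)
  have h2 : boxsum N (fun p q => e p * (e q * A (p + q - n))) n <=
      \sum_(p <- zbox N) k2 N p n * A p.
    rewrite -boxsumC /boxsum.
    apply: le_trans (_ : \sum_(q <- zbox N) \sum_(m <- zbox N) e q * (e (m + n - q) * A m) <= _).
      apply: ler_sum => q _; rewrite -big_filter.
      have -> : \sum_(p <- [seq p <- zbox N | q + p - n \in zbox N]) e p * (e q * A (p + q - n)) =
          \sum_(m <- [seq q + p - n | p <- [seq p <- zbox N | q + p - n \in zbox N]])
             e q * (e (m + n - q) * A m).
        rewrite big_map; apply: eq_bigr => p _.
        have -> : q + p - n + n - q = p by lia.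
        by rewrite [p + q]addrC; ring.
      apply: ler_sum_subset; first by move=> m; apply: mulr_ge0 => //; exact: mulr_ge0.
        by rewrite map_inj_uniq ?filter_uniq ?uniq_zbox//; exact: inj_addsub.
      by move=> m /mapP[p]; rewrite mem_filter => /andP[h _] ->.
    rewrite exchange_big /=; apply: ler_sum => m _; rewrite /k2 mulr_suml.
    by apply: ler_sum => q _; apply: le_of_eq; ring.
  by lra.
pose KK := (E * E) * ((E * E) * K).
have sch1 N : sumle (fun n => (\sum_(p <- zbox N) k1 N p n * A p) ^+ 2) KK.
  apply: schur_test => //.
    by move=> n; apply: (ksum N (zbox N) (fun q x => x + q - n)); [move=> q; exact: inj_add_sub|exact: uniq_zbox].
  by move=> p s us; apply: (ksum N s (fun q x => p + q - x)) => // q; exact: inj_sub.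
have sch2 N : sumle (fun n => (\sum_(p <- zbox N) k2 N p n * A p) ^+ 2) KK.
  apply: schur_test => //.
    by move=> n; apply: (ksum N (zbox N) (fun q x => x + n - q)); [move=> q; exact: inj_add_sub|exact: uniq_zbox].
  by move=> p s us; apply: (ksum N s (fun q x => p + x - q)) => // q; exact: inj_addsub.
exists (72 * KK + 18 * KK) => N.
have KK72 : 0 <= 72 :> R by []. have KK18 : 0 <= 18 :> R by [].
apply: le_sumle (sumleD (sumleZ KK72 (sch1 N)) (sumleZ KK18 (sch2 N))) => n.
have -> : 1 - 8 * eps = 2 * (1 / 2 - 4 * eps) by field.
rewrite -powR_half_sqr -exprMn; move: (bound n N).
have : 0 <= wt R n `^ (1 / 2 - 4 * eps) * asum N a n.
  by rewrite mulr_ge0 ?powR_ge0//; apply: boxsum_ge0 => p q; rewrite !mulr_ge0.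
set x := _ * asum _ _ _; set y := \sum_(_ <- _) _; set z := \sum_(_ <- _) _ => x0 xyz.
have : x ^+ 2 <= (6 * y + 3 * z) ^+ 2 by rewrite lerXn2r ?nnegrE//; exact: le_trans xyz.
by have := sqr_ge0 (6 * y - 3 * z); nra.
Qed.

End TrilinearSums.

(** * Oscillatory integrals in time and the gauge *)

Section ComplexCalculus.
Variable R : realType.
Local Notation mu := (@lebesgue_measure R).
Implicit Types (f g F : R -> R[i]) (p q P : R -> R) (a b x y t B L : R).

Lemma primitive_near p x : continuous p -> exists P, is_derive x 1 P (p x) /\
  forall y, x - 1 <= y -> P y = \int[mu]_(t in `[x - 1, y]) p t.
Proof.
move=> cp; exists (fun y => \int[mu]_(t in `[x - 1, y]) p t); split => //.
have x1 : x < x + 1 by rewrite ltrDl.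
have x2 : x - 1 < x by rewrite ltrBlDr ltrDl.
have [d1 d2] := continuous_FTC1_closed x1 (integrable_cont (x - 1) (x + 1) cp) x2 (cp x).
apply: DeriveDef; [exact: d1|by rewrite -derive1E d2].
Qed.

Lemma primitive_exists p : continuous p -> exists P, P 0 = 0 /\ forall x, is_derive x 1 P (p x).
Proof.
move=> cp; pose I a b := \int[mu]_(t in `[a, b]) p t.
have split a c b : a <= c <= b -> I a b = I a c + I c b.
  by move=> acb; apply: Rintegral_split => //; exact: integrable_cont.
have Iaa a : I a a = 0 by rewrite /I set_itv1 Rintegral_set1.
pose P x := if 0 <= x then I 0 x else - I x 0.
have Pdiff a x : a <= x -> P x - P a = I a x.
  move=> ax; rewrite /P; case: (leP 0 a) => a0; case: (leP 0 x) => x0.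
  - by rewrite (split 0 a x) ?a0 ?ax//; ring.
  - by lra.
  - by rewrite (split a 0 x) ?x0 ?(ltW a0)//; ring.
  - by rewrite (split a x 0) ?ax ?(ltW x0)//; ring.
exists P; split; first by rewrite /P lexx Iaa.
move=> x; have [Q [dQ Qe]] := primitive_near x cp.
have dQ2 : is_derive x 1 (fun y => Q y + P (x - 1)) (p x).
  by rewrite -[p x]addr0; apply: is_deriveD.
apply: near_eq_is_derive dQ2; near=> y.
have y1 : x - 1 <= y by apply: ltW; near: y; apply: lt_nbhsr; rewrite ltrBlDr ltrDl.
by rewrite Qe// -/(I _ _) -Pdiff// subrK.
Unshelve. all: by end_near. Qed.

Lemma cprimitive f : ccontinuous f -> exists F, F 0 = 0 /\ cderiv F f.
Proof.
move=> [c1 c2]; have [P [P0 dP]] := primitive_exists c1.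
have [Q [Q0 dQ]] := primitive_exists c2.
exists (fun x => P x +i* Q x); split; first by rewrite P0 Q0.
by move=> x; split; [exact: dP|exact: dQ].
Qed.

Lemma cFTC2 F f a b : a <= b -> cderiv F f -> ccontinuous f -> cintegral `[a, b] f = F b - F a.
Proof.
move=> ab dF [c1 c2]; apply: complexP; rewrite ?cReD ?cImD ?cReN ?cImN /=.
  by apply: (@FTC2R R (fun x => Re (F x)) (fun x => Re (f x)) a b ab) => // x; case: (dF x).
by apply: (@FTC2R R (fun x => Im (F x)) (fun x => Im (f x)) a b ab) => // x; case: (dF x).
Qed.

Lemma cintegral0E F f t : F 0 = 0 -> cderiv F f -> ccontinuous f -> cintegral0 t f = F t.
Proof.
move=> F0 dF cf; rewrite /cintegral0; case: leP => t0; rewrite (cFTC2 _ dF cf)// ?(ltW t0)//.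
  by rewrite F0 subr0.
by rewrite F0 opprB subr0.
Qed.

Lemma cderivM F f G g : cderiv F f -> cderiv G g ->
  cderiv (fun x => F x * G x) (fun x => f x * G x + F x * g x).
Proof.
move=> dF dG x; have [F1 F2] := dF x; have [G1 G2] := dG x; split.
  have d1 := is_deriveM F1 G1; have d2 := is_deriveM F2 G2.
  have := is_deriveB d1 d2; rewrite (_ : _ - _ = Re (f x * G x + F x * g x)).
    by congr is_derive; apply/funext => y; rewrite cReM.
  by rewrite cReD !cReM /GRing.scale /=; ring.
have d1 := is_deriveM F1 G2; have d2 := is_deriveM F2 G1.
have := is_deriveD d1 d2; rewrite (_ : _ + _ = Im (f x * G x + F x * g x)).
  by congr is_derive; apply/funext => y; rewrite cImM.
by rewrite cImD !cImM /GRing.scale /=; ring.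
Qed.

Lemma cderiv_cis_comp P p : (forall x, is_derive x 1 P (p x)) ->
  cderiv (fun x => cis (P x)) (fun x => ('i * (p x)%:C) * cis (P x)).
Proof.
move=> dP x; split.
  have := is_derive1_comp (is_derive_cos (P x)) (dP x).
  by congr is_derive; rewrite /=; ring.
have := is_derive1_comp (is_derive_sin (P x)) (dP x).
by congr is_derive; rewrite /=; ring.
Qed.

Lemma ccontinuous_cis_comp P p : (forall x, is_derive x 1 P (p x)) ->
  ccontinuous (fun x => cis (P x)).
Proof. by move=> dP; apply: cderiv_continuous (cderiv_cis_comp dP). Qed.

Lemma cintegral_bound f a b B : a <= b -> ccontinuous f ->
  (forall x, a <= x <= b -> normc (f x) <= B) -> normc (cintegral `[a, b] f) <= 2 * (B * (b - a)).
Proof.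
move=> ab cf fB; have cB : continuous (fun _ : R => B) by exact: cst_continuous.
have h := normc_cintegral (@measurable_itv R `[a, b]) (cintegrable_cont a b cf)
  (integrable_cont a b cB).
apply: le_trans (h _) _; first by move=> x /=; rewrite in_itv /= => /fB.
by rewrite Rintegral_cst// fine_itv.
Qed.

Definition bdlip a b B (L : R) f := (forall x, a <= x <= b -> normc (f x) <= B) /\
  (forall x y, a <= x <= y -> y <= b -> normc (f y - f x) <= L * (y - x)).

Lemma bdlipM a b B1 L1 B2 L2 f g : a <= b -> bdlip a b B1 L1 f -> bdlip a b B2 L2 g ->
  bdlip a b (B1 * B2) (L1 * B2 + B1 * L2) (fun x => f x * g x).
Proof.
move=> ab [fB fL] [gB gL]; split => [x xI|x y xy yb].
  by rewrite ComplexField.Normc.normcM ler_pM ?normc_ge0 ?fB ?gB.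
have xI : a <= x <= b by lra. have yI : a <= y <= b by lra.
have -> : f y * g y - f x * g x = (f y - f x) * g y + f x * (g y - g x) by ring.
apply: le_trans (normcD _ _) _; rewrite !ComplexField.Normc.normcM mulrDl.
have h1 := ler_pM (normc_ge0 _) (normc_ge0 _) (fL x y xy yb) (gB y yI).
have h2 := ler_pM (normc_ge0 _) (normc_ge0 _) (fB x xI) (gL x y xy yb).
by apply: le_trans (lerD h1 h2) _; apply: le_of_eq; ring.
Qed.

Lemma bdlip_conj a b B L f : bdlip a b B L f -> bdlip a b B L (fun x => conjc (f x)).
Proof.
move=> [fB fL]; split => [x xI|x y xy yb]; first by rewrite normc_conj fB.
by rewrite -rmorphB normc_conj fL.
Qed.

Lemma bdlip_cis a b L P : (forall x y, a <= x <= y -> y <= b -> `|P y - P x| <= L * (y - x)) ->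
  bdlip a b 1 L (fun x => cis (P x)).
Proof.
move=> PL; split => [x _|x y xy yb]; first by rewrite normc_cis.
by apply: le_trans (normc_cisB _ _) _; exact: PL.
Qed.

Lemma bdlip_parts a b B L f : a <= b -> 0 <= L -> bdlip a b B L f ->
  parts_bound a b (4 * (B + L * (b - a))) (fun x => Re (f x)) /\
  parts_bound a b (4 * (B + L * (b - a))) (fun x => Im (f x)).
Proof.
move=> ab L0 [fB fL]; split; apply: parts_bound_lipschitz => //.
- by move=> x xI; apply: le_trans (normc_Re _) (fB x xI).
- by move=> x y xy yb; rewrite -cReN -cReD; apply: le_trans (normc_Re _) (fL x y xy yb).
- by move=> x xI; apply: le_trans (normc_Im _) (fB x xI).
- by move=> x y xy yb; rewrite -cImN -cImD; apply: le_trans (normc_Im _) (fL x y xy yb).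
Qed.

Lemma cderiv_bdlip F f a b B : cderiv F f -> ccontinuous f ->
  (forall x, a <= x <= b -> normc (f x) <= B) ->
  forall x y, a <= x <= y -> y <= b -> normc (F y - F x) <= 2 * B * (y - x).
Proof.
move=> dF cf fB x y /andP[ax xy] yb; rewrite -(cFTC2 xy dF cf) -mulrA.
by apply: cintegral_bound => // z /andP[xz zy]; apply: fB; lra.
Qed.

Lemma normc_i : normc ('i : R[i]) = 1.
Proof. by rewrite /ComplexField.Normc.normc /= expr0n expr1n add0r sqrtr1. Qed.

(** Integration by parts against the primitive e^{ikx} / (ik), of size 1 / |k|. The amplitude is not
    differentiated: being Lipschitz, it enters through [parts_bound]. *)
Lemma oscillatory_bound (k : R) a b B L f : a <= b -> 0 <= L -> k != 0 -> bdlip a b B L f ->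
  normc (cintegral `[a, b] (fun x => cis (k * x) * f x)) <= 16 * (B + L * (b - a)) / `|k|.
Proof.
move=> ab L0 k0 bf; have [p1 p2] := bdlip_parts ab L0 bf.
pose c : R[i] := ('i * k%:C)^-1.
have kC0 : 'i * k%:C != 0 :> R[i].
  apply/eqP => /(congr1 (@ComplexField.Normc.normc R)); rewrite ComplexField.Normc.normcM normc_real ComplexField.Normc.normc0.
  rewrite normc_i mul1r => /eqP.
  by rewrite normr_eq0 (negbTE k0).
have e : (fun x => cis (k * x + 0)) = (fun x => cis (k * x)) by apply/funext => x; rewrite addr0.
have dc : cderiv (fun x => c * cis (k * x)) (fun x => cis (k * x)).
  have h := cderiv_cis k 0; rewrite e in h; have := cderivZ c h; congr cderiv; apply/funext => x.
  by rewrite addr0 mulrA mulVf// mul1r.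
have nc : normc c = `|k|^-1.
  have h : normc c * `|k| = 1.
    have : normc (c * ('i * k%:C)) = 1 by rewrite mulVf ?ComplexField.Normc.normc1.
    by rewrite !ComplexField.Normc.normcM normc_real normc_i mul1r.
  by rewrite -[LHS]mulr1 -(@mulfV _ `|k|) ?normr_eq0// mulrA h mul1r.
have hS x : a <= x <= b -> normc (c * cis (k * x)) <= `|k|^-1.
  by move=> _; apply: le_of_eq; rewrite ComplexField.Normc.normcM normc_cis mulr1.
by apply: le_trans (cparts ab dc (ccontinuous_cis k) p1 p2 hS) _; apply: le_of_eq; ring.
Qed.

Lemma ccontinuous_unif f (fN : nat -> R -> R[i]) (e : nat -> R) : (forall N, ccontinuous (fN N)) ->
  (forall N x, normc (f x - fN N x) <= e N) -> e @ \oo --> 0 -> ccontinuous f.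
Proof.
move=> cN fe /cvgr0Pnorm_lt e0.
have unif p (pN : nat -> R -> R) : (forall N, continuous (pN N)) ->
    (forall N x, `|p x - pN N x| <= e N) -> continuous p.
  move=> cpN pe x; apply/cvgrPdist_lt => d d0.
  have d3 : 0 < d / 3 by rewrite divr_gt0.
  have [N _ /(_ N (leqnn N)) /= hN] := e0 _ d3.
  have := cpN N x => /cvgrPdist_lt/(_ _ d3); apply: filterS => y hy.
  have := pe N x; have := pe N y; move: hN hy; rewrite !ltr_norml !ler_norml.
  by lra.
split.
  apply: (unif _ (fun N x => Re (fN N x))) => [N|N x]; first by case: (cN N).
  by rewrite -cReN -cReD; apply: le_trans (normc_Re _) (fe N x).
apply: (unif _ (fun N x => Im (fN N x))) => [N|N x]; first by case: (cN N).
by rewrite -cImN -cImD; apply: le_trans (normc_Im _) (fe N x).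
Qed.

End ComplexCalculus.

(** * Truncated cubic sums and their resonant terms *)

Section BoxSplit.
Variable V : zmodType.
Implicit Types (n p q : int) (N M : nat) (F : int * int -> V).

Definition boxpairs N n : seq (int * int) :=
  [seq x <- [seq (p, q) | p <- zbox N, q <- zbox N] | x.1 + x.2 - n \in zbox N].

Lemma mem_boxpairs N n x : (x \in boxpairs N n) =
  [&& x.1 \in zbox N, x.2 \in zbox N & x.1 + x.2 - n \in zbox N].
Proof.
rewrite mem_filter andbC andbA; congr andb.
apply/allpairsP/andP => [[[p q] [h1 h2 ->]]//|[h1 h2]].
by exists x; split => //; case: x {h1 h2}.
Qed.

Lemma uniq_boxpairs N n : uniq (boxpairs N n).
Proof.
by rewrite filter_uniq// allpairs_uniq ?uniq_zbox// => -[p q] [p' q'] _ _ /= [-> ->].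
Qed.

Lemma big_boxpairs N n F :
  \sum_(p <- zbox N) \sum_(q <- zbox N | p + q - n \in zbox N) F (p, q) =
  \sum_(x <- boxpairs N n) F x.
Proof.
rewrite [RHS]big_filter [RHS]big_mkcond [RHS]big_allpairs_dep /=; apply: eq_bigr => p _.
by rewrite big_mkcond.
Qed.

Lemma boxpairs_split N M n F : (N <= M)%N -> \sum_(x <- boxpairs M n) F x =
  \sum_(x <- boxpairs N n) F x + \sum_(x <- boxpairs M n | x \notin boxpairs N n) F x.
Proof.
move=> NM; rewrite (bigID (mem (boxpairs N n))) /=; congr (_ + _).
rewrite -big_filter; apply: perm_big; apply: uniq_perm.
- by rewrite filter_uniq// uniq_boxpairs.
- exact: uniq_boxpairs.
move=> x; rewrite mem_filter !mem_boxpairs andb_idr// => /and3P[h1 h2 h3].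
by rewrite !(zbox_sub NM).
Qed.

End BoxSplit.

Section CubicSums.
Variable R : realType.
Implicit Types (n p q : int) (N M : nat) (c : int -> R[i]) (a : int -> R).

(** Enlarging the box adds the same pairs to both sums, so the tail of the one is majorized term by
    term by the tail of the other. *)
Lemma csum_diff N M c a n : (forall m, normc (c m) <= a m) -> (N <= M)%N ->
  normc (csum M c n - csum N c n) <= asum M a n - asum N a n.
Proof.
move=> ca NM; rewrite /csum /asum.
rewrite !(big_boxpairs _ _ (fun x => c x.1 * conjc (c (x.1 + x.2 - n)) * c x.2)).
rewrite !(big_boxpairs _ _ (fun x => a x.1 * a (x.1 + x.2 - n) * a x.2)).
rewrite (boxpairs_split n (fun x => c x.1 * conjc (c (x.1 + x.2 - n)) * c x.2) NM).
rewrite (boxpairs_split n (fun x => a x.1 * a (x.1 + x.2 - n) * a x.2) NM).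
rewrite ![_ + _ - _]addrAC !subrr !add0r.
apply: le_trans (normc_sum _ _ _) _; apply: ler_sum => x _.
by rewrite !ComplexField.Normc.normcM normc_conj !ler_pM ?mulr_ge0 ?normc_ge0.
Qed.

Definition csum_nr N c n : R[i] :=
  \sum_(p <- zbox N) \sum_(q <- zbox N | p + q - n \in zbox N)
    if (p == n) || (q == n) then 0 else c p * conjc (c (p + q - n)) * c q.

(** Inclusion--exclusion over p = n and q = n; the doubly counted term p = q = n is the
    correction. *)
Lemma csum_resonance N c n : n \in zbox N -> csum N c n = csum_nr N c n +
  ((2 * \sum_(q <- zbox N) normc (c q) ^+ 2) - normc (c n) ^+ 2)%:C * c n.
Proof.
move=> nN; pose F p q := c p * conjc (c (p + q - n)) * c q.
pose r p q : R[i] := (if p == n then (normc (c q) ^+ 2)%:C * c n else 0) +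
  (if q == n then (normc (c p) ^+ 2)%:C * c n else 0) -
  (if (p == n) && (q == n) then (normc (c n) ^+ 2)%:C * c n else 0).
have e p q : F p q = (if (p == n) || (q == n) then 0 else F p q) + r p q.
  rewrite /r /F; have [->|pn] := eqVneq p n.
    have [->|qn] := eqVneq q n; first by rewrite /= addrK -mul_conjc; ring.
    by rewrite /= [n + q]addrC addrK -mul_conjc; ring.
  have [->|qn] := eqVneq q n; last by rewrite /= !subr0 !addr0.
  by rewrite /= addrK -mul_conjc; ring.
rewrite /csum -/F (eq_bigr (fun p => \sum_(q <- zbox N | p + q - n \in zbox N)
   (if (p == n) || (q == n) then 0 else F p q) + \sum_(q <- zbox N | p + q - n \in zbox N) r p q)).
  2: by move=> p _; rewrite -big_split; apply: eq_bigr => q _; exact: e.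
rewrite big_split; congr (_ + _).
have pick (G : int -> R[i]) : \sum_(q <- zbox N) (if q == n then G q else 0) = G n.
  by rewrite (bigD1_seq n) ?uniq_zbox//= eqxx big1 ?addr0// => q /negbTE ->.
have full p : \sum_(q <- zbox N | p + q - n \in zbox N) r p q =
    \sum_(q <- zbox N) (if p + q - n \in zbox N then r p q else 0) by rewrite big_mkcond.
rewrite (eq_big_seq (fun p => (if p == n then \sum_(q <- zbox N) (normc (c q) ^+ 2)%:C * c n else 0) +
   (normc (c p) ^+ 2)%:C * c n - (if p == n then (normc (c n) ^+ 2)%:C * c n else 0))); last first.
  move=> p pN; rewrite full /r.
  rewrite (eq_big_seq (fun q => (if p == n then (normc (c q) ^+ 2)%:C * c n else 0) +
    (if q == n then (normc (c p) ^+ 2)%:C * c n else 0) -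
    (if q == n then (if p == n then (normc (c n) ^+ 2)%:C * c n else 0) else 0))); last first.
    move=> q qN; have [->|pn] := eqVneq p n.
      by rewrite [n + q]addrC addrK qN /=; case: eqP.
    have [->|qn] := eqVneq q n; first by rewrite addrK pN.
    by rewrite /= !subr0 !addr0; case: ifP.
  rewrite sumrB big_split /= !pick; case: eqP => //= _.
  by rewrite big1.
rewrite sumrB big_split /= !pick -mulr_suml -realC_sum [2 * _]mulr_natl mulr2n rmorphB rmorphD /=.
by ring.
Qed.

End CubicSums.

(** * Duhamel's formula in interaction variables, with the gauge *)

Section GaugedDuhamel.
Variable R : realType.
Local Notation mu := (@lebesgue_measure R).
Implicit Types (n p q : int) (N M : nat) (t x y : R).

(** Otherwise [tri_weight], for admissible parameters, would bound a positive power of <n> by 0. *)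
Lemma phase_neq0 (al : R) p q n : 1 < al < 2 -> p != n -> q != n ->
  frac_symbol al p - frac_symbol al (p + q - n) + frac_symbol al q - frac_symbol al n != 0 :> R.
Proof.
move=> al12 pn qn; apply/negP => /eqP ph.
have := @tri_weight R al 0 (1 / 2) (1 / 2) p q n al12.
rewrite ph normr0 !mul0r mulr0 mulr0 add0r => /(_ _ _ _ _ _ pn qn) h.
have : wt R n `^ (1 / 2 + (al - 1 - 1 / 2)) <= 0 by apply: h; lra.
by rewrite leNgt powR_gt0// wt_gt0.
Qed.

Lemma ccontinuous_real (p : R -> R) : continuous p -> ccontinuous (fun x => (p x)%:C).
Proof. by move=> cp; split => //; exact: cst_continuous. Qed.

Lemma continuous_normc2 (f : R -> R[i]) : ccontinuous f -> continuous (fun x => normc (f x) ^+ 2).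
Proof.
move=> [c1 c2] x; under eq_fun do rewrite normcE_sqr.
by apply: cvgD; [apply: cvgM; exact: c1|apply: cvgM; exact: c2].
Qed.

Lemma tail_cvg0 (v : nat -> R) (l : R) : v @ \oo --> l -> l - v N @[N --> \oo] --> 0.
Proof. by move=> vl; rewrite -[X in _ --> X](subrr l); apply: cvgB => //; exact: cvg_cst. Qed.

(** c, G and gh stand for the coefficients of u, |u|^2 u and g. The time-dependent ones are defined
    for all t, being frozen outside [-delta, delta] where the section is applied; a and A3 majorize
    them uniformly in t. *)
Variables (al delta sgr : R) (c G : int -> R -> R[i]) (gh : int -> R[i]) (a A3 : int -> R).
Variables (Ka : R).
Hypotheses (al12 : 1 < al < 2) (delta0 : 0 <= delta) (sgr1 : `|sgr| = 1).
Hypothesis c_cont : forall n, ccontinuous (c n).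
Hypothesis ca : forall n t, normc (c n t) <= a n.
Hypothesis aK : sumle (fun n => a n ^+ 2) Ka.
Hypothesis asumA : forall n, asum N a n @[N --> \oo] --> A3 n.
Hypothesis Gcvg : forall n t, normc (G n t - csum N (c ^~ t) n) @[N --> \oo] --> 0.
Local Notation om := (@frac_symbol R al).
Hypothesis duh : forall n t, - delta <= t <= delta -> c n t = cis (t * om n) * gh n -
  (0 +i* 1) * sgr%:C * cintegral0 t (fun t' => cis ((t - t') * om n) * G n t').

Lemma core_a_ge0 n : 0 <= a n.
Proof. exact: le_trans (normc_ge0 _) (ca n 0). Qed.

Lemma core_asum_le N n : asum N a n <= A3 n.
Proof.
rewrite -(cvg_lim _ (@asumA n))//; apply: limr_ge; first by apply/cvg_ex; exists (A3 n).
exists N => // M /= NM; apply: boxsum_mono => // p q.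
by rewrite !mulr_ge0 ?core_a_ge0.
Qed.

Lemma core_A3_ge0 n : 0 <= A3 n.
Proof.
apply: le_trans (core_asum_le 0 n); apply: boxsum_ge0 => p q.
by rewrite !mulr_ge0 ?core_a_ge0.
Qed.

(** G is given as a limit pointwise in t. The majorant makes the convergence uniform, hence G
    continuous in time and its primitives available. *)
Lemma G_tail N n t : normc (G n t - csum N (c ^~ t) n) <= A3 n - asum N a n.
Proof.
apply/ler_addgt0Pr => e e0; have := Gcvg n t; move=> /cvgr0Pnorm_le/(_ _ e0)[M _ hM].
pose L := maxn M N; have := hM L (leq_maxl _ _).
rewrite /= (ger0_norm (normc_ge0 _)) => h1.
have h2 : normc (csum L (c ^~ t) n - csum N (c ^~ t) n) <= asum L a n - asum N a n.
  by apply: csum_diff; [move=> m; exact: ca|exact: leq_maxr].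
have h3 := core_asum_le L n.
rewrite -(subrKA (csum L (c ^~ t) n)).
by apply: le_trans (normcD _ _) _; lra.
Qed.

Lemma csum_continuous N n : ccontinuous (fun t => csum N (c ^~ t) n).
Proof.
apply: ccontinuous_sum => p; apply: ccontinuous_sum => q.
by apply: ccontinuousM => //; apply: ccontinuousM => //; exact: ccontinuous_conj.
Qed.

Lemma G_continuous n : ccontinuous (G n).
Proof.
apply: (ccontinuous_unif (fun N => csum_continuous N n) (fun N t => G_tail N n t)).
exact: tail_cvg0 (@asumA n).
Qed.

Lemma normc_G n t : normc (G n t) <= A3 n.
Proof.
rewrite -[G n t](subrK (csum 0 (c ^~ t) n)); apply: le_trans (normcD _ _) _.
have := G_tail 0 n t; have := @normc_csum R 0 (c ^~ t) a n (fun m => ca m t); lra.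
Qed.

Definition ms N t : R := \sum_(q <- zbox N) normc (c q t) ^+ 2.

(** Sum of the |c_n(t)|^2. It is continuous as a uniform limit, so that the gauge angle can be
    defined as a primitive. *)
Definition mass t : R := limn (ms ^~ t).

Definition as2 N : R := \sum_(q <- zbox N) a q ^+ 2.

Lemma as2_cvg : cvgn as2.
Proof.
apply: nondecreasing_is_cvgn.
  move=> N M NM; apply: ler_sum_subset; [|exact: uniq_zbox|exact: zbox_sub].
  by move=> q; exact: sqr_ge0.
by exists Ka => _ [N _ <-]; apply: aK; exact: uniq_zbox.
Qed.

Lemma normc2_le n t : normc (c n t) ^+ 2 <= a n ^+ 2.
Proof. by rewrite lerXn2r ?nnegrE ?normc_ge0 ?core_a_ge0. Qed.

Lemma zbox_diff (f : int -> R) N M : (N <= M)%N -> \sum_(q <- zbox M) f q -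
  \sum_(q <- zbox N) f q = \sum_(q <- zbox M | q \notin zbox N) f q.
Proof.
move=> NM; have -> : \sum_(q <- zbox N) f q = \sum_(q <- zbox M | q \in zbox N) f q.
  rewrite -[RHS]big_filter; apply: perm_big; rewrite perm_sym.
  apply: uniq_perm; rewrite ?filter_uniq ?uniq_zbox// => q.
  by rewrite mem_filter andb_idr//; exact: zbox_sub.
by rewrite (bigID (mem (zbox N))) /= addrAC subrr add0r.
Qed.

Lemma ms_nd t : {homo ms ^~ t : N M / (N <= M)%N >-> N <= M}.
Proof.
move=> N M NM; apply: ler_sum_subset; [|exact: uniq_zbox|exact: zbox_sub].
by move=> q; exact: sqr_ge0.
Qed.

Lemma ms_cvg t : cvgn (ms ^~ t).
Proof.
apply: nondecreasing_is_cvgn; first exact: ms_nd.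
exists Ka => _ [N _ <-]; apply: le_trans (aK (uniq_zbox N)).
by apply: ler_sum => q _; exact: normc2_le.
Qed.

Lemma ms_tail N t : 0 <= mass t - ms N t <= limn as2 - as2 N.
Proof.
have le1 : ms N t <= mass t.
  by apply: limr_ge; [exact: ms_cvg|exists N => // M /= NM; exact: ms_nd].
rewrite subr_ge0 le1 /= lerBlDr; apply: limr_le; first exact: ms_cvg.
exists N => // M /= NM; rewrite -lerBlDr.
apply: (@le_trans _ _ (as2 M - as2 N)).
  rewrite /ms /as2 !zbox_diff//; apply: ler_sum => q _; exact: normc2_le.
rewrite lerD2r; apply: limr_ge; first exact: as2_cvg.
exists M => // M' /= MM; apply: ler_sum_subset; [|exact: uniq_zbox|exact: zbox_sub].
by move=> q; exact: sqr_ge0.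
Qed.

Lemma ms_continuous N : continuous (ms N).
Proof.
move=> t; rewrite /ms; apply: cvg_sum => q.
exact: (continuous_normc2 (c_cont q)).
Qed.

Lemma mass_continuous : continuous mass.
Proof.
have [] : ccontinuous (fun t => (mass t)%:C) => //.
apply: (@ccontinuous_unif R _ (fun N t => (ms N t)%:C) (fun N => limn as2 - as2 N)).
- by move=> N; exact/ccontinuous_real/ms_continuous.
- move=> N t; rewrite -rmorphB normc_real.
  by have /andP[h1 h2] := ms_tail N t; rewrite ger0_norm.
- exact: tail_cvg0 as2_cvg.
Qed.

Lemma mass_bound t : 0 <= mass t <= Ka.
Proof.
apply/andP; split.
  by have /andP[h _] := ms_tail 0 t; rewrite subr_ge0 in h; apply: le_trans h;
     apply: sumr_ge0 => q _; exact: sqr_ge0.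
apply: limr_le; first exact: ms_cvg.
exists 0%N => // N _; apply: le_trans (aK (uniq_zbox N)).
by apply: ler_sum => q _; exact: normc2_le.
Qed.

(** The factor e^{i Th} then has logarithmic derivative 2 i sgr mass, opposite to the resonant term
    2 mass c_n as it appears in the equation for V. *)
Lemma gauge_exists : exists Th : R -> R, Th 0 = 0 /\
  forall t, is_derive t 1 Th (2 * sgr * mass t).
Proof.
apply: primitive_exists => t; apply: cvgM; first exact: cvg_cst.
exact: mass_continuous.
Qed.

Definition gam : R[i] := (0 +i* 1) * sgr%:C.

Lemma normc_gam : normc gam = 1.
Proof.
rewrite /gam ComplexField.Normc.normcM normc_real sgr1 mulr1.
by rewrite /ComplexField.Normc.normc expr0n expr1n add0r sqrtr1.
Qed.

Lemma normc_gamM z : normc (- gam * z) = normc z.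
Proof. by rewrite mulNr normcN ComplexField.Normc.normcM normc_gam mul1r. Qed.

(** The interaction variables. V is built as a primitive, hence differentiable on the whole line; it
    agrees with the twisted coefficients on [-delta, delta], where Duhamel's formula holds. *)
Lemma twist_exists : exists V : int -> R -> R[i], forall n,
  [/\ V n 0 = gh n, cderiv (V n) (fun t => - gam * (cis (- om n * t) * G n t)) &
   forall t, - delta <= t <= delta -> V n t = cis (- om n * t) * c n t].
Proof.
suff H n : exists Vn : R -> R[i], [/\ Vn 0 = gh n,
    cderiv Vn (fun t => - gam * (cis (- om n * t) * G n t)) &
    forall t, - delta <= t <= delta -> Vn t = cis (- om n * t) * c n t].
  by have [V hV] := choice H; exists V.
have ch : ccontinuous (fun t => cis (- om n * t) * G n t).
  by apply: ccontinuousM; [exact: ccontinuous_cis|exact: G_continuous].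
have [P [P0 dP]] := cprimitive ch.
exists (fun t => gh n + - gam * P t); split; first by rewrite P0 mulr0 addr0.
- have dg : cderiv (fun _ : R => gh n) (fun=> 0).
    by move=> x; split; exact: is_derive_cst.
  have dZ := cderivZ (- gam) dP.
  move=> x; have [h1 h2] := dZ x; have [g1 g2] := dg x; split.
    have := is_deriveD g1 h1; rewrite add0r.
    by congr is_derive; apply/funext => y; rewrite cReD.
  have := is_deriveD g2 h2; rewrite add0r.
  by congr is_derive; apply/funext => y; rewrite cImD.
move=> t tI; rewrite (duh n tI) -/gam.
have -> : (fun t' => cis ((t - t') * om n) * G n t') =
    (fun t' => cis (t * om n) * (cis (- om n * t') * G n t')).
  by apply/funext => t'; rewrite mulrA -cisD; congr (cis _ * _); ring.
rewrite (@cintegral0E R (fun t' => cis (t * om n) * P t')).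
- have c1 : cis (- om n * t) * cis (t * om n) = 1.
    by rewrite -cisD (_ : - om n * t + t * om n = 0) ?cis0//; ring.
  rewrite mulrBr [X in _ = X - _]mulrA c1 mul1r [gam * _]mulrCA [X in _ = _ - X]mulrA c1 mul1r.
  by rewrite mulNr.
- by rewrite P0 mulr0.
- exact: cderivZ.
- by apply: ccontinuousM => //; exact: ccontinuous_cst.
Qed.

Section WithTwist.
Variables (V : int -> R -> R[i]) (Th : R -> R).
Hypothesis V0 : forall n, V n 0 = gh n.
Hypothesis dV : forall n, cderiv (V n) (fun t => - gam * (cis (- om n * t) * G n t)).
Hypothesis VE : forall n t, - delta <= t <= delta -> V n t = cis (- om n * t) * c n t.
Hypothesis Th0 : Th 0 = 0.
Hypothesis dTh : forall t, is_derive t 1 Th (2 * sgr * mass t).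

(** A common bound for V n and its Lipschitz constant. The derivative of V n is at most A3 n, and
    the factor 2 comes from the components. *)
Definition Bd n := a n + 2 * A3 n.

Lemma V_cont n : ccontinuous (V n).
Proof. exact: cderiv_continuous (dV n). Qed.

Lemma dV_cont n : ccontinuous (fun t => - gam * (cis (- om n * t) * G n t)).
Proof.
apply: ccontinuousM; first exact: ccontinuous_cst.
by apply: ccontinuousM; [exact: ccontinuous_cis|exact: G_continuous].
Qed.

Lemma V_bdlip n : bdlip (- delta) delta (Bd n) (Bd n) (V n).
Proof.
have a0 := core_a_ge0 n; have A0 := core_A3_ge0 n.
split => [t tI|x y xy yd].
  rewrite VE// ComplexField.Normc.normcM normc_cis mul1r; apply: le_trans (ca n t) _.
  by rewrite /Bd; lra.
have bd t : - delta <= t <= delta -> normc (- gam * (cis (- om n * t) * G n t)) <= A3 n.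
  by move=> _; rewrite normc_gamM ComplexField.Normc.normcM normc_cis mul1r normc_G.
apply: le_trans (cderiv_bdlip (dV n) (dV_cont n) bd xy yd) _.
by rewrite ler_wpM2r ?subr_ge0 /Bd; lra.
Qed.

Lemma Th_lip x y : - delta <= x <= y -> y <= delta -> `|Th y - Th x| <= 2 * Ka * (y - x).
Proof.
move=> /andP[dx xy] yd; pose p t := 2 * sgr * mass t.
have cp : continuous p by move=> t; apply: cvgM; [exact: cvg_cst|exact: mass_continuous].
rewrite -(FTC2R xy dTh cp) -(fine_itv xy).
apply: normr_Rintegral_le => //; first exact: itv_fin.
  exact: integrable_cont.
move=> t _; have /andP[m0 mK] := mass_bound t.
by rewrite /p !normrM sgr1 mulr1 (ger0_norm m0) ger0_norm// ler_wpM2l.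
Qed.

(** The constant of [oscillatory_bound] for an amplitude of size P: its Lipschitz constant is (2 Ka
    + 3) P, from the gauge angle and the three factors V, on an interval of length at most 2
    delta. *)
Definition kosc := 16 * (1 + (2 * Ka + 3) * (2 * delta)).

Lemma Ka_ge0 : 0 <= Ka. Proof. exact: sumle_ge0 aK. Qed.

Lemma Bd_ge0 n : 0 <= Bd n.
Proof. by have := core_a_ge0 n; have := core_A3_ge0 n; rewrite /Bd; lra. Qed.

Definition nrterm n (z : int * int) t : R[i] :=
  if (z.1 == n) || (z.2 == n) then 0 else
  cis (Th t) * (cis (- om n * t) * (c z.1 t * conjc (c (z.1 + z.2 - n) t) * c z.2 t)).

Lemma nrterm_cont n z : ccontinuous (nrterm n z).
Proof.
rewrite /nrterm; case: ((z.1 == n) || (z.2 == n)); first exact: ccontinuous_cst.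
apply: ccontinuousM; first exact: ccontinuous_cis_comp dTh.
apply: ccontinuousM; first exact: ccontinuous_cis.
by apply: ccontinuousM => //; apply: ccontinuousM => //; exact: ccontinuous_conj.
Qed.

(** Written in V, the integrand is e^{ikt} times a Lipschitz amplitude, k being the phase, and
    [oscillatory_bound] gains 1 / |k|. Since [Bd] already contains the cubic sum A3, the quintic
    terms hidden in the derivative of the amplitude stay packed in [tri al Bd]. *)
Lemma nrterm_bound n z x y : - delta <= x <= y -> y <= delta ->
  normc (cintegral `[x, y] (nrterm n z)) <= kosc * tri al Bd n z.1 z.2.
Proof.
move=> /andP[dx xy] yd; rewrite /nrterm /tri; case: ifP => [_|/negbT].
  by rewrite cintegral_zero ComplexField.Normc.normc0 mulr0.
rewrite negb_or => /andP[pn qn]; set p := z.1 in pn *; set q := z.2 in qn *.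
set m := p + q - n; set k := _ - om n.
have k0 : k != 0 by exact: phase_neq0.
have sub f B L : bdlip (- delta) delta B L f -> bdlip x y B L f.
  by move=> [h1 h2]; split => [t tI|s t st ty]; [apply: h1; lra|apply: h2; lra].
pose P := Bd p * (Bd m * Bd q).
have P0 : 0 <= P by rewrite !mulr_ge0 ?Bd_ge0.
have bl : bdlip x y (1 * P) (2 * Ka * P + 1 * (Bd p * (Bd m * Bd q) + Bd p * (Bd m * Bd q + Bd m * Bd q)))
    (fun t => cis (Th t) * (V p t * (conjc (V m t) * V q t))).
  apply: bdlipM => //; first by apply: sub; apply: bdlip_cis; exact: Th_lip.
  apply: bdlipM => //; first by apply: sub; exact: V_bdlip.
  apply: bdlipM => //; first by apply: sub; apply: bdlip_conj; exact: V_bdlip.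
  by apply: sub; exact: V_bdlip.
have K0 := Ka_ge0.
have L0 : 0 <= 2 * Ka * P + 1 * (Bd p * (Bd m * Bd q) + Bd p * (Bd m * Bd q + Bd m * Bd q)).
  have -> : 2 * Ka * P + 1 * (Bd p * (Bd m * Bd q) + Bd p * (Bd m * Bd q + Bd m * Bd q)) =
    (2 * Ka + 3) * P by rewrite /P; ring.
  by apply: mulr_ge0 => //; lra.
have := oscillatory_bound xy L0 k0 bl.
rewrite (@eq_cintegral R _ (fun t => cis (k * t) * (cis (Th t) * (V p t * (conjc (V m t) * V q t))))
  (fun t => cis (Th t) * (cis (- om n * t) * (c p t * conjc (c m t) * c q t)))); last first.
  move=> t; rewrite inE /= in_itv /= => /andP[xt ty].
  rewrite !VE; [|lra..].
  have cj (s : R) w : conjc (cis s * w) = cis (- s) * conjc w.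
    by apply: complexP; rewrite !(cRe_conj, cIm_conj, cReM, cImM, cisN) /=; ring.
  have ek : cis (- om n * t) =
      cis (k * t) * cis (- om p * t) * cis (- (- om m * t)) * cis (- om q * t).
    by rewrite -!cisD /k; congr cis; ring.
  by rewrite cj ek; ring.
move=> /le_trans; apply.
have Pe : Bd p * Bd m * Bd q = P by rewrite /P mulrA.
rewrite Pe [leRHS]mulrA ler_wpM2r ?invr_ge0//.
have -> : 2 * Ka * P + 1 * (Bd p * (Bd m * Bd q) + Bd p * (Bd m * Bd q + Bd m * Bd q)) =
   (2 * Ka + 3) * P by rewrite /P; ring.
have K3 : 0 <= (2 * Ka + 3) * P by apply: mulr_ge0 => //; lra.
have yx2 : y - x <= 2 * delta by lra.
by have := ler_wpM2l K3 yx2; rewrite /kosc; lra.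
Qed.

(** What the truncation to a box leaves out: the tails of the cubic sum and of the mass. *)
Definition err N n t : R[i] := cis (Th t) *
  (cis (- om n * t) * (G n t - csum N (c ^~ t) n) - (2 * (mass t - ms N t))%:C * V n t).

Definition cube n t : R[i] := - (cis (Th t) * ((normc (c n t) ^+ 2)%:C * V n t)).

Lemma err_cont N n : ccontinuous (err N n).
Proof.
apply: ccontinuousM; first exact: ccontinuous_cis_comp dTh.
have cN f : ccontinuous f -> ccontinuous (fun t => - f t).
  move=> cf; have := ccontinuousM (ccontinuous_cst (-1)) cf.
  by congr ccontinuous; apply/funext => t; rewrite mulN1r.
apply: ccontinuousD.
  apply: ccontinuousM; first exact: ccontinuous_cis.
  by apply: ccontinuousD; [exact: G_continuous|apply: cN; exact: csum_continuous].
apply: cN; apply: ccontinuousM; last exact: V_cont.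
apply: ccontinuous_real => t; apply: cvgM; first exact: cvg_cst.
by apply: cvgB; [exact: mass_continuous|exact: ms_continuous].
Qed.

Lemma cube_cont n : ccontinuous (cube n).
Proof.
have := ccontinuousM (ccontinuous_cst (-1)) (ccontinuousM (ccontinuous_cis_comp dTh)
  (ccontinuousM (ccontinuous_real (continuous_normc2 (c_cont n))) (V_cont n))).
by congr ccontinuous; apply/funext => t; rewrite mulN1r.
Qed.

Definition dgauged n t : R[i] := (gam * (2 * mass t)%:C) * cis (Th t) * V n t +
  cis (Th t) * (- gam * (cis (- om n * t) * G n t)).

(** By [csum_resonance] the term 2 [ms N] V of the cubic sum meets the derivative 2 mass V of the
    gauge; they cancel up to the tail of the mass, which goes to [err], and the diagonal correction
    is [cube]. *)
Lemma dy_split N n t : n \in zbox N -> - delta <= t <= delta ->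
  dgauged n t = - gam * (cube n t + (\sum_(z <- boxpairs N n) nrterm n z t + err N n t)).
Proof.
move=> nN tI.
have nr : \sum_(z <- boxpairs N n) nrterm n z t =
    cis (Th t) * (cis (- om n * t) * csum_nr N (c ^~ t) n).
  rewrite -big_boxpairs /csum_nr !mulr_sumr; apply: eq_bigr => p _.
  rewrite !mulr_sumr; apply: eq_bigr => q _; rewrite /nrterm /=.
  by case: ifP; rewrite ?mulr0.
have res := csum_resonance (c ^~ t) nN; rewrite -/(ms N t) in res.
have -> : err N n t = cis (Th t) * (cis (- om n * t) * G n t) -
    cis (Th t) * (cis (- om n * t) * csum_nr N (c ^~ t) n) -
    cis (Th t) * ((2 * mass t - normc (c n t) ^+ 2)%:C * V n t).
  rewrite /err res (VE n tI) !rmorphB !rmorphM /= !rmorphB /=; ring.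
rewrite nr /dgauged /cube rmorphB /=; ring.
Qed.

Lemma dgauged_cont n : ccontinuous (dgauged n).
Proof.
apply: ccontinuousD.
  apply: ccontinuousM; last exact: V_cont.
  apply: ccontinuousM; last exact: ccontinuous_cis_comp dTh.
  apply: ccontinuousM; first exact: ccontinuous_cst.
  by apply: ccontinuous_real => t; apply: cvgM; [exact: cvg_cst|exact: mass_continuous].
by apply: ccontinuousM; [exact: ccontinuous_cis_comp dTh|exact: dV_cont].
Qed.

Lemma dy_bound N n x y : n \in zbox N -> - delta <= x <= y -> y <= delta ->
  normc (cintegral `[x, y] (dgauged n)) <= 4 * delta * a n ^+ 3 +
   (kosc * boxsum N (tri al Bd n) n +
    4 * delta * (A3 n - asum N a n + 2 * (limn as2 - as2 N) * a n)).
Proof.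
move=> nN /andP[dx xy] yd; have mI := @measurable_itv R `[x, y].
have xyd : y - x <= 2 * delta by lra.
have [ci1 ci2] := (cintegrable_cont x y (cube_cont n), cintegrable_cont x y (err_cont N n)).
have [si se] := cintegral_sum (boxpairs N n) mI
  (fun z => cintegrable_cont x y (nrterm_cont n z)).
have s2 := cintegrableD mI si ci2; have s3 := cintegrableD mI ci1 s2.
rewrite (@eq_cintegral R _ _ (fun t => - gam * (cube n t +
  (\sum_(z <- boxpairs N n) nrterm n z t + err N n t)))); last first.
  move=> t; rewrite inE /= in_itv /= => /andP[xt ty]; apply: dy_split => //; lra.
rewrite (cintegralZ _ mI s3) (cintegralD mI ci1 s2) (cintegralD mI si ci2) se.
rewrite normc_gamM.
have a0 := core_a_ge0 n.
have Vn t : - delta <= t <= delta -> normc (V n t) <= a n.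
  by move=> tI; rewrite VE// ComplexField.Normc.normcM normc_cis mul1r ca.
apply: le_trans (normcD _ _) _; apply: lerD.
  apply: le_trans (cintegral_bound xy (cube_cont n) (_ : forall t, _ -> _ <= a n ^+ 3)) _.
    move=> t tI; rewrite /cube normcN !ComplexField.Normc.normcM normc_cis mul1r normc_real.
    have Vt : normc (V n t) <= a n by apply: Vn; lra.
    by rewrite ger0_norm ?sqr_ge0// [_ ^+ 3]exprSr ler_pM ?sqr_ge0 ?normc_ge0 ?normc2_le.
  have : 0 <= a n ^+ 3 by rewrite exprn_ge0.
  by move=> a3; have := ler_wpM2l a3 xyd; lra.
apply: le_trans (normcD _ _) _; apply: lerD.
  apply: le_trans (normc_sum _ _ _) _.
  rewrite [boxsum N _ n](big_boxpairs N n (fun z => tri al Bd n z.1 z.2)) mulr_sumr.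
  by apply: ler_sum => z _; apply: nrterm_bound => //; rewrite dx.
set E := A3 n - asum N a n + 2 * (limn as2 - as2 N) * a n.
have Eb t : - delta <= t <= delta -> normc (err N n t) <= E.
  move=> tI; rewrite /err ComplexField.Normc.normcM normc_cis mul1r.
  apply: le_trans (normcB _ _) _; rewrite !ComplexField.Normc.normcM normc_cis mul1r.
  apply: lerD; first exact: G_tail.
  have /andP[m1 m2] := ms_tail N t.
  by rewrite normc_real ger0_norm ?mulr_ge0// ler_pM ?mulr_ge0 ?normc_ge0 ?Vn// ler_wpM2l.
have E0 : 0 <= E by apply: le_trans (normc_ge0 (err N n 0)) (Eb 0 _); lra.
apply: le_trans (cintegral_bound xy (err_cont N n) (_ : forall t, _ -> _ <= E)) _.
  by move=> t tI; apply: Eb; lra.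
by have := ler_wpM2l E0 xyd; lra.
Qed.

Lemma gauged_bound n t (T : int -> R) : (forall N, boxsum N (tri al Bd n) n <= T n) ->
  - delta <= t <= delta ->
  normc (cis (Th t) * V n t - gh n) <= 4 * delta * a n ^+ 3 + kosc * T n.
Proof.
move=> bT tI; have K0 : 0 <= kosc.
  by rewrite /kosc; have := Ka_ge0; have := delta0 => d0 k0; rewrite mulr_ge0// addr_ge0// !mulr_ge0// addr_ge0// mulr_ge0.
pose L := normc (cis (Th t) * V n t - gh n).
have dgaugedP : cderiv (fun t => cis (Th t) * V n t) (dgauged n).
  have := cderivM (cderiv_cis_comp dTh) (@dV n); congr cderiv; apply/funext => s.
  have -> : 'i * (2 * sgr * mass s)%:C = gam * (2 * mass s)%:C.
    by apply: complexP; rewrite /gam !(cReM, cImM) /=; ring.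
  by [].
have key N : n \in zbox N -> L <= 4 * delta * a n ^+ 3 +
   (kosc * boxsum N (tri al Bd n) n +
    4 * delta * (A3 n - asum N a n + 2 * (limn as2 - as2 N) * a n)).
  move=> nN; have e0 : cis (Th 0) * V n 0 = gh n by rewrite Th0 cis0 mul1r V0.
  have [t0|t0] := leP 0 t.
    rewrite /L -e0 -(cFTC2 t0 dgaugedP (dgauged_cont n)); apply: dy_bound => //; lra.
  rewrite /L -e0 normcBC -(cFTC2 (ltW t0) dgaugedP (dgauged_cont n)); apply: dy_bound => //; lra.
(* For fixed n the box grows, and the tails vanish in the limit. *)
have cv : 4 * delta * a n ^+ 3 + (kosc * T n +
    4 * delta * (A3 n - asum N a n + 2 * (limn as2 - as2 N) * a n)) @[N --> \oo] -->
    4 * delta * a n ^+ 3 + (kosc * T n + 4 * delta * (A3 n - A3 n + 2 * (limn as2 - limn as2) * a n)).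
  apply: cvgD; first exact: cvg_cst.
  apply: cvgD; first exact: cvg_cst.
  apply: cvgM; first exact: cvg_cst.
  apply: cvgD; first by apply: cvgB; [exact: cvg_cst|exact: asumA].
  apply: cvgM; last exact: cvg_cst.
  apply: cvgM; first exact: cvg_cst.
  by apply: cvgB; [exact: cvg_cst|exact: as2_cvg].
rewrite !subrr mulr0 mul0r addr0 mulr0 addr0 in cv.
rewrite -/L -(cvg_lim _ cv)//; apply: limr_ge; first by apply/cvg_ex; eexists; exact: cv.
exists `|n|%N => // N /= nN; have nz : n \in zbox N by rewrite mem_zbox.
apply: le_trans (key N nz) _; rewrite lerD2l lerD2r ler_wpM2l//.
Qed.

End WithTwist.

(* The gauge angle does not depend on n. *)
Lemma gauged_duhamel (T : int -> R) :
  (forall n N, boxsum N (tri al Bd n) n <= T n) ->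
  forall t, - delta <= t <= delta -> exists th : R, forall n,
    normc (cis th * (cis (- om n * t) * c n t) - gh n) <=
    4 * delta * a n ^+ 3 + kosc * T n.
Proof.
move=> bT t tI; have [V hV] := twist_exists; have [Th [Th0 dTh]] := gauge_exists.
exists (Th t) => n; have [_ _ VE] := hV n; rewrite -VE//.
have V0 m : V m 0 = gh m by case: (hV m).
have dV m : cderiv (V m) (fun t => - gam * (cis (- om m * t) * G m t)) by case: (hV m).
have VE' m s : - delta <= s <= delta -> V m s = cis (- om m * s) * c m s.
  by case: (hV m) => _ _; apply.
exact: (gauged_bound V0 dV VE' Th0 dTh (@bT n) tI).
Qed.

End GaugedDuhamel.

(** * Smoothing of the gauged profile *)

Section EsumSumle.
Variables (R : realType) (I : choiceType).
Implicit Types (f : I -> \bar R) (r : I -> R).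

Lemma seq_sum_le_esum f (s : seq I) : (forall i, (0 <= f i)%E) -> uniq s ->
  (\sum_(i <- s) f i <= \esum_(i in [set: I]) f i)%E.
Proof.
move=> f0 us; apply: esum_ge; exists [set` s].
  by split => //; exact: finite_seq.
by rewrite (fsbig_seq _ _ us).
Qed.

Lemma esum_sumle f : (forall i, (0 <= f i)%E) -> (\esum_(i in [set: I]) f i < +oo)%E ->
  (forall i, f i \is a fin_num) /\
  sumle (fun i => fine (f i)) (fine (\esum_(i in [set: I]) f i)).
Proof.
move=> f0 fo; set S := (\esum_(i in [set: I]) f i)%E in fo *.
have S0 : (0 <= S)%E by exact: esum_ge0.
have fS : S \is a fin_num by rewrite ge0_fin_numE.
have fin i : f i \is a fin_num.
  rewrite ge0_fin_numE//; apply: le_lt_trans fo.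
  by have := seq_sum_le_esum f0 (isT : uniq [:: i]); rewrite big_seq1.
split=> // s us; rewrite -lee_fin fineK// -sumEFin.
have -> : (\sum_(i <- s) (fine (f i))%:E = \sum_(i <- s) f i)%E.
  by apply: eq_bigr => i _; rewrite fineK.
exact: seq_sum_le_esum.
Qed.

Lemma sumle_esum r K : (forall i, 0 <= r i) -> sumle r K ->
  (\esum_(i in [set: I]) (r i)%:E <= K%:E)%E.
Proof.
move=> r0 rK; apply: ub_ereal_sup => _ [A [fA _] <-].
by rewrite fsbig_finite//= sumEFin lee_fin; apply: rK; exact: finmap.fset_uniq.
Qed.

End EsumSumle.

Section Jap2Integral.
Variable R : realType.
Local Notation mu := (@lebesgue_measure R).
Implicit Types (x y b w : R).

Lemma jap2_gt0 x : 0 < jap2 x.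
Proof. by rewrite /jap2 ltr_pwDl// sqr_ge0. Qed.

Lemma jap2_pow_cont (r : R) : continuous (fun x : R => jap2 x `^ r).
Proof.
move=> x; have c1 : {for x, continuous (@jap2 R)}.
  by apply: cvgD; [exact: cvg_cst|rewrite expr2; apply: cvgM].
have c2 : {for jap2 x, continuous (fun y : R => y `^ r)}.
  exact: is_derive_cvg (is_derive_powR r (jap2_gt0 x)).
exact: (@continuous_comp _ _ _ (@jap2 R) (fun y : R => y `^ r) x c1 c2).
Qed.

(** (1 + x)^2 <= 2 (1 + x^2) allows comparison with (1 + x)^(-2b), which has an explicit
    primitive. *)
Lemma jap2_half_fin b : 1 / 2 < b -> (\int[mu]_(x in `[0%R, +oo[) (jap2 x `^ (- b))%:E < +oo)%E.
Proof.
move=> hb; pose e := 2 * b - 1; have e0 : 0 < e by rewrite /e; lra.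
pose C : R := 2 `^ b; have C0 : 0 < C by exact: powR_gt0.
pose f x : R := C * (1 + x) `^ (- e - 1); pose F x : R := - (C / e) * (1 + x) `^ (- e).
have dF x : 0 <= x -> is_derive x 1 F (f x).
  move=> x0; have x1 : 0 < 1 + x by lra.
  have d1 : is_derive x 1 (fun y : R => 1 + y) 1.
    by rewrite -[X in is_derive _ _ _ X]add0r; apply: is_deriveD.
  have d2 := @is_derive1_comp R (fun y => y `^ (- e)) (fun y => 1 + y) x _ _ (is_derive_powR (- e) x1) d1.
  have := is_deriveZ (- (C / e)) d2; congr is_derive.
  rewrite /f /GRing.scale /= mulr1; field; exact: lt0r_neq0.
have cf x : 0 <= x -> {for x, continuous f}.
  move=> x0; have x1 : 0 < 1 + x by lra.
  have d1 : is_derive x 1 (fun y : R => 1 + y) 1.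
    by rewrite -[X in is_derive _ _ _ X]add0r; apply: is_deriveD.
  have d2 := @is_derive1_comp R (fun y => y `^ (- e - 1)) (fun y => 1 + y) x _ _ (is_derive_powR (- e - 1) x1) d1.
  exact: is_derive_cvg (is_deriveZ C d2).
have f0 x : 0 <= x -> 0 <= f x by move=> _; rewrite mulr_ge0 ?powR_ge0// ltW.
have lim0 : F x @[x --> +oo] --> 0.
  rewrite -[0](mulr0 (- (C / e))); apply: cvgM; first exact: cvg_cst.
  apply/cvgr0Pnorm_le => d d0; near=> x.
  have xd : d `^ (- e^-1) <= x by near: x; apply: nbhs_pinfty_ge; exact: num_real.
  have xp := powR_gt0 (- e^-1) d0.
  rewrite ger0_norm ?powR_ge0//.
  have -> : d = (d `^ (- e^-1)) `^ (- e).
    by rewrite -powRrM mulrNN mulVf ?gt_eqF// powRr1// ltW.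
  by apply: powR_opp_mono => //; lra.
have c1 : {within `[0, +oo[, continuous f}.
  by apply: continuous_in_subspaceT => x; rewrite inE /= in_itv /= andbT; exact: cf.
have c2 (x : R) : 0 < x -> derivable F x 1 by move=> x0; have [] := dF x (ltW x0).
have c3 : F x @[x --> 0^'+] --> F 0.
  by apply: cvg_at_right_filter; exact: is_derive_cvg (dF 0 (lexx 0)).
have c4 : {in `]0, +oo[, F^`()%classic =1 f}.
  by move=> x; rewrite in_itv /= andbT => x0; rewrite derive1E; have [_ ->] := dF x (ltW x0).
have E := ge0_continuous_FTC2y f0 c1 lim0 c2 c3 c4.
apply: (@le_lt_trans _ _ (\int[mu]_(x in `[0%R, +oo[) (f x)%:E)%E); last by rewrite E -EFinB ltry.
apply: ge0_le_integral => //.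
- by move=> x _; rewrite lee_fin powR_ge0.
- apply/measurable_EFinP; apply: measurable_funTS_itv.
  by apply: continuous_measurable_fun; exact: jap2_pow_cont.
- apply/measurable_EFinP; apply: measurable_funM => //.
  apply: (measurableT_comp (measurable_powR _)); apply: measurable_funD => //.
- move=> x; rewrite /= in_itv /= andbT => x0; rewrite lee_fin /f.
  have x1 : 0 <= (1 + x) ^+ 2 by exact: sqr_ge0.
  have -> : (1 + x) `^ (- e - 1) = ((1 + x) ^+ 2) `^ (- b).
    by rewrite -powR_mulrn ?addr_ge0// -powRrM /e; congr powR; ring.
  have h : (1 + x) ^+ 2 <= 2 * jap2 x by rewrite /jap2; have := sqr_ge0 (1 - x); nra.
  have x2 : 0 < (1 + x) ^+ 2 by rewrite exprn_gt0//; lra.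
  have := @powR_opp_mono R (- b) _ _ _ x2 h; rewrite powRM// ?(ltW (jap2_gt0 _))//.
  have -> : - b <= 0 by lra.
  move=> /(_ isT) hh; have := ler_wpM2l (ltW C0) hh.
  by rewrite mulrA /C -powRDp// subrr powRr0 mul1r.
Unshelve. all: by end_near. Qed.

Lemma jap2_integral_fin b : 1 / 2 < b -> exists2 Ib : R, 0 < Ib & forall w,
  (\int[mu]_(x in [set: R]) (jap2 (x - w) `^ (- b))%:E <= Ib%:E)%E.
Proof.
move=> hb; have hf := jap2_half_fin hb.
have p0 x : 0 <= jap2 x `^ (- b) by exact: powR_ge0.
have T := ge0_symfun_integralT p0 (@jap2_pow_cont (- b)).
set J := (\int[mu]_(x in `[0%R, +oo[) (jap2 x `^ (- b))%:E)%E in hf.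
have J0 : (0 <= J)%E by apply: integral_ge0 => x _; rewrite lee_fin.
have Jfin : J \is a fin_num by rewrite ge0_fin_numE.
have IT : (\int[mu]_(x in [set: R]) (jap2 x `^ (- b))%:E = (2 * fine J)%:E)%E.
  rewrite T; first by rewrite -set_itvcy -/J -[in LHS](fineK Jfin) -EFinM.
  by move=> x; rewrite /= /jap2 sqrrN.
exists (2 * fine J + 1).
  by have := fine_ge0 J0; lra.
move=> w; pose F (x : R) : R := x - w.
have dF x : is_derive x 1 F 1.
  by rewrite -[X in is_derive _ _ _ X]subr0; apply: is_deriveB.
have F'E : F^`()%classic = (fun=> 1) by apply/funext => x; rewrite derive1E; have [_ ->] := dF x.
have := @increasing_ge0_integration_by_substitutionT R F (fun x => jap2 x `^ (- b)).
rewrite F'E => H; apply: (@le_trans _ _ (2 * fine J)%:E); last by rewrite lee_fin lerDl.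
rewrite -IT H//.
- by apply: le_of_eq; apply: eq_integral => x _ /=; rewrite /F mulr1.
- by move=> x y xy; rewrite /F ltrD2r.
- by move=> x; exact: cvg_cst.
- by apply/cvg_ex; exists 1; exact: cvg_cst.
- by apply/cvg_ex; exists 1; exact: cvg_cst.
- by apply/cvgrNyPle => A; near=> x; rewrite /F lerBlDr; near: x; apply: nbhs_ninfty_le; exact: num_real.
- by apply/cvgryPge => A; near=> x; rewrite /F lerBrDr; near: x; apply: nbhs_pinfty_ge; exact: num_real.
- exact: jap2_pow_cont.
Unshelve. all: by end_near. Qed.

End Jap2Integral.

Section SolutionFacts.
Variable R : realType.
Local Notation mu := (@lebesgue_measure R).
Implicit Types (g f : R -> R[i]) (u : R -> R -> R[i]) (n : int) (N : nat) (s b delta t : R).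

(** The choice l = x / (2 B) absorbs the second term into half of x; with B = 0 a large l forces x =
    0. It recovers Cauchy--Schwarz from Young's inequality applied under the integral. *)
Lemma sqr_le_of_split (x A B : R) : 0 <= x -> 0 <= B ->
  (forall l, 0 < l -> x <= l^-1 * A + l * B) -> x ^+ 2 <= 4 * A * B.
Proof.
move=> x0 B0 h; have A0 : 0 <= A.
  rewrite leNgt; apply/negP => A0; have B1 : 0 < B + 1 by lra.
  pose l := - A / (B + 1); have := h (Num.min 1 l).
  have l0 : 0 < l by rewrite divr_gt0// oppr_gt0.
  have m0 : 0 < Num.min 1 l by rewrite lt_min ltr01.
  move=> /(_ m0); set m := Num.min 1 l in m0 *.
  have m1 : m <= 1 by rewrite ge_min lexx.
  have ml : m * (B + 1) <= - A by rewrite -ler_pdivlMr// ge_min lexx orbT.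
  have : m * (m^-1 * A) = A by rewrite mulVKf// gt_eqF.
  by move=> e hh; have := ler_wpM2l (ltW m0) hh; rewrite mulrDr e; nra.
move: x0; rewrite le_eqVlt => /predU1P[<-|x0]; first by rewrite expr0n/= mulr_ge0// mulr_ge0.
move: B0; rewrite le_eqVlt => /predU1P[B0|B0].
  have A1 : 0 < A + 1 by lra.
  have l0 : 0 < 2 * (A + 1) / x by rewrite divr_gt0// mulr_gt0.
  have := h _ l0; rewrite -B0 mulr0 addr0 invf_div.
  have -> : x / (2 * (A + 1)) * A = x * (A / (A + 1)) / 2 by field; rewrite gt_eqF.
  have : A / (A + 1) <= 1 by rewrite ler_pdivrMr//; lra.
  by move=> q; have := ler_wpM2l (ltW x0) q; lra.
have l0 : 0 < x / (2 * B) by rewrite divr_gt0// mulr_gt0.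
have := h _ l0; rewrite invf_div; have -> : x / (2 * B) * B = x / 2 by field; exact: lt0r_neq0.
rewrite -[2 * B / x * A]mulrAC => hh; have := ler_wpM2l (ltW x0) hh.
rewrite mulrDr [x * (_ / x)]mulrC divfK ?gt_eqF//; rewrite expr2; lra.
Qed.

Lemma wt_pow_jap2 (n : int) s : 0 <= s <= 1 -> wt R n `^ (2 * s) <= 2 * jap2 (n%:~R : R) `^ s.
Proof.
move=> /andP[s0 s1]; have /andP[_ h] := wt_jap2 R n; have w0 := ltW (wt_gt0 R n).
rewrite powRrM powR_mulrn//; apply: (@le_trans _ _ ((2 * jap2 n%:~R) `^ s)).
  by rewrite ge0_ler_powR ?nnegrE ?sqr_ge0// mulr_ge0// ltW// jap2_gt0.
by rewrite powRM ?(ltW (jap2_gt0 _))// ler_wpM2r ?powR_ge0// ler1_powR//; lra.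
Qed.

Lemma jap2_pow_wt (n : int) s : 0 <= s -> jap2 (n%:~R : R) `^ s <= wt R n `^ (2 * s).
Proof.
move=> s0; have /andP[h _] := wt_jap2 R n; have w0 := ltW (wt_gt0 R n).
by rewrite powRrM powR_mulrn// ge0_ler_powR ?nnegrE ?sqr_ge0// ltW// jap2_gt0.
Qed.

(* Cauchy--Schwarz in tau, with (1 + x^2)^(-b) integrable as b > 1/2. *)
Lemma X_majorant (al : R) s b delta u : 0 <= s <= 1 -> 1 / 2 < b -> in_X al s b delta u ->
  exists a : int -> R, exists K : R, [/\ forall n, 0 <= a n,
    sumle (fun n => wt R n `^ (2 * s) * a n ^+ 2) K &
    forall n t, - delta <= t <= delta -> normc (fourier (u t) n) <= a n].
Proof.
move=> s01 hb [F [mF fin rep]]; have [Ib Ib0 kI] := jap2_integral_fin hb.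
pose j n := jap2 (n%:~R : R) `^ s; have j0 n : 0 < j n by rewrite powR_gt0// jap2_gt0.
pose w n := @frac_symbol R al n.
pose W n (x : R) := j n * jap2 (x - w n) `^ b * normc (F n x) ^+ 2.
have W0 n x : 0 <= W n x by apply: mulr_ge0; [apply: mulr_ge0; [exact: ltW|exact: powR_ge0]|exact: sqr_ge0].
have mT := @measurableT _ (measurableTypeR R).
have f0 n : (0 <= \int[mu]_(x in [set: R]) (W n x)%:E)%E.
  by apply: integral_ge0 => x _; rewrite lee_fin.
have [Wfin WS] := esum_sumle f0 fin.
set K := fine _ in WS.
have cj r n : continuous (fun x : R => jap2 (x - w n) `^ r).
  move=> x; apply: (@continuous_comp _ _ _ (fun x : R => x - w n) (fun y : R => jap2 y `^ r)).
    by apply: cvgB; [exact: cvg_id|exact: cvg_cst].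
  exact: jap2_pow_cont.
have mW n : measurable_fun [set: R] (W n).
  apply: measurable_funM; last exact: (cmeas_normc2 (cmeasW setT (mF n))).
  apply: measurable_funM; first exact: measurable_cst.
  exact: (continuous_measurable_fun (cj b n)).
have iW n : mu.-integrable [set: R] (EFin \o W n).
  apply/integrableP; split; first by apply/measurable_EFinP; exact: mW.
  apply: (@le_lt_trans _ _ (\int[mu]_(x in [set: R]) (W n x)%:E)%E).
    by apply: le_of_eq; apply: eq_integral => x _ /=; rewrite ger0_norm.
  by rewrite -ge0_fin_numE.
pose k n (x : R) := jap2 (x - w n) `^ (- b).
have k0 n x : 0 < k n x by rewrite powR_gt0// jap2_gt0.
have ik n : mu.-integrable [set: R] (EFin \o k n).
  apply/integrableP; split.
    apply/measurable_EFinP; exact: (continuous_measurable_fun (cj (- b) n)).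
  apply: le_lt_trans (ltry Ib); apply: le_trans (kI (w n)).
  by apply: le_of_eq; apply: eq_integral => x _ /=; rewrite ger0_norm// ltW.
have kIb n : \int[mu]_(x in [set: R]) k n x <= Ib.
  rewrite /Rintegral -lee_fin fineK ?kI//.
  exact: (@integrable_fin_num _ _ R mu setT mT _ (ik n)).
pose J n := \int[mu]_(x in [set: R]) W n x.
have WJ : sumle J K by exact: WS.
have J0 n : 0 <= J n by apply: Rintegral_ge0 => x _; exact: W0.
have key n t : - delta <= t <= delta -> normc (fourier (u t) n) ^+ 2 <=
    4 * (2 * (j n)^-1 * Ib) * (2 * J n).
  move=> tI; apply: sqr_le_of_split; rewrite ?normc_ge0 ?mulr_ge0// => l l0.
  rewrite rep ?in_itv//.
  have hi := integrable_lin (l^-1 * (j n)^-1) l mT (ik n) (iW n).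
  have bd x : [set: R] x -> normc (F n x * cis (t * x)) <= l^-1 * (j n)^-1 * k n x + l * W n x.
    move=> _; rewrite ComplexField.Normc.normcM normc_cis mulr1.
    have e : (l^-1 * (j n)^-1 * k n x) * (l * W n x) = normc (F n x) ^+ 2.
      have kk : k n x * jap2 (x - w n) `^ b = 1.
        by rewrite /k -powRDp ?jap2_gt0// addNr powRr0.
      rewrite /W; transitivity ((l^-1 * l) * ((j n)^-1 * j n) * (k n x * jap2 (x - w n) `^ b) * normc (F n x) ^+ 2).
        by ring.
      by rewrite kk !mulVf ?gt_eqF// !mul1r.
    have P0 : 0 <= l^-1 * (j n)^-1 * k n x.
      by rewrite !mulr_ge0 ?invr_ge0//; apply: ltW.
    have Q0 : 0 <= l * W n x by rewrite mulr_ge0// ltW.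
    rewrite -ler_sqr ?nnegrE ?normc_ge0 ?addr_ge0// -e.
    set p := l^-1 * _ * _ in P0 *; set q := l * _ in Q0 *; rewrite sqrrD; nra.
  have ci : cintegrable setT (fun x => F n x * cis (t * x)).
    apply: (cintegrable_le mT _ hi bd); apply: cmeasM; first exact: (cmeasW setT (mF n)).
    exact/ccontinuous_meas/ccontinuous_cis.
  apply: le_trans (normc_cintegral mT ci hi bd) _.
  rewrite (Rintegral_lin _ _ mT (ik n) (iW n)) -/(J n).
  have := ler_wpM2l (_ : 0 <= l^-1 * (j n)^-1) (kIb n).
  rewrite mulr_ge0 ?invr_ge0 ?(ltW l0) ?(ltW (j0 n))// => /(_ isT).
  by set A := \int[mu]_(_ in _) _; lra.
pose a n := Num.sqrt (4 * (2 * (j n)^-1 * Ib) * (2 * J n)).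
have r0 n : 0 <= 4 * (2 * (j n)^-1 * Ib) * (2 * J n).
  by rewrite !mulr_ge0// ?invr_ge0; apply: ltW.
have a2 n : a n ^+ 2 = 4 * (2 * (j n)^-1 * Ib) * (2 * J n) by rewrite sqr_sqrtr.
exists a, (32 * Ib * K); split.
- by move=> n; exact: sqrtr_ge0.
- have I32 : 0 <= 32 * Ib by rewrite mulr_ge0// ltW.
  apply: le_sumle (sumleZ I32 WJ) => n; rewrite a2.
  have := ler_wpM2r (r0 n) (wt_pow_jap2 n s01); rewrite -/(j n) => /le_trans; apply.
  by apply: le_of_eq; field; exact: lt0r_neq0.
- move=> n t tI; rewrite -ler_sqr ?nnegrE ?normc_ge0 ?sqrtr_ge0// a2; exact: key.
Qed.

(** Projection onto [-delta, delta]. Composition with it extends the coefficients to all times,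
    keeping continuity and bounds. *)
Definition clamp delta t : R := Num.max (- delta) (Num.min t delta).

Lemma clamp_in delta t : 0 <= delta -> - delta <= clamp delta t <= delta.
Proof.
by move=> d0; rewrite /clamp; case: (leP t delta) => ?; case: (leP (- delta) t) => ?;
  case: (leP (- delta) delta) => ?; lra.
Qed.

Lemma clamp_id delta t : - delta <= t <= delta -> clamp delta t = t.
Proof.
move=> /andP[h1 h2]; rewrite /clamp (min_idPl h2); exact/max_idPr.
Qed.

Lemma clamp_lip delta (x y : R) : 0 <= delta -> `|clamp delta x - clamp delta y| <= `|x - y|.
Proof.
move=> d0; have h (a b : R) : a <= b -> `|clamp delta a - clamp delta b| <= `|a - b|.
  move=> ab; rewrite [leRHS]distrC [leRHS]ger0_norm ?subr_ge0// ler_norml /clamp.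
  by case: (leP a delta) => ?; case: (leP b delta) => ?; case: (leP (- delta) a) => ?;
     case: (leP (- delta) b) => ?; case: (leP (- delta) delta) => ?; lra.
have [xy|/ltW yx] := leP x y; first exact: h.
by rewrite distrC [leRHS]distrC; exact: h.
Qed.

(** One coefficient is dominated by the H^s norm, whose weights are at least 1 as s >= 0. *)
Lemma coef_continuous s delta u n : 0 <= delta -> 0 <= s -> continuous_in_H s delta u ->
  ccontinuous (fun t => fourier (u (clamp delta t)) n).
Proof.
move=> d0 s0 [uH uc].
have key t0 e : 0 < e -> \forall t \near t0,
    normc (fourier (u (clamp delta t)) n - fourier (u (clamp delta t0)) n) < e.
  move=> e0; set t1 := clamp delta t0; have t1I := clamp_in t0 d0.
  have t1I' : t1 \in `[- delta, delta] by rewrite in_itv.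
  have nb : nbhs 0%E [set y : \bar R | (y < (e ^+ 2)%:E)%E].
    by apply: open_nbhs_nbhs; split; [exact: open_ereal_lt_ereal|rewrite /= lte_fin exprn_gt0].
  have := uc t1 t1I' _ nb; rewrite /nbhs /= /within /= => /nbhs_ballP[d /= dp hd].
  near=> t; have tI := clamp_in t d0.
  have tb : `|t0 - t| < d by near: t; exact: nbhsx_ballx.
  have := hd (clamp delta t); rewrite /ball /= => /(_ (le_lt_trans (clamp_lip _ _ d0) tb)).
  rewrite /= in_itv /= tI => /(_ isT) hs.
  have L1 := in_L2_L2 (proj1 (uH _ (_ : clamp delta t \in `[- delta, delta]))).
  have L2' := in_L2_L2 (proj1 (uH _ t1I')).
  have {}L1 : L2 (u (clamp delta t)) by apply: L1; rewrite in_itv.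
  rewrite -fourierB// -ltr_sqr ?nnegrE ?normc_ge0// -?lte_fin; last exact: ltW.
  apply: le_lt_trans hs.
  pose f m := (jap2 (m%:~R : R) `^ s * normc (fourier (fun x => u (clamp delta t) x - u t1 x) m) ^+ 2)%:E.
  have f0 m : (0 <= f m)%E by rewrite lee_fin mulr_ge0 ?sqr_ge0 ?powR_ge0.
  have := seq_sum_le_esum f0 (isT : uniq [:: n]); rewrite big_seq1; apply: le_trans.
  rewrite /f lee_fin ler_peMl ?sqr_ge0// powR_ge1// /jap2 lerDl sqr_ge0//.
split=> t0; apply/cvgrPdist_lt => e e0; have := key t0 e e0; apply: filterS => t;
  rewrite normcBC; apply: le_lt_trans; rewrite -?cReN -?cImN -?cReD -?cImD.
  exact: normc_Re.
exact: normc_Im.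
Unshelve. all: by end_near. Qed.

Lemma eq_cintegral0 delta t f g : 0 <= delta -> - delta <= t <= delta ->
  (forall x, - delta <= x <= delta -> f x = g x) -> cintegral0 t f = cintegral0 t g.
Proof.
move=> d0 tI fg; rewrite /cintegral0; case: leP => t0.
  by apply: eq_cintegral => x; rewrite inE /= in_itv /= => xI; apply: fg; lra.
by congr (- _); apply: eq_cintegral => x; rewrite inE /= in_itv /= => xI; apply: fg; lra.
Qed.

(** [asum_gain] takes the majorant from eps to 4 eps, and [tri_gain] with kp = eps then loses 3 (4
    eps) + eps = 13 eps. The condition 26 eps <= al - 1 leaves a gain of at least (al - 1) / 2. *)
Lemma gain_step (al : R) (sg : bool) s delta g u (a : int -> R) (eps Ka : R) :
  1 < al < 2 -> 0 < eps -> 26 * eps <= al - 1 -> 0 <= delta -> 0 <= s ->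
  continuous_in_H s delta u -> duhamel al sg delta g u ->
  (forall n t, - delta <= t <= delta -> normc (fourier (u t) n) <= a n) ->
  sumle (fun n => wt R n `^ (1 - 2 * eps) * a n ^+ 2) Ka ->
  exists z : int -> R, exists K : R, [/\ forall n, 0 <= z n,
    sumle (fun n => wt R n `^ (1 + 2 * (al - 1 - 13 * eps)) * z n ^+ 2) K &
    forall t, - delta <= t <= delta -> exists th : R, forall n,
      normc (cis th * (cis (- frac_symbol al n * t) * fourier (u t) n) - fourier g n) <= z n].
Proof.
move=> al12 e0 e26 d0 s0 uH du ua aK; have /andP[al1 al2] := al12.
have t0I : - delta <= 0 <= delta by lra.
have a0 n : 0 <= a n by apply: le_trans (normc_ge0 _) (ua n 0 t0I).
have wt1 := wt_ge1 R; have wt0 := wt_gt0 R.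
have mono_pow n (r q : R) : r <= q -> wt R n `^ r <= wt R n `^ q by move=> rq; rewrite ler_powR.
have aK0 : sumle (fun n => a n ^+ 2) Ka.
  apply: le_sumle aK => n; rewrite ler_peMl ?sqr_ge0// powR_ge1//; lra.
have e8 : 8 * eps <= 1 by lra.
have [K1 hK1] := asum_gain e0 e8 a0 aK.
have asum0 n N : 0 <= asum N a n by apply: boxsum_ge0 => p q; exact: mulr3_ge0.
have asumM n N M : (N <= M)%N -> asum N a n <= asum M a n.
  by move=> NM; apply: boxsum_mono => // p q; exact: mulr3_ge0.
have w0 n : 0 < wt R n `^ (1 - 8 * eps) by exact: powR_gt0.
have [asumB A3K] := sumle_seqsup asumM w0 hK1.
set A3 := seqsup _ in A3K.
have asumA n : asum N a n @[N --> \oo] --> A3 n.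
  by have [D hD] := asumB n; exact: (seqsup_cvg asumM hD).
have asumle N n : asum N a n <= A3 n by have [D hD] := asumB n; exact: (le_seqsup hD).
pose c n t := fourier (u (clamp delta t)) n.
pose G n t := fourier (cubic (u (clamp delta t))) n.
pose sgr : R := (-1) ^+ sg.
have sgr1 : `|sgr| = 1 by rewrite /sgr normrX normrN1 expr1n.
have cc n : ccontinuous (c n) by exact: coef_continuous uH.
have ca n t : normc (c n t) <= a n by apply: ua; exact: clamp_in.
have hL t : L2 (u (clamp delta t)).
  by apply: in_L2_L2; apply: (proj1 (proj1 uH _ _)); rewrite in_itv /= clamp_in.
have aA3 : sumle (fun n => a n * A3 n) (Ka + K1).
  apply: le_sumle (sumleD aK A3K) => n.
  have h1 : wt R n `^ (1 - 8 * eps) <= wt R n `^ (1 - 2 * eps) by apply: mono_pow; lra.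
  have h2 : 1 <= wt R n `^ (1 - 8 * eps) by apply: powR_ge1 => //; lra.
  have q1 := sqr_ge0 (a n); have q2 := sqr_ge0 (A3 n); have := sqr_ge0 (a n - A3 n).
  have := ler_wpM2r q1 (le_trans h2 h1); have := ler_wpM2r q2 h2.
  by rewrite !mul1r; nra.
have Gcvg n t : normc (G n t - csum N (c ^~ t) n) @[N --> \oo] --> 0.
  by apply: cubic_coef_cvg aA3 => // m; exact: ca.
have duh n t : - delta <= t <= delta -> c n t = cis (t * frac_symbol al n) * fourier g n -
    (0 +i* 1) * sgr%:C * cintegral0 t (fun t' => cis ((t - t') * frac_symbol al n) * G n t').
  move=> tI; have ce : c n t = fourier (u t) n by rewrite /c clamp_id.
  have tI' : t \in `[- delta, delta] by rewrite in_itv.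
  rewrite ce (du n t tI').
  have -> : (-1) ^+ sg = sgr%:C :> R[i] by rewrite rmorphXn /= rmorphN1.
  have E x : - delta <= x <= delta -> cis ((t - x) * frac_symbol al n) * fourier (cubic (u x)) n =
      cis ((t - x) * frac_symbol al n) * G n x by move=> xI; rewrite /G (clamp_id xI).
  by rewrite (eq_cintegral0 d0 tI E).
pose B n := Bd a A3 n.
have B0 n : 0 <= B n.
  by rewrite /B /Bd addr_ge0// mulr_ge0//; apply: le_trans (asumle 0%N n).
have BK : sumle (fun n => wt R n `^ (1 - 2 * (4 * eps)) * B n ^+ 2) (2 * Ka + 8 * K1).
  have r2 : 0 <= 2 :> R by []. have r8 : 0 <= 8 :> R by [].
  apply: le_sumle (sumleD (sumleZ r2 aK) (sumleZ r8 A3K)) => n.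
  have -> : 1 - 2 * (4 * eps) = 1 - 8 * eps by ring.
  have h1 : wt R n `^ (1 - 8 * eps) <= wt R n `^ (1 - 2 * eps) by apply: mono_pow; lra.
  have q1 := sqr_ge0 (a n); have := ler_wpM2r q1 h1.
  have h3 : B n ^+ 2 <= 2 * a n ^+ 2 + 8 * A3 n ^+ 2.
    by rewrite /B /Bd; have := sqr_ge0 (a n - 2 * A3 n); nra.
  have := ler_wpM2l (ltW (w0 n)) h3; lra.
have e4 : 0 <= 4 * eps by lra.
have [K2 hK2] := @tri_gain R al (4 * eps) (13 * eps) eps B _ al12 e4 e0
  (ltac:(lra)) (ltac:(lra)) (ltac:(lra)) B0 BK.
have triM n N M : (N <= M)%N -> boxsum N (tri al B n) n <= boxsum M (tri al B n) n.
  by move=> NM; apply: boxsum_mono => // p q; exact: tri_ge0.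
have tri0 n N : 0 <= boxsum N (tri al B n) n by apply: boxsum_ge0 => p q; exact: tri_ge0.
have w1 n : 0 < wt R n `^ (1 + 2 * (al - 1 - 13 * eps)) by exact: powR_gt0.
have [triB TK] := sumle_seqsup triM w1 hK2.
set T := seqsup _ in TK.
have Tle n N : boxsum N (tri al B n) n <= T n by have [D hD] := triB n; exact: (le_seqsup hD).
have T0 n : 0 <= T n by apply: le_trans (Tle n 0%N).
have gd := gauged_duhamel al12 d0 sgr1 cc ca aK0 asumA Gcvg duh Tle.
set kk := kosc delta Ka in gd; have Ka0 := sumle_ge0 aK.
have kk0 : 0 <= kk.
  rewrite /kk /kosc mulr_ge0// addr_ge0// mulr_ge0 ?mulr_ge0//; lra.
exists (fun n => 4 * delta * a n ^+ 3 + kk * T n).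
exists (2 * (4 * delta * Ka) ^+ 2 * Ka + 2 * kk ^+ 2 * K2); split.
- by move=> n; apply: addr_ge0; apply: mulr_ge0 => //; [exact: mulr_ge0|exact: exprn_ge0].
- have c1 : 0 <= 2 * (4 * delta * Ka) ^+ 2 by rewrite mulr_ge0// sqr_ge0.
  have c2 : 0 <= 2 * kk ^+ 2 by rewrite mulr_ge0// sqr_ge0.
  apply: le_sumle (sumleD (sumleZ c1 aK) (sumleZ c2 TK)) => n.
  set wp := wt R n `^ (1 + _) in w1 *; have wp0 : 0 <= wp by exact: powR_ge0.
  have h1 : (4 * delta * a n ^+ 3 + kk * T n) ^+ 2 <=
      2 * (4 * delta) ^+ 2 * (a n ^+ 2) ^+ 3 + 2 * kk ^+ 2 * T n ^+ 2.
    by have := sqr_ge0 (4 * delta * a n ^+ 3 - kk * T n); rewrite -exprM; nra.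
  apply: le_trans (ler_wpM2l wp0 h1) _; rewrite mulrDr; apply: lerD; last first.
    by apply: le_of_eq; ring.
  have pt := sumle_point n aK; set wa := wt R n `^ (1 - 2 * eps) in pt *.
  have wa0 : 0 < wa by exact: powR_gt0.
  have a20 := sqr_ge0 (a n); set a2 := a n ^+ 2 in pt a20 *.
  (* The term a_n^3 has regularity to spare: <n>^(1 - 2 eps) a_n^2 is at most Ka for each n, and al
     < 2 gives 1 + 2 (al - 1 - 13 eps) <= 3 (1 - 2 eps). *)
  have wpwa : wp <= wa * (wa * wa).
    rewrite /wp /wa -!powRDp//; apply: mono_pow; lra.
  have h2 : (wa * a2) * ((wa * a2) * (wa * a2)) <= (wa * a2) * (Ka * Ka).
    have := mulr_ge0 (ltW wa0) a20 => wa2.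
    by rewrite ler_wpM2l// ler_pM.
  have h3 : wp * a2 ^+ 3 <= wa * a2 * (Ka * Ka).
    apply: le_trans h2; have := ler_wpM2r (exprn_ge0 3 a20) wpwa => /le_trans; apply.
    by apply: le_of_eq; ring.
  have d2 : 0 <= 2 * (4 * delta) ^+ 2 by rewrite mulr_ge0// sqr_ge0.
  by have := ler_wpM2l d2 h3; rewrite !expr2; lra.
move=> t tI; have [th hth] := gd t tI; exists th => n.
by have := hth n; rewrite /c clamp_id.
Qed.

End SolutionFacts.

(** * Data of bounded variation *)

Section BoundedVariationData.
Variable R : realType.
Local Notation mu := (@lebesgue_measure R).
Local Notation torus := (@torus R).
Implicit Types (g : R -> R[i]) (n : int) (x y S V : R).

Lemma parts_bound_le (a b V V' : R) (p : R -> R) : a <= b -> V <= V' ->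
  parts_bound a b V p -> parts_bound a b V' p.
Proof.
move=> ab VV [m B P]; split => // F f S dF cf FS; apply: le_trans (P F f S dF cf FS) _.
by rewrite ler_wpM2l//; apply: le_trans (FS a _); rewrite ?normr_ge0 ?lexx.
Qed.

Lemma BV_parts g : in_BV g -> exists V, [/\ 0 <= V,
  parts_bound 0 (2 * pi) V (fun x => Re (g x)) & parts_bound 0 (2 * pi) V (fun x => Im (g x))].
Proof.
have tp := ltW (twopi_gt0 R).
move=> [_ b1 b2]; have [V1 h1] := parts_bound_BV tp b1; have [V2 h2] := parts_bound_BV tp b2.
exists (`|V1| + `|V2|); split; first exact: addr_ge0.
- by apply: parts_bound_le h1 => //; have := ler_norm V1; have := normr_ge0 V2; lra.
- by apply: parts_bound_le h2 => //; have := ler_norm V2; have := normr_ge0 V1; lra.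
Qed.

Lemma BV_bounded g : in_BV g -> cmeas torus g /\ exists M : R, forall x, torus x -> normc (g x) <= M.
Proof.
move=> /BV_parts[V [_ [m1 [B1 h1] _] [m2 [B2 h2] _]]]; split; first by split.
exists (B1 + B2) => x; rewrite /Defs.torus /= in_itv /= => xT.
by apply: le_trans (normc_ReIm _) _; rewrite lerD ?h1 ?h2.
Qed.

Lemma BV_L2 g : in_BV g -> L2 g.
Proof. by move=> /BV_bounded[mg [M gM]]; exact: (@L2_bounded R g M). Qed.

(* Integration by parts against the kernel sum_n (c_n / n) e^{in(x - y)}. *)
Lemma BV_kernel g : in_BV g -> exists2 C, 0 <= C & forall (s : seq int) (c : int -> R[i]) S,
  (forall n, n \in s -> n != 0) ->
  (forall y, normc (\sum_(n <- s) c n * ((n%:~R : R)^-1)%:C * expi n y) <= S) ->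
  forall x, normc (\sum_(n <- s) c n * fourier g n * expi n x) <= C * S.
Proof.
move=> hg; have [V [V0 p1 p2]] := BV_parts hg; have Lg := BV_L2 hg; have tp := twopi_gt0 R.
have mT := @measurable_torus R.
exists ((2 * pi)^-1 * (4 * V)); first by rewrite mulr_ge0 ?invr_ge0 ?(ltW tp)// mulr_ge0.
move=> s c S s0 cS x.
pose d n : R[i] := ('i * (n%:~R : R)^-1%:C).
pose f y := \sum_(n <- s) (if n == 0 then 0 else c n * expi n x) * cis ((- n)%:~R * y).
pose F y := \sum_(n <- s) (if n == 0 then 0 else c n * expi n x * d n) * cis ((- n)%:~R * y).
have dF : cderiv F f.
  apply: cderiv_sum => n; have h := cderiv_cis ((- n)%:~R : R) 0.
  have e : (fun y => cis ((- n)%:~R * y + 0)) = (fun y : R => cis ((- n)%:~R * y)).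
    by apply/funext => y; rewrite addr0.
  rewrite e in h; have := cderivZ (if n == 0 then 0 else c n * expi n x * d n) h.
  congr cderiv; apply/funext => y; rewrite addr0; case: eqP => [_|/eqP n0]; first by rewrite !mul0r.
  have n0R : (n%:~R : R) != 0 by rewrite intr_eq0.
  have -> : ((- n)%:~R : R)%:C = - (n%:~R : R)%:C :> R[i] by rewrite mulrNz rmorphN.
  have ii : 'i * 'i = -1 :> R[i] by rewrite -expr2 sqrCi.
  have hd : d n * ('i * - (n%:~R : R)%:C) = 1.
    transitivity (- ('i * 'i) * ((n%:~R : R)^-1%:C * (n%:~R : R)%:C) : R[i]); first by rewrite /d; ring.
    by rewrite ii opprK mul1r -rmorphM mulVf.
  by rewrite -[RHS](mulr1) -hd; ring.
have cf : ccontinuous f.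
  apply: ccontinuous_sum => n; apply: ccontinuousM; first exact: ccontinuous_cst.
  exact: ccontinuous_cis.
have FS y : 0 <= y <= 2 * pi -> normc (F y) <= S.
  move=> _; have -> : F y = 'i * \sum_(n <- s) c n * ((n%:~R : R)^-1)%:C * expi n (x - y).
    rewrite mulr_sumr; apply: eq_big_seq => n ns; rewrite (negbTE (s0 n ns)) /d.
    have -> : expi n (x - y) = expi n x * cis ((- n)%:~R * y).
      by rewrite /expi -cisD; congr cis; rewrite mulrNz; ring.
    by ring.
  by rewrite ComplexField.Normc.normcM normc_i mul1r.
have := cparts (ltW tp) dF cf p1 p2 FS.
have [ci ce] := cintegral_sum s mT (fun n => cintegrableZ (c n * expi n x) mT (L2_fourier_integrable n Lg)).
rewrite (@eq_cintegral R _ _ (fun y => \sum_(n <- s) (c n * expi n x) * (g y * expi (- n) y))); last first.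
  move=> y _; rewrite mulr_suml; apply: eq_big_seq => n ns; rewrite (negbTE (s0 n ns)) /expi.
  by ring.
rewrite -/torus ce => h.
have -> : \sum_(n <- s) c n * fourier g n * expi n x = ((2 * pi)^-1)%:C *
    \sum_(n <- s) cintegral torus (fun y => c n * expi n x * (g y * expi (- n) y)).
  rewrite mulr_sumr; apply: eq_bigr => n _.
  by rewrite (cintegralZ _ mT (L2_fourier_integrable n Lg)) fourierE; ring.
rewrite ComplexField.Normc.normcM normc_real ger0_norm ?invr_ge0 ?(ltW tp)// -mulrA ler_wpM2l//.
  by rewrite invr_ge0 ltW.
by apply: le_trans h _; apply: le_of_eq; ring.
Qed.

(** [BV_kernel] for a single frequency. *)
Lemma BV_coef g : in_BV g -> exists2 C, 0 <= C & forall n, normc (fourier g n) <= C / wt R n.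
Proof.
move=> hg; have [C C0 hC] := BV_kernel hg.
exists (2 * C + normc (fourier g 0)); first by rewrite addr_ge0 ?normc_ge0// mulr_ge0.
move=> n; have w0 := wt_gt0 R n; rewrite ler_pdivlMr//.
have [->|n0] := eqVneq n 0.
  by rewrite /wt mulr0z normr0 addr0 mulr1 lerDr mulr_ge0.
have n1 : 1 <= `|n%:~R : R| by rewrite -intr_norm ler1z; lia.
have np : 0 < `|n%:~R : R| by exact: lt_le_trans n1.
have := hC [:: n] (fun=> 1) `|n%:~R|^-1 _ _ 0.
rewrite big_seq1 mul1r ComplexField.Normc.normcM normc_expi mulr1 => h.
have {}h : normc (fourier g n) <= C * `|n%:~R|^-1.
  apply: h => [m|y]; first by rewrite inE => /eqP ->.
  by rewrite big_seq1 mul1r ComplexField.Normc.normcM normc_expi mulr1 normc_real normfV.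
rewrite -ler_pdivlMr// in h *.
have h2 : wt R n <= 2 * `|n%:~R : R| by rewrite /wt; lra.
rewrite ler_pdivlMr//; have := ler_wpM2l (normc_ge0 (fourier g n)) h2.
rewrite ler_pdivlMr// in h; have := normc_ge0 (fourier g 0); lra.
Qed.

(* Two rounds of the gain: the first puts u(t) in the scale of the data, where every
   exponent below 1/2 is available to the second. *)
Lemma solution_structure (al : R) (sg : bool) (s delta kap : R) g u : 1 < al < 2 ->
  1 / 2 - (al - 1) / 52 < s < 1 / 2 -> 0 < delta -> in_BV g -> fNLS_solution al sg s delta g u ->
  0 < kap < al - 1 ->
  exists z : int -> R, exists K : R, [/\ forall n, 0 <= z n,
    sumle (fun n => wt R n `^ (1 + 2 * (al - 1 - kap)) * z n ^+ 2) K &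
    forall t, - delta <= t <= delta -> exists th : R, forall n,
      normc (cis th * (cis (- frac_symbol al n * t) * fourier (u t) n) - fourier g n) <= z n].
Proof.
move=> al12 /andP[s1 s2] d0 hg [b [hb uX uH du]] /andP[k0 k1]; have /andP[al1 al2] := al12.
have s01 : 0 <= s <= 1 by lra.
have [a [K [a0 aK ua]]] := X_majorant s01 hb uX.
pose eps := 1 / 2 - s; have e0 : 0 < eps by rewrite /eps; lra.
have aK' : sumle (fun n => wt R n `^ (1 - 2 * eps) * a n ^+ 2) K.
  by rewrite (_ : 1 - 2 * eps = 2 * s) // /eps; field.
have [|z1 [K1 [z10 zK1 hz1]]] := gain_step al12 e0 _ (ltW d0) (proj1 (andP s01)) uH du ua aK'.
  by rewrite /eps; lra.
have [Cg Cg0 hCg] := BV_coef hg.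
(* The second round then loses 13 e2 = kap / 2. *)
pose e2 := kap / 26; have e20 : 0 < e2 by rewrite divr_gt0.
(* A majorant in H^{1/2 - e} for every e > 0: Cg / <n> just misses H^{1/2}, and z1 lies above it. *)
pose a' n := Cg / wt R n + z1 n.
have ua' n t : - delta <= t <= delta -> normc (fourier (u t) n) <= a' n.
  move=> tI; have [th hth] := hz1 t tI.
  have -> : normc (fourier (u t) n) = normc (cis th * (cis (- frac_symbol al n * t) * fourier (u t) n)).
    by rewrite !ComplexField.Normc.normcM !normc_cis !mul1r.
  rewrite -(subrK (fourier g n) (cis th * _)); apply: le_trans (normcD _ _) _.
  by rewrite addrC lerD// hCg.
have r1 : 1 < 1 + 2 * e2 by rewrite ltrDl mulr_gt0.
have [W wW] := sumle_wt_opp r1.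
have aK2 : sumle (fun n => wt R n `^ (1 - 2 * e2) * a' n ^+ 2) (2 * Cg ^+ 2 * W + 2 * K1).
  have c1 : 0 <= 2 * Cg ^+ 2 by rewrite mulr_ge0// sqr_ge0.
  have c2 : 0 <= 2 :> R by [].
  apply: le_sumle (sumleD (sumleZ c1 wW) (sumleZ c2 zK1)) => n.
  have w0 := wt_gt0 R n; have w1 := wt_ge1 R n.
  have p0 : 0 <= wt R n `^ (1 - 2 * e2) by exact: powR_ge0.
  have h : a' n ^+ 2 <= 2 * Cg ^+ 2 * (wt R n)^-1 ^+ 2 + 2 * z1 n ^+ 2.
    rewrite /a'; have := sqr_ge0 (Cg / wt R n - z1 n).
    have : (Cg / wt R n) ^+ 2 = Cg ^+ 2 * (wt R n)^-1 ^+ 2 by rewrite exprMn.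
    by set q := Cg / _; set q2 := (wt R n)^-1; nra.
  apply: le_trans (ler_wpM2l p0 h) _; rewrite mulrDr; apply: lerD.
    rewrite mulrCA ler_wpM2l// (_ : - (1 + 2 * e2) = (1 - 2 * e2) + - 2%:R); last by ring.
    by rewrite [leRHS]powRDp// [wt R n `^ (- _)]powRN powR_mulrn ?(ltW w0)// exprVn.
  rewrite mulrCA ler_wpM2l// ler_wpM2r ?sqr_ge0// ler_powR//.
  by move: s1 k0; rewrite /eps /e2; lra.
have e26 : 26 * e2 <= al - 1 by rewrite /e2; lra.
have [z [K2 [z0 zK hz]]] := gain_step al12 e20 e26 (ltW d0) (proj1 (andP s01)) uH du ua' aK2.
exists z, K2; split => //; apply: le_sumle zK => n.
rewrite ler_wpM2r ?sqr_ge0// ler_powR ?wt_ge1//; rewrite /e2; lra.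
Qed.

End BoundedVariationData.

(** * Box dimension *)

Section BoxDimension.
Variable R : realType.
Local Notation mu := (@lebesgue_measure R).
Implicit Types (E : set (R * R)) (f : R -> R) (x y h eps D C b : R) (k : nat).

Lemma at_right_ex (V : set R) : (0 : R)^'+ V -> exists2 e, 0 < e & forall x, 0 < x < e -> V x.
Proof.
move=> /nbhs_ballP[e /= e0 he]; exists e => // x /andP[x0 xe].
by apply: he => //; rewrite /ball /= sub0r normrN gtr0_norm.
Qed.

Lemma ln_inv_gt0 eps : 0 < eps < 1 -> 0 < ln eps^-1.
Proof. by move=> /andP[e0 e1]; rewrite ln_gt0// invf_gt1. Qed.

Lemma powR_opp_ln eps D : 0 < eps -> eps `^ (- D) = expR (D * ln eps^-1).
Proof. by move=> e0; rewrite /powR gt_eqF// lnV ?posrE// mulrN mulNr. Qed.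

(** A limsup below D gives covering numbers at most eps^(-D1) for small eps and some D1 < D. The
    infimum over coverings is attained up to the room between D1 and the midpoint D0. *)
Lemma dim_lt_cover E D : (fractal_dim E < D%:E)%E -> exists D0 e0, [/\ D0 < D, 0 < e0, e0 < 1 &
  forall eps, 0 < eps < e0 -> exists k, Defs.covered_by E eps k /\ k%:R <= eps `^ (- D0)].
Proof.
rewrite /fractal_dim /limf_esup => /ereal_inf_lt[_ [V V0 <-]] supV.
have [e e0 eV] := at_right_ex V0.
have [D1 D1D hD1] : exists2 D1 : R, D1 < D & forall x, V x ->
    (lne (covering_number E x) * ((ln x^-1)^-1)%:E <= D1%:E)%E.
  move: supV; set S := ereal_sup _; have Sub x : V x ->
      (lne (covering_number E x) * ((ln x^-1)^-1)%:E <= S)%E.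
    by move=> Vx; apply: ereal_sup_ubound; exists x.
  case: S Sub => [r| |] Sub //.
    by rewrite lte_fin => rD; exists r.
  by move=> _; exists (D - 1) => [|x Vx]; [lra|apply: le_trans (Sub x Vx) _; rewrite leNye].
pose D0 := (D1 + D) / 2; pose e1 := Num.min e (1 / 2).
have e10 : 0 < e1 by rewrite lt_min e0/=; lra.
have e11 : e1 < 1 by rewrite gt_min; apply/orP; right; lra.
exists D0, e1; split => //; first by rewrite /D0; lra.
move=> eps /andP[p0 p1].
have pe : eps < e by apply: lt_le_trans p1 _; rewrite ge_min lexx.
have p01 : 0 < eps < 1 by rewrite p0 (lt_trans p1).
have L0 := ln_inv_gt0 p01; have Li : 0 < (ln eps^-1)^-1 by rewrite invr_gt0.
have Veps : V eps by apply: eV; rewrite p0.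
have := hD1 eps Veps.
suff key : (covering_number E eps <= (eps `^ (- D1))%:E)%E ->
    exists k, Defs.covered_by E eps k /\ k%:R <= eps `^ (- D0).
  move=> h; apply: key; move: h; case: (covering_number E eps) => [r| |] /=; last first.
  - by rewrite leNye.
  - by rewrite gt0_mulye ?lte_fin.
  case: (leP r 0) => [r0 _|r0]; first by rewrite lee_fin; apply: le_trans r0 _; exact: powR_ge0.
  rewrite -EFinM !lee_fin ler_pdivrMr// => h.
  by rewrite powR_opp_ln// -[r in leLHS](lnK) ?posrE// ler_expR.
move=> h; have lt1 : (covering_number E eps < (eps `^ (- D0))%:E)%E.
  apply: le_lt_trans h _; rewrite lte_fin !powR_opp_ln// ltr_expR ltr_pM2r//.
  by rewrite /D0; lra.
move: lt1; rewrite /covering_number => /ereal_inf_lt[_ [k kc <-]].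
by rewrite lte_fin => /ltW hk; exists k.
Qed.

(** The constant K contributes ln K / ln (1 / eps), which is at most d once eps is below exp (- |ln
    K| / d). *)
Lemma dim_le_cover E D K : 0 < K -> (forall eps, 0 < eps < 1 ->
    exists k, Defs.covered_by E eps k /\ k%:R <= K * eps `^ (- D)) ->
  (fractal_dim E <= D%:E)%E.
Proof.
move=> K0 hK; apply/lee_addgt0Pr => d d0.
pose e := Num.min (1 / 2) (expR (- (`|ln K| / d))).
have e0 : 0 < e by rewrite lt_min expR_gt0 andbT; lra.
have e1 : e < 1 by rewrite gt_min; apply/orP; left; lra.
apply: (@le_trans _ _ (ereal_sup ((fun eps => lne (covering_number E eps) * ((ln eps^-1)^-1)%:E)%E
    @` [set eps | 0 < eps < e]))).
  apply: ereal_inf_lbound; exists [set eps | 0 < eps < e] => //.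
  apply/nbhs_ballP; exists e => //= x; rewrite /ball /= sub0r normrN => xe x0.
  by rewrite x0 -(gtr0_norm x0).
apply: ub_ereal_sup => _ [eps /= /andP[p0 pe] <-].
have p01 : 0 < eps < 1 by rewrite p0 (lt_trans pe).
have L0 := ln_inv_gt0 p01; have Li : 0 < (ln eps^-1)^-1 by rewrite invr_gt0.
have [k [kc kK]] := hK eps p01.
have Nk : (covering_number E eps <= k%:R%:E)%E by apply: ereal_inf_lbound; exists k.
have lnK : ln K <= d * ln eps^-1.
  have : eps <= expR (- (`|ln K| / d)).
    by apply: le_trans (ltW pe) _; rewrite ge_min lexx orbT.
  move=> h; have {}h : ln eps <= - (`|ln K| / d) by rewrite -[leRHS]expRK ler_ln ?posrE ?expR_gt0.
  rewrite lnV ?posrE//; apply: le_trans (ler_norm _) _; rewrite mulrC -ler_pdivrMr//; lra.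
move: Nk; case: (covering_number E eps) => [r| |] //= => [rk|_]; last first.
  by rewrite gt0_mulNye ?lte_fin// leNye.
case: (leP r 0) => r0; first by rewrite gt0_mulNye ?lte_fin// leNye.
rewrite -EFinM -EFinD lee_fin ler_pdivrMr//.
have rX : r <= K * eps `^ (- D) by apply: le_trans kK; move: rk; rewrite lee_fin.
have := rX; rewrite -ler_ln ?posrE ?mulr_gt0 ?powR_gt0// lnM ?posrE ?powR_gt0// ln_powR.
by rewrite lnV ?posrE// in lnK *; lra.
Qed.

(** About 1 / eps columns of width eps / 2, each covered by balls stacked over the oscillation of f,
    which is of order eps^b. *)
Lemma holder_dim f C b : 0 < b <= 1 -> 0 <= C ->
  (forall x y, `|f x - f y| <= C * `|x - y| `^ b) ->
  (fractal_dim (graph_on_torus f) <= (2 - b)%:E)%E.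
Proof.
move=> /andP[b0 b1] C0 fC; have p0 := pi_gt0 R.
apply: (@dim_le_cover _ _ ((4 * pi + 1) * (4 * C + 1))).
  by apply: mulr_gt0; rewrite ltr_wpDl// mulr_ge0// ltW.
move=> eps /andP[e0 e1]; pose d := eps / 2; have d0 : 0 < d by rewrite divr_gt0.
pose m := (Num.truncn (2 * pi / d)).+1; pose H := C * eps `^ b.
have H0 : 0 <= H by rewrite mulr_ge0// powR_ge0.
pose q := (Num.truncn (2 * H / d)).+1.
exists (m * q)%N; split.
  (* The index j = i q + l encodes the column i and the level l in the stack. *)
  pose c (j : 'I_(m * q)) := let x := (j %/ q)%:R * d in (x, f x - H + (j %% q)%:R * d).
  exists c => -[x y] [/= ]; rewrite /Defs.torus /= in_itv /= => /andP[x0 x2p] ->.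
  pose i := Num.truncn (x / d).
  have xd0 : 0 <= x / d by rewrite divr_ge0// ltW.
  have im : (i < m)%N.
    by rewrite ltnS; apply: le_truncn; rewrite ler_wpM2r// invr_ge0 ltW.
  have [i1 i2] : i%:R * d <= x /\ x < i%:R * d + d.
    have /andP[h1 h2] := truncn_itv xd0.
    split; first by rewrite -ler_pdivlMr.
    have -> : i%:R * d + d = i.+1%:R * d by rewrite -[i.+1%:R]natr1 mulrDl mul1r.
    by rewrite -ltr_pdivrMr.
  pose xi := i%:R * d.
  have fx : `|f x - f xi| <= H.
    have /andP[xx1 xx2] : 0 <= x - xi <= eps by rewrite /xi; move: i1 i2 d0; rewrite /d; lra.
    apply: le_trans (fC _ _) _; rewrite ler_wpM2l// ge0_ler_powR ?nnegrE ?(ltW b0) ?(ltW e0)//.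
    by rewrite ger0_norm.
  pose y0 := f xi - H; have y00 : 0 <= (f x - y0) / d.
    by rewrite divr_ge0 ?(ltW d0)//; move: fx; rewrite /y0 ler_norml; lra.
  pose l := Num.truncn ((f x - y0) / d).
  have lq : (l < q)%N.
    rewrite ltnS; apply: le_truncn; rewrite ler_wpM2r ?invr_ge0 ?(ltW d0)//.
    by move: fx; rewrite /y0 ler_norml; lra.
  have [l1 l2] : l%:R * d <= f x - y0 /\ f x - y0 < l%:R * d + d.
    have /andP[h1 h2] := truncn_itv y00.
    split; first by rewrite -ler_pdivlMr.
    have -> : l%:R * d + d = l.+1%:R * d by rewrite -[l.+1%:R]natr1 mulrDl mul1r.
    by rewrite -ltr_pdivrMr.
  have jlt : (i * q + l < m * q)%N.
    by apply: leq_trans (_ : i.+1 * q <= _)%N; [rewrite mulSn addnC ltn_add2r|rewrite leq_mul2r im orbT].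
  exists (Ordinal jlt) => //; rewrite /eball /c /=.
  have -> : ((i * q + l) %/ q)%N = i by rewrite divnMDl// divn_small// addn0.
  have -> : ((i * q + l) %% q)%N = l by rewrite modnMDl modn_small.
  rewrite -/xi -/y0.
  have a1 : (x - xi) ^+ 2 <= d ^+ 2.
    by rewrite lerXn2r ?nnegrE ?(ltW d0)//; rewrite /xi; lra.
  have a2 : (f x - (y0 + l%:R * d)) ^+ 2 <= d ^+ 2.
    by rewrite lerXn2r ?nnegrE ?(ltW d0)//; lra.
  have : eps ^+ 2 = 4 * d ^+ 2 by rewrite /d; field.
  have : 0 < d ^+ 2 by rewrite exprn_gt0.
  by lra.
have ei : 1 <= eps^-1 by rewrite invf_ge1// ltW.
have mb : m%:R <= (4 * pi + 1) * eps^-1.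
  rewrite /m -natr1; have : (Num.truncn (2 * pi / d))%:R <= 2 * pi / d.
    by have /andP[] := truncn_itv (divr_ge0 (ltW (twopi_gt0 R)) (ltW d0)).
  by have -> : 2 * pi / d = 4 * pi * eps^-1 by [rewrite /d; field; exact: lt0r_neq0]; lra.
have qb : q%:R <= (4 * C + 1) * eps `^ (b - 1).
  rewrite /q -natr1; have HH : 0 <= 2 * H by exact: mulr_ge0.
  have : (Num.truncn (2 * H / d))%:R <= 2 * H / d.
    by have /andP[] := truncn_itv (divr_ge0 HH (ltW d0)).
  have -> : 2 * H / d = 4 * C * eps `^ (b - 1).
    by rewrite powRDp// powRN powRr1 ?(ltW e0)// /H /d; field; exact: lt0r_neq0.
  have : 1 <= eps `^ (b - 1).
    by apply: (@le_trans _ _ (1 `^ (b - 1))); [rewrite powR1|apply: powR_opp_mono; lra].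
  lra.
rewrite natrM; apply: le_trans (ler_pM _ _ mb qb) _ => //.
have -> : - (2 - b) = - 1 + (b - 1) by ring.
rewrite [eps `^ (- 1 + _)]powRDp// powR_inv1 ?(ltW e0)//; apply: le_of_eq; ring.
Qed.

(** Induction on the number of centres: the interval around the centre c that covers [lo] is
    removed, and the rest covers from c + h on. *)
Lemma interval_cover (s : seq R) lo hi h : 0 <= h ->
  (forall y, lo <= y <= hi -> exists2 c, c \in s & `|y - c| < h) ->
  hi - lo <= (size s)%:R * (2 * h).
Proof.
move=> h0; move sk : (size s) => k; elim: k s sk lo => [|k IH] s sk lo hc.
  have [lh|hl] := leP lo hi; last by rewrite mul0r; lra.
  have [|c] := hc lo; first by rewrite lexx.
  by rewrite (size0nil sk).
have [lh|hl] := leP lo hi; last by apply: (@le_trans _ _ 0); [lra|rewrite !mulr_ge0].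
have [|c cs clo] := hc lo; first by rewrite lexx.
have := IH (rem c s) _ (c + h); rewrite size_rem// sk /= => /(_ erefl) H.
have : hi - (c + h) <= k%:R * (2 * h).
  apply: H => y /andP[y1 y2]; have [|d ds dy] := hc y.
    by rewrite y2 andbT; move: clo; rewrite ltr_norml; lra.
  exists d => //; have dc : d != c.
    by apply: contraTneq dy => ->; rewrite -leNgt ger0_norm; lra.
  by rewrite rem_mem// eq_sym.
by rewrite -natr1 mulrDl mul1r; move: clo; rewrite ltr_norml; lra.
Qed.

Definition near_ind (c h x : R) : R := \1_(`]c - 2 * h, c + 2 * h[%classic) x.

Lemma near_ind_integrable (a b' c h : R) : mu.-integrable `[a, b'] (EFin \o near_ind c h).
Proof.
apply: (@integrable_bdd R _ _ 1) => //; first exact: itv_fin.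
  by apply: measurable_funTS_itv; apply: measurable_indic.
by move=> x _; rewrite /near_ind indicE; case: (_ \in _); rewrite ?normr1 ?normr0.
Qed.

Lemma near_ind_le (a b' c h : R) : 0 <= h ->
  \int[mu]_(x in `[a, b']) near_ind c h x <= 4 * h.
Proof.
move=> h0; rewrite /Rintegral; have i := near_ind_integrable a b' c h.
have fi := @integrable_fin_num _ _ R mu _ (@measurable_itv R `[a, b']) _ i.
rewrite -lee_fin fineK//.
rewrite (_ : (\int[mu]_(x in _) _)%E = mu (`]c - 2 * h, c + 2 * h[%classic `&` `[a, b'])); last first.
  by rewrite integral_indic.
apply: (@le_trans _ _ (mu `]c - 2 * h, c + 2 * h[%classic)).
  by apply: le_measure; rewrite ?inE//; exact: measurableI.
rewrite lebesgue_measure_itv /= lte_fin; case: ifP => _; last by rewrite lee_fin mulr_ge0.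
by rewrite -EFinB lee_fin; lra.
Qed.

Lemma near_sum_le (a b' h : R) (s : seq (R * R)) : 0 <= h ->
  mu.-integrable `[a, b'] (EFin \o (fun x => \sum_(c <- s) near_ind c.1 h x)) /\
  \int[mu]_(x in `[a, b']) (\sum_(c <- s) near_ind c.1 h x) <= (size s)%:R * (4 * h).
Proof.
move=> h0; have mI := @measurable_itv R `[a, b']; elim: s => [|c s [IH1 IH2]].
  have -> : (fun x => \sum_(c <- [::] : seq (R * R)) near_ind c.1 h x) = (fun=> 0).
    by apply/funext => x; rewrite big_nil.
  split; first exact: (integrable_cont a b' (@cst_continuous _ _ (0 : R))).
  by rewrite Rintegral_cst// !mul0r.
have i1 := near_ind_integrable a b' c.1 h.
have e : (fun x => \sum_(d <- c :: s) near_ind d.1 h x) =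
    (fun x => 1 * near_ind c.1 h x + 1 * \sum_(d <- s) near_ind d.1 h x).
  by apply/funext => x; rewrite big_cons !mul1r.
rewrite e; split; first exact: integrable_lin.
rewrite Rintegral_lin// !mul1r /= -[(size s).+1%:R]natr1 mulrDl mul1r addrC lerD//.
exact: near_ind_le.
Qed.

(* The graph over [x, x + h] crosses every height between f x and f (x + h), so the balls
   centred within 2h of x cover that interval of heights. *)
Lemma increment_le f h k x (c : 'I_k -> R * R) : continuous f -> 0 < h ->
  graph_on_torus f `<=` \bigcup_(i in [set: 'I_k]) eball (c i) h ->
  0 <= x <= 2 * pi - h ->
  `|f (x + h) - f x| <= 2 * h * \sum_(d <- [seq c i | i <- enum 'I_k]) near_ind d.1 h x.
Proof.
move=> cf h0 hc /andP[x0 xh]; pose cs := [seq c i | i <- enum 'I_k].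
pose s := [seq d.2 | d <- cs & `|x - d.1| < 2 * h].
have ss : (size s)%:R <= \sum_(d <- cs) near_ind d.1 h x.
  rewrite size_map size_filter -sum1_count natr_sum big_mkcond /=.
  apply: ler_sum => d _; rewrite /near_ind indicE.
  case: ifP => [hd|_]; last by case: (_ \in _).
  by rewrite mem_set//= in_itv /=; move: hd; rewrite ltr_norml; lra.
have cover y : Num.min (f x) (f (x + h)) <= y <= Num.max (f x) (f (x + h)) ->
    exists2 d, d \in s & `|y - d| < h.
  move=> yI; have xxh : x <= x + h by lra.
  have [z zI fz] := IVT xxh (continuous_subspaceT cf) yI.
  move: zI; rewrite in_itv /= => /andP[z1 z2].
  have gz : graph_on_torus f (z, y).
    by split => //=; rewrite /Defs.torus /= in_itv /=; apply/andP; split; lra.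
  have [i _] := hc _ gz; rewrite /eball /= => hi.
  have s1 := sqr_ge0 (z - (c i).1); have s2 := sqr_ge0 (y - (c i).2).
  have sq (w : R) : w ^+ 2 < h ^+ 2 -> `|w| < h.
    by rewrite -(real_normK (num_real w)) ltr_sqr ?nnegrE// ltW.
  exists (c i).2; last by apply: sq; lra.
  apply/mapP; exists (c i) => //; rewrite mem_filter; apply/andP; split.
    have : `|z - (c i).1| < h by apply: sq; lra.
    by rewrite !ltr_norml; lra.
  by apply/mapP; exists i => //; rewrite mem_enum.
have := interval_cover (ltW h0) cover => h1.
have : `|f (x + h) - f x| <= (size s)%:R * (2 * h).
  apply: le_trans h1; case: (leP (f x) (f (x + h))) => q.
    by rewrite ger0_norm ?subr_ge0//.
  by rewrite ltr0_norm ?opprB// subr_lt0.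
move=> /le_trans; apply; rewrite mulrC ler_wpM2l//; lra.
Qed.

(** [increment_le] integrated in x: each ball counts on an interval of length 4 h, with weight 2
    h. *)
Lemma increments_L1 f h k : continuous f -> 0 < h -> Defs.covered_by (graph_on_torus f) h k ->
  \int[mu]_(x in `[0, 2 * pi - h]) `|f (x + h) - f x| <= 8 * h ^+ 2 * k%:R.
Proof.
move=> cf h0 [c hc]; have mI := @measurable_itv R `[0, 2 * pi - h].
have [i1 i2] := near_sum_le 0 (2 * pi - h) [seq c i | i <- enum 'I_k] (ltW h0).
have cd : continuous (fun x => `|f (x + h) - f x| : R).
  move=> x; apply: cvg_norm; apply: cvgB; last exact: cf.
  apply: (@continuous_comp _ _ _ (fun x : R => x + h) f); last exact: cf.
  by apply: cvgD; [exact: cvg_id|exact: cvg_cst].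
have i0 : mu.-integrable `[0, 2 * pi - h] (EFin \o (fun=> 0 : R)).
  exact: (integrable_cont _ _ (@cst_continuous _ _ (0 : R))).
have il := integrable_lin (2 * h) 1 mI i1 i0.
apply: (@le_trans _ _ (\int[mu]_(x in `[0, 2 * pi - h])
   (2 * h * (\sum_(d <- [seq c i | i <- enum 'I_k]) near_ind d.1 h x) + 1 * 0))).
  apply: (@le_Rintegral _ _ R mu _ _ _ mI (integrable_cont _ _ cd) il) => x.
  by rewrite /= in_itv /= mulr0 addr0 => xI; exact: increment_le hc xI.
rewrite (Rintegral_lin _ _ mI i1 i0) Rintegral_cst// mul0r mulr0 addr0.
have h2 : 0 <= 2 * h by lra.
apply: le_trans (ler_wpM2l h2 i2) _.
by rewrite size_map size_enum_ord; apply: le_of_eq; ring.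
Qed.

End BoxDimension.

(** * Increments in L^2 *)

Section Increments.
Variable R : realType.
Local Notation mu := (@lebesgue_measure R).
Local Notation torus := (@torus R).
Implicit Types (v : R -> R[i]) (x y h C b D : R).

Lemma holder_ccontinuous v C b : 0 < b -> 0 <= C ->
  (forall x y, normc (v x - v y) <= C * `|x - y| `^ b) -> ccontinuous v.
Proof.
move=> b0 C0 vC.
have key (p : R -> R) : (forall x y, `|p x - p y| <= C * `|x - y| `^ b) -> continuous p.
  move=> pC x; apply/cvgrPdist_lt => e e0; have C1 : 0 < C + 1 by lra.
  pose d := (e / (C + 1)) `^ b^-1; have d0 : 0 < d by rewrite powR_gt0// divr_gt0.
  near=> y; apply: le_lt_trans (pC _ _) _.
  have xy : `|x - y| < d by near: y; apply/nbhs_ballP; exists d.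
  have h : `|x - y| `^ b <= e / (C + 1).
    apply: (@le_trans _ _ (d `^ b)).
      by rewrite ge0_ler_powR ?nnegrE ?(ltW b0) ?(ltW d0)// ltW.
    by rewrite /d -powRrM mulVf ?gt_eqF// powRr1// ltW// divr_gt0.
  apply: le_lt_trans (ler_wpM2l C0 h) _; rewrite mulrA ltr_pdivrMr// mulrC mulrDr; lra.
split; apply: key => x y.
  by rewrite -cReN -cReD; apply: le_trans (normc_Re _) (vC x y).
by rewrite -cImN -cImD; apply: le_trans (normc_Im _) (vC x y).
Unshelve. all: by end_near. Qed.

Definition incr h v x : R[i] := v (x + h) - v x.

Lemma incr_cont h v : ccontinuous v -> ccontinuous (incr h v).
Proof.
move=> [c1 c2]; split => x.
  under eq_fun do rewrite cReD cReN; apply: cvgB; last exact: c1.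
  apply: (@continuous_comp _ _ _ (fun x : R => x + h) (fun x => Re (v x))); last exact: c1.
  by apply: cvgD; [exact: cvg_id|exact: cvg_cst].
under eq_fun do rewrite cImD cImN; apply: cvgB; last exact: c2.
apply: (@continuous_comp _ _ _ (fun x : R => x + h) (fun x => Im (v x))); last exact: c2.
by apply: cvgD; [exact: cvg_id|exact: cvg_cst].
Qed.

(** One factor of the square is bounded by Holder continuity, the other integrated by
    [increments_L1]. The last interval of length h, where x + h leaves the fundamental domain, gives
    the second summand. *)
Lemma nrm2_incr_le v C b h k1 k2 : 0 < b -> 0 <= C -> 0 < h < 2 * pi ->
  (forall x y, normc (v x - v y) <= C * `|x - y| `^ b) ->
  Defs.covered_by (graph_on_torus (fun x => Re (v x))) h k1 ->
  Defs.covered_by (graph_on_torus (fun x => Im (v x))) h k2 ->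
  nrm2 (incr h v) <= C * h `^ b * (8 * h ^+ 2 * (k1%:R + k2%:R)) + (C * h `^ b) ^+ 2 * h.
Proof.
move=> b0 C0 /andP[h0 h2] vC cov1 cov2; have cv := holder_ccontinuous b0 C0 vC.
have [c1 c2] := cv; have ci := incr_cont h cv.
set H := C * h `^ b; have H0 : 0 <= H by rewrite mulr_ge0// powR_ge0.
have vh x : normc (incr h v x) <= H.
  by apply: le_trans (vC _ _) _; rewrite addrC addKr gtr0_norm.
have cn : continuous (fun x => normc (incr h v x) ^+ 2) by exact: continuous_normc2.
have sp : nrm2 (incr h v) = \int[mu]_(x in `[0, 2 * pi - h]) normc (incr h v x) ^+ 2 +
    \int[mu]_(x in `[2 * pi - h, 2 * pi]) normc (incr h v x) ^+ 2.
  by apply: Rintegral_split; [lra|exact: integrable_cont].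
rewrite sp; apply: lerD; last first.
  have le1 : 2 * pi - h <= 2 * pi by lra.
  have := @normr_Rintegral_le R `[2 * pi - h, 2 * pi] (fun x => normc (incr h v x) ^+ 2) (H ^+ 2)
    (measurable_itv _) (itv_fin _ _) (integrable_cont _ _ cn).
  rewrite fine_itv// => /(_ _)/(le_trans (ler_norm _)) hh.
  apply: le_trans (hh _) _.
    move=> x _; rewrite ger0_norm ?sqr_ge0// lerXn2r ?nnegrE ?normc_ge0//.
  by apply: le_of_eq; ring.
have mI := @measurable_itv R `[0, 2 * pi - h].
have ca (p : R -> R) : continuous p -> continuous (fun x => `|p (x + h) - p x| : R).
  move=> cp x; apply: cvg_norm; apply: cvgB; last exact: cp.
  apply: (@continuous_comp _ _ _ (fun x : R => x + h) p); last exact: cp.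
  by apply: cvgD; [exact: cvg_id|exact: cvg_cst].
have i1 := integrable_cont 0 (2 * pi - h) (ca _ c1).
have i2 := integrable_cont 0 (2 * pi - h) (ca _ c2).
have il := integrable_lin H H mI i1 i2.
apply: (@le_trans _ _ (\int[mu]_(x in `[0, 2 * pi - h])
   (H * `|Re (v (x + h)) - Re (v x)| + H * `|Im (v (x + h)) - Im (v x)|))).
  apply: (@le_Rintegral _ _ R mu _ _ _ mI (integrable_cont _ _ cn) il) => x _.
  rewrite expr2 -mulrDr; apply: ler_pM; rewrite ?normc_ge0 ?vh//.
  by apply: le_trans (normc_ReIm _) _; rewrite /incr cReD cImD cReN cImN.
rewrite (Rintegral_lin H H mI i1 i2) -mulrDr ler_wpM2l//.
have := increments_L1 c1 h0 cov1; have := increments_L1 c2 h0 cov2; lra.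
Qed.

(** For D = 1 + b both exponents exceed 1; this surplus is what becomes regularity above 1/2. *)
Lemma increments_small v C b D : 0 < b -> 0 <= C ->
  (forall x y, normc (v x - v y) <= C * `|x - y| `^ b) ->
  (max_graph_dim v < D%:E)%E -> exists D0 e0 K, [/\ D0 < D, 0 < e0, e0 < 1, 0 <= K &
  forall h, 0 < h < e0 -> nrm2 (incr h v) <= K * (h `^ (2 + b - D0) + h `^ (1 + 2 * b))].
Proof.
move=> b0 C0 vC; rewrite /max_graph_dim gt_max => /andP[d1 d2].
have [D1 [e1 [D1D e10 e11 h1]]] := dim_lt_cover d1.
have [D2 [e2 [D2D e20 e21 h2]]] := dim_lt_cover d2.
exists (Num.max D1 D2), (Num.min e1 e2), (16 * C + C ^+ 2).
have CC : 0 <= C ^+ 2 by exact: sqr_ge0.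
split; [by rewrite gt_max D1D|by rewrite lt_min e10|by rewrite gt_min e11|lra|].
move=> h /andP[h0]; rewrite lt_min => /andP[he1 he2]; set D0 := Num.max D1 D2.
have h1' : h < 1 by exact: lt_trans he1 e11.
have [k1 [c1 b1]] := h1 h (introT andP (conj h0 he1)).
have [k2 [c2 b2]] := h2 h (introT andP (conj h0 he2)).
have p2 : 1 < pi :> R by have := @pi_ge2 R; lra.
have hI : 0 < h < 2 * pi by rewrite h0 /=; lra.
apply: le_trans (nrm2_incr_le b0 C0 hI vC c1 c2) _.
have mono (Di : R) : Di <= D0 -> h `^ (- Di) <= h `^ (- D0).
  move=> DD; rewrite !powR_opp_ln// ler_expR ler_wpM2r// ltW// ln_inv_gt0// h0//.
have m1 : k1%:R <= h `^ (- D0) by apply: le_trans b1 (mono _ _); rewrite le_max lexx.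
have m2 : k2%:R <= h `^ (- D0) by apply: le_trans b2 (mono _ _); rewrite le_max lexx orbT.
have e1' : h `^ (2 + b - D0) = h `^ b * h ^+ 2 * h `^ (- D0).
  by rewrite -(powR_mulrn 2 (ltW h0)) -!powRDp//; congr powR; ring.
have e2' : h `^ (1 + 2 * b) = (h `^ b) ^+ 2 * h.
  by rewrite powRX -[X in _ = _ * X](powRr1 (ltW h0)) -powRDp//; congr powR; ring.
rewrite e1' e2'; set X := h `^ b; set Y := h `^ (- D0) in m1 m2 *.
have X0 : 0 <= X by exact: powR_ge0.
have Y0 : 0 <= Y by exact: powR_ge0.
have h20 := sqr_ge0 h.
have Q0 : 0 <= C * X * (8 * h ^+ 2) by apply: mulr_ge0; [exact: mulr_ge0|lra].
have kk : k1%:R + k2%:R <= 2 * Y by lra.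
have t1 : C * X * (8 * h ^+ 2 * (k1%:R + k2%:R)) <= 16 * C * (X * h ^+ 2 * Y).
  by have := ler_wpM2l Q0 kk; lra.
have Z0 : 0 <= X * h ^+ 2 * Y by exact: mulr3_ge0.
have Z1 : 0 <= X ^+ 2 * h by apply: mulr_ge0; [exact: sqr_ge0|exact: ltW].
have t2 : (C * X) ^+ 2 * h = C ^+ 2 * (X ^+ 2 * h) by ring.
rewrite t2; have := mulr_ge0 C0 Z1; have := mulr_ge0 CC Z0; lra.
Qed.

End Increments.

(** * Dyadic blocks and assembly *)

Section DyadicBlocks.
Variable R : realType.
Implicit Types (x y t b : R) (n : int) (j J m N : nat).

(** The frequencies of size about 2^j, with the two signs listed separately because the exponential
    sum bounds are for positive n. *)
Definition block j : seq int :=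
  [seq m%:Z | m <- index_iota (2 ^ j) (2 ^ j.+1)] ++
  [seq - m%:Z | m <- index_iota (2 ^ j) (2 ^ j.+1)].

Lemma expn2_gt0 j : (0 < 2 ^ j)%N. Proof. by rewrite expn_gt0. Qed.

Lemma mem_block j n : (n \in block j) = (2 ^ j <= `|n| < 2 ^ j.+1)%N.
Proof.
rewrite mem_cat; have p := expn2_gt0 j; apply/orP/idP => [[|]/mapP[m]|h].
- by rewrite mem_index_iota => h ->; rewrite absz_nat.
- by rewrite mem_index_iota => h ->; rewrite abszN absz_nat.
have [n0|n0] := leP 0 n; [left|right]; apply/mapP; exists `|n|%N; rewrite ?mem_index_iota//.
  by rewrite gez0_abs.
by rewrite ltz0_abs// opprK.
Qed.

Lemma uniq_block j : uniq (block j).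
Proof.
rewrite cat_uniq !map_inj_uniq ?iota_uniq ?andbT; [|by move=> a c; lia|by move=> a c; lia].
apply/andP; split => //; apply/hasPn => n /mapP[m]; rewrite mem_index_iota => /andP[h _] ->.
have p := expn2_gt0 j; apply/negP => /mapP[m']; rewrite mem_index_iota => /andP[h' _].
by move: (2 ^ j)%N p h h' => k; lia.
Qed.

Lemma block_neq0 j n : n \in block j -> n != 0.
Proof. by rewrite mem_block; apply: contraTneq => ->; rewrite absz0 leqn0 expn_eq0. Qed.

Definition dbox J := zbox (2 ^ J).-1.

Lemma big_dboxS (V : nmodType) (F : int -> V) J :
  \sum_(n <- dbox J.+1) F n = \sum_(n <- dbox J) F n + \sum_(n <- block J) F n.
Proof.
have p := expn2_gt0 J; have p' := expn2_gt0 J.+1.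
have h : perm_eq (dbox J.+1) (dbox J ++ block J).
  apply: uniq_perm; first exact: uniq_zbox.
    rewrite cat_uniq uniq_zbox uniq_block andbT /=; apply/hasPn => n.
    by rewrite mem_block /= mem_zbox; lia.
  move=> n; rewrite mem_cat mem_block !mem_zbox.
  have : (2 ^ J.+1 = 2 * 2 ^ J)%N by rewrite expnS.
  by move: (2 ^ J)%N (2 ^ J.+1)%N p p' => k l; lia.
by rewrite (perm_big _ h) big_cat.
Qed.

Lemma big_dbox (V : nmodType) (F : int -> V) J :
  \sum_(n <- dbox J) F n = F 0 + \sum_(0 <= j < J) \sum_(n <- block j) F n.
Proof.
elim: J => [|J IH]; first by rewrite (_ : dbox 0 = [:: 0])// big_seq1 (big_geq (leqnn 0)) addr0.
by rewrite big_dboxS IH big_nat_recr//= addrA.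
Qed.

Lemma zbox_dbox N : {subset zbox N <= dbox N}.
Proof.
apply: zbox_sub; have := ltn_expl N (isT : (1 < 2)%N); move: (2 ^ N)%N => k; lia.
Qed.

Definition dy j : R := (2 ^ j)%N%:R.

Lemma dy_ge1 j : 1 <= dy j. Proof. by rewrite ler1n expn2_gt0. Qed.
Lemma dy_gt0 j : 0 < dy j. Proof. by apply: lt_le_trans (dy_ge1 j). Qed.

Lemma dy_pow j b : dy j `^ b = (2 `^ b) ^+ j.
Proof. by rewrite powRX /dy natrX -powR_mulrn// -powRrM mulrC. Qed.

Lemma block_norm j n : n \in block j -> dy j <= `|n%:~R : R| /\ `|n%:~R : R| <= 2 * dy j.
Proof.
rewrite mem_block => /andP[h1 h2].
have -> : `|n%:~R : R| = (`|n|%N)%:R by rewrite -intr_norm -abszE.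
split; first by rewrite ler_nat.
by rewrite /dy -natrM ler_nat -expnS ltnW.
Qed.

Lemma geom_sum_le (q : R) J : 0 <= q < 1 -> \sum_(0 <= j < J) q ^+ j <= (1 - q)^-1.
Proof.
move=> /andP[q0 q1]; have q10 : 0 < 1 - q by lra.
have e : (1 - q) * \sum_(0 <= j < J) q ^+ j = 1 - q ^+ J.
  elim: J => [|J IH]; first by rewrite big_geq// expr0; ring.
  by rewrite big_nat_recr//= mulrDr IH exprS; ring.
rewrite -(ler_pM2l q10) e mulfV ?gt_eqF// lerBlDr lerDl exprn_ge0//.
Qed.

Lemma dyadic_sumle (f : int -> R) C q : (forall n, 0 <= f n) -> 0 <= q < 1 -> 0 <= C ->
  (forall j, \sum_(n <- block j) f n <= C * q ^+ j) -> sumle f (f 0 + C * (1 - q)^-1).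
Proof.
move=> f0 q01 C0 fC s us; have [N sN] := seq_sub_zbox s.
apply: le_trans (ler_sum_subset f0 us (_ : {subset s <= dbox N})) _.
  by move=> n /sN /zbox_dbox.
rewrite big_dbox lerD2l; apply: le_trans (_ : \sum_(0 <= j < N) C * q ^+ j <= _).
  by apply: ler_sum => j _.
by rewrite -mulr_sumr ler_wpM2l// geom_sum_le.
Qed.

(** Abel summation: the differences of the decreasing weights are nonnegative and telescope. *)
Lemma abel_bound (A B : nat) (f : nat -> R[i]) (w : nat -> R) (P : R) : (A <= B)%N ->
  (forall m, (A <= m <= B)%N -> normc (\sum_(A <= n < m) f n) <= P) ->
  (forall n : nat, (A <= n)%N -> w n.+1 <= w n) -> (forall n : nat, 0 <= w n) ->
  normc (\sum_(A <= n < B) f n * (w n)%:C) <= P * w A.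
Proof.
move=> AB fP wd w0; have P0 : 0 <= P by apply: le_trans (normc_ge0 _) (fP A _); rewrite leqnn.
pose S m := \sum_(A <= n < m) f n.
have e m : (A <= m)%N -> \sum_(A <= n < m) f n * (w n)%:C =
    S m * (w m)%:C + \sum_(A <= n < m) S n.+1 * (w n - w n.+1)%:C.
  move=> Am; rewrite -(subnKC Am); elim: (m - A)%N => [|k IH].
    by rewrite addn0 /S !big_geq// mul0r addr0.
  rewrite addnS !big_nat_recr ?leq_addr//= IH /S [\sum_(A <= n < (A + k).+1) f n]big_nat_recr ?leq_addr//=.
  by rewrite rmorphB /=; ring.
rewrite e//; apply: le_trans (normcD _ _) _.
have tel : \sum_(A <= n < B) (w n - w n.+1) = w A - w B.
  rewrite -[LHS]opprK -sumrN (eq_bigr (fun n : nat => w n.+1 - w n)).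
    by rewrite telescope_sumr// opprB.
  by move=> n _; rewrite opprB.
have -> : P * w A = P * w B + \sum_(A <= n < B) P * (w n - w n.+1).
  by rewrite -mulr_sumr tel; ring.
apply: lerD.
  by rewrite ComplexField.Normc.normcM normc_real ger0_norm// ler_wpM2r// fP// AB leqnn.
apply: le_trans (normc_sum _ _ _) _; rewrite big_nat_cond [leRHS]big_nat_cond.
apply: ler_sum => n /andP[/andP[An nB] _].
rewrite ComplexField.Normc.normcM normc_real ger0_norm ?subr_ge0 ?wd// ler_wpM2r ?subr_ge0 ?wd// fP//.
by rewrite leqW.
Qed.

(** The symbol is even, so negative frequencies are positive ones at - y. The second bound is the
    exponential sum itself; the first follows by Abel summation with weights 1 / n. *)
Lemma block_kernel (al t b gam : R) : 1 < al < 2 -> t != 0 -> 0 < b < gam ->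
  (gam = 1 - al / 2) \/ (3 / 2 <= al /\ gam = 1 / 2 - al / 6) ->
  exists2 K, 0 < K & forall j y,
    normc (\sum_(n <- block j) cis (t * frac_symbol al n) * ((n%:~R : R)^-1)%:C * expi n y) <=
      K * dy j `^ (- b) /\
    normc (\sum_(n <- block j) cis (t * frac_symbol al n) * expi n y) <= K * dy j `^ (1 - b).
Proof.
move=> al12 t0 bg hgam; have [K K0 hK] := expsum_bound al12 t0 bg hgam.
exists (2 * K) => [|j y]; first by rewrite mulr_gt0.
have p := expn2_gt0 j; pose N := (2 ^ j)%N.
pose f (x : R) m : R[i] := cis (power_phase al t x m%:R).
have fpos m : cis (t * frac_symbol al m%:Z) * expi m%:Z y = f y m.
  rewrite /expi -cisD /f /power_phase /frac_symbol ger0_norm//.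
  by congr cis; ring.
have fneg m : cis (t * frac_symbol al (- m%:Z)) * expi (- m%:Z) y = f (- y) m.
  rewrite /expi -cisD /f /power_phase /frac_symbol mulrNz normrN ger0_norm//.
  by congr cis; ring.
have part (x : R) (B : nat) : (B <= 2 ^ j.+1)%N -> normc (\sum_(N <= m < B) f x m) <= K * dy j `^ (1 - b).
  by move=> hB; apply: hK => //; rewrite -mul2n -expnS.
have dj0 := dy_gt0 j.
have inv (x : R) : normc (\sum_(N <= m < 2 ^ j.+1) f x m * ((m%:R : R)^-1)%:C) <= K * dy j `^ (- b).
  have NB : (N <= 2 ^ j.+1)%N by rewrite leq_exp2l.
  pose w m : R := (m.-1.+1)%:R^-1.
  have we m : (N <= m)%N -> w m = m%:R^-1 by move=> Nm; rewrite /w prednK// (leq_trans p).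
  rewrite (eq_big_nat _ _ (F2 := fun m => f x m * (w m)%:C)); last first.
    by move=> m /andP[Nm _]; rewrite we.
  apply: le_trans (abel_bound NB (P := K * dy j `^ (1 - b)) _ _ _) _.
  - by move=> m /andP[_ mB]; apply: part.
  - move=> m Nm; rewrite !we ?(leqW Nm)// lef_pV2 ?posrE ?ltr0n ?ler_nat//.
    exact: leq_trans p Nm.
  - by move=> m; rewrite /w invr_ge0.
  rewrite we// -/(dy j) -mulrA ler_wpM2l ?(ltW K0)//.
  by rewrite [1 - b]addrC powRDp// powRr1 ?(ltW dj0)// mulfK ?gt_eqF.
split; rewrite big_cat /= !big_map; apply: le_trans (normcD _ _) _;
  rewrite -mulrA mulr_natl mulr2n; apply: lerD.
- rewrite (eq_bigr (fun m => f y m * ((m%:R : R)^-1)%:C)); first exact: inv.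
  by move=> m _; rewrite -fpos mulrAC.
- rewrite (eq_bigr (fun m => - (f (- y) m * ((m%:R : R)^-1)%:C))); last first.
    by move=> m _; rewrite -fneg mulrNz invrN rmorphN /=; ring.
  by rewrite sumrN normcN; exact: inv.
- by rewrite (eq_bigr (f y)); [exact: part|move=> m _; rewrite -fpos].
- by rewrite (eq_bigr (f (- y))); [exact: part|move=> m _; rewrite -fneg].
Qed.

End DyadicBlocks.

Section DyadicLimits.
Variable R : realType.
Local Notation mu := (@lebesgue_measure R).
Local Notation torus := (@torus R).
Implicit Types (x y h b q C E : R) (n : int) (j J N : nat) (c : int -> R[i]).

(** The intervals of centre p J and radius E q^J are nested, and the limit is the common point. *)
Lemma geom_cvg (p : nat -> R) E q : 0 <= q < 1 -> 0 <= E ->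
  (forall J, `|p J.+1 - p J| <= E * (1 - q) * q ^+ J) ->
  exists l, forall J, `|l - p J| <= E * q ^+ J.
Proof.
move=> /andP[q0 q1] E0 hp.
have step J : p J.+1 + E * q ^+ J.+1 <= p J + E * q ^+ J /\ p J - E * q ^+ J <= p J.+1 - E * q ^+ J.+1.
  have := hp J; rewrite ler_norml exprS => /andP[h1 h2].
  by split; move: h1 h2; set z := q ^+ J; lra.
have mono1 J M : (J <= M)%N -> p M + E * q ^+ M <= p J + E * q ^+ J.
  move=> JM; rewrite -(subnKC JM); elim: (M - J)%N => [|k IH]; first by rewrite addn0.
  by rewrite addnS; apply: le_trans IH; case: (step (J + k)%N).
have mono2 J M : (J <= M)%N -> p J - E * q ^+ J <= p M - E * q ^+ M.
  move=> JM; rewrite -(subnKC JM); elim: (M - J)%N => [|k IH]; first by rewrite addn0.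
  by rewrite addnS; apply: le_trans IH _; case: (step (J + k)%N).
have pos J : 0 <= E * q ^+ J by rewrite mulr_ge0// exprn_ge0.
pose A J := [set p M + E * q ^+ M | M in [set: nat]].
have cv : cvgn (fun J => p J + E * q ^+ J).
  apply: nonincreasing_is_cvgn; first by move=> J M JM; exact: mono1.
  exists (p 0%N - E) => _ [M _ <-]; have := mono2 0%N M (leq0n M); rewrite expr0 mulr1.
  by have := pos M; lra.
exists (limn (fun J => p J + E * q ^+ J)) => J.
have up : limn (fun J => p J + E * q ^+ J) <= p J + E * q ^+ J.
  by apply: limr_le => //; exists J => // M /= JM; exact: mono1.
have lo : p J - E * q ^+ J <= limn (fun J => p J + E * q ^+ J).
  apply: limr_ge => //; exists J => // M /= JM; have := mono2 J M JM; have := pos M; lra.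
by rewrite ler_norml; lra.
Qed.

Lemma geom_cvg0 E q e : 0 <= q < 1 -> 0 <= E -> 0 < e -> exists J, E * q ^+ J <= e.
Proof.
move=> /andP[q0 q1] E0 e0.
have q1' : `|q| < 1 by rewrite ger0_norm.
have cv : (fun J => E * q ^+ J) @ \oo --> 0.
  by rewrite -[0](mulr0 E); apply: cvgM; [exact: cvg_cst|exact: cvg_expr].
have [J _ hJ] := (@cvgr0Pnorm_le _ _ _ _ _ _).1 cv e e0.
exists J; have := hJ J (leqnn J); rewrite /= ger0_norm//.
by rewrite mulr_ge0// exprn_ge0.
Qed.

Lemma cgeom_cvg (p : nat -> R -> R[i]) E q : 0 <= q < 1 -> 0 <= E ->
  (forall J x, normc (p J.+1 x - p J x) <= E * (1 - q) * q ^+ J) ->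
  exists v : R -> R[i], forall J x, normc (v x - p J x) <= 2 * E * q ^+ J.
Proof.
move=> q01 E0 hp.
have h1 x : exists l, forall J, `|l - Re (p J x)| <= E * q ^+ J.
  apply: geom_cvg => // J; rewrite -cReN -cReD; exact: le_trans (normc_Re _) (hp J x).
have h2 x : exists l, forall J, `|l - Im (p J x)| <= E * q ^+ J.
  apply: geom_cvg => // J; rewrite -cImN -cImD; exact: le_trans (normc_Im _) (hp J x).
have [v1 H1] := choice h1; have [v2 H2] := choice h2.
exists (fun x => v1 x +i* v2 x) => J x; apply: le_trans (normc_ReIm _) _.
rewrite cReD cImD cReN cImN /=; have := H1 x J; have := H2 x J; lra.
Qed.

Lemma trig_lip s c B x y : (forall z, normc (\sum_(n <- s) c n * (n%:~R : R)%:C * expi n z) <= B) ->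
  normc (trig s c x - trig s c y) <= 2 * B * `|x - y|.
Proof.
move=> hB.
have d : cderiv (trig s c) (fun z => \sum_(n <- s) c n * ('i * (n%:~R : R)%:C * expi n z)).
  rewrite /trig; apply: cderiv_sum => n; apply: cderivZ.
  have := cderiv_cis (n%:~R : R) 0; rewrite /expi.
  by under eq_fun do rewrite addr0; under [X in cderiv _ X]eq_fun do rewrite addr0.
have cd : ccontinuous (fun z => \sum_(n <- s) c n * ('i * (n%:~R : R)%:C * expi n z)).
  apply: ccontinuous_sum => n; apply: ccontinuousM; first exact: ccontinuous_cst.
  by apply: ccontinuousM; [exact: ccontinuous_cst|exact: ccontinuous_expi].
have bd z : normc (\sum_(n <- s) c n * ('i * (n%:~R : R)%:C * expi n z)) <= B.
  have -> : \sum_(n <- s) c n * ('i * (n%:~R : R)%:C * expi n z) =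
      'i * \sum_(n <- s) c n * (n%:~R : R)%:C * expi n z.
    by rewrite mulr_sumr; apply: eq_bigr => n _; ring.
  by rewrite ComplexField.Normc.normcM normc_i mul1r.
have key a b : a <= b -> normc (trig s c b - trig s c a) <= 2 * B * (b - a).
  move=> ab; apply: (cderiv_bdlip (a := a) (b := b) d cd) => //; last by rewrite lexx.
by have [xy|/ltW yx] := leP x y;
  [rewrite normcBC distrC ger0_norm ?subr_ge0//; exact: key
  |rewrite ger0_norm ?subr_ge0//; exact: key].
Qed.

Lemma interp_le (X A B r : R) : 0 <= X -> X <= A -> X <= B -> 0 < r < 1 -> X <= A `^ (1 - r) * B `^ r.
Proof.
move=> X0 XA XB /andP[r0 r1]; move: X0; rewrite le_eqVlt => /predU1P[<-|X0].
  by rewrite mulr_ge0// powR_ge0.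
have e : X = X `^ (1 - r) * X `^ r by rewrite -powRDp// subrK powRr1// ltW.
rewrite [leLHS]e; apply: ler_pM; rewrite ?powR_ge0// ge0_ler_powR ?nnegrE//.
- lra.
- exact: ltW.
- by apply: le_trans XA; exact: ltW.
- exact: ltW.
- exact: ltW.
- by apply: le_trans XB; exact: ltW.
Qed.

(* Interpolating between the sup bound 2^(-jb) and the Lipschitz bound 2^(j(1-b)) of the
   dyadic blocks. *)
Lemma dyadic_holder c C b beta : 0 < C -> 0 < beta < b -> b < 1 ->
  (forall j x, normc (trig (block j) c x) <= C * dy R j `^ (- b)) ->
  (forall j x, normc (\sum_(n <- block j) c n * (n%:~R : R)%:C * expi n x) <= C * dy R j `^ (1 - b)) ->
  exists v : R -> R[i], exists E q H, [/\ 0 <= q < 1, 0 <= E, 0 <= H,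
    forall J x, normc (v x - trig (dbox J) c x) <= E * q ^+ J &
    forall x y, normc (v x - v y) <= H * `|x - y| `^ beta].
Proof.
move=> Cp /andP[be0 beb] b1 sup lip; have C0 := ltW Cp.
(* q is the rate at which the partial sums converge uniformly, q2 the decay of the Holder seminorms
   of the blocks after interpolation. *)
pose q : R := 2 `^ (- b); pose q2 : R := 2 `^ (- (b - beta)).
have qlt (r : R) : 0 < r -> 0 <= (2 : R) `^ (- r) < 1.
  move=> r0; rewrite powR_ge0 powRN invf_lt1 ?powR_gt0//=.
  have l2 : 0 < ln (2 : R) by apply: ln_gt0; rewrite ltr1n.
  by rewrite /powR (negbTE (lt0r_neq0 _))// -[ltLHS]expR0 ltr_expR; exact: mulr_gt0.
have q01 : 0 <= q < 1 by apply: qlt; lra.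
have q201 : 0 <= q2 < 1 by apply: qlt; lra.
have q10 : 0 < 1 - q by lra.
have q210 : 0 < 1 - q2 by lra.
have S J x : trig (dbox J.+1) c x = trig (dbox J) c x + trig (block J) c x.
  by rewrite /trig big_dboxS.
pose E := C / (1 - q); have E0 : 0 <= E by rewrite divr_ge0// ltW.
have hp J x : normc (trig (dbox J.+1) c x - trig (dbox J) c x) <= E * (1 - q) * q ^+ J.
  by rewrite S addrC addKr /E divfK ?gt_eqF// -dy_pow; exact: sup.
have [v hv] := cgeom_cvg q01 E0 hp.
pose H := 2 * C / (1 - q2); have H0 : 0 <= H by rewrite divr_ge0 ?mulr_ge0// ltW.
exists v, (2 * E), q, H; split => //; first by rewrite mulr_ge0.
have bl j x y : normc (trig (block j) c x - trig (block j) c y) <= 2 * C * q2 ^+ j * `|x - y| `^ beta.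
  have h1 : normc (trig (block j) c x - trig (block j) c y) <= 2 * C * dy R j `^ (- b).
    by apply: le_trans (normcB _ _) _; have := sup j x; have := sup j y; lra.
  have h2 := trig_lip x y (lip j).
  have be1 : 0 < beta < 1 by lra.
  apply: le_trans (interp_le (normc_ge0 _) h1 h2 be1) _.
  have C2 : 0 <= 2 * C by rewrite mulr_ge0.
  have d0 := dy_gt0 R j.
  rewrite mulrA !powRM ?mulr_ge0 ?powR_ge0//.
  rewrite -!powRrM.
  have -> : 2 `^ (1 - beta) * C `^ (1 - beta) * dy R j `^ (- b * (1 - beta)) *
      (2 `^ beta * C `^ beta * dy R j `^ ((1 - b) * beta) * `|x - y| `^ beta) =
    (2 `^ (1 - beta) * 2 `^ beta) * (C `^ (1 - beta) * C `^ beta) *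
    (dy R j `^ (- b * (1 - beta)) * dy R j `^ ((1 - b) * beta)) * `|x - y| `^ beta by ring.
  rewrite ler_wpM2r ?powR_ge0// -!powRDp//.
  have -> : 1 - beta + beta = 1 by ring.
  have -> : - b * (1 - beta) + (1 - b) * beta = - (b - beta) by ring.
  by rewrite !powRr1// dy_pow.
have hS J x y : normc (trig (dbox J) c x - trig (dbox J) c y) <= H * `|x - y| `^ beta.
  have e z : trig (dbox J) c z = c 0 * expi 0 z + \sum_(0 <= j < J) trig (block j) c z.
    by rewrite /trig big_dbox.
  have -> : trig (dbox J) c x - trig (dbox J) c y =
      \sum_(0 <= j < J) (trig (block j) c x - trig (block j) c y).
    by rewrite sumrB !e /expi mulr0z !mul0r; ring.
  apply: le_trans (normc_sum _ _ _) _.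
  apply: (@le_trans _ _ (\sum_(0 <= j < J) 2 * C * `|x - y| `^ beta * q2 ^+ j)).
    by apply: ler_sum => j _; apply: le_trans (bl j x y) _; apply: le_of_eq; ring.
  rewrite -mulr_sumr; apply: le_trans (ler_wpM2l _ (geom_sum_le J q201)) _.
    by rewrite !mulr_ge0// powR_ge0.
  by apply: le_of_eq; rewrite /H; ring.
move=> x y; apply/ler_addgt0Pr => e e0; have e2 : 0 < e / 2 by rewrite divr_gt0.
have E20 : 0 <= 2 * E by rewrite mulr_ge0.
have [J hJ] := geom_cvg0 q01 E20 e2.
have -> : v x - v y = (v x - trig (dbox J) c x) + (trig (dbox J) c x - trig (dbox J) c y) -
    (v y - trig (dbox J) c y) by ring.
apply: le_trans (normcB _ _) _; have := normcD (v x - trig (dbox J) c x) (trig (dbox J) c x - trig (dbox J) c y).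
by have := hv J x; have := hv J y; have := hS J x y; lra.
Qed.

End DyadicLimits.

(** * Periodicity and identification almost everywhere *)

Section Periodic.
Variable R : realType.
Local Notation mu := (@lebesgue_measure R).
Local Notation torus := (@torus R).
Implicit Types (f g v : R -> R[i]) (x y c : R).

(** The image measure agrees with Lebesgue measure on half-open intervals, which determine it. *)
Lemma lebesgue_shift c (A : set R) : measurable A -> mu ((fun x => x + c) @^-1` A) = mu A.
Proof.
have ms : measurable_fun [set: R] (fun x : R => x + c).
  by apply: continuous_measurable_fun => x; apply: cvgD; [exact: cvg_id|exact: cvg_cst].
move=> mA; apply/esym.
pose nu := pushforward mu (fun x : measurableTypeR R => (x + c : measurableTypeR R)).
have := @lebesgue_measure_unique R [the measure _ _ of nu] _ A mA.
apply=> _ [[a b] _ <-] /=; rewrite /nu /pushforward /=.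
have -> : (fun x : R => x + c) @^-1` `]a, b] = `]a - c, b - c]%classic.
  by apply/seteqP; split => x /=; rewrite !in_itv /=; lra.
rewrite !lebesgue_measure_itv /= !lte_fin ltrD2r; case: ifP => // _.
by rewrite -!EFinB; congr (_%:E); ring.
Qed.

Definition fold x : R := x - (Num.floor (x / (2 * pi)))%:~R * (2 * pi).

Lemma fold_torus x : torus (fold x).
Proof.
have tp := twopi_gt0 R; rewrite /Defs.torus /= in_itv /= /fold.
have /andP[] := floor_itv (x / (2 * pi)).
rewrite intrD ler_pdivlMr// ltr_pdivrMr// mulrDl mul1r => h1 h2.
by apply/andP; split; lra.
Qed.

Lemma fold_measurable : measurable_fun [set: R] fold.
Proof.
have tp := twopi_gt0 R.
apply: measurable_funB => //; apply: measurable_funM => //.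
apply: nondecreasing_measurable => // x y xy.
by rewrite ler_int; apply: le_floor; rewrite ler_pM2r// invr_gt0.
Qed.

Lemma periodic_nat (T : Type) (p : R -> T) (m : nat) x : (forall x, p (x + 2 * pi) = p x) ->
  p (x + m%:R * (2 * pi)) = p x.
Proof.
move=> pp; elim: m => [|m IH]; first by rewrite mul0r addr0.
by rewrite -natr1 mulrDl mul1r addrA pp.
Qed.

Lemma periodic_fold (T : Type) (p : R -> T) x : (forall x, p (x + 2 * pi) = p x) ->
  p (fold x) = p x.
Proof.
move=> pp; rewrite /fold; case: (Num.floor _) => m.
  by rewrite -(periodic_nat m _ pp) subrK.
by rewrite NegzE mulrNz mulNr opprK -[LHS](periodic_nat 0 _ pp) mul0r addr0 (periodic_nat m.+1).
Qed.

Lemma measurable_periodic (p : R -> R) : (forall x, p (x + 2 * pi) = p x) ->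
  measurable_fun torus p -> measurable_fun [set: R] p.
Proof.
move=> pp mp _ Y mY; rewrite setTI.
have := fold_measurable measurableT (mp (@measurable_torus R) Y mY); rewrite setTI.
suff -> : fold @^-1` (torus `&` p @^-1` Y) = p @^-1` Y by [].
apply/seteqP; split=> x /=; rewrite (periodic_fold x pp); first by case.
by split=> //; exact: fold_torus.
Qed.

(** The exceptional set lies in the union of the translates of a null set by multiples of 2 pi. *)
Lemma ae_periodic (P : R -> Prop) : (forall x, P (x + 2 * pi) = P x) ->
  {ae mu, forall x, torus x -> P x} -> {ae mu, forall x, P x}.
Proof.
move=> pP [N [mN N0 sN]].
pose B (s : bool) (k : nat) := (fun x : R => x + (if s then k%:R * (2 * pi) else - (k%:R * (2 * pi)))) @^-1` N.
have nB s k : mu.-negligible (B s k).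
  apply/negligibleP; last exact: (etrans (lebesgue_shift _ mN) N0).
  rewrite -[B s k]setTI; apply: (_ : measurable_fun [set: R] _) => //.
  by apply: continuous_measurable_fun => x; apply: cvgD; [exact: cvg_id|exact: cvg_cst].
apply: (@negligibleS _ _ _ mu (\bigcup_k (B true k `|` B false k))).
  move=> x /= nPx; have fT := fold_torus x.
  have nPf : ~ P (fold x) by rewrite (periodic_fold x pP).
  have Nf : N (fold x) by apply: sN => /= h; apply: nPf; exact: h.
  move: Nf; rewrite /fold; case: (Num.floor _) => m Nf.
    by exists m => //; right.
  by exists m.+1 => //; left; move: Nf; rewrite /B /= NegzE mulrNz mulNr opprK.
by apply: negligible_bigcup => k; apply: negligibleU.
Qed.

Lemma trig_periodic s (c : int -> R[i]) x : trig s c (x + 2 * pi) = trig s c x.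
Proof.
apply: eq_bigr => n _; congr (_ * _); rewrite /expi mulrDr; exact: cis2pin.
Qed.

Lemma BV_in_L2 g : in_BV g -> in_L2 g.
Proof.
move=> hg; have [pg _ _] := hg; have [[m1 m2] _] := BV_bounded hg.
have [_ /integrableP[_ hi]] := BV_L2 hg; split => //.
  split; apply: measurable_periodic => // x; first by rewrite pg.
  by rewrite pg.
apply: le_lt_trans hi; apply: le_of_eq; apply: eq_integral => x _ /=.
by rewrite ger0_norm ?sqr_ge0.
Qed.

(** The dyadic partial sums converge to v uniformly and to f in L^2, so f - v has norm 0. *)
Lemma L2_limit_unique f v (c : int -> R[i]) (E q : R) : L2 f -> ccontinuous v ->
  0 <= q < 1 -> 0 <= E ->
  (forall J x, normc (v x - trig (dbox J) (fourier f) x) <= E * q ^+ J) ->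
  {ae mu, forall x, torus x -> v x = f x}.
Proof.
move=> Lf cv q01 E0 hv; have tp := twopi_gt0 R; have Lv := L2_cont cv.
have Ld := L2B Lf Lv.
have z : nrm2 (fun x => f x - v x) = 0.
  apply/eqP; rewrite eq_le nrm2_ge0 andbT; apply/ler_addgt0Pr => e e0; rewrite add0r.
  have e4 : 0 < e / 4 by rewrite divr_gt0.
  have [N _ hN] := (@cvgr0Pnorm_le _ _ _ _ _ _).1 (L2cvg_L2 Lf) _ e4.
  pose d := Num.min 1 (e / (4 * (2 * pi))).
  have d0 : 0 < d by rewrite lt_min ltr01 divr_gt0// mulr_gt0.
  have [J0 hJ0] := geom_cvg0 q01 E0 d0.
  pose J := maxn N J0; have /andP[q0 q1] := q01.
  have EJ : E * q ^+ J <= d.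
    apply: le_trans hJ0; rewrite ler_wpM2l// ler_wiXn2l//; first exact: ltW.
    exact: leq_maxr.
  have NJ : (N <= (2 ^ J).-1)%N.
    rewrite -ltnS prednK ?expn_gt0//.
    apply: leq_ltn_trans (leq_maxl N J0) _; exact: ltn_expl.
  have := hN _ NJ; rewrite /= (ger0_norm (nrm2_ge0 _)) => h1.
  have Lt := L2_trig (dbox J) (fourier f).
  have h2 : nrm2 (fun x => trig (dbox J) (fourier f) x - v x) <= e / 4.
    have cd : ccontinuous (fun x => trig (dbox J) (fourier f) x - v x).
      apply: ccontinuousD; first exact: ccontinuous_trig.
      have := ccontinuousM (ccontinuous_cst (-1)) cv.
      by congr ccontinuous; apply/funext => x; rewrite mulN1r.
    have le0 : 0 <= 2 * pi :> R by exact: ltW.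
    apply: le_trans (ler_norm _) _.
    apply: le_trans (normr_Rintegral_le (@measurable_torus R) (torus_fin R) (M := e / (4 * (2 * pi)))
      (proj2 (L2_cont cd)) _) _; last first.
      by rewrite mu_torus -ler_pdivlMr// -mulrA -invfM.
      move=> x _; rewrite ger0_norm ?sqr_ge0// normcBC.
      have dd : d <= 1 by rewrite ge_min lexx.
      have de : d <= e / (4 * (2 * pi)) by rewrite ge_min lexx orbT.
      have nv := normc_ge0 (v x - trig (dbox J) (fourier f) x).
      by have := le_trans (hv J x) EJ; rewrite expr2; nra.
  have := nrm2D_le (L2B Lf Lt) (L2B Lt Lv).
  have -> : (fun x => f x - trig (dbox J) (fourier f) x + (trig (dbox J) (fourier f) x - v x)) =
      (fun x => f x - v x) by apply/funext => x; rewrite subrKA.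
  by rewrite /fsum -/(dbox J) in h1; lra.
have mD := cmeas_normc2 (proj1 Ld).
have := @ae_eq_integral_abs _ _ R mu torus (@measurable_torus R)
  (fun x => (normc (f x - v x) ^+ 2)%:E).
move=> /(_ ((measurable_EFinP _ _).2 mD))[H _].
have ae0 : ae_eq mu torus (fun x => (normc (f x - v x) ^+ 2)%:E) (cst 0%E).
  have : (nrm2 (fun x => f x - v x))%:E = 0%E by rewrite z.
  rewrite /nrm2 /Rintegral fineK => [z'|].
    by apply: H; rewrite -[RHS]z'; apply: eq_integral => x _ /=; rewrite ger0_norm ?sqr_ge0.
  exact: (@integrable_fin_num _ _ R mu torus (@measurable_torus R) _ (proj2 Ld)).
have [B [mB B0 sB]] := ae0; exists B; split => // x nx; apply: sB => /= h; apply: nx => /=.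
move=> tx; have [] := h tx => /eqP; rewrite sqrf_eq0 => /eqP /ComplexField.Normc.eq0_normc /eqP.
by rewrite subr_eq0 => /eqP.
Qed.

End Periodic.

(** * Holder continuity and regularity of the solution *)

Section Assembly.
Variable R : realType.
Local Notation mu := (@lebesgue_measure R).
Local Notation torus := (@torus R).
Implicit Types (f g v : R -> R[i]) (c : int -> R[i]) (z : int -> R) (x y h : R) (j J : nat).

Lemma powR_le1 (a r : R) : 0 <= a -> a <= 1 -> 0 <= r -> a `^ r <= 1.
Proof. by move=> a0 a1 r0; have := @ge0_ler_powR R r r0 a 1; rewrite !nnegrE powR1 => ->. Qed.

Lemma block_card j : \sum_(n <- block j) 1 = 2 * dy R j.
Proof.
rewrite big_const_seq count_predT -[RHS]mulr1 iter_addr_0 -mulr_natl mulr1 mulr1.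
rewrite size_cat !size_map !size_iota expnS mulSn mul1n addnK /dy natrD; ring.
Qed.

Lemma dy_wt j n : n \in block j -> dy R j <= wt R n /\ wt R n <= 3 * dy R j.
Proof. by move=> /(block_norm R)[h1 h2]; have := dy_ge1 R j; rewrite /wt; split; lra. Qed.

Lemma block_l1 z b K j : 0 <= b -> (forall n, 0 <= z n) ->
  sumle (fun n => wt R n `^ (1 + 2 * b) * z n ^+ 2) K ->
  \sum_(n <- block j) z n <= (2 * K + 1) * dy R j `^ (- b).
Proof.
move=> b0 z0 hz; have K0 := sumle_ge0 hz; have d0 := dy_gt0 R j.
set S := \sum_(n <- _) _; pose Q := \sum_(n <- block j) z n ^+ 2.
have SQ : S ^+ 2 <= 2 * dy R j * Q.
  have := @jensen_sum R int (fun=> 1) z (block j) (fun=> ler01).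
  by rewrite block_card /Q; under eq_bigr do rewrite mul1r; under [in leRHS]eq_bigr do rewrite mul1r.
have QK : dy R j `^ (1 + 2 * b) * Q <= K.
  apply: le_trans (hz _ (uniq_block j)); rewrite mulr_sumr big_seq [leRHS]big_seq.
  apply: ler_sum => n /dy_wt[h _]; apply: ler_wpM2r; first exact: sqr_ge0.
  by rewrite ge0_ler_powR ?nnegrE ?(ltW d0) ?(ltW (wt_gt0 R n))//; lra.
set p := dy R j `^ (- b); have p0 : 0 < p by rewrite powR_gt0.
have e : dy R j `^ (1 + 2 * b) * p ^+ 2 = dy R j.
  rewrite /p powRX -powRDp// (_ : 1 + 2 * b + - b * 2%:R = 1); last ring.
  by rewrite powRr1// ltW.
have Qp : dy R j * Q <= K * p ^+ 2.
  have w0 : 0 < dy R j `^ (1 + 2 * b) by rewrite powR_gt0.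
  by rewrite -(ler_pM2l w0) mulrCA (mulrCA _ K) e mulrC ler_pM2r.
have S2 : S ^+ 2 <= ((2 * K + 1) * p) ^+ 2.
  apply: le_trans SQ _; rewrite -mulrA exprMn; apply: le_trans (ler_wpM2l (ler0n _ 2) Qp) _.
  by rewrite mulrA ler_wpM2r ?sqr_ge0// expr2; nra.
by rewrite -(ler_pXn2r (ltn0Sn 1)) ?nnegrE// ?sumr_ge0// mulr_ge0 ?(ltW p0)//; lra.
Qed.

Lemma normc_sum_perturb (s : seq int) (F G : int -> R[i]) (w : int -> R) P :
  normc (\sum_(n <- s) F n) <= P -> (forall n, n \in s -> normc (G n - F n) <= w n) ->
  normc (\sum_(n <- s) G n) <= P + \sum_(n <- s) w n.
Proof.
move=> hP hw; have -> : \sum_(n <- s) G n = \sum_(n <- s) F n + \sum_(n <- s) (G n - F n).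
  by rewrite -big_split; apply: eq_bigr => n _; rewrite /= addrC subrK.
apply: le_trans (normcD _ _) _; apply: lerD => //; apply: le_trans (normc_sum _ _ _) _.
by rewrite big_seq [leRHS]big_seq; apply: ler_sum => n /hw.
Qed.

Lemma profile_error th a (c d : R[i]) (e : R) : normc (cis th * (cis (- a) * c) - d) <= e ->
  normc (c - cis (- th) * (cis a * d)) <= e.
Proof.
suff -> : c - cis (- th) * (cis a * d) = cis (- th) * cis a * (cis th * (cis (- a) * c) - d).
  by rewrite !ComplexField.Normc.normcM !normc_cis !mul1r.
have h1 := cisNM th; have h2 := cisNM a.
rewrite mulrBr; congr (_ - _); last by rewrite mulrA.
rewrite [RHS](_ : _ = (cis (- th) * cis th) * (cis (- a) * cis a) * c); last ring.
by rewrite h1 h2 !mul1r.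
Qed.

(** The linear evolution is treated by [block_kernel] and [BV_kernel], the error by [block_l1]. In
    the second bound the factor n cancels the 1 / n of [BV_kernel] in the evolution, and costs 2 2^j
    in the error. *)
Lemma solution_blocks (al t b gam K th : R) g c z : 1 < al < 2 -> t != 0 -> 0 < b < gam ->
  (gam = 1 - al / 2) \/ (3 / 2 <= al /\ gam = 1 / 2 - al / 6) -> in_BV g ->
  (forall n, 0 <= z n) -> sumle (fun n => wt R n `^ (1 + 2 * b) * z n ^+ 2) K ->
  (forall n, normc (cis th * (cis (- frac_symbol al n * t) * c n) - fourier g n) <= z n) ->
  exists2 C, 0 < C & forall j x, normc (trig (block j) c x) <= C * dy R j `^ (- b) /\
    normc (\sum_(n <- block j) c n * (n%:~R : R)%:C * expi n x) <= C * dy R j `^ (1 - b).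
Proof.
move=> al12 t0 bg hgam hg z0 hz hc; have [A A0 hA] := block_kernel al12 t0 bg hgam.
have [V V0 hV] := BV_kernel hg; have K0 := sumle_ge0 hz; have /andP[b0 _] := bg.
pose C := V * A + 2 * (2 * K + 1).
have C0 : 0 < C by rewrite /C; have := mulr_ge0 V0 (ltW A0); lra.
have err n : normc (c n - cis (- th) * (cis (t * frac_symbol al n) * fourier g n)) <= z n.
  by apply: profile_error; rewrite -(mulrC (frac_symbol al n)) -mulNr.
exists C => // j x; have l1 := block_l1 j (ltW b0) z0 hz; have d0 := dy_gt0 R j.
have pb : 0 < dy R j `^ (- b) by rewrite powR_gt0.
have db : dy R j * dy R j `^ (- b) = dy R j `^ (1 - b).
  by rewrite powRDp// powRr1// ltW.
split.
  apply: le_trans (normc_sum_perturb (w := z) (P := V * (A * dy R j `^ (- b))) (F := fun n =>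
    cis (- th) * (cis (t * frac_symbol al n) * fourier g n * expi n x)) _ _) _.
  - rewrite -mulr_sumr ComplexField.Normc.normcM normc_cis mul1r.
    by apply: hV => [n /block_neq0//|y]; have [] := hA j y.
  - move=> n _; apply: le_trans (err n).
    by rewrite mulrA -mulrBl ComplexField.Normc.normcM normc_expi mulr1.
  - apply: le_trans (lerD (lexx _) l1) _; rewrite mulrA -mulrDl ler_pM2r// /C; lra.
apply: le_trans (normc_sum_perturb (w := fun n => 2 * dy R j * z n) (P := V * (A * dy R j `^ (1 - b)))
  (F := fun n => cis (- th) * (cis (t * frac_symbol al n) * (n%:~R : R)%:C * fourier g n * expi n x)) _ _) _.
- rewrite -mulr_sumr ComplexField.Normc.normcM normc_cis mul1r.
  apply: hV => [n /block_neq0//|y]; have [_] := hA j y; congr (normc _ <= _).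
  apply: eq_big_seq => n /block_neq0 n0; congr (_ * _); rewrite -mulrA -rmorphM /= mulfV ?mulr1//.
  by rewrite intr_eq0.
- move=> n nb; rewrite [X in normc X](_ : _ = (c n - cis (- th) * (cis (t * frac_symbol al n) * fourier g n))
     * (n%:~R : R)%:C * expi n x); last ring.
  rewrite !ComplexField.Normc.normcM normc_expi mulr1 normc_real mulrC.
  by apply: ler_pM; rewrite ?normc_ge0//; have [] := block_norm R nb.
- rewrite -mulr_sumr -db; apply: le_trans (_ : _ <= V * (A * (dy R j * dy R j `^ (- b))) +
    2 * dy R j * ((2 * K + 1) * dy R j `^ (- b))) _; first by rewrite lerD2l ler_pM2l// mulr_gt0.
  by apply: le_of_eq; rewrite /C; ring.
Qed.

Section Limit.
Variables (c : int -> R[i]) (v : R -> R[i]) (E q : R).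
Hypothesis q01 : 0 <= q < 1.
Hypothesis E0 : 0 <= E.
Hypothesis hv : forall J x, normc (v x - trig (dbox J) c x) <= E * q ^+ J.

Lemma limit_periodic : is_periodic v.
Proof.
move=> x; apply/eqP; rewrite -subr_eq0; apply/eqP/ComplexField.Normc.eq0_normc/eqP.
rewrite eq_le normc_ge0 andbT; apply/ler_addgt0Pr => e e0; rewrite add0r.
have e2 : 0 < e / 2 by rewrite divr_gt0.
have [J hJ] := geom_cvg0 q01 E0 e2.
have h1 := le_trans (hv J (x + 2 * pi)) hJ; have h2 := le_trans (hv J x) hJ.
rewrite trig_periodic in h1; rewrite normcBC in h2.
by have := normc_triang (v (x + 2 * pi)) (trig (dbox J) c x) (v x); lra.
Qed.

Lemma incr_trig s h x : incr h (trig s c) x = trig s (fun n => (cis (n%:~R * h) - 1) * c n) x.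
Proof.
rewrite /incr /trig -sumrB; apply: eq_bigr => n _; rewrite /expi mulrDr cisD; ring.
Qed.

(** Parseval for the increments of the dyadic sums, which converge uniformly to v. The factor 2 pi
    of Parseval pays for the 2 lost in |x + y|^2 <= 2 |x|^2 + 2 |y|^2. *)
Lemma incr_spectrum h J : ccontinuous v ->
  \sum_(n <- dbox J) normc (cis (n%:~R * h) - 1) ^+ 2 * normc (c n) ^+ 2 <= nrm2 (incr h v).
Proof.
move=> cv; apply/ler_addgt0Pr => e e0; have tp := twopi_gt0 R; have /andP[q0 q1] := q01.
pose d := Num.min 1 (e / 8); have d0 : 0 < d by rewrite lt_min ltr01 divr_gt0.
have [J0 hJ0] := geom_cvg0 q01 E0 d0; pose M := maxn J J0.
have EM : E * q ^+ M <= d.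
  apply: le_trans hJ0; rewrite ler_wpM2l// ler_wiXn2l//; [exact: ltW|exact: leq_maxr].
pose T := trig (dbox M) c.
have cT : ccontinuous T by exact: ccontinuous_trig.
have L1 := L2_cont (incr_cont h cv); have L2 := L2B (L2_cont (incr_cont h cT)) L1.
have := nrm2D_le L1 L2.
rewrite (_ : (fun x => incr h v x + (incr h T x - incr h v x)) =
  trig (dbox M) (fun n => (cis (n%:~R * h) - 1) * c n)); last first.
  by apply/funext => x; rewrite addrC subrK incr_trig.
rewrite nrm2_trig ?uniq_zbox//.
have sm : nrm2 (fun x => incr h T x - incr h v x) <= 4 * d ^+ 2 * (2 * pi).
  apply: le_trans (ler_norm _) _; rewrite -mu_torus.
  apply: normr_Rintegral_le (@measurable_torus R) (torus_fin R) (proj2 L2) _ => x _.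
  rewrite ger0_norm ?sqr_ge0//.
  have : normc (incr h T x - incr h v x) <= 2 * d.
    rewrite /incr (_ : _ - _ = (T (x + h) - v (x + h)) - (T x - v x)); last ring.
    apply: le_trans (normcB _ _) _; rewrite (normcBC (T (x + h))) (normcBC (T x)).
    by have := le_trans (hv M x) EM; have := le_trans (hv M (x + h)) EM; rewrite -/T; lra.
  by have := normc_ge0 (incr h T x - incr h v x); nra.
have d1 : d ^+ 2 <= e / 8.
  have dd : d <= 1 by rewrite ge_min lexx.
  have de : d <= e / 8 by rewrite ge_min lexx orbT.
  by rewrite expr2; nra.
have sub : \sum_(n <- dbox J) normc (cis (n%:~R * h) - 1) ^+ 2 * normc (c n) ^+ 2 <=
    \sum_(n <- dbox M) normc ((cis (n%:~R * h) - 1) * c n) ^+ 2.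
  under [leRHS]eq_bigr do rewrite ComplexField.Normc.normcM exprMn.
  apply: ler_sum_subset; [by move=> n; rewrite mulr_ge0 ?sqr_ge0|exact: uniq_zbox|].
  apply: zbox_sub; have : (2 ^ J <= 2 ^ M)%N by rewrite leq_exp2l// leq_maxl.
  by case: (2 ^ J)%N (2 ^ M)%N => [|a] [].
move: sub sm; set X := \sum_(n <- dbox M) _; set N2 := nrm2 (fun=> _); set N1 := nrm2 _; set Y := \sum_(n <- _) _.
move=> YX hN2 H; have N0 : 0 <= N1 by exact: nrm2_ge0.
have p1 : 1 <= pi :> R by have := pi_ge2 R; lra.
have : 2 * pi * X <= 2 * pi * (N1 + e).
  apply: le_trans H _.
  have h8 : pi * d ^+ 2 <= pi * (e / 8) by rewrite ler_wpM2l//; lra.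
  have h9 : 2 * N1 <= 2 * pi * N1 by rewrite ler_wpM2r//; lra.
  lra.
by rewrite ler_pM2l// => ?; lra.
Qed.

(** At h = 1 / (2 2^j) every n of the block has |n h| between 1/2 and 1, where |e^{inh} - 1| >=
    1/4. *)
Lemma block_mass j : ccontinuous v ->
  \sum_(n <- block j) normc (c n) ^+ 2 <= 16 * nrm2 (incr (2 * dy R j)^-1 v).
Proof.
move=> cv; have d0 := dy_gt0 R j; set h := (_)^-1.
have := incr_spectrum h j.+1 cv; rewrite big_dboxS => H.
have : \sum_(n <- block j) normc (cis (n%:~R * h) - 1) ^+ 2 * normc (c n) ^+ 2 <= nrm2 (incr h v).
  by apply: le_trans H; rewrite lerDr sumr_ge0// => n _; rewrite mulr_ge0 ?sqr_ge0.
move=> {}H; rewrite -ler_pdivrMl//; apply: le_trans H; rewrite mulr_sumr.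
rewrite big_seq [leRHS]big_seq; apply: ler_sum => n nb; rewrite ler_wpM2r ?sqr_ge0//.
have [h1 h2] := block_norm R nb; have h0 : 0 < h by rewrite invr_gt0 mulr_gt0.
have hd : h * (2 * dy R j) = 1 by rewrite mulVf// gt_eqF// mulr_gt0.
have e : `|n%:~R * h| = `|n%:~R : R| * h by rewrite normrM (gtr0_norm h0).
have u : `|n%:~R * h| <= 1 by rewrite e; nra.
have l : 1 / 2 <= `|n%:~R * h| by rewrite e; nra.
have := @normc_cisB1_ge R (n%:~R * h); rewrite (le_trans u) ?ler1n// => /(_ isT) k.
have k4 : 1 / 4 <= normc (cis (n%:~R * h) - 1) by lra.
by rewrite expr2; nra.
Qed.

(** [block_mass] turns decay h^(1 + eta) of the increments into mass of order 2^(-j (1 + eta)) per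
    block; half of eta is spent on summing the blocks. *)
Lemma increments_regularity b D B : 0 < b -> 0 <= D -> sumle (fun n => normc (c n) ^+ 2) B ->
  (forall x y, normc (v x - v y) <= D * `|x - y| `^ b) ->
  (max_graph_dim v < (1 + b)%:E)%E ->
  exists r K, 1 < r /\ sumle (fun n => wt R n `^ r * normc (c n) ^+ 2) K.
Proof.
move=> b0 D0 cB vD /(increments_small b0 D0 vD)[D1 [e0 [K [DD e00 e01 K0 hK]]]].
have cv := holder_ccontinuous b0 D0 vD; have B0 := sumle_ge0 cB.
(* The surplus over 1 of the two exponents in [increments_small]. *)
pose eta := Num.min (1 + b - D1) (2 * b).
have eta0 : 0 < eta by rewrite lt_min; apply/andP; split; lra.
(* For the low blocks, with h >= e0 or 2 e0 2^j <= 1, the total mass B is used instead; division by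
   m gives it the same form. *)
pose m := (2 * e0) `^ (1 + eta); have m0 : 0 < m by apply: powR_gt0; exact: mulr_gt0.
pose C := 32 * K + B / m.
have C0 : 0 <= C by rewrite addr_ge0 ?divr_ge0 ?(ltW m0)// mulr_ge0.
have mass j : \sum_(n <- block j) normc (c n) ^+ 2 <= C * dy R j `^ (- (1 + eta)).
  have d0 := dy_gt0 R j; have d1 := dy_ge1 R j; pose h := (2 * dy R j)^-1.
  have h0 : 0 < h by rewrite invr_gt0 mulr_gt0.
  have hd : h * (2 * dy R j) = 1 by rewrite mulVf// gt_eqF// mulr_gt0.
  have p0 : 0 < dy R j `^ (- (1 + eta)) by rewrite powR_gt0.
  have [he|he] := ltP h e0.
    have h1 : h <= 1 by lra.
    apply: le_trans (block_mass j cv) _; rewrite -/h.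
    apply: (@le_trans _ _ (32 * K * dy R j `^ (- (1 + eta)))); last first.
      by rewrite ler_pM2r// lerDl divr_ge0// ltW.
    have ph (r : R) : 1 + eta <= r -> h `^ r <= dy R j `^ (- (1 + eta)).
      move=> hr; apply: (@le_trans _ _ (h `^ (1 + eta))).
        by rewrite ger_powR ?h0.
      rewrite powRN -[leRHS]mul1r ler_pdivlMr ?powR_gt0// -powRM ?(ltW h0) ?(ltW d0)//.
      apply: powR_le1; [by rewrite mulr_ge0 ?(ltW h0) ?(ltW d0)| |by lra].
      by have := mulr_gt0 h0 d0; lra.
    have := hK h; rewrite h0 he => /(_ isT) {}hK.
    have := ph (2 + b - D1); have := ph (1 + 2 * b).
    have -> : 1 + eta <= 1 + 2 * b by rewrite lerD2l ge_min lexx orbT.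
    have -> : 1 + eta <= 2 + b - D1.
      by rewrite (_ : 2 + b - D1 = 1 + (1 + b - D1)) ?lerD2l ?ge_min ?lexx//; ring.
    move=> /(_ isT) a1 /(_ isT) a2.
    apply: le_trans (_ : 16 * (K * (2 * dy R j `^ (- (1 + eta)))) <= _); last by apply: le_of_eq; ring.
    rewrite ler_pM2l//; apply: le_trans hK _; rewrite ler_wpM2l//; lra.
  apply: (@le_trans _ _ B); first exact: cB (uniq_block j).
  apply: (@le_trans _ _ (B / m * dy R j `^ (- (1 + eta)))); last first.
    by rewrite ler_pM2r// lerDr mulr_ge0.
  rewrite -mulrA ler_peMr// mulrC ler_pdivlMr// mul1r powRN.
  rewrite -(mul1r (_^-1)) ler_pdivlMr ?powR_gt0// /m -powRM ?mulr_ge0 ?(ltW e00) ?(ltW d0)//.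
  apply: powR_le1; [by rewrite !mulr_ge0 ?(ltW e00) ?(ltW d0)| |by lra].
  have : e0 * (2 * dy R j) <= h * (2 * dy R j) by rewrite ler_wpM2r// mulr_ge0// ltW.
  by rewrite hd; lra.
pose r := 1 + eta / 2; pose q' : R := 2 `^ (- (eta / 2)).
have r1 : 1 < r by rewrite /r ltrDl divr_gt0.
have q'01 : 0 <= q' < 1.
  rewrite powR_ge0 /= /q' powRN invf_lt1 ?powR_gt0// /powR gt_eqF// -[ltLHS]expR0 ltr_expR mulr_gt0 ?divr_gt0// ln_gt0 ?ltr1n//.
exists r, (wt R 0 `^ r * normc (c 0) ^+ 2 + 3 `^ r * C * (1 - q')^-1); split=> //.
apply: (@dyadic_sumle R _ (3 `^ r * C) q') => //.
- by move=> n; rewrite mulr_ge0 ?powR_ge0 ?sqr_ge0.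
- by rewrite mulr_ge0// powR_ge0.
move=> j; rewrite -dy_pow.
apply: (@le_trans _ _ (\sum_(n <- block j) (3 * dy R j) `^ r * normc (c n) ^+ 2)).
  rewrite big_seq [leRHS]big_seq; apply: ler_sum => n /dy_wt[_ h]; rewrite ler_wpM2r ?sqr_ge0//.
  by rewrite ge0_ler_powR ?nnegrE ?(ltW (wt_gt0 R n)) ?mulr_ge0 ?(ltW (dy_gt0 R j))//; lra.
rewrite -mulr_sumr powRM ?(ltW (dy_gt0 R j))// -mulrA -[leRHS]mulrA ler_pM2l ?powR_gt0//.
have pr : 0 < dy R j `^ r by rewrite powR_gt0 ?dy_gt0.
apply: le_trans (ler_wpM2l (ltW pr) (mass j)) _; apply: le_of_eq.
by rewrite mulrCA -powRDp ?dy_gt0//; congr (_ * _ `^ _); rewrite /r; field.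
Qed.

End Limit.

Lemma in_Hhalfplus_of_coef g r K : in_BV g -> 1 < r ->
  sumle (fun n => wt R n `^ r * normc (fourier g n) ^+ 2) K -> in_Hhalfplus g.
Proof.
move=> hg r1 hK; exists (r / 2); first by rewrite ltr_pM2r ?invr_gt0.
split; first exact: BV_in_L2.
apply: le_lt_trans (ltry K); apply: sumle_esum => [n|].
  by rewrite mulr_ge0 ?powR_ge0 ?sqr_ge0.
apply: le_sumle hK => n; rewrite ler_wpM2r ?sqr_ge0//; apply: le_trans (jap2_pow_wt _ _) _.
  by rewrite divr_ge0//; lra.
by rewrite mulrC divfK.
Qed.

(** Phases do not change the moduli of the coefficients, so g inherits the smaller of the
    regularities of the solution and of the remainder. *)
Lemma profile_regularity th a r1 r2 K1 K2 g c z : (forall n, 0 <= z n) -> in_BV g ->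
  (forall n, normc (cis th * (cis (a n) * c n) - fourier g n) <= z n) -> 1 < r1 -> 1 < r2 ->
  sumle (fun n => wt R n `^ r1 * normc (c n) ^+ 2) K1 ->
  sumle (fun n => wt R n `^ r2 * z n ^+ 2) K2 -> in_Hhalfplus g.
Proof.
move=> z0 hg hz r11 r21 h1 h2.
have r1' : 1 < Num.min r1 r2 by rewrite lt_min r11.
apply: (in_Hhalfplus_of_coef hg r1').
apply: le_sumle (sumleD (sumleZ (c := 2) _ h1) (sumleZ (c := 2) _ h2)) => // n.
have w1 := wt_ge1 R n; have n0 := normc_ge0 (cis th * (cis (a n) * c n) - fourier g n).
have p r : Num.min r1 r2 <= r -> wt R n `^ Num.min r1 r2 <= wt R n `^ r by move=> ?; rewrite ler_powR.
have P1 : wt R n `^ Num.min r1 r2 <= wt R n `^ r1 by apply: p; rewrite ge_min lexx.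
have P2 : wt R n `^ Num.min r1 r2 <= wt R n `^ r2 by apply: p; rewrite ge_min lexx orbT.
have G : normc (fourier g n) ^+ 2 <= 2 * normc (c n) ^+ 2 + 2 * z n ^+ 2.
  have -> : fourier g n = cis th * (cis (a n) * c n) + - (cis th * (cis (a n) * c n) - fourier g n).
    by rewrite opprB addrC subrK.
  apply: le_trans (normc_sqrD _ _) _.
  rewrite normcN !ComplexField.Normc.normcM !normc_cis !mul1r lerD2l ler_pM2l//.
  by rewrite ler_pXn2r ?nnegrE.
apply: le_trans (ler_wpM2l (powR_ge0 _ _) G) _; rewrite mulrDr !(mulrCA _ 2).
by apply: lerD; rewrite ler_pM2l// ler_wpM2r ?sqr_ge0.
Qed.

End Assembly.

(** b is the midpoint between beta and the exponent in force. For al < 4/3 the remainder is the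
    bottleneck, as al - 1 < 1 - al/2; for al > 3/2 the third derivative test beats the second. *)
Lemma beta_exponentP (R : realType) (al beta : R) : 1 < al < 2 -> 0 < beta < beta_exponent al ->
  exists b gam : R, [/\ beta < b, 0 < b < gam, b < al - 1 &
    (gam = 1 - al / 2) \/ (3 / 2 <= al /\ gam = 1 / 2 - al / 6)].
Proof.
move=> /andP[al1 al2]; rewrite /beta_exponent => /andP[b0].
have [a1|a1] := ltP al (4 / 3).
  move=> b1; exists ((beta + (al - 1)) / 2), (1 - al / 2); split; [lra|apply/andP; split; lra|lra|by left].
have [a2|a2] := leP al (3 / 2) => b1.
  exists ((beta + (1 - al / 2)) / 2), (1 - al / 2); split; [lra|apply/andP; split; lra|lra|by left].
exists ((beta + (1 / 2 - al / 6)) / 2), (1 / 2 - al / 6).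
by split; [lra|apply/andP; split; lra|lra|right; split; [lra|]].
Qed.

Theorem theorem4p2 (R : realType) (alpha : R) (halpha : 1 < alpha < 2) :
  exists2 s0 : R, s0 < 1 / 2 &
  forall (s : R) (sg : bool) (delta : R) (g : R -> R[i]) (u : R -> R -> R[i]),
    s0 < s < 1 / 2 -> 0 < delta -> in_BV g ->
    fNLS_solution alpha sg s delta g u ->
    forall (beta t : R), 0 < beta < beta_exponent alpha ->
      t \in `[- delta, delta] -> t != 0 ->
      exists v : R -> R[i],
        [/\ is_periodic v,
            {ae @lebesgue_measure R, forall x, v x = u t x},
            holder beta v,
            (max_graph_dim v <= (2 - beta)%:E)%E &
            ~ in_Hhalfplus g -> ((1 + beta)%:E <= max_graph_dim v)%E].
Proof.
have /andP[al1 al2] := halpha.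
(* With eps = 1/2 - s this gives 26 eps < (alpha - 1) / 2, within the condition of the first round
   of the gain. *)
exists (1 / 2 - (alpha - 1) / 52); first by rewrite ltrBlDr ltrDl divr_gt0// subr_gt0.
move=> s sg delta g u hs d0 hg hu beta t hbeta tI t0; have /andP[beta0 _] := hbeta.
have [b [gam [bb bg ba hgam]]] := beta_exponentP halpha hbeta; have /andP[b0 _] := bg.
(* With this loss the remainder is left exactly in the scale of H^{1/2 + b}. *)
have kI : 0 < alpha - 1 - b < alpha - 1 by apply/andP; split; lra.
have [z [K [z0 hz hzt]]] := solution_structure halpha hs d0 hg hu kI.
have tI' : - delta <= t <= delta by move: tI; rewrite in_itv.
have [th hth] := hzt t tI'.
have hz' : sumle (fun n => wt R n `^ (1 + 2 * b) * z n ^+ 2) K.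
  by move: hz; rewrite (_ : alpha - 1 - (alpha - 1 - b) = b)//; ring.
have [C C0 hC] := solution_blocks halpha t0 bg hgam hg z0 hz' hth.
have bI : 0 < beta < b by rewrite beta0.
have b1 : b < 1 by lra.
have [v [E [q [H [q01 E0 H0 hv vH]]]]] := dyadic_holder C0 bI b1
  (fun j x => (hC j x).1) (fun j x => (hC j x).2).
have cv := holder_ccontinuous beta0 H0 vH.
have [b' [_ _ [uH _] _]] := hu; have [uL2 _] := uH t tI.
have beta1 : 0 < beta <= 1 by rewrite beta0; lra.
exists v; split.
- exact: limit_periodic q01 E0 hv.
- apply: ae_periodic; last exact: L2_limit_unique (in_L2_L2 uL2) cv q01 E0 hv.
  by have [pu _ _] := uL2 => x; rewrite pu (limit_periodic q01 E0 hv).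
- by exists H.
- rewrite /max_graph_dim ge_max; apply/andP; split; apply: holder_dim H0 _ => // x y.
    by rewrite -cReN -cReD; apply: le_trans (normc_Re _) (vH x y).
  by rewrite -cImN -cImD; apply: le_trans (normc_Im _) (vH x y).
move=> ng; rewrite leNgt; apply/negP => lo; apply: ng.
have [r [K' [r1 hr]]] := increments_regularity q01 E0 hv beta0 H0 (bessel (in_L2_L2 uL2)) vH lo.
have b21 : 1 < 1 + 2 * b by rewrite ltrDl mulr_gt0.
exact: profile_regularity z0 hg hth r1 b21 hr hz'.
Qed.
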